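(* Let $X\subset\mathbb R^m$ be compact with normalized Lebesgue measure $\nu$, let $\widehat X\subset X$ be compact with positive Lebesgue measure, let $T:X\to X$ be a map with first return map $\widehat T=T^\tau$ on $\widehat X$, and let $\mathcal B\subset L^1(\widehat X,\hat\nu)$ be a Banach space as in the context having the properties Compactness, Boundedness and Algebra. Assume: (1) (Quasi-compactness) there are constants $B,\hat D>0$ and $\hat\eta\in(0,1)$ such that for all $f\in\mathcal B$, all $z\in\mathbb C$ with $|z|\le1$, and all $n\ge1$, $$\|R(z)^nf\|_{\mathcal B}\le |z^n|\bigl(B\hat\eta^n\|f\|_{\mathcal B}+\hat D\|f\|_1\bigr);$$ (2) (Aperiodicity) the only solutions of $e^{it\tau}=f/f\circ\widehat T$ almost everywhere, with $t\in[0,2\pi)$ and $f:\widehat X\to\mathbb S$ measurable, are $t=0$ and $f$ constant almost everywhere; (3) (Return times tail) the operator norms $\|R_n\|_{\mathcal B}$ are summable and $\sum_{k=n+1}^\infty\|R_k\|_{\mathcal B}=O(n^{-\beta})$ for some $\beta>1$. Then there exists a constant $C>0$ such that for all $f\in\mathcal B$ and $g\in L^\infty(X,\nu)$ with $\operatorname{supp}f,\operatorname{supp}g\subset\widehat X$ and all $n\ge 1$, $$\Bigl|\operatorname{Cov}(f,g\circ T^n)-\Bigl(\sum_{k=n+1}^\infty\mu(\tau>k)\Bigr)\int f\,d\mu\int g\,d\mu\Bigr|\le C\,F_\beta(n)\,\|g\|_\infty\|f\|_{\mathcal B},$$ where $F_\beta(n)=n^{-\beta}$ if $\beta>2$, $F_\beta(n)=(\log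 n)/n^2$ if $\beta=2$, and $F_\beta(n)=n^{-(2\beta-2)}$ if $1<\beta<2$.
   Context: $\nu$ is Lebesgue measure on $X$, $\nu(X)=1$; $\hat\nu$ is the normalized Lebesgue measure on $\widehat X$. The transfer operator $\mathscr P$ of $T$ on $L^1(X,\nu)$ is defined by $\int(\psi\circ T)\phi\,d\nu=\int\psi\,\mathscr P\phi\,d\nu$ for $\phi\in L^1(X,\nu)$, $\psi\in L^\infty(X,\nu)$ ($T$ is nonsingular). The first return time is $\tau(x)=\min\{i\ge1:T^ix\in\widehat X\}$ for $x\in\widehat X$, and $\widehat T(x)=T^{\tau(x)}(x)$; $\widehat{\mathscr P}$ is the transfer operator of $\widehat T$ with respect to $\hat\nu$. Functions on $\widehat X$ are regarded as functions on $X$ supported in $\widehat X$. For $f$ on $\widehat X$ put $R_nf=\mathbf 1_{\widehat X}\,\mathscr P^n(f\mathbf 1_{\{\tau=n\}})$ and $R(z)=\sum_{n\ge1}z^nR_n$; so $\widehat{\mathscr P}=R(1)$. $\mathbb S=\{z\in\mathbb C:|z|=1\}$. Banach space: there is a seminorm $|\cdot|_{\mathcal B}$ for functions in $L^1(\widehat X,\hat\nu)$, $\mathcal B=\{f\in L^1(\widehat X,\hat\nu):|f|_{\mathcal B}<\infty\}$, $\|f\|_{\mathcal B}=|f|_{\mathcal B}+\|f\|_1$. Compactness: $\mathcal B$ is a Banach space and the inclusion $\mathcal B\hookrightarrow L^1(\hat\nu)$ is compact. Boundedness: there is $C_b>0$ with $\|f\|_\infty\le C_b\|f\|_{\mathcal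 B}$ for all $f\in\mathcal B$. Algebra: $\mathcal B$ is an algebra under the usual sum and product and there is $C_a$ with $\|fg\|_{\mathcal B}\le C_a\|f\|_{\mathcal B}\|g\|_{\mathcal B}$. Almost everywhere in (2) is with respect to $\hat\nu$. Invariant measures: by (1) there is a nonnegative $\hat h\in\mathcal B$ with $\widehat{\mathscr P}\hat h=\hat h$, $\int\hat h\,d\hat\nu=1$; $\hat\mu$ is the $\widehat T$-invariant probability with density $\hat h$, and $\mu$ is its extension to a $T$-invariant probability on $X$: $\mu(A)=\bigl(\int\tau\,d\hat\mu\bigr)^{-1}\sum_{i\ge0}\hat\mu(\{\tau>i\}\cap T^{-i}A)$. Here $\mu(\tau>k)=\mu(\{x\in\widehat X:\tau(x)>k\})$ and $\operatorname{Cov}(f,g\circ T^n)=\int f\cdot g\circ T^n\,d\mu-\int f\,d\mu\int g\,d\mu$.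
   Formalization: For β=2 the bound is claimed only for n≥2: at n=1, F_2(1)=log 1=0 would force exact equality, which fails for the doubling map on [0,1] with τ=1 and B=BV, where Cov(x, x∘T)=1/24. *)

(* Defs.v *)
From HB Require Import structures.
From mathcomp Require Import all_boot all_order all_algebra.
From mathcomp Require Import complex.
From mathcomp Require Import all_classical all_reals all_analysis.
From mathcomp Require Import ess_sup_inf lra.

Set Implicit Arguments.
Unset Strict Implicit.
Unset Printing Implicit Defensive.
Import Order.TTheory GRing.Theory Num.Theory.
Import numFieldNormedType.Exports.
Import Normc.
Local Open Scope classical_set_scope.
Local Open Scope ring_scope.

Section LebesgueOuter.
Context (R : realType) (m : nat).
Local Notation V := 'rV[R]_m.+1.
Local Open Scope ereal_scope.

Definition box (p : V * V) : set V :=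
  [set x | forall i, (p.1 ord0 i < x ord0 i <= p.2 ord0 i)%R].

Definition box_volume (p : V * V) : \bar R :=
  (\prod_i Num.max 0 (p.2 ord0 i - p.1 ord0 i))%R%:E.

Definition lebesgue_outer (A : set V) : \bar R :=
  ereal_inf [set \sum_(k <oo) box_volume (B k) |
             B in [set B : nat -> V * V | A `<=` \bigcup_k box (B k)]].

Lemma box_volume_ge0 p : 0 <= box_volume p.
Proof. by rewrite lee_fin; apply: prodr_ge0 => i _; rewrite le_max lexx. Qed.

Lemma lebesgue_outer_ge0 A : 0 <= lebesgue_outer A.
Proof.
apply: le_ereal_inf_tmp => x [B _ <-{x}]; apply: nneseries_ge0 => *.
exact: box_volume_ge0.
Qed.

Lemma lebesgue_outer_le : {homo lebesgue_outer : A B / A `<=` B >-> A <= B}.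
Proof.
move=> A B AB; apply/ereal_inf_le_tmp => x [C BC <-{x}].
by exists C => //; apply: subset_trans AB BC.
Qed.

Lemma lebesgue_outer0 : lebesgue_outer set0 = 0.
Proof.
apply/eqP; rewrite eq_le lebesgue_outer_ge0 andbT.
apply: ereal_inf_lbound; exists (fun=> (0, 0)%R) => //.
rewrite eseries0// => k _ _; rewrite /box_volume /= big_ord_recl.
by rewrite !mxE subrr max_l// mul0r.
Qed.

Lemma lebesgue_outer_sigma_subadditive : sigma_subadditive lebesgue_outer.
Proof.
move=> A; have [[i ioo]|] := pselect (exists i, lebesgue_outer (A i) = +oo).
  rewrite (eseries_pinfty _ _ ioo) ?leey// => n _.
  by rewrite -ltNye (lt_le_trans _ (lebesgue_outer_ge0 _)).
rewrite -forallNE => Aoo.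
suff add2e (e : {posnum R}) : lebesgue_outer (\bigcup_n A n) <=
    \sum_(i <oo) lebesgue_outer (A i) + e%:num%:E.
  by apply/lee_addgt0Pr => _/posnumP[].
rewrite (le_trans _ (epsilon_trick _ _ _))//; last first.
  by move=> n; exact: lebesgue_outer_ge0.
pose P n (B : nat -> V * V) := A n `<=` \bigcup_k box (B k) /\
  \sum_(k <oo) box_volume (B k) <=
    lebesgue_outer (A n) + (e%:num / (2 ^ n.+1)%:R)%:E.
have [G PG] : {G : nat -> nat -> V * V & forall n, P n (G n)}.
  apply: (@choice _ _ P) => n; rewrite /P /lebesgue_outer.
  set S := (X in ereal_inf X); move infS : (ereal_inf S) => iS.
  case: iS infS => [r Sr|Soo|Soo].
  - have en1 : (0 < e%:num / (2 ^ n.+1)%:R)%R by [].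
    have /(lb_ereal_inf_adherent en1) : ereal_inf S \is a fin_num by rewrite Sr.
    move=> [x [B AnB muBx] xS].
    by exists B; split => //; rewrite muBx -Sr; exact/ltW.
  - by have := Aoo n; rewrite /lebesgue_outer Soo.
  - suff : lbound S 0 by move/le_ereal_inf_tmp; rewrite Soo.
    by move=> /= _ [B AnB <-]; apply: nneseries_ge0 => *; exact: box_volume_ge0.
have muG_ge0 x : 0 <= (box_volume \o uncurry G) x by exact: box_volume_ge0.
apply: (@le_trans _ _ (\esum_(i in setT) (box_volume \o uncurry G) i)).
  apply: ereal_inf_lbound => /=.
  have /card_esym/ppcard_eqP[f] := card_nat2.
  exists (uncurry G \o f).
    move=> t [i _ /(PG i).1 [j _ Bijt]].
    by exists (f^-1%FUN (i, j)) => //=; rewrite invK ?inE.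
  rewrite -(esum_pred_image (box_volume \o uncurry G) _ xpredT)
    ?[fun=> _]set_true//.
  by rewrite image_eq.
rewrite (_ : esum _ _ = \sum_(i <oo) \sum_(j <oo) box_volume (G i j));
    last first.
  pose J : nat -> set (nat * nat) := fun i => [set (i, j) | j in setT].
  rewrite (_ : setT = \bigcup_k J k); last first.
    by rewrite predeqE => -[a b]; split => // _; exists a => //; exists b.
  rewrite esum_bigcupT /=; last 2 first.
    - apply/trivIsetP => i j _ _ ij.
      rewrite predeqE => -[n k] /=; split => //= -[] [_] _ [<-{n} _].
      by move=> [k' _] [] /esym/eqP; rewrite (negbTE ij).
    - by move=> /= [n k]; exact: box_volume_ge0.
  rewrite -(image_id [set: nat]) -fun_true esum_pred_image//; last first.
    by move=> n _; apply: esum_ge0 => ? _; exact: muG_ge0.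
  apply: eq_eseriesr => /= j _.
  rewrite -(esum_pred_image (box_volume \o uncurry G) (pair j) predT)//=;
      last first.
    by move=> ? ? _ _; exact: (@can_inj _ _ _ snd).
    by move=> n _; exact: box_volume_ge0.
  by congr esum; rewrite predeqE => -[a b]; split; move=> [i _ <-]; exists i.
apply: lee_lim.
- apply: is_cvg_nneseries => n *.
  by apply: nneseries_ge0 => k *; exact: (muG_ge0 (n, k)).
- apply: is_cvg_nneseries => n *; apply: adde_ge0 => //.
  exact: lebesgue_outer_ge0.
- by apply: nearW => n; apply: lee_sum => i _; exact: (PG i).2.
Qed.

HB.instance Definition _ := isOuterMeasure.Build R V lebesgue_outer
  lebesgue_outer0 lebesgue_outer_ge0 lebesgue_outer_le
  lebesgue_outer_sigma_subadditive.

End LebesgueOuter.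

(* R^(m+1) with the sigma-algebra of its Lebesgue measurable sets. *)
Definition rVleb (R : realType) (m : nat) : Type :=
  caratheodory_type (@lebesgue_outer R m).
HB.instance Definition _ (R : realType) (m : nat) :=
  Measurable.on (rVleb R m).

Definition lebesgue (R : realType) (m : nat) : set (rVleb R m) -> \bar R :=
  @lebesgue_outer R m.
HB.instance Definition _ (R : realType) (m : nat) :=
  isMeasure.Build _ (rVleb R m) R (@lebesgue R m)
    (@caratheodory_measure0 R 'rV[R]_m.+1 (@lebesgue_outer R m))
    (@caratheodory_measure_ge0 R 'rV[R]_m.+1 (@lebesgue_outer R m))
    (@caratheodory_measure_sigma_additive R 'rV[R]_m.+1 (@lebesgue_outer R m)).

Section compact_measurable.
Context (R : realType) (m : nat).
Local Notation V := 'rV[R]_m.+1.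

Lemma measurable_halfspace (i : 'I_m.+1) (c : R) :
  measurable ([set x : V | x ord0 i <= c] : set (rVleb R m)).
Proof.
apply: le_caratheodory_measurable => X /=.
apply: le_ereal_inf_tmp => _ [B XB <-].
pose B1 k : V * V := ((B k).1,
  \row_j if j == i then Num.min ((B k).2 ord0 j) c else (B k).2 ord0 j).
pose B2 k : V * V :=
  (\row_j (if j == i then Num.max ((B k).1 ord0 j) c else (B k).1 ord0 j),
   (B k).2).
have vE k : (box_volume (B k) = box_volume (B1 k) + box_volume (B2 k))%E.
  rewrite /box_volume -EFinD; congr EFin.
  pose w (p : V * V) j := Num.max 0 (p.2 ord0 j - p.1 ord0 j).
  have wE p : (forall j, j != i -> w p j = w (B k) j) ->
      \prod_j w p j = w p i * \prod_(j < m.+1 | j != i) w (B k) j.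
    by move=> pB; rewrite (bigD1 i)//=; congr (_ * _); exact: eq_bigr.
  rewrite -!/(w _ _) !wE//; last 2 first.
  - by move=> j /negbTE ji; rewrite /w/= !mxE ji.
  - by move=> j /negbTE ji; rewrite /w/= !mxE ji.
  rewrite -mulrDl; congr (_ * _); rewrite /w/= !mxE eqxx.
  move: ((B k).2 ord0 i) ((B k).1 ord0 i) => b a.
  have [ac|ac] := leP a c; have [bc|bc] := leP b c.
  - by case: (leP 0 (b - a)) => ?; case: (leP 0 (b - c)) => ?; lra.
  - by case: (leP 0 (b - a)) => ?; case: (leP 0 (b - c)) => ?;
      case: (leP 0 (c - a)) => ?; lra.
  - by case: (leP 0 (b - a)) => ?; case: (leP 0 (b - a)) => ?; lra.
  - by case: (leP 0 (b - a)) => ?; case: (leP 0 (b - a)) => ?;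
      case: (leP 0 (c - a)) => ?; lra.
rewrite (eq_eseriesr (fun k _ => vE k)) nneseriesD; last 2 first.
- by move=> *; exact: box_volume_ge0.
- by move=> *; exact: box_volume_ge0.
apply: leeD; apply: ereal_inf_lbound.
- exists B1 => // x [/XB[k _ Bkx] xc]; exists k => // j; rewrite mxE.
  have /andP[-> /= ?] := Bkx j; case: eqP => [ji|//].
  by rewrite le_min; apply/andP; split => //; rewrite ji.
- exists B2 => // x [/XB[k _ Bkx] /negP]; rewrite -ltNge => xc.
  exists k => // j; rewrite mxE.
  have /andP[? ->] := Bkx j; rewrite andbT; case: eqP => [ji|//].
  by rewrite gt_max; apply/andP; split => //; rewrite ji.
Qed.

Lemma measurable_box p : measurable (@box R m p : set (rVleb R m)).
Proof.
rewrite (_ : box p = \bigcap_(i in [set: 'I_m.+1])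
  ([set x : V | x ord0 i <= p.2 ord0 i] `\`
   [set x : V | x ord0 i <= p.1 ord0 i])).
  apply: fin_bigcap_measurable => // i _.
  by apply: measurableD; exact: measurable_halfspace.
apply/seteqP; split => x /=.
  by move=> bx i _ /=; have /andP[h1 h2] := bx i; split => //; apply/negP; rewrite -ltNge.
move=> bx i; have [/= h1 /negP] := bx i I.
by rewrite -ltNge => ->.
Qed.

Lemma open_rVleb_measurable (U : set V) :
  open U -> measurable (U : set (rVleb R m)).
Proof.
move=> oU.
pose toV (p : 'rV[rat]_m.+1 * 'rV[rat]_m.+1) : V * V :=
  (map_mx ratr p.1, map_mx ratr p.2).
rewrite (_ : U = \bigcup_p (if `[<box (toV p) `<=` U>] then box (toV p) else set0)).
  apply: countable_bigcupT_measurable => // p.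
  by case: ifPn => _; [exact: measurable_box|exact: measurable0].
apply/seteqP; split => x /=; last first.
  by move=> [p _]; case: ifPn => [/asboolP + ?|//]; apply.
move=> Ux.
have /nbhs_ballP[e /= e0 eU] : nbhs x U by apply: open_nbhs_nbhs.
have pP (i : 'I_m.+1) : exists q : rat, x ord0 i - e < ratr q < x ord0 i.
  have /rat_in_itvoo[q] : x ord0 i - e < x ord0 i by rewrite ltrBlDr ltrDl.
  by rewrite in_itv /= => qP; exists q.
have qP (i : 'I_m.+1) : exists q : rat, x ord0 i < ratr q < x ord0 i + e.
  have /rat_in_itvoo[q] : x ord0 i < x ord0 i + e by rewrite ltrDl.
  by rewrite in_itv /= => qP; exists q.
have [p {}pP] := choice pP; have [q {}qP] := choice qP.
exists (\row_i p i, \row_i q i) => //.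
rewrite ifT.
  by move=> i; rewrite !mxE; have /andP[_ ->] := pP i; have /andP[/ltW -> _] := qP i.
apply/asboolP => y yB; apply: eU; split => // i j; rewrite /ball /=.
have -> : i = ord0 by exact: ord1.
have := yB j; rewrite /= !mxE => /andP[h1 h2].
have /andP[h3 _] := pP j; have /andP[_ h4] := qP j.
by rewrite ltr_norml; apply/andP; split; lra.
Qed.

Lemma compact_rVleb_measurable (K : set V) :
  compact K -> measurable (K : set (rVleb R m)).
Proof.
move=> cK; rewrite -[K]setCK; apply: measurableC.
apply: open_rVleb_measurable; apply: closed_openC.
by apply: compact_closed => //; exact: norm_hausdorff.
Qed.

End compact_measurable.

Definition normalized_lebesgue (R : realType) (m : nat) (K : set 'rV[R]_m.+1)
    (cK : compact K) : {measure set (rVleb R m) -> \bar R} :=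
  let mK := compact_rVleb_measurable cK in
  let c := (fine (lebesgue (K : set (rVleb R m))))^-1 in
  let c_ge0 : 0 <= c := ltac:(by rewrite invr_ge0 fine_ge0) in
  mscale (NngNum c_ge0) (mrestr (@lebesgue R m) mK).

Definition cindic (E : Type) (R : realType) (A : set E) : E -> R[i] :=
  fun x => (\1_A x)%:C%C.
Arguments cindic {E R} A x.

Section ComplexFunctions.
Context d (E : measurableType d) (R : realType).
Implicit Types (mu : set E -> \bar R) (D : set E) (f g : E -> R[i]).

Definition cmeasurable D f :=
  measurable_fun D (fun x => complex.Re (f x)) /\
  measurable_fun D (fun x => complex.Im (f x)).

Definition cint mu D f : R[i] :=
  Complex (fine (\int[mu]_(x in D) (complex.Re (f x))%:E))
          (fine (\int[mu]_(x in D) (complex.Im (f x))%:E)).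

Definition norm1 mu D f : \bar R := (\int[mu]_(x in D) (normc (f x))%:E)%E.

Definition L1 mu D f := cmeasurable D f /\ (norm1 mu D f < +oo)%E.

Variable nu : {measure set E -> \bar R}.

Definition normoo D f : \bar R :=
  ess_sup nu ((fun x => (normc (f x))%:E) \_ D).

Definition Loo D f := cmeasurable D f /\ (normoo D f < +oo)%E.

Definition nonsingular D (S : E -> E) :=
  forall A, measurable A -> nu A = 0%E -> nu (D `&` S @^-1` A) = 0%E.

(* P is determined on L^1 up to null sets, which is all that is used of it. *)
Definition transfer_operator D (S : E -> E)
    (P : (E -> R[i]) -> E -> R[i]) :=
  forall phi, L1 nu D phi -> L1 nu D (P phi) /\
    forall psi, Loo D psi ->
      cint nu D (fun x => psi (S x) * phi x) =
      cint nu D (fun x => psi x * P phi x).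

End ComplexFunctions.

Section FirstReturn.
Context (E : Type).
Implicit Types (T : E -> E) (A : set E).

(* 0 at the points that never return to A. *)
Definition return_time T A (x : E) : nat :=
  xget 0%N [set n | [/\ (0 < n)%N, A (iter n T x) &
    forall j, (0 < j < n)%N -> ~ A (iter j T x)]].

Definition return_map T A (x : E) : E := iter (return_time T A x) T x.

End FirstReturn.

Section BanachSpace.
Context d (E : measurableType d) (R : realType).
Variables (nu : {measure set E -> \bar R}) (D : set E).
Variable sn : (E -> R[i]) -> \bar R.
Implicit Types f g : E -> R[i].
Local Open Scope ereal_scope.

(* Functions stand for their classes in L^1(D, nu); the seminorm is +oo on the
   integrable functions that are not in the space. *)
Definition L1_seminorm :=
  [/\ forall f g, L1 nu D f -> L1 nu D g ->
        {ae nu, forall x, D x -> f x = g x} -> sn f = sn g,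
      forall f, L1 nu D f -> 0 <= sn f,
      forall (c : R[i]) f, L1 nu D f ->
        sn (fun x => c * f x)%R = (normc c)%:E * sn f &
      forall f g, L1 nu D f -> L1 nu D g ->
        sn (fun x => f x + g x)%R <= sn f + sn g].

Definition inB f := L1 nu D f /\ sn f < +oo.

Definition normB f : \bar R := sn f + norm1 nu D f.

Definition B_complete :=
  forall u : nat -> E -> R[i], (forall n, inB (u n)) ->
    (forall e : R, (0 < e)%R -> exists N : nat, forall p q, (N <= p)%N ->
       (N <= q)%N -> normB (fun x => u p x - u q x)%R <= e%:E) ->
  exists2 f, inB f & normB (fun x => u n x - f x)%R @[n --> \oo] --> 0.

Definition B_compact_in_L1 :=
  forall (u : nat -> E -> R[i]) (M : R),
    (forall n, inB (u n) /\ normB (u n) <= M%:E) ->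
  exists (k : nat -> nat) f, [/\ {homo k : i j / (i < j)%N}, L1 nu D f &
    norm1 nu D (fun x => u (k n) x - f x)%R @[n --> \oo] --> 0].

Definition B_bounded := exists2 Cb : R, (0 < Cb)%R &
  forall f, inB f -> normoo nu D f <= Cb%:E * normB f.

Definition B_algebra := exists Ca : R, forall f g, inB f -> inB g ->
  inB (fun x => f x * g x)%R /\
  normB (fun x => f x * g x)%R <= Ca%:E * normB f * normB g.

(* +oo when A does not map B boundedly to itself. *)
Definition opnormB (A : (E -> R[i]) -> E -> R[i]) : \bar R :=
  ereal_sup [set normB (A f) | f in [set f | inB f /\ normB f <= 1]].

End BanachSpace.

Section Renewal.
Context d (E : measurableType d) (R : realType).
Variables (T : E -> E) (Xhat : set E).
Local Notation tau := (return_time T Xhat).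
Local Notation That := (return_map T Xhat).

Definition renewal (P : (E -> R[i]) -> E -> R[i]) (n : nat)
    (f : E -> R[i]) : E -> R[i] :=
  fun x => cindic Xhat x *
    iter n P (fun y => f y * cindic [set z | Xhat z /\ tau z = n] y) x.

(* R(z) = \sum_(n >= 1) z^n R_n, the series converging in L^1. *)
Definition renewal_series (nuhat : {measure set E -> \bar R})
    (Rn : nat -> (E -> R[i]) -> E -> R[i])
    (Rz : R[i] -> (E -> R[i]) -> E -> R[i]) :=
  forall z f, normc z <= 1 -> L1 nuhat Xhat f ->
    L1 nuhat Xhat (Rz z f) /\
    (norm1 nuhat Xhat
       (fun x => (\sum_(1 <= n < N) z ^+ n * Rn n f x - Rz z f x)%R)
      @[N --> \oo] --> 0)%E.

Definition quasi_compact (nuhat : {measure set E -> \bar R})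
    (sn : (E -> R[i]) -> \bar R) (Rz : R[i] -> (E -> R[i]) -> E -> R[i]) :=
  exists B Dhat etahat : R, [/\ 0 < B, 0 < Dhat, 0 < etahat < 1 &
    forall f z n, inB nuhat Xhat sn f -> normc z <= 1 -> (1 <= n)%N ->
      (normB nuhat Xhat sn (iter n (Rz z) f) <=
        (normc (z ^+ n))%:E *
        ((B * etahat ^+ n)%:E * normB nuhat Xhat sn f +
         Dhat%:E * norm1 nuhat Xhat f))%E].

Definition aperiodic (nuhat : {measure set E -> \bar R}) :=
  forall (t : R) (f : E -> R[i]), 0 <= t < 2 * pi -> cmeasurable Xhat f ->
    (forall x, Xhat x -> normc (f x) = 1) ->
    {ae nuhat, forall x, Xhat x ->
       Complex (cos (t * (tau x)%:R)) (sin (t * (tau x)%:R)) =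
       f x / f (That x)} ->
    t = 0 /\ exists c, {ae nuhat, forall x, Xhat x -> f x = c}.

Definition return_tail (nuhat : {measure set E -> \bar R})
    (sn : (E -> R[i]) -> \bar R) (Rn : nat -> (E -> R[i]) -> E -> R[i])
    (beta : R) :=
  (\sum_(1 <= k <oo) opnormB nuhat Xhat sn (Rn k) < +oo)%E /\
  exists K : R, \forall n \near \oo,
    (\sum_(n.+1 <= k <oo) opnormB nuhat Xhat sn (Rn k) <=
      (K * n%:R `^ (- beta))%:E)%E.

Definition density_measure (nuhat : set E -> \bar R) (h : E -> R) (A : set E)
    : \bar R :=
  (\int[nuhat]_(x in A `&` Xhat) (h x)%:E)%E.

(* A measure on the Lebesgue measurable sets when T is measurable and muhat is a
   measure; integrals against it only use these values. *)
Definition tower_measure (muhat : set E -> \bar R) (A : set E) : \bar R :=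
  ((fine (\int[muhat]_(x in Xhat) (tau x)%:R%:E))^-1%:E *
   \sum_(0 <= i <oo)
      muhat [set x | Xhat x /\ (i < tau x)%N /\ A (iter i T x)])%E.

Definition Cov (mu : set E -> \bar R) (X : set E) (f g : E -> R[i]) : R[i] :=
  cint mu X (fun x => f x * g x) - cint mu X f * cint mu X g.

End Renewal.

(* Vanishes at beta = 2, n = 1. *)
Definition Fbeta (R : realType) (beta : R) (n : nat) : R :=
  if 2 < beta then n%:R `^ (- beta)
  else if beta == 2 then ln n%:R / n%:R ^+ 2
  else n%:R `^ (- (2 * beta - 2)).

(* Main.v *)
From HB Require Import structures.
From mathcomp Require Import all_boot all_order all_algebra.
From mathcomp Require Import complex.
From mathcomp Require Import all_classical all_reals all_analysis.
From mathcomp Require Import measurable_realfun ess_sup_inf ring lra zify.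
Require Import Defs.
Set Implicit Arguments.
Unset Strict Implicit.
Unset Printing Implicit Defensive.
Import Order.TTheory GRing.Theory Num.Theory.
Import numFieldNormedType.Exports.
Import Normc.
Local Open Scope classical_set_scope.
Local Open Scope ring_scope.

(**
Operator renewal theory: with R(z) the generating series of the first-return
operators R_n, the operators T_n describing all returns satisfy
sum_n T_n z^n = (1 - R(z))^{-1}.  Quasi-compactness and aperiodicity make
1 - R(z) invertible on the closed disc except for a simple pole at z = 1, whose
residue is the projection f |-> (int f) hhat.  Subtracting from (1 - R(z))^{-1}
the scalar renewal sequence of the return times, a Wiener lemma in the
convolution algebra of operator sequences with tails O(n^-beta) shows that
T_n f = (1/tbar + tbar^-2 sum_{k>n} muhat(tau>k)) (int f) hhat + O(F_beta(n)).
Covariances against mu are then read off from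
int f (g o T^n) dmu = tbar^-1 int_Xhat g o T^n (f hhat) dnuhat, which holds since
mu is the suspension of hhat nuhat over the first-return tower.
*)

(** The pole is first removed: M = 1 - R + a Pi, with Pi the rank one projection, is bounded below
    uniformly on the closed disc, by compactness and contradiction instead of spectral theory. The
    obstacle is then Wiener's lemma for noncommuting coefficients. The first moment sum n |R_n|,
    finite as beta > 1, makes M(z) Lipschitz, and a second difference of M^-1 at step pi/n bounds
    its n-th coefficient summably. That estimate presupposes a summable inverse, which continuity
    along M(rz), 0 <= r <= 1, provides; a bootstrap yields the decay n^-beta. As 1 - R = M - a Pi is
    a rank one perturbation, the Sherman-Morrison formula inverts it. Up to a constant its
    denominator is (1 - z) kappa(z), with kappa scalar, zero-free on the disc and equal to tbar at
    1. What remains is commutative: Newman's argument inverts kappa, and 1 / ((1 - z) kappa) is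
    expanded to second order. The remainder contains (1 - z) Q^2 with Q_n = O(n^(1 - beta)); its
    coefficients are O(n^-beta sum_(i <= n) i^(1 - beta)), the origin of the three regimes of
    F_beta. *)

(** * Formal power series with the Cauchy product *)

Definition fps (A : pzRingType) : Type := nat -> A.
HB.instance Definition _ (A : pzRingType) := GRing.Zmodule.on (fps A).

Section FormalSeries.
Context (A : pzRingType).
Implicit Types a b c : fps A.

Definition fps_mul a b : fps A := fun n => \sum_(i < n.+1) a i * b (n - i)%N.
Definition fpsC (x : A) : fps A := fun n => if n == 0%N then x else 0.

Lemma sum_triangle (G : nat -> nat -> A) n :
  \sum_(i < n.+1) \sum_(j < (n - i).+1) G i j =
  \sum_(k < n.+1) \sum_(i < k.+1) G i (k - i)%N.
Proof.
elim: n => [|n IH]; first by rewrite !big_ord1.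
rewrite [RHS]big_ord_recr /= -IH big_ord_recr /= subnn big_ord1.
rewrite [X in _ = _ + X]big_ord_recr /= subnn addrA -big_split /=; congr (_ + _).
by apply: eq_bigr => i _; rewrite subSn ?big_ord_recr//= -ltnS.
Qed.

Lemma fps_mulA : associative fps_mul.
Proof.
move=> a b c; apply/funext => n; rewrite /fps_mul.
under eq_bigr do rewrite mulr_sumr.
under [RHS]eq_bigr do rewrite mulr_suml.
rewrite (sum_triangle (fun i j => a i * (b j * c (n - i - j)%N))).
apply: eq_bigr => k _; apply: eq_bigr => i _.
by rewrite mulrA; congr (_ * c _); have := ltn_ord i; have := ltn_ord k; lia.
Qed.

Lemma fps_mul1 : left_id (fpsC 1) fps_mul.
Proof.
move=> a; apply/funext => n; rewrite /fps_mul big_ord_recl /= mul1r subn0.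
by rewrite big1 ?addr0// => i _; rewrite /fpsC mul0r.
Qed.

Lemma fps_mulr1 : right_id (fpsC 1) fps_mul.
Proof.
move=> a; apply/funext => n; rewrite /fps_mul big_ord_recr /= subnn mulr1.
rewrite big1 ?add0r// => i _; rewrite /fpsC ifF ?mulr0//.
by apply/eqP; have := ltn_ord i; lia.
Qed.

Lemma fps_mulDl : left_distributive fps_mul +%R.
Proof.
move=> a b c; apply/funext => n.
rewrite -[RHS]/(fps_mul a c n + fps_mul b c n) /fps_mul -big_split/=.
by apply: eq_bigr => i _; rewrite -mulrDl.
Qed.

Lemma fps_mulDr : right_distributive fps_mul +%R.
Proof.
move=> a b c; apply/funext => n.
rewrite -[RHS]/(fps_mul a b n + fps_mul a c n) /fps_mul -big_split/=.
by apply: eq_bigr => i _; rewrite -mulrDr.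
Qed.

HB.instance Definition _ := GRing.Zmodule_isPzRing.Build (fps A)
  fps_mulA fps_mul1 fps_mulr1 fps_mulDl fps_mulDr.

Lemma fpsM a b n : (a * b) n = \sum_(i < n.+1) a i * b (n - i)%N.
Proof. by []. Qed.
Lemma fpsD a b n : (a + b) n = a n + b n. Proof. by []. Qed.
Lemma fpsN a n : (- a) n = - a n. Proof. by []. Qed.
Lemma fpsB a b n : (a - b) n = a n - b n. Proof. by []. Qed.
Lemma fps1 n : (1 : fps A) n = if n == 0%N then 1 else 0. Proof. by []. Qed.

Lemma fps_sum I (r : seq I) (P : pred I) (F : I -> fps A) n :
  (\sum_(i <- r | P i) F i) n = \sum_(i <- r | P i) F i n.
Proof. by elim/big_rec2: _ => // i x y _ <-. Qed.

Lemma fpsCM x a n : (fpsC x * a) n = x * a n.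
Proof.
rewrite fpsM big_ord_recl /= subn0 big1 ?addr0// => i _.
by rewrite /fpsC mul0r.
Qed.

Lemma fpsMC a x n : (a * fpsC x) n = a n * x.
Proof.
rewrite fpsM big_ord_recr /= subnn big1 ?add0r// => i _.
by rewrite /fpsC ifF ?mulr0//; apply/eqP; have := ltn_ord i; lia.
Qed.

Lemma fpsC1 : fpsC 1 = 1. Proof. by []. Qed.
Lemma fpsC_mul x y : fpsC (x * y) = fpsC x * fpsC y.
Proof. by apply/funext => n; rewrite fpsCM /fpsC; case: eqP; rewrite ?mulr0. Qed.

(** The series 1 - z: multiplication by it takes backward differences, and [fps_int] below divides
    by it. *)
Definition fps_u : fps A := fun n => if n is n'.+1 then if n' is _.+1 then 0 else -1 else 1.

Lemma fps_uMS a n : (fps_u * a) n.+1 = a n.+1 - a n.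
Proof.
rewrite fpsM !big_ord_recl /= mul1r subn0 mulN1r subn1 /= big1 ?addr0// => i _.
by rewrite mul0r.
Qed.

Lemma fps_uM0 a : (fps_u * a) 0%N = a 0%N.
Proof. by rewrite fpsM big_ord1 /= mul1r. Qed.

Lemma fps_uC a : a * fps_u = fps_u * a.
Proof.
apply/funext => -[|n]; first by rewrite fps_uM0 fpsM big_ord1 /= mulr1.
rewrite fps_uMS fpsM big_ord_recr/= subnn mulr1 big_ord_recr /= subSn// subnn mulrN1.
rewrite big1 ?add0r 1?addrC// => i _.
suff -> : (n.+1 - i = (n - i).-1.+2)%N by rewrite /= mulr0.
by have := ltn_ord i; lia.
Qed.

Definition fps_int a : fps A := fun n => \sum_(i < n.+1) a i.

Lemma fps_intK a : fps_u * fps_int a = a.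
Proof.
apply/funext => -[|n]; first by rewrite fps_uM0 /fps_int big_ord1.
by rewrite fps_uMS /fps_int big_ord_recr /= addrAC subrr add0r.
Qed.

Lemma fps_uK a : fps_int (fps_u * a) = a.
Proof.
apply/funext => n; rewrite /fps_int.
elim: n => [|n IH]; first by rewrite big_ord1 fps_uM0.
by rewrite big_ord_recr /= IH fps_uMS addrC subrK.
Qed.

Lemma fps_u_inj a b : fps_u * a = fps_u * b -> a = b.
Proof. by move=> /(congr1 fps_int); rewrite !fps_uK. Qed.

Lemma fps_expr_low c k n : c 0%N = 0 -> (n < k)%N -> (c ^+ k) n = 0.
Proof.
move=> c0; elim: k n => // k IH n nk; rewrite exprS fpsM big_ord_recl /= c0 mul0r.
rewrite add0r big1// => i _; rewrite IH ?mulr0//.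
by rewrite /bump; have := ltn_ord i; lia.
Qed.

(** Neumann series in [c = 1 - u a]: since [c] has no constant term, its powers beyond the [n]-th do
    not reach coefficient [n], and every coefficient is a finite sum. *)
Lemma fps_inv a (u : A) : u * a 0%N = 1 -> a 0%N * u = 1 ->
  exists b, a * b = 1 /\ b * a = 1.
Proof.
move=> ua au; pose c : fps A := 1 - fpsC u * a.
have c0 : c 0%N = 0 by rewrite /c fpsB fpsCM ua fps1 subrr.
pose s n := \sum_(k < n) c ^+ k.
pose b : fps A := fun n => s n.+1 n.
have sE m n : (n < m)%N -> s m n = b n.
  move=> nm; rewrite /b /s -(subnKC nm) big_split_ord/= fpsD [X in _ + X]fps_sum.
  by rewrite [X in _ + X]big1 ?addr0// => i _; rewrite fps_expr_low//; lia.
have cb : (1 - c) * b = 1.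
  apply/funext => n.
  have -> : ((1 - c) * b) n = ((1 - c) * s n.+1) n.
    by rewrite !fpsM; apply: eq_bigr => i _; rewrite sE// ltnS leq_subr.
  by rewrite /s -opprB mulNr -subrX1 opprB fpsB (fps_expr_low c0 (ltnSn n)) subr0.
have bc : b * (1 - c) = 1.
  apply/funext => n.
  have -> : (b * (1 - c)) n = (s n.+1 * (1 - c)) n.
    by rewrite !fpsM; apply: eq_bigr => i _; rewrite sE// ltnS -ltnS.
  have -> : s n.+1 * (1 - c) = (1 - c) * s n.+1.
    rewrite /s mulr_sumr mulr_suml; apply: eq_bigr => i _.
    by rewrite mulrBl mulrBr mul1r mulr1 -exprS -exprSr.
  by rewrite /s -opprB mulNr -subrX1 opprB fpsB (fps_expr_low c0 (ltnSn n)) subr0.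
have cE : 1 - c = fpsC u * a by rewrite /c opprB addrC subrK.
(* [b] is a two-sided inverse of [u a]. In a noncommutative ring [a (b u) = 1] also takes
   [a 0 * u = 1], by which [u] is conjugated away. *)
have uu : fpsC (a 0%N) * fpsC u = 1 by rewrite -fpsC_mul au.
exists (b * fpsC u); split; last by rewrite -mulrA -cE.
rewrite -[a]mul1r -uu -!mulrA (mulrA (fpsC u) a) -cE (mulrA (1 - c)) cb mul1r.
by [].
Qed.

Lemma fps_inv_uniq a b c : b * a = 1 -> a * c = 1 -> b = c.
Proof. by move=> ba ac; rewrite -[b]mulr1 -ac mulrA ba mul1r. Qed.

End FormalSeries.

Section ComFormalSeries.
Context (A : comPzRingType).
Implicit Types a b c : fps A.

Lemma fps_mulC (a b : fps A) : a * b = b * a.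
Proof.
apply/funext => n; rewrite !fpsM (reindex_inj rev_ord_inj)/=.
by apply: eq_bigr => i _; rewrite subSS subKn 1?mulrC// -ltnS.
Qed.

HB.instance Definition _ := GRing.PzRing_hasCommutativeMul.Build (fps A) fps_mulC.

End ComFormalSeries.

(** * Seminorms and partial l1 sums of series *)

Section Norms.
Context (R : realType).

(** Neither definiteness nor homogeneity is asked, so that reals, complex scalars, vectors and
    operators share the estimates on series. *)
Record seminorm (V : zmodType) := Seminorm {
  seminorm_fun :> V -> R;
  seminorm0 : seminorm_fun 0 = 0;
  seminormD : forall x y, seminorm_fun (x + y) <= seminorm_fun x + seminorm_fun y;
  seminormN : forall x, seminorm_fun (- x) = seminorm_fun x }.

Section seminorm_theory.
Context (V : zmodType) (N : seminorm V).

Lemma seminorm_ge0 x : 0 <= N x.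
Proof.
by have := seminormD N x (- x); rewrite subrr seminorm0 seminormN -mulr2n pmulrn_lge0.
Qed.

Lemma seminormB x y : N (x - y) <= N x + N y.
Proof. by rewrite -(seminormN N y) seminormD. Qed.

Lemma seminorm_sub x y : N (x - y) = N (y - x).
Proof. by rewrite -opprB seminormN. Qed.

Lemma seminorm_sum I (r : seq I) (P : pred I) (F : I -> V) :
  N (\sum_(i <- r | P i) F i) <= \sum_(i <- r | P i) N (F i).
Proof.
elim/big_rec2: _ => [|i y x _ xy]; first by rewrite seminorm0.
by rewrite (le_trans (seminormD _ _ _))// lerD2l.
Qed.

Lemma seminorm_leD x y : N x <= N y + N (x - y).
Proof. by rewrite -{1}(subrK y x) addrC seminormD. Qed.

End seminorm_theory.

Section NormedRing.
Context (A : pzRingType) (N : seminorm A).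
Hypothesis NM : forall x y, N (x * y) <= N x * N y.
Implicit Types a b c : fps A.

Definition psum a n := \sum_(i < n) N (a i).

Lemma psum_ge0 a n : 0 <= psum a n.
Proof. by apply: sumr_ge0 => i _; exact: seminorm_ge0. Qed.

Lemma psum_le a m n : (m <= n)%N -> psum a m <= psum a n.
Proof.
move=> mn; rewrite /psum -(subnKC mn) big_split_ord/= lerDl.
by apply: sumr_ge0 => i _; exact: seminorm_ge0.
Qed.

Lemma psumD a b n : psum (a + b) n <= psum a n + psum b n.
Proof. by rewrite /psum -big_split/=; apply: ler_sum => i _; exact: seminormD. Qed.

Lemma psumN a n : psum (- a) n = psum a n.
Proof. by apply: eq_bigr => i _; rewrite fpsN seminormN. Qed.

Lemma psumB a b n : psum (a - b) n <= psum a n + psum b n.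
Proof. by rewrite -(psumN b) psumD. Qed.

Lemma seminorm_fpsM a b n : N ((a * b) n) <= \sum_(i < n.+1) N (a i) * N (b (n - i)%N).
Proof. by rewrite fpsM (le_trans (seminorm_sum _ _ _ _))//; apply: ler_sum. Qed.

(** The index pairs with [i + j < n] form a triangle inside the square of pairs with both indices
    below [n]; submultiplicativity therefore holds for partial sums, before any convergence is
    known. *)
Lemma psumM a b n : psum (a * b) n <= psum a n * psum b n.
Proof.
case: n => [|n]; first by rewrite /psum !big_ord0 mul0r.
rewrite /psum mulr_suml.
apply: le_trans (_ : \sum_(i < n.+1) \sum_(j < (n - i).+1) N (a i) * N (b j) <= _).
  rewrite (sum_triangle (fun i j => N (a i) * N (b j))).
  by apply: ler_sum => i _; exact: seminorm_fpsM.
apply: ler_sum => i _; rewrite -mulr_sumr ler_wpM2l ?seminorm_ge0//.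
by apply: (@psum_le b); rewrite ltnS leq_subr.
Qed.

End NormedRing.
End Norms.

Lemma powRN_le (R : realType) (e x y : R) : 0 <= e -> 0 < x -> x <= y -> y `^ (- e) <= x `^ (- e).
Proof.
move=> e0 x0 xy; have y0 : 0 < y by exact: lt_le_trans xy.
by rewrite !powRN lef_pV2 ?posrE ?powR_gt0// ge0_ler_powR ?nnegrE// ltW.
Qed.

Lemma powRN_half (R : realType) (e : R) j n : 0 <= e -> (n <= j.*2.+1)%N ->
  j.+1%:R `^ (- e) <= 2 `^ e * n.+1%:R `^ (- e).
Proof.
move=> e0 nj; have -> : 2 `^ e * n.+1%:R `^ (- e) = (2^-1 * n.+1%:R) `^ (- e).
  by rewrite powRM// -[2^-1]powR_inv1// -powRrM mulN1r opprK.
apply: powRN_le => //.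
rewrite mulrC ler_pdivrMr// -natrM ler_nat; lia.
Qed.

(** * Polynomial weights *)

Section PowerWeights.
Context (R : realType) (beta : R).
Hypothesis beta_gt1 : 1 < beta.

Definition dw (n : nat) : R := n.+1%:R `^ (- beta).
(** Up to constants this is bounded, [ln n] or [n^(2 - beta)] according as [beta] is above, equal to
    or below 2. The product [dw n * hw n] is thus the rate F_beta without case distinction; the
    cases appear only in [Fbeta_bound]. *)
Definition hw (n : nat) : R := \sum_(i < n.+1) i.+1%:R `^ (1 - beta).

Lemma natS_ge1 (n : nat) : 1 <= n.+1%:R :> R.
Proof. by rewrite ler1n. Qed.
Hint Resolve natS_ge1 : core.

Let beta_ge0 : 0 <= beta.
Proof. by rewrite (le_trans ler01)// ltW. Qed.

Lemma dw_gt0 n : 0 < dw n.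
Proof. by rewrite powR_gt0. Qed.

Lemma dw_ge0 n : 0 <= dw n.
Proof. exact: powR_ge0. Qed.

Lemma dw_le m n : (m <= n)%N -> dw n <= dw m.
Proof. by move=> mn; apply: powRN_le; [exact: beta_ge0 | by rewrite ltr0n | by rewrite ler_nat]. Qed.

Lemma dw_le1 n : dw n <= 1.
Proof. by rewrite (le_trans (@dw_le 0 n _))// /dw powR1. Qed.

Lemma dw_half j n : (n <= j.*2)%N -> dw j <= 2 `^ beta * dw n.
Proof. by move=> nj; apply: powRN_half => //; rewrite leqW. Qed.

(** Discrete form of the integral of x^-beta. Divided by [(n + 2)^(1 - beta)] it reads
    [q^(- al) >= 1 + al / (n + 2)] with [q = (n + 1) / (n + 2)], a consequence of [exp y >= 1 + y]
    and [ln (1 + y) <= y]. *)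
Lemma dw_telescope n :
  (beta - 1) * dw n.+1 <= n.+1%:R `^ (1 - beta) - n.+2%:R `^ (1 - beta).
Proof.
set al := beta - 1; have al0 : 0 < al by rewrite subr_gt0.
have -> : 1 - beta = - al by rewrite /al; ring.
rewrite lerBrDr.
have n2 : n.+2%:R != 0 :> R by rewrite pnatr_eq0.
have -> : dw n.+1 = n.+2%:R `^ (- al) * n.+2%:R^-1.
  by rewrite -powR_inv1// -powRD ?n2 ?implybT//; congr powR; rewrite /al; ring.
set y := n.+2%:R `^ (- al).
have -> : n.+1%:R `^ (- al) = y * (n.+1%:R / n.+2%:R) `^ (- al).
  rewrite /y -powRM ?divr_ge0//; congr (_ `^ _).
  by rewrite mulrCA divff// mulr1.
have -> : al * (y * n.+2%:R^-1) + y = y * (1 + al * n.+2%:R^-1) by ring.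
rewrite ler_wpM2l ?powR_ge0//.
have q0 : 0 < n.+1%:R / n.+2%:R :> R by rewrite divr_gt0.
rewrite /powR gt_eqF//.
apply: le_trans (expR_ge1Dx _).
rewrite lerD2l mulNr -mulrN; apply: ler_wpM2l; first exact: ltW.
rewrite lerNr.
have -> : n.+1%:R / n.+2%:R = 1 + - n.+2%:R^-1 :> R.
  by rewrite -(natr1 n.+1) in n2 *; field.
apply: le_ln1Dx; rewrite ltrN2 invf_lt1//.
by rewrite ltr1n.
Qed.

Lemma sum_dw_tail m n : (m <= n)%N ->
  \sum_(m.+1 <= i < n.+1) dw i <= (beta - 1)^-1 * m.+1%:R `^ (1 - beta).
Proof.
move=> mn; have al0 : 0 < beta - 1 by rewrite subr_gt0.
rewrite -ler_pdivrMl ?invr_gt0// invrK mulr_sumr big_add1/=.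
apply: le_trans (_ : \sum_(m <= i < n) (i.+1%:R `^ (1 - beta) - i.+2%:R `^ (1 - beta)) <= _).
  by apply: ler_sum => i _; exact: dw_telescope.
rewrite (eq_bigr (fun i => - (i.+2%:R `^ (1 - beta) - i.+1%:R `^ (1 - beta)))); last first.
  by move=> i _; rewrite opprB.
rewrite sumrN (telescope_sumr (fun i => i.+1%:R `^ (1 - beta)))// opprB gerBl.
exact: powR_ge0.
Qed.

Lemma sum_dw n : \sum_(i < n) dw i <= 1 + (beta - 1)^-1.
Proof.
have al0 : 0 < beta - 1 by rewrite subr_gt0.
case: n => [|n]; first by rewrite big_ord0 addr_ge0// invr_ge0 ltW.
rewrite -(big_mkord xpredT dw) big_ltn//; apply: lerD; first exact: dw_le1.
by rewrite (le_trans (sum_dw_tail _))// powR1 mulr1.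
Qed.

Lemma hw_ge1 n : 1 <= hw n.
Proof.
rewrite /hw big_ord_recl powR1 lerDl.
by apply: sumr_ge0 => i _; exact: powR_ge0.
Qed.

Lemma hw_le m n : (m <= n)%N -> hw m <= hw n.
Proof.
move=> mn; rewrite /hw -(@subnKC m.+1 n.+1)// big_split_ord/= lerDl.
by apply: sumr_ge0 => i _; exact: powR_ge0.
Qed.

Lemma hw_leS n : hw n <= n.+1%:R.
Proof.
have -> : n.+1%:R = \sum_(i < n.+1) (1 : R) by rewrite sumr_const card_ord.
apply: ler_sum => i _; rewrite -opprB (le_trans (powRN_le _ ltr01 _))//.
  by rewrite subr_ge0 ltW.
by rewrite powR1.
Qed.

(** Each of the [n + 1] terms of [hw n] is at least the last one. The boundary term of the summation
    by parts in [dech_square] is absorbed in this way. *)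
Lemma dw_hw_lower n : n.+1%:R `^ (1 - beta) * n.+1%:R `^ (1 - beta) <= dw n * hw n.
Proof.
have -> : n.+1%:R `^ (1 - beta) * n.+1%:R `^ (1 - beta) =
    dw n * (n.+1%:R * n.+1%:R `^ (1 - beta)).
  have n0 : n.+1%:R != 0 :> R by rewrite pnatr_eq0.
  rewrite /dw -[X in _ = _ * (X * _)]powRr1// -!powRD ?n0 ?implybT//.
  by congr (_ `^ _); ring.
rewrite ler_wpM2l ?dw_ge0// /hw mulr_natl.
rewrite -[X in _ *+ X]card_ord -sumr_const.
apply: ler_sum => i _; rewrite -opprB; apply: powRN_le => //.
  by rewrite subr_ge0 ltW.
by rewrite ler_nat; apply: ltn_ord.
Qed.

(** Since [hw i <= i + 1], each summand is at most [(i + 1)^(1 - beta)], the corresponding term of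
    [hw n]. This makes [dech] sequences stable under multiplication by [dec] ones. *)
Lemma sum_dw_hw n : \sum_(i < n.+1) dw i * hw i <= hw n.
Proof.
apply: ler_sum => i _.
have n0 : i.+1%:R != 0 :> R by rewrite pnatr_eq0.
apply: le_trans (_ : dw i * i.+1%:R <= _).
  by rewrite ler_wpM2l ?dw_ge0// hw_leS.
by rewrite /dw -[X in _ * X]powRr1// -powRD ?n0 ?implybT// addrC.
Qed.

End PowerWeights.

Lemma hw_ge0 (R : realType) (beta : R) n : 1 < beta -> 0 <= hw beta n.
Proof. by move=> b1; rewrite (le_trans ler01)// hw_ge1. Qed.

Ltac nneg := first
  [ assumption
  | match goal with
    | |- is_true (0 <= _ * _) => apply: mulr_ge0; nneg
    | |- is_true (0 <= _ + _) => apply: addr_ge0; nneg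
    | |- is_true (0 <= _ ^+ _) => apply: exprn_ge0; nneg
    | |- is_true (0 <= _ ^-1) => rewrite invr_ge0; nneg
    | |- is_true (0 <= _ `^ _) => exact: powR_ge0
    | |- is_true (0 <= seminorm_fun _ _) => exact: seminorm_ge0
    | |- is_true (0 <= psum _ _ _) => exact: psum_ge0
    | |- is_true (0 <= dw _ _) => exact: dw_ge0
    | |- is_true (0 <= hw _ _) => exact: hw_ge0
    | |- is_true (0 <= _%:R) => exact: ler0n
    end
  | done
  | apply: ltW; assumption ].

(** * The convolution algebra of sequences of order n^-beta *)

Section DecaySeries.
Context (R : realType) (beta : R).
Hypothesis beta_gt1 : 1 < beta.
Context (A : pzRingType) (N : seminorm R A).
Hypothesis NM : forall x y, N (x * y) <= N x * N y.
Implicit Types a b c : fps A.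
Local Notation dw := (dw beta).
Local Notation hw := (hw beta).

Let beta_ge0 : 0 <= beta.
Proof. by rewrite (le_trans ler01)// ltW. Qed.

(* One of the two indices of each term is at least [n / 2]. *)
Lemma fpsM_half a b (U V : R) n : 0 <= U -> 0 <= V ->
  (forall i, (i <= n)%N -> (n <= i.*2)%N ->
    N (a i) * N (b (n - i)%N) <= U * N (b (n - i)%N)) ->
  (forall i, (i <= n)%N -> (n <= i.*2)%N ->
    N (a (n - i)%N) * N (b i) <= V * N (a (n - i)%N)) ->
  N ((a * b) n) <= U * psum N b n.+1 + V * psum N a n.+1.
Proof.
move=> U0 V0 aU bV; apply: le_trans (seminorm_fpsM NM _ _ _) _.
have -> : psum N b n.+1 = \sum_(i < n.+1) N (b (n - i)%N).
  by rewrite /psum (reindex_inj rev_ord_inj)/=; apply: eq_bigr => i _; rewrite subSS.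
rewrite !mulr_sumr -big_split/=; apply: ler_sum => i _.
have iN : (i <= n)%N by rewrite -ltnS.
have [ni|ni] := leqP n i.*2.
  by rewrite (le_trans (aU _ _ _))// lerDl mulr_ge0 ?seminorm_ge0.
have := bV (n - i)%N (leq_subr _ _); rewrite subKn// => h.
by rewrite (le_trans (h _)) ?lerDr ?mulr_ge0 ?seminorm_ge0//; lia.
Qed.

Definition dec a := exists2 C : R, 0 <= C & forall n, N (a n) <= C * dw n.
Definition dech a := exists2 C : R, 0 <= C & forall n, N (a n) <= C * (dw n * hw n).
Definition abssum a := exists S : R, forall n, psum N a n <= S.

Lemma dec_abssum a : dec a -> abssum a.
Proof.
move=> [C C0 aC]; exists (C * (1 + (beta - 1)^-1)) => n.
apply: le_trans (_ : \sum_(i < n) C * dw i <= _); first by apply: ler_sum => i _.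
by rewrite -mulr_sumr ler_wpM2l// sum_dw.
Qed.

Lemma decD a b : dec a -> dec b -> dec (a + b).
Proof.
move=> [C C0 aC] [D D0 bD]; exists (C + D) => [|n]; first exact: addr_ge0.
by rewrite fpsD (le_trans (seminormD _ _ _))// mulrDl lerD.
Qed.

Lemma decN a : dec a -> dec (- a).
Proof. by move=> [C C0 aC]; exists C => // n; rewrite fpsN seminormN. Qed.

Lemma dechD a b : dech a -> dech b -> dech (a + b).
Proof.
move=> [C C0 aC] [D D0 bD]; exists (C + D) => [|n]; first exact: addr_ge0.
by rewrite fpsD (le_trans (seminormD _ _ _))// mulrDl lerD.
Qed.

Lemma dec_dech a : dec a -> dech a.
Proof.
move=> [C C0 aC]; exists C => // n; rewrite (le_trans (aC n))// ler_wpM2l//.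
by rewrite ler_peMr ?dw_ge0// hw_ge1.
Qed.

Lemma dec_finite a m : (forall n, (m <= n)%N -> a n = 0) -> dec a.
Proof.
move=> am; have S0 : 0 <= psum N a m by exact: psum_ge0.
exists (psum N a m / dw m) => [|n]; first by rewrite divr_ge0// dw_ge0.
have [mn|nm] := leqP m n.
  by rewrite am// seminorm0 mulr_ge0 ?dw_ge0// divr_ge0// dw_ge0.
apply: le_trans (_ : psum N a m <= _).
  rewrite /psum (bigD1 (Ordinal nm))//= lerDl.
  by apply: sumr_ge0 => i _; exact: seminorm_ge0.
rewrite -mulrA -[leLHS]mulr1 ler_wpM2l// ler_pdivlMl ?dw_gt0// mulr1.
by rewrite dw_le// ltnW.
Qed.

Lemma decC x : dec (fpsC x).
Proof. by apply: (@dec_finite _ 1) => -[]. Qed.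

Lemma decM a b : dec a -> dec b -> dec (a * b).
Proof.
move=> da db; have [S aS] := dec_abssum da; have [T bT] := dec_abssum db.
case: da => C C0 aC; case: db => D D0 bD.
have S0 : 0 <= S by apply: le_trans (aS 0%N); exact: psum_ge0.
have T0 : 0 <= T by apply: le_trans (bT 0%N); exact: psum_ge0.
have p0 : 0 <= 2 `^ beta :> R by exact: powR_ge0.
exists (C * 2 `^ beta * T + D * 2 `^ beta * S) => [|n].
  nneg.
apply: le_trans (fpsM_half (U := C * 2 `^ beta * dw n) (V := D * 2 `^ beta * dw n) _ _ _ _) _.
- nneg.
- nneg.
- move=> i _ ni; rewrite ler_wpM2r ?seminorm_ge0// (le_trans (aC i))// -mulrA.
  by rewrite ler_wpM2l// dw_half.
- move=> i _ ni; rewrite mulrC ler_wpM2r ?seminorm_ge0// (le_trans (bD i))// -mulrA.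
  by rewrite ler_wpM2l// dw_half.
rewrite mulrDl; apply: lerD.
  by rewrite [leRHS]mulrAC; apply: ler_wpM2l; [nneg | exact: bT].
by rewrite [leRHS]mulrAC; apply: ler_wpM2l; [nneg | exact: aS].
Qed.

Lemma dwhw_half j n : (j <= n)%N -> (n <= j.*2)%N ->
  dw j * hw j <= 2 `^ beta * (dw n * hw n).
Proof.
by move=> jn nj; rewrite mulrA; apply: ler_pM; [nneg | nneg | exact: dw_half | exact: hw_le].
Qed.

(** For [beta <= 3/2] the sequence [dw n * hw n] is not summable, so the argument of [decM] fails
    for [b]. Its partial sums are at most [hw n] by [sum_dw_hw], just the factor that the target
    rate affords. *)
Lemma dec_dechM a b : dec a -> dech b -> dech (a * b).
Proof.
move=> da; have [S aS] := dec_abssum da.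
case: da => C C0 aC; case=> D D0 bD.
have S0 : 0 <= S by apply: le_trans (aS 0%N); exact: psum_ge0.
have p0 : 0 <= 2 `^ beta :> R by exact: powR_ge0.
exists (C * 2 `^ beta * D + D * 2 `^ beta * S) => [|n].
  nneg.
apply: le_trans (fpsM_half (U := C * 2 `^ beta * dw n) (V := D * 2 `^ beta * (dw n * hw n)) _ _ _ _) _.
- nneg.
- nneg.
- move=> i _ ni; rewrite ler_wpM2r ?seminorm_ge0// (le_trans (aC i))// -mulrA.
  by rewrite ler_wpM2l// dw_half.
- move=> i iN ni; rewrite mulrC ler_wpM2r ?seminorm_ge0// (le_trans (bD i))// -mulrA.
  by rewrite ler_wpM2l// dwhw_half.
rewrite mulrDl; apply: lerD.
  have -> : C * 2 `^ beta * D * (dw n * hw n) = C * 2 `^ beta * dw n * (D * hw n) by ring.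
  apply: ler_wpM2l; first nneg.
  apply: le_trans (_ : \sum_(i < n.+1) D * (dw i * hw i) <= _).
    by apply: ler_sum => i _; exact: bD.
  by rewrite -mulr_sumr; apply: ler_wpM2l => //; exact: sum_dw_hw.
by rewrite [leRHS]mulrAC; apply: ler_wpM2l; [nneg | exact: aS].
Qed.

(** Otherwise disjoint blocks of mass more than [e] could be chosen forever, and the partial sums
    would exceed [S]. *)
Lemma abssum_tail a (e : R) : abssum a -> 0 < e ->
  exists m, forall n, (m <= n)%N -> \sum_(m <= i < n) N (a i) <= e.
Proof.
move=> [S aS] e0; apply: contrapT => /forallNP h.
have step k : exists m, k%:R * e <= psum N a m.
  elim: k => [|k [m km]]; first by exists 0%N; rewrite mul0r psum_ge0.
  have /existsNP[n /not_implyP[mn /negP]] := h m; rewrite -ltNge => en.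
  exists n; rewrite -natr1 mulrDl mul1r /psum -(big_mkord xpredT (N \o a)).
  rewrite (big_cat_nat (n := m))//= big_mkord; apply: lerD => //; exact: ltW.
have [m] := step (Num.truncn (S / e)).+1.
apply/negP; rewrite -ltNge (le_lt_trans (aS m))//.
by rewrite -ltr_pdivrMr// truncnS_gt.
Qed.

Definition fps_trunc m a : fps A := fun n => if (n < m)%N then a n else 0.

Lemma psum_trunc m a n : psum N (fps_trunc m a) n <= psum N a n.
Proof.
by apply: ler_sum => i _; rewrite /fps_trunc; case: ifP => // _; rewrite seminorm0 seminorm_ge0.
Qed.

Lemma psum_sub_trunc m a n e : 
  (forall n, (m <= n)%N -> \sum_(m <= i < n) N (a i) <= e) -> psum N (a - fps_trunc m a) n <= e.
Proof.
move=> h; apply: le_trans (psum_le _ _ (leq_maxr m n)) _.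
rewrite /psum -(big_mkord xpredT (fun i => N ((a - fps_trunc m a) i))).
rewrite (big_cat_nat (n := m)) ?leq_maxl//= big_nat_cond big1 ?add0r.
  apply: le_trans (h _ (leq_maxl m n)); rewrite le_eqVlt; apply/orP; left; apply/eqP.
  apply: eq_big_nat => i /andP[mi _]; rewrite fpsB /fps_trunc ltnNge mi/= subr0//.
by move=> i /andP[/andP[_ im] _]; rewrite fpsB /fps_trunc im subrr seminorm0.
Qed.

(* With [T] a truncation of [w], [w = T + e w] where [e = (w - T) m = 1 - T m]
   is small in l1 and decays like [m]. *)
Lemma dec_inverse (m w : fps A) : m * w = 1 -> w * m = 1 -> abssum w -> dec m -> dec w.
Proof.
move=> mw wm sw dm; have [T mT] := dec_abssum dm.
have [S wS] := sw.
have T0 : 0 <= T by apply: le_trans (mT 0%N); exact: psum_ge0.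
have S0 : 0 <= S by apply: le_trans (wS 0%N); exact: psum_ge0.
set p : R := 2 `^ beta.
have p0 : 0 < p by rewrite powR_gt0.
(* Passing from an index [i >= n / 2] to [n] costs the factor [p = 2^beta]. With [e] of l1 norm at
   most [1 / (2 p)], the recursive term is half of the bound to be proved. *)
pose ep := (2 * p)^-1.
have ep0 : 0 < ep by rewrite invr_gt0 mulr_gt0.
have [k0 hk0] := abssum_tail sw (divr_gt0 ep0 (ltr_wpDl T0 ltr01)).
pose k := k0.+1.
have hk n : (k <= n)%N -> \sum_(k <= i < n) N (w i) <= ep / (T + 1).
  move=> kn; apply: le_trans (hk0 n (ltnW kn)); rewrite [leRHS](big_cat_nat (n := k))//=.
  by rewrite lerDr; apply: sumr_ge0 => i _; exact: seminorm_ge0.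
pose t := fps_trunc k w.
pose e := (w - t) * m.
have et : e = 1 - t * m by rewrite /e mulrBl wm.
have wE : w = t + e * w by rewrite /e -mulrA mw mulr1 addrC subrK.
have dt : dec t by apply: (@dec_finite _ k) => n kn; rewrite /t /fps_trunc ltnNge kn.
have de : dec e by rewrite et; apply: decD; [exact: decC|apply: decN; exact: decM].
have ee n : psum N e n <= ep.
  apply: le_trans (psumM NM _ _ _) _.
  apply: le_trans (ler_pM (psum_ge0 _ _ _) (psum_ge0 _ _ _) (psum_sub_trunc n hk) (mT n)) _.
  rewrite mulrAC ler_pdivrMr ?ltr_wpDl// ler_wpM2l ?ltW//.
  by rewrite ltrDl.
(* As [k > 0], the truncation keeps the constant term of [w]; hence [e] starts at index 1 and the
   induction for [w n] never calls on [w n] itself. *)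
have e0 : e 0%N = 0 by rewrite /e fpsM big_ord1 fpsB /t /fps_trunc /= subrr mul0r.
case: dt => Ct Ct0 tC; case: de => Ce Ce0 eC.
(* The solution of [C = Ct + Ce p S + C / 2]. *)
pose C := 2 * (Ct + Ce * p * S).
have C0 : 0 <= C by rewrite /C; nneg.
exists C => // n; elim/ltn_ind: n => n IH.
rewrite {1}wE fpsD; apply: le_trans (seminormD _ _ _) _.
apply: le_trans (lerD (tC n) (fpsM_half (U := Ce * p * dw n) (V := C * p * dw n) _ _ _ _)) _.
- nneg.
- nneg.
- move=> i _ ni; rewrite ler_wpM2r ?seminorm_ge0// (le_trans (eC i))// -mulrA.
  by rewrite ler_wpM2l// dw_half.
- move=> i iN ni; move: (iN); rewrite leq_eqVlt => /orP[/eqP ->|ilt].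
    by rewrite subnn e0 seminorm0 mul0r mulr0.
  rewrite mulrC ler_wpM2r ?seminorm_ge0// (le_trans (IH i ilt))// -mulrA.
  by rewrite ler_wpM2l// dw_half.
apply: le_trans (_ : Ct * dw n + (Ce * p * dw n * S + C * p * dw n * ep) <= _).
  by rewrite lerD2l; apply: lerD; (apply: ler_wpM2l; first nneg); [exact: wS | exact: ee].
have -> : C * p * dw n * ep = C / 2 * dw n.
  by rewrite /ep; field; rewrite lt0r_neq0.
by rewrite /C le_eqVlt; apply/orP; left; apply/eqP; field.
Qed.

(** The coefficient is the sum of [d i * q (n - i)] with [d = (1 - z) q]. For [i > n / 2] the
    difference [d i] is already of order [n^-beta]. For [i <= n / 2] summation by parts moves the
    difference to the factor whose index is at least [n / 2], at the price of a boundary term of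
    order [n^(2 - 2 beta)]. *)
Lemma dech_square (q : fps A) : (exists2 C : R, 0 <= C & forall n, N (q n) <= C * n.+1%:R `^ (1 - beta)) ->
  dec (fps_u A * q) -> dech (fps_u A * (q * q)).
Proof.
move=> [C C0 qC] [D D0 dD]; rewrite mulrA; set d := fps_u A * q in dD *.
have dS n : d n.+1 = q n.+1 - q n by rewrite /d fps_uMS.
have abel h n : (h <= n)%N -> \sum_(i < h.+1) d i * q (n - i)%N =
    q h * q (n - h)%N + \sum_(i < h) q i * d (n - i)%N.
  elim: h => [|h IH] hn.
    by rewrite big_ord1 big_ord0 addr0 /d fps_uM0.
  rewrite big_ord_recr/= IH ?(ltnW hn)// [in RHS]big_ord_recr/=.
  have -> : (n - h = (n - h.+1).+1)%N by lia.
  rewrite !dS mulrBr mulrBl !addrA; congr (_ - _).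
  by rewrite [LHS]addrC addrA [LHS]addrAC.
set p : R := 2 `^ beta; have p0 : 0 <= p by exact: powR_ge0.
have b0 : 0 <= beta - 1 by rewrite subr_ge0 ltW.
have sq n m : (m <= n)%N -> \sum_(i < m) N (q i) <= C * hw n.
  move=> mn; apply: le_trans (_ : \sum_(i < n.+1) N (q i) <= _).
    by apply: (@psum_le _ _ N q); rewrite leqW.
  by rewrite /hw mulr_sumr; apply: ler_sum.
exists (C ^+ 2 * p ^+ 2 + 2 * (C * D * p)) => [|n].
  nneg.
have hn : (n./2 <= n)%N by lia.
rewrite fpsM -(big_mkord xpredT (fun i => d i * q (n - i)%N)).
rewrite (big_cat_nat (n := n./2.+1))//= big_mkord abel//.
apply: le_trans (seminormD _ _ _) _.
apply: le_trans (lerD (seminormD _ _ _) (lexx _)) _.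
have I1 : N (q n./2 * q (n - n./2)%N) <= C ^+ 2 * p ^+ 2 * (dw n * hw n).
  apply: le_trans (NM _ _) _.
  have qp j : (n <= j.*2.+1)%N -> N (q j) <= C * (p * n.+1%:R `^ (1 - beta)).
    move=> nj; apply: le_trans (qC _) _; rewrite ler_wpM2l//.
    have /= h := powRN_half b0 nj; rewrite opprB in h; apply: le_trans h _.
    rewrite ler_wpM2r ?powR_ge0//; apply: ler_powR => //; first by rewrite ler1n.
    by rewrite gerBl.
  apply: le_trans (ler_pM (seminorm_ge0 _ _) (seminorm_ge0 _ _) (qp n./2 _) (qp (n - n./2)%N _)) _; try lia.
  have -> (x : R) : C * (p * x) * (C * (p * x)) = C ^+ 2 * p ^+ 2 * (x * x) by ring.
  by apply: ler_wpM2l; [nneg | exact: dw_hw_lower].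
have I2 : N (\sum_(i < n./2) q i * d (n - i)%N) <= C * D * p * (dw n * hw n).
  apply: le_trans (seminorm_sum _ _ _ _) _.
  apply: le_trans (_ : \sum_(i < n./2) N (q i) * (D * (p * dw n)) <= _).
    apply: ler_sum => i _; apply: le_trans (NM _ _) _.
    rewrite ler_wpM2l ?seminorm_ge0// (le_trans (dD _))// ler_wpM2l// dw_half//.
    by have := ltn_ord i; lia.
  rewrite -mulr_suml; apply: le_trans (ler_wpM2r _ (sq n _ hn)) _.
    nneg.
  rewrite le_eqVlt; apply/orP; left; apply/eqP; ring.
have I3 : N (\sum_(n./2.+1 <= i < n.+1) d i * q (n - i)%N) <= C * D * p * (dw n * hw n).
  apply: le_trans (seminorm_sum _ _ _ _) _.
  apply: le_trans (_ : \sum_(n./2.+1 <= i < n.+1) (D * (p * dw n)) * N (q (n - i)%N) <= _).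
    apply: ler_sum_nat => i /andP[hi _]; apply: le_trans (NM _ _) _.
    rewrite ler_wpM2r ?seminorm_ge0// (le_trans (dD _))// ler_wpM2l// dw_half//; lia.
  rewrite -mulr_sumr (_ : \sum_(_ <= i < _) _ = \sum_(i < n - n./2) N (q i)); last first.
    rewrite -(big_mkord xpredT (N \o q)) -[n./2.+1]add0n big_addn/= subSS.
    rewrite big_nat_rev /= !big_mkord.
    by apply: eq_bigr => i _; congr (N (q _)); have := ltn_ord i; lia.
  apply: le_trans (ler_wpM2l _ (sq n _ (leq_subr _ _))) _.
    nneg.
  rewrite le_eqVlt; apply/orP; left; apply/eqP; ring.
lra.
Qed.

End DecaySeries.

(** * The complex unit circle and roots of unity *)

Lemma sin_le_id (R : realType) (x : R) : 0 <= x -> sin x <= x.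
Proof.
move=> x0.
have [c _ sc] := MVT_segment x0 (fun y _ => is_derive_sin y)
  (continuous_subspaceT (@continuous_sin R)).
by move: sc; rewrite sin0 !subr0 => ->; rewrite ler_piMl// cos_le1.
Qed.

Lemma normr_sin_le (R : realType) (x : R) : `|sin x| <= `|x|.
Proof.
wlog x0 : x / 0 <= x => [h|].
  have [x0|/ltW x0] := leP 0 x; first exact: h.
  by rewrite -normrN -sinN -[leRHS]normrN h// oppr_ge0.
have [x1|x1] := leP x 1.
  have s0 : 0 <= sin x by apply: sin_ge0_pi; rewrite x0/= (le_trans x1)// (le_trans _ (pi_ge2 R))// ler1n.
  by rewrite !ger0_norm// sin_le_id.
by rewrite (le_trans (sin_max _))// ger0_norm// ltW.
Qed.

Section UnitCircle.
Context (R : realType).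
Implicit Types (z : R[i]) (t : R).

Lemma normc_ge0 z : 0 <= normc z.
Proof. by case: z => a b; exact: sqrtr_ge0. Qed.
Lemma normcDle z w : normc (z + w) <= normc z + normc w.
Proof. exact: (le_normcD (z : Rcomplex R) w). Qed.
Lemma normc_opp z : normc (- z) = normc z.
Proof. exact: (normcN (z : Rcomplex R)). Qed.

Definition cnorm : seminorm R R[i] := Seminorm (@normc0 R) normcDle normc_opp.

Lemma normcX z n : normc (z ^+ n) = normc z ^+ n.
Proof. by elim: n => [|n IH]; rewrite ?expr0 ?normc1// !exprS normcM IH. Qed.

Lemma normc_nat n : normc (n%:R : R[i]) = n%:R.
Proof.
have -> : (n%:R : R[i]) = Complex n%:R 0.
  elim: n => [//|n IH]; rewrite -!natr1 IH; apply/eqP.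
  by rewrite eq_complex/= !eqxx/= add0r eqxx.
by rewrite /normc expr0n/= addr0 sqrtr_sqr ger0_norm.
Qed.

Definition cis t : R[i] := Complex (cos t) (sin t).

Lemma cis0 : cis 0 = 1.
Proof. by rewrite /cis cos0 sin0. Qed.

Lemma cisD t u : cis (t + u) = cis t * cis u.
Proof.
by apply/eqP; rewrite eq_complex /= cosD sinD; apply/andP; split; apply/eqP; ring.
Qed.

Lemma cisX t n : cis t ^+ n = cis (n%:R * t).
Proof.
elim: n => [|n IH]; first by rewrite mul0r cis0.
by rewrite exprS IH -cisD -natr1 mulrDl mul1r addrC.
Qed.

Lemma normc_cis t : normc (cis t) = 1.
Proof. by rewrite /normc /= cos2Dsin2 sqrtr1. Qed.

Lemma cis_pi : cis pi = -1.
Proof. by apply/eqP; rewrite eq_complex /= cospi sinpi oppr0 !eqxx. Qed.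

Lemma cos_half t : cos t = 1 - sin (t / 2) ^+ 2 *+ 2.
Proof.
have -> : cos t = cos ((t / 2) *+ 2) by congr cos; rewrite -mulr_natr; field.
by rewrite cos_mulr2n cos2sin2; ring.
Qed.

(** The chord has length [2 |sin (t / 2)|]. *)
Lemma normc_1cis t : normc (1 - cis t) <= `|t|.
Proof.
rewrite -(@ler_pXn2r _ 2)// ?nnegrE ?normc_ge0// /normc /= sqr_sqrtr ?addr_ge0 ?sqr_ge0//.
rewrite sub0r sqrrN sin2cos2 cos_half.
have -> : (1 - (1 - sin (t / 2) ^+ 2 *+ 2)) ^+ 2 + (1 - (1 - sin (t / 2) ^+ 2 *+ 2) ^+ 2) =
  (2 * `|sin (t / 2)|) ^+ 2 :> R by rewrite exprMn real_normK ?num_real//; ring.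
rewrite ler_pXn2r ?nnegrE// ?mulr_ge0//.
apply: le_trans (ler_wpM2l _ (normr_sin_le _)) _ => //.
by rewrite normrM (ger0_norm (_ : 0 <= 2^-1))//; lra.
Qed.

Lemma cis_neq1 t : 0 < t < 2 * pi -> cis t != 1.
Proof.
move=> /andP[t0 t2]; apply/eqP => /(congr1 (@complex.Re R)) /=.
rewrite cos_half => h.
have : 0 < sin (t / 2) by apply: sin_gt0_pi; rewrite divr_gt0//= ltr_pdivrMr// mulrC.
by move=> /(exprn_gt0 2); rewrite mulr2n in h; lra.
Qed.

Lemma cis_surj z : normc z = 1 -> exists2 t, 0 <= t < 2 * pi & z = cis t.
Proof.
case: z => a b /= ab.
have ab1 : a ^+ 2 + b ^+ 2 = 1.
  have := congr1 (fun x => x ^+ 2) ab; rewrite sqr_sqrtr ?expr1n//.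
  by rewrite addr_ge0 ?sqr_ge0.
have a1 : -1 <= a <= 1.
  rewrite -ler_norml -(@ler_pXn2r _ 2)// ?nnegrE// expr1n real_normK ?num_real//.
  by rewrite -ab1 lerDl sqr_ge0.
have p0 := @pi_gt0 R.
have [/andP[c0 c1] cE] := acos_def a1.
have sE : sin (acos a) = `|b|.
  by rewrite sin_acos// -ab1 addrAC subrr add0r sqrtr_sqr.
have [b0|b0] := leP 0 b.
  exists (acos a); first by rewrite c0/=; lra.
  by rewrite /cis cE sE ger0_norm.
exists (2 * pi - acos a).
  have : 0 < acos a.
    rewrite lt_neqAle c0 andbT; apply/eqP => h0.
    by move: sE; rewrite -h0 sin0 => /esym/eqP; rewrite normr_eq0 lt_eqF.
  by move=> h0; rewrite subr_ge0; apply/andP; split; lra.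
have -> : cis (2 * pi - acos a) = cis (- acos a).
  by rewrite cisD -[2 * _]/(2%:R * pi) -cisX cis_pi sqrrN expr1n mul1r.
by rewrite /cis cosN sinN cE sE ltr0_norm// opprK.
Qed.

(* Average of [z^-n X(z)] over the [L]-th roots of unity. *)
Lemma coef_le_sup (V : lmodType R[i]) (N : seminorm R V)
    (NZ : forall c x, N (c *: x) = normc c * N x) (w : nat -> V) L S :
  (forall z, normc z = 1 -> N (\sum_(n < L) z ^+ n *: w n) <= S) ->
  forall n, (n < L)%N -> N (w n) <= S.
Proof.
move=> wS n nL; have L0 : (0 < L)%N by lia.
pose om := cis (2 * pi / L%:R).
have omL : om ^+ L = 1.
  rewrite cisX mulrC divfK ?pnatr_eq0 -?lt0n// -[2 * _]/(2%:R * pi) -cisX cis_pi.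
  by rewrite sqrrN expr1n.
have om1 k : (0 < k < L)%N -> om ^+ k != 1.
  move=> /andP[k0 kL]; rewrite cisX; apply: cis_neq1.
  have Lp : 0 < L%:R :> R by rewrite ltr0n.
  apply/andP; split; first by rewrite mulr_gt0 ?ltr0n// divr_gt0// mulr_gt0// pi_gt0.
  by rewrite mulrA ltr_pdivrMr// mulrC ltr_pM2l ?ltr_nat// mulr_gt0// pi_gt0.
(* The inverse of [om], written as a power so that it is visibly an [L]-th root of unity too. *)
pose ov := om ^+ L.-1.
have omv : om * ov = 1 by rewrite /ov -exprS prednK.
have orth m : (m < L)%N -> \sum_(j < L) (om ^+ j) ^+ m * (ov ^+ j) ^+ n =
    if m == n then L%:R else 0.
  move=> mL; case: eqP => [->|/eqP mn].
    rewrite (eq_bigr (fun=> 1)); first by rewrite sumr_const card_ord.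
    by move=> j _; rewrite -!exprM ![(j * _)%N]mulnC !exprM -exprMn -exprMn omv !expr1n.
  pose q := om ^+ m * ov ^+ n.
  have qL : q ^+ L = 1.
    by rewrite exprMn exprAC omL expr1n mul1r exprAC /ov (exprAC _ L.-1) omL !expr1n.
  have q1 : q != 1.
    rewrite /q; wlog lt : / (n < m)%N.
      move=> h; have [|mn'] := ltnP n m; first exact: h.
      apply/eqP => /(congr1 (fun x => x * om ^+ n)); rewrite -mulrA -exprMn (mulrC ov) omv expr1n mulr1 mul1r.
      rewrite -(subnKC mn') exprD -{1}[om ^+ m]mulr1 => /mulfI h1.
      have : om ^+ m != 0.
        by apply: expf_neq0; apply/eqP => o0; move: omv; rewrite o0 mul0r => /eqP; rewrite eq_sym oner_eq0.
      move=> /h1 /esym/eqP; apply/negP; apply: om1; lia.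
    by rewrite -(subnKC (ltnW lt)) exprD mulrAC -exprMn omv expr1n mul1r; apply: om1; lia.
  rewrite (eq_bigr (fun j : 'I_L => q ^+ j)); last first.
    by move=> j _; rewrite /q exprMn -!exprM ![(j * _)%N]mulnC.
  have /eqP := subrX1 q L; rewrite qL subrr eq_sym mulf_eq0 subr_eq0 (negbTE q1).
  by move=> /eqP.
have key : L%:R *: w n = \sum_(j < L) (ov ^+ j) ^+ n *: \sum_(m < L) (om ^+ j) ^+ m *: w m.
  under eq_bigr do rewrite scaler_sumr; rewrite exchange_big/=.
  rewrite (bigD1 (Ordinal nL))//= [X in _ + X]big1 ?addr0.
    under eq_bigr do rewrite scalerA mulrC.
    by rewrite -scaler_suml orth// eqxx.
  move=> m mn; under eq_bigr do rewrite scalerA mulrC.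
  by rewrite -scaler_suml orth// ifF ?scale0r//; apply: contraNF mn => /eqP mn; apply/eqP/val_inj.
have Lp : 0 < L%:R :> R by rewrite ltr0n.
rewrite -(ler_pM2l Lp) -{1}normc_nat -NZ key (le_trans (seminorm_sum _ _ _ _))//.
have -> : L%:R * S = \sum_(j < L) S by rewrite sumr_const card_ord mulr_natl.
apply: ler_sum => j _; rewrite NZ !normcX !normc_cis !expr1n mul1r.
by apply: wS; rewrite normcX normc_cis expr1n.
Qed.

End UnitCircle.

(** * Wiener's lemma for scalar power series *)

Section ScalarWiener.
Context (R : realType).
Local Notation C := R[i].
Local Notation cn := (cnorm R).
Local Notation abssum := (abssum cn).
Local Notation psum := (psum cn).

Lemma cnormM (x y : C) : cn (x * y) <= cn x * cn y.
Proof. by rewrite /= normcM. Qed.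

Lemma psum1 n : psum 1 n <= 1.
Proof.
case: n => [|n]; first by rewrite /psum big_ord0.
rewrite /psum big_ord_recl big1 ?addr0 => [|i _]; last exact: normc0.
by rewrite -[leLHS]/(normc 1) normc1.
Qed.

Definition fps_poly (p : {poly C}) : fps C := fun n => p`_n.

Lemma fps_polyM p q : fps_poly (p * q) = fps_poly p * fps_poly q.
Proof. by apply/funext => n; rewrite fpsM /fps_poly coefM. Qed.

Lemma fps_polyX p n : fps_poly (p ^+ n) = fps_poly p ^+ n.
Proof.
elim: n => [|n IH]; last by rewrite !exprS fps_polyM IH.
by apply/funext => -[|n]; rewrite /fps_poly coef1.
Qed.

Lemma fps_trunc_poly n (a : fps C) : fps_trunc n a = fps_poly (\poly_(i < n) a i).
Proof. by apply/funext => i; rewrite /fps_poly coef_poly. Qed.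

Lemma abssumM (a b : fps C) : abssum a -> abssum b -> abssum (a * b).
Proof.
move=> [S aS] [T bT]; exists (S * T) => n.
apply: le_trans (psumM cnormM _ _ _) _.
by apply: ler_pM; rewrite ?psum_ge0.
Qed.

Lemma abssumC x : abssum (fpsC x).
Proof.
exists (normc x) => -[|n]; first by rewrite /psum big_ord0 normc_ge0.
rewrite /psum big_ord_recl/= big1 ?addr0// => i _; exact: normc0.
Qed.

(** [p] splits into linear factors whose roots [l] have modulus above 1, and the inverse of [z - l]
    has the summable geometric coefficients [- l^-(n+1)]. *)
Lemma fps_poly_inv (p : {poly C}) : (forall z, normc z <= 1 -> p.[z] != 0) ->
  exists2 y : fps C, fps_poly p * y = 1 & abssum y.
Proof.
move=> p0; have [r pr] := closed_field_poly_normal p.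
have p1 : lead_coef p != 0.
  by rewrite lead_coef_eq0; apply: contra (p0 0 _) => [/eqP ->|]; rewrite ?horner0 ?normc0.
have [y ry yS] : exists2 y : fps C, fps_poly (\prod_(z <- r) ('X - z%:P)) * y = 1 & abssum y.
  have r1 z : z \in r -> 1 < normc z.
    move=> zr; rewrite ltNge; apply/negP => /p0; rewrite pr hornerZ mulf_eq0 (negbTE p1)/=.
    by rewrite -[_ == 0]/(root _ z) root_prod_XsubC zr.
  elim: r r1 {pr} => [|l r IH] r1.
    exists 1; last exact: abssumC.
    by rewrite mulr1 big_nil; apply/funext => -[|n]; rewrite /fps_poly coef1.
  have [z zr|y ry yS] := IH; first by apply: r1; rewrite inE zr orbT.
  have l1 : 1 < normc l by apply: r1; rewrite inE eqxx.
  have l0 : l != 0 by apply/eqP => l0; move: l1; rewrite l0 normc0 ltr10.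
  pose x : fps C := fun n => - l^-1 ^+ n.+1.
  exists (x * y).
    rewrite big_cons fps_polyM mulrACA ry mulr1; apply/funext => -[|n].
      rewrite fpsM big_ord1 /fps_poly !coefB coefX coefC /= sub0r /x expr1 mulrNN.
      by rewrite fps1 divff.
    rewrite fpsM 2!big_ord_recl big1 ?addr0 => [|i _].
      rewrite /fps_poly !coefB !coefX !coefC /= sub0r subr0 mul1r /x fps1/=.
      by rewrite /bump /= subn1/= mulrNN subn0 [_ ^+ n.+2]exprS mulrA divff// mul1r subrr.
    by rewrite /fps_poly coefB coefX coefC/= subr0 mul0r.
  apply: abssumM => //.
  pose q := (normc l)^-1; have q1 : 0 <= q < 1.
    by rewrite /q invr_ge0 normc_ge0 invf_lt1// (lt_trans ltr01).
  exists (q / (1 - q)) => n; rewrite ler_pdivlMr; last by rewrite subr_gt0; case/andP: q1.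
  have -> : psum x n = q * \sum_(i < n) q ^+ i.
    by rewrite mulr_sumr; apply: eq_bigr => i _; rewrite seminormN /= normcX normcV exprS.
  rewrite -mulrA mulrC -[leRHS]mul1r ler_wpM2r//; first by case/andP: q1.
  by rewrite mulrC -opprB mulNr -subrX1 opprB gerBl exprn_ge0//; case/andP: q1.
exists (fpsC (lead_coef p)^-1 * y); last by apply: abssumM => //; exact: abssumC.
rewrite [in X in X * _]pr; have -> : fps_poly (lead_coef p *: \prod_(z <- r) ('X - z%:P)) =
    fpsC (lead_coef p) * fps_poly (\prod_(z <- r) ('X - z%:P)).
  by apply/funext => n; rewrite fpsCM /fps_poly coefZ.
by rewrite mulrACA ry mulr1 -fpsC_mul mulfV.
Qed.

(** The power has at most [D j + 1] nonzero coefficients, each below the supremum on the circle by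
    [coef_le_sup]. Passing from the supremum norm to l1 thus costs a factor only linear in [j]. *)
Lemma psum_polyX (p : {poly C}) (D : nat) (B : R) j n : (size p <= D)%N ->
  (forall z, normc z = 1 -> normc p.[z] <= B) ->
  psum (fps_poly p ^+ j) n <= (D * j).+1%:R * B ^+ j.
Proof.
move=> pD pB; rewrite -fps_polyX.
have B0 : 0 <= B by apply: le_trans (pB 1 (normc1 _)); exact: normc_ge0.
have sz : (size (p ^+ j) <= (D * j).+1)%N.
  apply: leq_trans (size_exp_leq _ _) _; rewrite ltnS leq_mul2r.
  by apply/orP; right; apply: leq_trans pD; exact: leq_pred.
set L := (D * j).+1 in sz *.
have cB i : normc ((p ^+ j)`_i) <= B ^+ j.
  have [iL|Li] := ltnP i L; last by rewrite nth_default ?normc0 ?exprn_ge0// (leq_trans sz).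
  apply: (@coef_le_sup R C^o cn _ (fun k => (p ^+ j)`_k) L (B ^+ j) _ i iL) => [c x|z z1].
    by rewrite /= normcM.
  rewrite (_ : \sum_(_ < _) _ = (p ^+ j).[z]).
    rewrite horner_exp /= normcX; apply: lerXn2r => //; rewrite ?nnegrE ?normc_ge0//; exact: pB.
  rewrite (horner_coef_wide z sz); apply: eq_bigr => i' _; exact: mulrC.
apply: le_trans (psum_le _ _ (leq_maxr L n)) _.
have -> : psum (fps_poly (p ^+ j)) (maxn L n) = psum (fps_poly (p ^+ j)) L.
  rewrite /psum -!(big_mkord xpredT (fun i => cn (fps_poly (p ^+ j) i))).
  rewrite (big_cat_nat (n := L)) ?leq_maxl//= [X in _ + X]big_nat_cond [X in _ + X]big1 ?addr0//.
  by move=> i /andP[/andP[Li _] _]; rewrite /fps_poly nth_default ?normc0// (leq_trans sz).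
apply: le_trans (_ : \sum_(i < L) B ^+ j <= _); first by apply: ler_sum => i _; exact: cB.
by rewrite sumr_const card_ord mulr_natl.
Qed.

(* Newman's argument: the powers of [1 / p], [p] a truncation of [k], grow in l1
   no faster than in the supremum norm. *)
Lemma scalar_wiener (k : fps C) (de : R) n0 : 0 < de -> abssum k ->
  (forall n z, (n0 <= n)%N -> normc z <= 1 -> de <= normc (\sum_(i < n) k i * z ^+ i)) ->
  exists2 p : fps C, k * p = 1 & abssum p.
Proof.
move=> de0 sk kde.
(* The powers [y^m] below grow like [(3 / de)^m] up to a linear factor; a remainder [r] of mass
   [de / 16] makes [(y r)^m] decay like [(3 / 16)^m], again up to a linear factor. *)
have [n1 hn1] := abssum_tail sk (divr_gt0 de0 (ltr0Sn _ 15)).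
pose n := (n0 + n1).+1.
have tk m : (n <= m)%N -> \sum_(n <= i < m) cn (k i) <= de / 16.
  move=> nm; apply: le_trans (hn1 m _); last by lia.
  rewrite [leRHS](big_cat_nat (n := n))//=; last by lia.
  by rewrite lerDr; apply: sumr_ge0 => i _; exact: normc_ge0.
pose P := \poly_(i < n) k i.
have PE z : P.[z] = \sum_(i < n) k i * z ^+ i by rewrite horner_poly.
have Pde z : normc z <= 1 -> de <= normc P.[z] by move=> z1; rewrite PE; apply: kde => //; lia.
have [|y Py yS] := @fps_poly_inv P.
  by move=> z /Pde; apply: contraTneq => ->; rewrite normc0 -ltNge.
have [T kT] := sk; have T0 : 0 <= T := le_trans (psum_ge0 _ _ _) (kT 0%N).
(* The first bound keeps the powers of [d] below those of [1 / de]; the second makes [d P] of l1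
   norm at most 1, as [P] has l1 norm at most [T]. *)
pose ep := Num.min de^-1 (T + 1)^-1.
have ep0 : 0 < ep by rewrite lt_min !invr_gt0 de0/=; lra.
have [D hD] := abssum_tail yS ep0.
pose Bp := \poly_(i < D) y i.
pose b := fps_poly Bp; pose d := y - b.
have dep m : psum d m <= ep.
  by rewrite /d /b -fps_trunc_poly; exact: psum_sub_trunc.
have PT m : psum (fps_poly P) m <= T.
  by rewrite /P -fps_trunc_poly; apply: le_trans (psum_trunc _ _ _ _) _; exact: kT.
(* On the circle [b P = 1 - d P] has modulus at most 2 while [P] has modulus at least [de]. *)
have Bsup z : normc z = 1 -> normc Bp.[z] <= 2 / de.
  move=> z1; rewrite ler_pdivlMr//.
  apply: le_trans (ler_wpM2l (normc_ge0 _) (Pde z _)) _; first by rewrite z1.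
  rewrite -normcM -hornerM.
  have BP : fps_poly (Bp * P) = 1 - d * fps_poly P.
    by rewrite fps_polyM /d mulrBl (mulrC y) Py opprB addrCA subrr addr0.
  rewrite horner_coef; apply: le_trans (seminorm_sum cn _ _ _) _.
  apply: le_trans (_ : psum (1 - d * fps_poly P) (size (Bp * P)) <= _).
    rewrite -BP; apply: ler_sum => i _ /=.
    by rewrite normcM normcX z1 expr1n mulr1.
  apply: le_trans (psumB _ _ _ _) _; apply: (@le_trans _ _ (1 + 1)); last by [].
  apply: lerD.
    exact: psum1.
  apply: le_trans (psumM cnormM _ _ _) _.
  apply: le_trans (ler_pM (psum_ge0 _ _ _) (psum_ge0 _ _ _) (dep _) (PT _)) _.
  apply: le_trans (_ : (T + 1)^-1 * T <= _).
    by rewrite ler_wpM2r// ge_min lexx orbT.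
  by rewrite ler_pdivrMl ?mulr1; lra.
(* Binomial expansion of [(d + b)^m]: [d] is below [1 / de] in l1, and the powers of the polynomial
   [b] are below those of [2 / de] up to the linear factor. *)
have yX m j : psum (y ^+ m) j <= (D * m).+1%:R * (3 / de) ^+ m.
  have -> : y = d + b by rewrite subrK.
  rewrite exprDn; apply: le_trans (_ : \sum_(i < m.+1) psum (d ^+ (m - i) * b ^+ i *+ 'C(m, i)) j <= _).
    rewrite /psum exchange_big/=; apply: ler_sum => l _.
    by rewrite fps_sum; exact: (seminorm_sum cn).
  have -> : (3 / de) ^+ m = \sum_(i < m.+1) (de^-1 ^+ (m - i) * (2 / de) ^+ i) *+ 'C(m, i).
    by rewrite -exprDn; congr (_ ^+ _); ring.
  rewrite mulr_sumr; apply: ler_sum => i _.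
  have MN (a : fps C) l : psum (a *+ l) j = psum a j *+ l.
    rewrite /psum -sumrMnl; apply: eq_bigr => o _.
    have -> : (a *+ l) o = l%:R * a o by elim: l => [|l IH]; rewrite ?mulr0n ?mul0r// mulrS fpsD IH -natr1 mulrDl mul1r addrC.
    by rewrite /= normcM normc_nat mulr_natl.
  rewrite MN mulrnAr lerMn2r; apply/orP; right.
  apply: le_trans (psumM cnormM _ _ _) _; rewrite mulrCA; apply: ler_pM; rewrite ?psum_ge0//.
    elim: (m - i)%N => [|l IH].
      by rewrite !expr0 psum1.
    rewrite !exprS; apply: le_trans (psumM cnormM _ _ _) _; apply: ler_pM; rewrite ?psum_ge0//.
    by apply: le_trans (dep _) _; rewrite ge_min lexx.
  apply: le_trans (psum_polyX (D := D) _ _ _ Bsup) _; first exact: size_poly.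
  rewrite ler_wpM2r//; first by rewrite exprn_ge0// divr_ge0// ltW.
  by rewrite ler_nat ltnS leq_mul2l; apply/orP; right; rewrite -ltnS.
pose r := k - fps_poly P.
have rS m : psum r m <= de / 16.
  by rewrite /r /P -fps_trunc_poly; exact: psum_sub_trunc.
pose e := - (y * r).
have ky : k * y = 1 - e.
  by rewrite /e opprK /r mulrBr (mulrC y (fps_poly P)) Py addrCA subrr addr0 mulrC.
have [p [kp pk]] : exists p : fps C, k * p = 1 /\ p * k = 1.
  have k0 : k 0%N != 0.
    have := kde n 0 _ _; rewrite normc0 => /(_ _ ler01); rewrite /n big_ord_recl expr0 mulr1 big1 ?addr0.
      by move=> h; apply/eqP => k0; move: h; rewrite k0 normc0 leNgt de0/= => /(_ (leqW (leq_addr _ _))).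
    by move=> i _; rewrite expr0n /= mulr0.
  by apply: (fps_inv (u := (k 0%N)^-1)); rewrite ?mulfV ?mulVf.
exists p => //.
(* Large enough for [e^m] to have l1 norm at most 1/2, because
   [(D m + 1) (3/16)^m <= (D + 1) / 2^m]. *)
pose m := (D.+1).*2.
have eX j l : psum (e ^+ j) l <= (D * j).+1%:R * (3 / 16) ^+ j.
  rewrite /e -mulN1r exprMn exprMn.
  have -> : psum ((-1) ^+ j * (y ^+ j * r ^+ j)) l = psum (y ^+ j * r ^+ j) l.
    by rewrite -signr_odd; case: odd; rewrite ?mulN1r ?psumN ?mul1r.
  apply: le_trans (psumM cnormM _ _ _) _.
  have -> : (3 / 16 : R) ^+ j = (3 / de) ^+ j * (de / 16) ^+ j.
    by rewrite -exprMn; congr (_ ^+ _); field; exact: lt0r_neq0.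
  rewrite mulrA; apply: ler_pM; rewrite ?psum_ge0//.
  elim: j => [|j IH].
    by rewrite !expr0 psum1.
  rewrite !exprS; apply: le_trans (psumM cnormM _ _ _) _; exact: ler_pM (psum_ge0 _ _ _) (psum_ge0 _ _ _) (rS _) IH.
have em l : psum (e ^+ m) l <= 1 / 2.
  apply: le_trans (eX _ _) _.
  have p2 j : (j.+1 <= 2 ^ j)%N by elim: j => // j IH; rewrite expnS; lia.
  have h1 : (D * m).+1%:R <= D.+1%:R * (2 ^+ m) :> R.
    rewrite -natrX -natrM ler_nat; apply: leq_trans (leq_mul (leqnn _) (p2 m)); nia.
  apply: le_trans (ler_wpM2r _ h1) _; first by rewrite exprn_ge0//; lra.
  rewrite -mulrA -exprMn.
  apply: le_trans (_ : D.+1%:R * (1 / 2) ^+ m <= _).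
    by rewrite ler_wpM2l//; apply: lerXn2r; rewrite ?nnegrE; lra.
  rewrite expr_div_n expr1n mulrA mulr1 ler_pdivrMr ?exprn_gt0// mulrC mulrA mulr1.
  rewrite ler_pdivlMr// -natrX -natrM ler_nat; apply: leq_trans _ (p2 m); rewrite /m; lia.
(* Iteration of [p = y + e p]. For [j = m] the last term has at most half the partial sum of [p];
   partial sums being finite, it is absorbed on the left. *)
have pE j : p = y * \sum_(i < j) e ^+ i + e ^+ j * p.
  have p1 : p = y + e * p.
    have : p * (1 - e) = y by rewrite -ky mulrA pk mul1r.
    by move=> <-; rewrite mulrBr mulr1 (mulrC p e) subrK.
  elim: j => [|j IH]; first by rewrite big_ord0 mulr0 add0r expr0 mul1r.
  rewrite {1}IH big_ord_recr/= mulrDr -addrA; congr (_ + _).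
  by rewrite {1}p1 mulrDr (mulrC _ y) exprSr mulrA.
have [Y yY] : abssum (y * \sum_(i < m) e ^+ i).
  apply: abssumM => //; exists (\sum_(i < m) (D * i).+1%:R * (3 / 16) ^+ i) => l.
  apply: le_trans (_ : \sum_(i < m) psum (e ^+ i) l <= _); last by apply: ler_sum => i _.
  rewrite /psum exchange_big/=; apply: ler_sum => l' _.
  by rewrite fps_sum; exact: (seminorm_sum cn).
exists (2 * Y) => l; have := yY l; have : psum p l <= psum (y * \sum_(i < m) e ^+ i) l + 1 / 2 * psum p l.
  rewrite {1}(pE m); apply: le_trans (psumD _ _ _ _) _; rewrite lerD2l.
  apply: le_trans (psumM cnormM _ _ _) _; rewrite ler_wpM2r ?psum_ge0//.
lra.
Qed.

End ScalarWiener.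

(** * The ring of bounded operators *)

Section LmoduleNorms.
Context (R : realType) (V : lmodType R[i]).

Record lnorm := Lnorm {
  lnorm_seminorm :> seminorm R V;
  lnormZ : forall (c : R[i]) x, lnorm_seminorm (c *: x) = normc c * lnorm_seminorm x }.

Variable N : lnorm.

Definition bounded_linear (f : V -> V) : Prop :=
  (forall c x y, f (c *: x + y) = c *: f x + f y) /\
  exists2 c : R, 0 <= c & forall x, N (f x) <= c * N x.

Definition bop_pred : {pred V -> V} := fun f => `[< bounded_linear f >].

Lemma bop_closed : submod_closed bop_pred.
Proof.
split=> [|a f g /asboolP[lf [c c0 fc]] /asboolP[lg [d d0 gd]]]; apply/asboolP.
  split=> [c x y|]; first by rewrite /= scaler0 addr0.
  by exists 0 => // x; rewrite mul0r seminorm0.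
split=> [b x y|].
  rewrite -[LHS]/(a *: f (b *: x + y) + g (b *: x + y)).
  rewrite -[RHS]/(b *: (a *: f x + g x) + (a *: f y + g y)) lf lg !scalerDr !scalerA.
  by rewrite (mulrC a b) addrACA.
exists (normc a * c + d) => [|x]; first by rewrite addr_ge0 ?mulr_ge0 ?normc_ge0.
rewrite -[X in N X]/(a *: f x + g x) (le_trans (seminormD _ _ _))// mulrDl lerD//.
by rewrite lnormZ -mulrA ler_wpM2l ?normc_ge0.
Qed.

HB.instance Definition _ := GRing.isSubmodClosed.Build R[i] (V -> V) bop_pred bop_closed.

Record bop := Bop { bop_fun :> V -> V ; _ : bop_fun \in bop_pred }.
HB.instance Definition _ := [isSub of bop for bop_fun].
HB.instance Definition _ := [Choice of bop by <:].
HB.instance Definition _ := [SubChoice_isSubLmodule of bop by <:].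

Implicit Types (A B : bop) (x y : V).

Lemma bopP A B : (forall x, A x = B x) -> A = B.
Proof. by move=> AB; apply/val_inj/funext. Qed.

Lemma bopD A B x : (A + B) x = A x + B x. Proof. by []. Qed.
Lemma bopN A x : (- A) x = - A x. Proof. by []. Qed.
Lemma bopB A B x : (A - B) x = A x - B x. Proof. by []. Qed.
Lemma bopZ c A x : (c *: A) x = c *: A x. Proof. by []. Qed.
Lemma bop0 x : (0 : bop) x = 0. Proof. by []. Qed.

Lemma bop_bounded_linear A : bounded_linear A.
Proof. by case: A => f /= /asboolP. Qed.

Lemma bop_linear A c x y : A (c *: x + y) = c *: A x + A y.
Proof. by case: (bop_bounded_linear A). Qed.

Lemma bop_add A x y : A (x + y) = A x + A y.
Proof. by rewrite -[x]scale1r bop_linear !scale1r. Qed.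

Lemma bop_zero A : A 0 = 0.
Proof. by apply: (@addrI _ (A 0)); rewrite -bop_add !addr0. Qed.

Lemma bop_scale A c x : A (c *: x) = c *: A x.
Proof. by rewrite -[c *: x]addr0 bop_linear bop_zero addr0. Qed.

Lemma bop_opp A x : A (- x) = - A x.
Proof. by rewrite -scaleN1r bop_scale scaleN1r. Qed.

Lemma bop_sub A x y : A (x - y) = A x - A y.
Proof. by rewrite bop_add bop_opp. Qed.

Lemma bop_sumE I (r : seq I) (P : pred I) (F : I -> bop) x :
  (\sum_(i <- r | P i) F i) x = \sum_(i <- r | P i) F i x.
Proof. by elim/big_rec2: _ => // i u v _ <-. Qed.

Definition mkbop (f : V -> V) (h : bounded_linear f) : bop := Bop (introT (asboolP _) h).

Lemma bop_one_subproof : bounded_linear id.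
Proof. by split=> //; exists 1 => // x; rewrite mul1r. Qed.

Lemma bop_mul_subproof A B : bounded_linear (A \o B).
Proof.
split=> [c x y|]; first by rewrite /= !bop_linear.
case: (bop_bounded_linear A) => _ [c c0 Ac]; case: (bop_bounded_linear B) => _ [d d0 Bd].
exists (c * d) => [|x]; first exact: mulr_ge0.
by rewrite (le_trans (Ac _))// -mulrA ler_wpM2l.
Qed.

Definition bop_one := mkbop bop_one_subproof.
Definition bop_mul A B := mkbop (bop_mul_subproof A B).

Fact bop_mulA : associative bop_mul. Proof. by move=> A B C; apply: bopP. Qed.
Fact bop_mul1 : left_id bop_one bop_mul. Proof. by move=> A; apply: bopP. Qed.
Fact bop_mulr1 : right_id bop_one bop_mul. Proof. by move=> A; apply: bopP. Qed.
Fact bop_mulDl : left_distributive bop_mul +%R. Proof. by move=> A B C; apply: bopP. Qed.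
Fact bop_mulDr : right_distributive bop_mul +%R.
Proof. by move=> A B C; apply: bopP => x; rewrite /= bop_add. Qed.

HB.instance Definition _ := GRing.Zmodule_isPzRing.Build bop
  bop_mulA bop_mul1 bop_mulr1 bop_mulDl bop_mulDr.

Lemma bopM A B x : (A * B) x = A (B x). Proof. by []. Qed.
Lemma bop1 x : (1 : bop) x = x. Proof. by []. Qed.

Lemma bop_scaleAl c A B : (c *: A) * B = c *: (A * B).
Proof. by apply: bopP. Qed.
Lemma bop_scaleAr c A B : A * (c *: B) = c *: (A * B).
Proof. by apply: bopP => x; rewrite /= bop_scale. Qed.

(** The operator norm is the infimum of the admissible bounds. This form takes no normalization of
    vectors, on some of which the seminorm [N] may vanish. *)
Definition opn_set A : set R := [set c | 0 <= c /\ forall x, N (A x) <= c * N x].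
Definition opn_fun A : R := inf (opn_set A).

Lemma opn_has_inf A : has_inf (opn_set A).
Proof.
split; last by exists 0 => c [].
by case: (bop_bounded_linear A) => _ [c c0 Ac]; exists c.
Qed.

Lemma opn_ge0 A : 0 <= opn_fun A.
Proof. by apply: lb_le_inf => [|c []//]; case: (opn_has_inf A). Qed.

Lemma opnP A x : N (A x) <= opn_fun A * N x.
Proof.
have N0 := seminorm_ge0 N x.
have [Nx|Nx] := eqVneq (N x) 0.
  have [[c [c0 Ac]] _] := opn_has_inf A.
  by rewrite Nx mulr0 -[leRHS](mulr0 c) -Nx.
have {}N0 : 0 < N x by rewrite lt_neqAle eq_sym Nx.
rewrite -ler_pdivrMr//; apply: lb_le_inf => [|c [c0 Ac]]; first by case: (opn_has_inf A).
by rewrite ler_pdivrMr.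
Qed.

Lemma opn_le A c : 0 <= c -> (forall x, N (A x) <= c * N x) -> opn_fun A <= c.
Proof. by move=> c0 Ac; apply: ge_inf => //; case: (opn_has_inf A). Qed.

Lemma opn0 : opn_fun 0 = 0.
Proof.
apply/le_anti; rewrite opn_ge0 andbT; apply: opn_le => // x.
by rewrite bop0 seminorm0 mul0r.
Qed.

Lemma opnD A B : opn_fun (A + B) <= opn_fun A + opn_fun B.
Proof.
apply: opn_le => [|x]; first by rewrite addr_ge0 ?opn_ge0.
by rewrite bopD (le_trans (seminormD _ _ _))// mulrDl lerD ?opnP.
Qed.

Lemma opnN_le A : opn_fun (- A) <= opn_fun A.
Proof. by apply: opn_le => [|x]; rewrite ?opn_ge0// bopN seminormN opnP. Qed.

Lemma opnN A : opn_fun (- A) = opn_fun A.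
Proof. by apply/le_anti; rewrite opnN_le -{1}(opprK A) opnN_le. Qed.

Definition opn : seminorm R bop := Seminorm opn0 opnD opnN.

Lemma opnM A B : opn (A * B) <= opn A * opn B.
Proof.
apply: opn_le => [|x]; first by rewrite mulr_ge0 ?opn_ge0.
rewrite bopM (le_trans (opnP _ _))// -mulrA ler_wpM2l ?opn_ge0//; exact: opnP.
Qed.

Lemma opnZ c A : opn (c *: A) <= normc c * opn A.
Proof.
apply: opn_le => [|x]; first by rewrite mulr_ge0 ?opn_ge0 ?normc_ge0.
by rewrite bopZ lnormZ -mulrA ler_wpM2l ?normc_ge0//; exact: opnP.
Qed.

End LmoduleNorms.

#[global] Arguments seminorm_fun : simpl never.

(** * Summability of the inverse of an operator series *)

(** About [i] terms equal 1, and the others add up to at most [i^2] times a tail of the sum of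
    [1 / n^2]. Weighted by the coefficients of M, this turns the second differences at steps
    [pi / n], summed over [n], into the first moment of M. *)
Lemma sum_min1_sqr (R : realType) (i m : nat) :
  \sum_(n < m) Num.min 1 ((i%:R / n.+1%:R) ^+ 2) <= 2 * i%:R :> R.
Proof.
case: i => [|i].
  by rewrite big1 ?mulr0// => n _; rewrite mul0r expr0n/= min_r.
have [mi|im] := leqP m i.+1.
  apply: le_trans (_ : \sum_(n < m) (1 : R) <= _).
    by apply: ler_sum => n _; rewrite ge_min lexx.
  by rewrite sumr_const card_ord -natrM ler_nat; lia.
have im' : (i.+1 <= m)%N by lia.
(* The sharper bound [2 i - i^2 / m] passes through the induction, as [1 / (n + 1)^2] is at most
   [1 / n - 1 / (n + 1)]. *)
apply: (@le_trans _ _ (2 * i.+1%:R - i.+1%:R ^+ 2 / m%:R)); last first.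
  by rewrite gerBl mulr_ge0// invr_ge0.
rewrite -(subnKC im'); move: (m - i.+1)%N => k.
elim: k => [|k IH].
  rewrite addn0; apply: le_trans (_ : \sum_(n < i.+1) (1 : R) <= _).
    by apply: ler_sum => n _; rewrite ge_min lexx.
  by rewrite sumr_const card_ord expr2 mulfK ?pnatr_eq0//; lra.
rewrite addnS big_ord_recr/=; apply: le_trans (lerD IH (_ : _ <= (i.+1%:R / (i.+1 + k).+1%:R) ^+ 2)) _.
  by rewrite ge_min lexx orbT.
set x : R := i.+1%:R; set n := (i.+1 + k)%N; rewrite -[n.+1%:R]natr1.
have n0 : 0 < n%:R :> R by rewrite ltr0n.
set y : R := n%:R in n0 *.
suff : (x / (y + 1)) ^+ 2 <= x ^+ 2 / y - x ^+ 2 / (y + 1) by lra.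
have -> : x ^+ 2 / y - x ^+ 2 / (y + 1) = x ^+ 2 / (y * (y + 1)) by field; rewrite !gt_eqF//; lra.
rewrite expr_div_n ler_wpM2l ?sqr_ge0// lef_pV2 ?posrE ?mulr_gt0 ?exprn_gt0//;
  rewrite ?expr2 ?ler_wpM2r; lra.
Qed.

Lemma subr_shift (G : zmodType) (p o e f : G) : p - (o + f) = p - (o + e) + (e - f).
Proof. by rewrite !opprD !addrA subrK. Qed.

(** Discrete Leibniz rule for the second difference of [M X = 1], the analogue of
    [M X'' = - 2 M' X' - M'' X]. The errors [e_j] are there because truncated series are inverse to
    each other only approximately. *)
Lemma inverse_second_difference (A : pzRingType) (M0 M1 M2 X0 X1 X2 e0 e1 e2 : A) :
  M0 * X0 = 1 + e0 -> M1 * X1 = 1 + e1 -> M2 * X2 = 1 + e2 ->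
  M1 * (X0 - X1 - (X1 - X2)) = ((M1 - M0) * (X0 - X1) + (M1 - M2) * (X2 - X1)) +
    ((M1 - M0 + (M1 - M2)) * X1 + ((e0 - e1) + (e2 - e1))).
Proof.
move=> E0 E1 E2.
have h a (Ma : A) Xa : Ma * Xa = 1 + a -> M1 * (Xa - X1) = (M1 - Ma) * Xa + (a - e1).
  by move=> Ea; rewrite mulrBr E1 mulrBl Ea; exact: subr_shift.
rewrite (opprB X1) mulrDr (h _ _ _ E0) (h _ _ _ E2) [(M1 - M0 + _) * X1]mulrDl.
rewrite [LHS]addrACA [RHS]addrA; congr (_ + _).
by rewrite [RHS]addrACA -!mulrDr !subrK.
Qed.

Section APriori.
Context (R : realType) (V : lmodType R[i]) (N : lnorm V).
Local Notation A := (bop N).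
Local Notation O := (opn N).
Local Notation OM := (@opnM R V N).
Implicit Types (M W : fps A) (z : R[i]) (r : R).

Lemma opnZE c (a : A) : O (c *: a) = normc c * O a.
Proof.
apply/le_anti/andP; split; first exact: opnZ.
have [->|c0] := eqVneq c 0; first by rewrite normc0 mul0r seminorm_ge0.
have nc : 0 < normc c.
  by rewrite lt_neqAle normc_ge0 eq_sym andbT; apply: contra c0 => /eqP/eq0_normc ->.
rewrite -ler_pdivlMl// -normcV; apply: le_trans (opnZ _ _).
by rewrite scalerA mulVf// scale1r.
Qed.

Lemma opn1 : O 1 <= 1.
Proof. by apply: opn_le => // x; rewrite mul1r. Qed.

(** Evaluation is truncated, so that no infinite sum of operators is formed; [fps_evalM] measures
    its failure to be multiplicative. *)
Definition fps_eval (n : nat) (a : fps A) z : A := \sum_(i < n) z ^+ i *: a i.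

(** The index pairs that occur in a product of partial sums but not in the partial sum of the
    product. In each of them one index lies in a tail. *)
Lemma sum_corner (a b : fps A) e : abssum O a -> abssum O b -> 0 < e ->
  exists n0, forall n, (n0 <= n)%N ->
    \sum_(i < n) \sum_(j < n | (n <= i + j)%N) O (a i) * O (b j) <= e.
Proof.
move=> sa sb e0; have [S aS] := sa; have [T bT] := sb.
have S0 : 0 <= S := le_trans (psum_ge0 _ _ _) (aS 0%N).
have T0 : 0 <= T := le_trans (psum_ge0 _ _ _) (bT 0%N).
pose d := e / (S + T + 1).
have d0 : 0 < d by rewrite divr_gt0//; lra.
have [k hk] := abssum_tail sa d0; have [l hl] := abssum_tail sb d0.
exists (k + l)%N => n kln.
pose u (c : fps A) p i := if (p <= i)%N then O (c i) else 0.
have usum c p q : (p <= q)%N -> \sum_(i < q) u c p i = \sum_(p <= i < q) O (c i).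
  move=> pq; rewrite -(big_mkord xpredT (u c p)) (big_cat_nat (n := p))//= big_nat big1 ?add0r.
    by apply: eq_big_nat => i /andP[pi _]; rewrite /u pi.
  by move=> i /andP[_ ip]; rewrite /u leqNgt ip.
have u0 c p i : 0 <= u c p i by rewrite /u; case: ifP => // _; exact: seminorm_ge0.
apply: le_trans (_ : \sum_(i < n) \sum_(j < n) (u a k i * O (b j) + O (a i) * u b l j) <= _).
  apply: ler_sum => i _; rewrite big_mkcond; apply: ler_sum => j _.
  have pos : 0 <= u a k i * O (b j) + O (a i) * u b l j.
    by rewrite addr_ge0// mulr_ge0// seminorm_ge0.
  case: ifP => // nij; have [ki|ki] := leqP k i.
    by rewrite {1}/u ki lerDl mulr_ge0// seminorm_ge0.
  have lj : (l <= j)%N by lia.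
  by rewrite {2}/u lj lerDr mulr_ge0// seminorm_ge0.
under eq_bigr do rewrite big_split/= -!mulr_sumr.
rewrite big_split/= -!mulr_suml !usum//; try lia.
apply: le_trans (_ : d * T + S * d <= _).
  apply: lerD; apply: ler_pM; rewrite ?psum_ge0//.
  - by apply: sumr_ge0 => i _; exact: seminorm_ge0.
  - by apply: hk; lia.
  - exact: bT.
  - by apply: sumr_ge0 => i _; exact: seminorm_ge0.
  - exact: aS.
  - by apply: hl; lia.
rewrite (mulrC S) -mulrDr /d mulrAC ler_pdivrMr; last lra.
by apply: ler_wpM2l; [exact: ltW | lra].
Qed.

Lemma fps_evalM (a b : fps A) n z : normc z <= 1 ->
  O (fps_eval n a z * fps_eval n b z - fps_eval n (a * b) z) <=
    \sum_(i < n) \sum_(j < n | (n <= i + j)%N) O (a i) * O (b j).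
Proof.
move=> z1; pose F (i j : nat) : A := z ^+ (i + j) *: (a i * b j).
have -> : fps_eval n a z * fps_eval n b z = \sum_(i < n) \sum_(j < n) F i j.
  rewrite /fps_eval mulr_suml; apply: eq_bigr => i _; rewrite mulr_sumr; apply: eq_bigr => j _.
  by rewrite bop_scaleAl bop_scaleAr scalerA -exprD.
have -> : fps_eval n (a * b) z = \sum_(i < n) \sum_(j < n | ~~ (n <= i + j)%N) F i j.
  case: n => [|n]; first by rewrite /fps_eval !big_ord0.
  transitivity (\sum_(k < n.+1) \sum_(i < k.+1) F i (k - i)%N).
    apply: eq_bigr => k _; rewrite fpsM scaler_sumr; apply: eq_bigr => i _.
    by rewrite /F subnKC// -ltnS.
  rewrite -(sum_triangle F); apply: eq_bigr => i _.
  rewrite (big_ord_widen n.+1 (F i)) ?ltnS ?leq_subr//; apply: eq_bigl => j.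
  by have := ltn_ord i; lia.
rewrite -sumrB; apply: le_trans (seminorm_sum _ _ _ _) _; apply: ler_sum => i _.
rewrite (bigID (fun j : 'I_n => (n <= i + j)%N))/= addrK.
apply: le_trans (seminorm_sum _ _ _ _) _; apply: ler_sum => j _.
rewrite opnZE normcX; apply: le_trans (_ : 1 * O (a i * b j) <= _).
  by rewrite ler_wpM2r ?opn_ge0// exprn_ile1// normc_ge0.
by rewrite mul1r; exact: opnM.
Qed.

(** [K] bounds the constant coefficient; [32 K^3 L^2] comes from products of first differences,
    through the sum of [1 / n^2], at most 2; [16 K^2 L] comes from the second differences of M,
    through [sum_min1_sqr]. *)
Definition l1_const (K L : R) : R := K + 32 * K ^+ 3 * L ^+ 2 + 16 * K ^+ 2 * L.

(* [M(z)] is C^1 with a Fourier-Lipschitz derivative, so the second difference of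
   [W(z) = M(z)^-1] at step [pi / n] controls [4 W_n]. *)
Lemma inverse_l1_apriori M W (K L : R) n0 : 0 <= K -> 0 <= L ->
  M * W = 1 -> abssum O W -> abssum O M ->
  (forall n, \sum_(i < n) i%:R * O (M i) <= L) ->
  (forall n z x, (n0 <= n)%N -> normc z <= 1 -> N x <= K * N (fps_eval n M z x)) ->
  forall m, psum O W m <= l1_const K L.
Proof.
move=> K0 L0 MW sW sM ML lb m.
apply/ler_addgt0Pr => e e0.
(* Total weight of the truncation error [ep]: [4 K^2 L + K] for each of up to [m] coefficients and
   [K] for the constant one. The choice [ep G <= e] keeps it below [e]. *)
pose G := m%:R * (4 * K ^+ 2 * L + K) + K + 1.
have G0 : 0 < G.
  rewrite /G; have : 0 <= m%:R * (4 * K ^+ 2 * L + K) by nneg.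
  lra.
pose ep := Num.min 1 (e / G).
have ep0 : 0 < ep by rewrite lt_min ltr01 divr_gt0.
have [k hk] := sum_corner sM sW ep0.
pose n := (k + n0 + m).+1.
have kn : (k <= n)%N by rewrite /n; lia.
have n0n : (n0 <= n)%N by rewrite /n; lia.
have ep1 : ep <= 1 by rewrite ge_min lexx.
(* The lower bound on vectors becomes a left cancellation in operator norm, which stands in for the
   inverse of M(z). *)
have lbO z (a : A) : normc z <= 1 -> O a <= K * O (fps_eval n M z * a).
  move=> z1; apply: opn_le => [|x]; first by rewrite mulr_ge0 ?opn_ge0.
  apply: le_trans (lb n z _ n0n z1) _; rewrite -mulrA ler_wpM2l// -bopM.
  exact: opnP.
pose E z := fps_eval n M z * fps_eval n W z - 1.
have EE z : normc z <= 1 -> O (E z) <= ep.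
  move=> z1; have := fps_evalM M W n z1; rewrite MW.
  have -> : fps_eval n 1 z = 1.
    rewrite /fps_eval big_ord_recl/= expr0 scale1r big1 ?addr0// => i _.
    by rewrite fps1 scaler0.
  by move=> /le_trans; apply; exact: hk.
have ME z : fps_eval n M z * fps_eval n W z = 1 + E z by rewrite /E addrC subrK.
have XB z : normc z <= 1 -> O (fps_eval n W z) <= K * (1 + ep).
  move=> z1; apply: le_trans (lbO z _ z1) _; rewrite ler_wpM2l// ME.
  by apply: le_trans (seminormD _ _ _) _; apply: lerD; [exact: opn1 | exact: EE].
have Mdiff z z' (t : R) : normc z = 1 -> normc z' = 1 -> 
    (forall i, normc (z ^+ i - z' ^+ i) <= i%:R * t) -> 0 <= t ->
    O (fps_eval n M z - fps_eval n M z') <= L * t.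
  move=> z1 z1' zz t0; rewrite /fps_eval -sumrB; apply: le_trans (seminorm_sum _ _ _ _) _.
  apply: le_trans (_ : \sum_(i < n) (i%:R * O (M i)) * t <= _).
    apply: ler_sum => i _; rewrite -scalerBl opnZE mulrAC ler_wpM2r ?opn_ge0//.
  by rewrite -mulr_suml ler_wpM2r.
have coefW j : (0 < j < n)%N ->
    O (W j) <= 16 * K ^+ 3 * L ^+ 2 * (1 / j%:R) ^+ 2 +
      8 * K ^+ 2 * \sum_(i < n) O (M i) * Num.min 1 ((i%:R / j%:R) ^+ 2) +
      ep * (4 * K ^+ 2 * L + K).
  move=> /andP[j0 jn].
  have jp : 0 < j%:R :> R by rewrite ltr0n.
  have j1 : 1 <= j%:R :> R by rewrite ler1n.
  (* At this step [zt^j = -1], so the second difference multiplies the [j]-th coefficient by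
     [(1 - zt^j)^2 = 4], and [coef_le_sup] reads this coefficient off the circle. *)
  pose th : R := pi / j%:R.
  pose zt := cis th.
  have ztj : zt ^+ j = -1 by rewrite cisX mulrC divfK ?gt_eqF// cis_pi.
  have zt1 : normc zt = 1 by exact: normc_cis.
  pose t : R := 4 / j%:R.
  have t0 : 0 <= t by rewrite divr_ge0.
  have t4 : t <= 4 by rewrite /t ler_pdivrMr// ler_peMr.
  have pi4 : pi <= 4 :> R.
    by have := pihalf_lt2 R; rewrite ltr_pdivrMr//; lra.
  have ztB i : normc (1 - zt ^+ i) <= i%:R * t.
    rewrite cisX; apply: le_trans (normc_1cis _) _.
    rewrite normrM ger0_norm// ler_wpM2l// /th /t normrM !gtr0_norm ?invr_gt0//; last exact: pi_gt0.
    by rewrite ler_wpM2r// invr_ge0 ltW.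
  set cc := \sum_(i < n) O (M i) * Num.min 1 ((i%:R / j%:R) ^+ 2).
  have cc0 : 0 <= cc.
    apply: sumr_ge0 => i _; rewrite mulr_ge0 ?opn_ge0// le_min ler01/= exprn_ge0// divr_ge0//.
  suff D2 : forall z, normc z = 1 ->
      O (\sum_(i < n) z ^+ i *: ((1 - zt ^+ i) ^+ 2 *: W i)) <=
      4 * (16 * K ^+ 3 * L ^+ 2 * (1 / j%:R) ^+ 2 + 8 * K ^+ 2 * cc + ep * (4 * K ^+ 2 * L + K)).
    have := @coef_le_sup R _ (opn N) opnZE (fun i => (1 - zt ^+ i) ^+ 2 *: W i) n _ D2 j jn.
    rewrite opnZE ztj normcX opprK -(natrD _ 1 1) normc_nat -natrX ler_pM2l//.
  move=> z z1.
  pose X0 := fps_eval n W z; pose X1 := fps_eval n W (zt * z); pose X2 := fps_eval n W (zt ^+ 2 * z).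
  pose M0 := fps_eval n M z; pose M1 := fps_eval n M (zt * z); pose M2 := fps_eval n M (zt ^+ 2 * z).
  have z1z : normc (zt * z) = 1 by rewrite normcM zt1 z1 mulr1.
  have z2z : normc (zt ^+ 2 * z) = 1 by rewrite normcM normcX zt1 z1 expr1n mulr1.
  have -> : \sum_(i < n) z ^+ i *: ((1 - zt ^+ i) ^+ 2 *: W i) = X0 - X1 - (X1 - X2).
    rewrite /X0 /X1 /X2 /fps_eval -!sumrB; apply: eq_bigr => i _.
    rewrite -!scalerBl scalerA; congr (_ *: _).
    by rewrite !exprMn; ring.
  have L01 : O (M1 - M0) <= L * t.
    apply: Mdiff => // i; rewrite exprMn -{2}[z ^+ i]mul1r -mulrBl normcM normcX z1 expr1n mulr1.
    by rewrite -normc_opp opprB.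
  have L12 : O (M1 - M2) <= L * t.
    apply: Mdiff => // i; rewrite !exprMn -mulrBl -{1}[zt ^+ i]mulr1 -mulrBr.
    by rewrite !normcM !normcX zt1 z1 !expr1n mulr1 mul1r.
  (* [|1 - zt^i|^2] is at most 4 and at most [(i t)^2], hence at most [16 min (1, (i / j)^2)]. *)
  have L2 : O (M1 - M0 + (M1 - M2)) <= 16 * cc.
    have -> : M1 - M0 + (M1 - M2) = \sum_(i < n) (- (z ^+ i * (1 - zt ^+ i) ^+ 2)) *: M i.
      rewrite /M0 /M1 /M2 /fps_eval -!sumrB -big_split/=; apply: eq_bigr => i _.
      rewrite -!scalerBl -scalerDl; congr (_ *: _).
      by rewrite !exprMn; ring.
    apply: le_trans (seminorm_sum _ _ _ _) _; rewrite /cc mulr_sumr; apply: ler_sum => i _.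
    rewrite opnZE normc_opp normcM normcX z1 expr1n mul1r normcX mulrC [leRHS]mulrCA.
    apply: ler_wpM2l; first exact: opn_ge0.
    rewrite minr_pMr// le_min; apply/andP; split.
      rewrite mulr1 -[leRHS]/((4 * 4)%:R) natrM -expr2.
      have h : normc (1 - zt ^+ i) <= 2%:R.
        apply: le_trans (normcDle _ _) _; rewrite normc_opp normc1 normcX zt1 expr1n.
        by rewrite -natr1.
      apply: le_trans (lerXn2r 2 _ _ h) _; rewrite ?nnegrE ?normc_ge0//.
      by rewrite -!natrX ler_nat.
    have -> : 16 * (i%:R / j%:R) ^+ 2 = (i%:R * t) ^+ 2 by rewrite /t; field; rewrite gt_eqF.
    by apply: lerXn2r; rewrite ?nnegrE ?normc_ge0 ?mulr_ge0.
  have DX a b (Ma Mb : A) Xa Xb : Ma * Xa = 1 + E a -> Mb * Xb = 1 + E b -> normc a <= 1 -> normc b <= 1 ->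
      O (Mb - Ma) <= L * t -> O Xa <= K * (1 + ep) -> (forall c : A, O c <= K * O (Mb * c)) ->
      O (Xa - Xb) <= K * (L * t * (K * (1 + ep)) + 2 * ep).
    move=> Ea Eb a1 b1 Lab Xa1 lbb; apply: le_trans (lbb _) _; rewrite ler_wpM2l//.
    have -> : Mb * (Xa - Xb) = (Mb - Ma) * Xa + (E a - E b).
      by rewrite mulrBr Eb mulrBl Ea; exact: subr_shift.
    apply: le_trans (seminormD _ _ _) _; apply: lerD.
      by apply: le_trans (opnM _ _) _; apply: ler_pM => //; exact: opn_ge0.
    apply: le_trans (seminormB _ _ _) _; rewrite mulr_natl mulr2n.
    by apply: lerD; exact: EE.
  have z1' : normc z <= 1 by rewrite z1.
  have z1z' : normc (zt * z) <= 1 by rewrite z1z.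
  have z2z' : normc (zt ^+ 2 * z) <= 1 by rewrite z2z.
  have D01 := DX _ _ _ _ _ _ (ME z) (ME (zt * z)) z1' z1z' L01 (XB z z1') (fun c => lbO (zt * z) c z1z').
  have D21 := DX _ _ _ _ _ _ (ME (zt ^+ 2 * z)) (ME (zt * z)) z2z' z1z' L12 (XB _ z2z') (fun c => lbO (zt * z) c z1z').
  rewrite -/X0 -/X1 -/X2 in D01 D21.
  apply: le_trans (lbO (zt * z) _ z1z') _; rewrite -/M1.
  have -> : M1 * (X0 - X1 - (X1 - X2)) = ((M1 - M0) * (X0 - X1) + (M1 - M2) * (X2 - X1)) +
      ((M1 - M0 + (M1 - M2)) * X1 + ((E z - E (zt * z)) + (E (zt ^+ 2 * z) - E (zt * z)))).
    exact: inverse_second_difference (ME z) (ME (zt * z)) (ME (zt ^+ 2 * z)).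
  set D := K * _ in D01 D21.
  have D0 : 0 <= D by apply: le_trans D01; exact: opn_ge0.
  apply: (@le_trans _ _ (K * ((L * t * D + L * t * D) + (16 * cc * (K * (1 + ep)) + ((ep + ep) + (ep + ep)))))).
    rewrite ler_wpM2l//; apply: le_trans (seminormD _ _ _) _; apply: lerD.
      apply: le_trans (seminormD _ _ _) _; apply: lerD; apply: le_trans (opnM _ _) _.
        by apply: ler_pM; [exact: opn_ge0 | exact: opn_ge0 | exact: L01 | exact: D01].
      by apply: ler_pM; [exact: opn_ge0 | exact: opn_ge0 | exact: L12 | exact: D21].
    apply: le_trans (seminormD _ _ _) _; apply: lerD.
      by apply: le_trans (opnM _ _) _; apply: ler_pM; rewrite ?opn_ge0//; exact: XB.
    apply: le_trans (seminormD _ _ _) _; apply: lerD; apply: le_trans (seminormB _ _ _) _;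
      by apply: lerD; exact: EE.
  have tE : (1 / j%:R) ^+ 2 = t ^+ 2 / 16 :> R by rewrite /t; field; rewrite gt_eqF.
  rewrite tE /D.
  have h1 : K ^+ 3 * L ^+ 2 * t ^+ 2 * ep <= K ^+ 3 * L ^+ 2 * t ^+ 2.
    by rewrite ler_piMr//; nneg.
  have h2 : K ^+ 2 * L * ep * t <= K ^+ 2 * L * ep * 4.
    by apply: ler_wpM2l => //; nneg.
  have h3 : K ^+ 2 * cc * ep <= K ^+ 2 * cc by rewrite ler_piMr//; nneg.
  rewrite -subr_ge0.
  set lhs := (X in 0 <= X).
  have -> : lhs = 2 * (K ^+ 3 * L ^+ 2 * t ^+ 2 - K ^+ 3 * L ^+ 2 * t ^+ 2 * ep) +
      4 * (K ^+ 2 * L * ep * 4 - K ^+ 2 * L * ep * t) + 16 * (K ^+ 2 * cc - K ^+ 2 * cc * ep) by rewrite /lhs; field.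
  by apply: addr_ge0; [apply: addr_ge0|]; (apply: mulr_ge0; [exact: ler0n | rewrite subr_ge0]).
have mn : (m < n)%N by rewrite /n; lia.
have eG : ep * G <= e by rewrite -ler_pdivlMr// ge_min lexx orbT.
have W0 : O (W 0%N) <= K * (1 + ep).
  apply: (@coef_le_sup R _ (opn N) opnZE W n (K * (1 + ep)) _ 0%N) => // z z1.
  by apply: XB; rewrite z1.
rewrite /G in eG; clear lbO E EE ME XB Mdiff hk kn n0n; clearbody ep n; clear G G0.
case: m => [|m] in mn eG *.
  by rewrite /psum big_ord0 addr_ge0 ?(ltW e0)// /l1_const; nneg.
rewrite /psum big_ord_recl; apply: le_trans (lerD W0 (ler_sum _ (fun j _ => coefW (lift ord0 j) _))) _.
    by move=> j _; have := ltn_ord j; rewrite /= /bump/=; lia.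
rewrite !big_split/= -!mulr_sumr sumr_const card_ord.
have S1 : \sum_(i < m) (1 / (bump 0 i)%:R) ^+ 2 <= 2 :> R.
  rewrite -[leRHS]mulr1; apply: le_trans _ (sum_min1_sqr R 1 m).
  apply: ler_sum => i _; rewrite le_min lexx andbT expr_div_n expr1n ler_pdivrMr ?exprn_gt0 ?ltr0n//.
  by rewrite mul1r -natrX ler1n expn_gt0.
have S2 : \sum_(i < m) \sum_(i0 < n) O (M i0) * Num.min 1 ((i0%:R / (bump 0 i)%:R) ^+ 2) <= 2 * L.
  rewrite exchange_big/=; apply: le_trans (_ : \sum_(i < n) 2 * (i%:R * O (M i)) <= _).
    apply: ler_sum => i _; rewrite -mulr_sumr mulrCA mulrA [leRHS]mulrC ler_wpM2l ?opn_ge0//.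
    rewrite mulrC; exact: sum_min1_sqr.
  by rewrite -mulr_sumr ler_wpM2l.
have K3 : 16 * K ^+ 3 * L ^+ 2 * (\sum_(i < m) (1 / (bump 0 i)%:R) ^+ 2) <= 16 * K ^+ 3 * L ^+ 2 * 2.
  by apply: ler_wpM2l => //; nneg.
have K2 : 8 * K ^+ 2 * (\sum_(i < m) \sum_(i0 < n) O (M i0) * Num.min 1 ((i0%:R / (bump 0 i)%:R) ^+ 2)) <=
    8 * K ^+ 2 * (2 * L).
  by apply: ler_wpM2l => //; nneg.
have eG2 : ep * (4 * K ^+ 2 * L + K) *+ m <= ep * (m.+1%:R * (4 * K ^+ 2 * L + K)).
  rewrite -mulrnAr ler_wpM2l ?(ltW ep0)// -[leLHS]mulr_natl ler_wpM2r ?ler_nat//; nneg.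
rewrite /l1_const.
rewrite !(mulrDr ep) mulr1 in eG; rewrite -(mulrDr ep) in eG.
have := ltW ep0; lra.
Qed.

Definition fps_dil r (a : fps A) : fps A := fun n => (r ^+ n)%:C%C *: a n.

Lemma fps_dilM r (a b : fps A) : fps_dil r (a * b) = fps_dil r a * fps_dil r b.
Proof.
apply/funext => n; rewrite fpsM /fps_dil fpsM scaler_sumr; apply: eq_bigr => i _.
by rewrite bop_scaleAl bop_scaleAr scalerA -rmorphM/= -exprD subnKC// -ltnS.
Qed.

Lemma fps_dil1 r : fps_dil r 1 = 1.
Proof. by apply/funext => -[|n]; rewrite /fps_dil !fps1 ?scaler0// expr0 scale1r. Qed.

Lemma normc_real r : normc (r%:C%C) = `|r|.
Proof. by rewrite /normc /= expr0n /= addr0 sqrtr_sqr. Qed.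

Lemma opn_dil r (a : fps A) n : 0 <= r -> O (fps_dil r a n) = r ^+ n * O (a n).
Proof. by move=> r0; rewrite opnZE normc_real ger0_norm// exprn_ge0. Qed.

Lemma opn_dil_le r (a : fps A) n : 0 <= r <= 1 -> O (fps_dil r a n) <= O (a n).
Proof.
move=> /andP[r0 r1]; rewrite opn_dil// ler_piMl ?opn_ge0//; exact: exprn_ile1.
Qed.

Lemma fps_eval_dil n r (a : fps A) z : fps_eval n (fps_dil r a) z = fps_eval n a (r%:C%C * z).
Proof.
by apply: eq_bigr => i _; rewrite /fps_dil scalerA exprMn mulrC rmorphXn.
Qed.

(* Method of continuity along the dilations [r |-> M(r z)], [r] from 0 to 1. *)
Lemma inverse_l1 M W (K L : R) n0 : 0 <= K -> 0 <= L ->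
  M * W = 1 -> W * M = 1 -> abssum O M ->
  (forall n, \sum_(i < n) i%:R * O (M i) <= L) ->
  (forall n z x, (n0 <= n)%N -> normc z <= 1 -> N x <= K * N (fps_eval n M z x)) ->
  forall m, psum O W m <= l1_const K L.
Proof.
move=> K0 L0 MW WM [S MS] ML lb.
pose C := l1_const K L.
have C0 : 0 <= C by rewrite /C /l1_const; nneg.
have ap r : 0 <= r <= 1 -> abssum O (fps_dil r W) -> forall m, psum O (fps_dil r W) m <= C.
  move=> r01 sW; apply: (@inverse_l1_apriori (fps_dil r M) (fps_dil r W) K L n0) => //.
  - by rewrite -fps_dilM MW fps_dil1.
  - exists S => n; apply: le_trans (MS n); apply: ler_sum => i _; exact: opn_dil_le.
  - move=> n; apply: le_trans (ML n); apply: ler_sum => i _.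
    by rewrite ler_wpM2l//; exact: opn_dil_le.
  - move=> n z x nn z1; rewrite fps_eval_dil; apply: lb => //.
    case/andP: r01 => r0 r1.
    by rewrite normcM normc_real ger0_norm// mulr_ile1// normc_ge0.
have step r r' : 0 <= r -> r <= r' -> r' <= 1 -> (r' - r) * L * C <= 1 / 2 ->
    (forall m, psum O (fps_dil r W) m <= C) -> forall m, psum O (fps_dil r' W) m <= C.
  move=> r0 rr' r1 small P; apply: ap; first by rewrite r1 (le_trans r0).
  pose D := fps_dil r' M - fps_dil r M.
  have DL m : psum O D m <= (r' - r) * L.
    apply: le_trans (_ : (r' - r) * \sum_(i < m) i%:R * O (M i) <= _); last first.
      by rewrite ler_wpM2l// subr_ge0.
    rewrite mulr_sumr; apply: ler_sum => i _.
    rewrite /D fpsB /fps_dil -scalerBl opnZE.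
    have -> : (r' ^+ i)%:C%C - (r ^+ i)%:C%C = (r' ^+ i - r ^+ i)%:C%C :> R[i] by rewrite rmorphB.
    rewrite normc_real ger0_norm; last first.
      by rewrite subr_ge0; apply: lerXn2r; rewrite ?nnegrE// (le_trans r0).
    rewrite mulrA ler_wpM2r ?opn_ge0// subrXX ler_wpM2l ?subr_ge0//.
    rewrite -[X in _ <= X%:R]card_ord -sumr_const; apply: ler_sum => j _.
    by rewrite mulr_ile1 ?exprn_ge0 ?exprn_ile1// ?(le_trans r0)// (le_trans rr').
  (* Resolvent identity. The factor before the last [W] has l1 norm at most 1/2, so the dilation at
     [r'] is summable with bound [2 C]; [ap] then brings the bound back to [C], and nothing
     accumulates along the steps. *)
  have E : fps_dil r' W = fps_dil r W - fps_dil r W * D * fps_dil r' W.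
    have h1 : fps_dil r' M * fps_dil r' W = 1 by rewrite -fps_dilM MW fps_dil1.
    have h2 : fps_dil r W * fps_dil r M = 1 by rewrite -fps_dilM WM fps_dil1.
    rewrite /D mulrBr h2 mulrBl mul1r -mulrA h1 mulr1.
    by rewrite opprB addrCA subrr addr0.
  exists (2 * C) => m.
  have : psum O (fps_dil r' W) m <= C + 1 / 2 * psum O (fps_dil r' W) m.
    rewrite {1}E; apply: le_trans (psumB _ _ _ _) _; apply: lerD; first exact: P.
    apply: le_trans (psumM OM _ _ _) _; rewrite ler_wpM2r ?psum_ge0//.
    apply: le_trans (psumM OM _ _ _) _; apply: le_trans small; rewrite mulrC.
    by apply: ler_pM; rewrite ?psum_ge0.
  lra.
(* The a priori constant does not depend on [r], hence neither does the admissible step length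
   [1 / k]. *)
pose k := (Num.truncn (2 * L * C)).+1.
have kL : L * C / k%:R <= 1 / 2.
  rewrite ler_pdivrMr ?ltr0n//.
  by have := truncnS_gt (2 * L * C); rewrite -/k; lra.
have Pj j : (j <= k)%N -> forall m, psum O (fps_dil (j%:R / k%:R) W) m <= C.
  elim: j => [|j IH] jk.
    rewrite mul0r; apply: ap; first by rewrite lexx ler01.
    exists (O (W 0%N)) => -[|m]; first by rewrite /psum big_ord0 opn_ge0.
    rewrite /psum big_ord_recl big1 ?addr0 => [|i _].
      by rewrite opn_dil// expr0 mul1r.
    by rewrite opn_dil// expr0n/= mul0r.
  have kp : 0 < k%:R :> R by rewrite ltr0n.
  apply: (@step (j%:R / k%:R)); last by apply: IH; exact: ltnW.
  - by rewrite divr_ge0.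
  - by rewrite ler_pM2r ?invr_gt0// ler_nat.
  - by rewrite ler_pdivrMr// mul1r ler_nat.
  - apply: le_trans kL; rewrite le_eqVlt; apply/orP; left; apply/eqP.
    by rewrite -natr1; field; rewrite gt_eqF.
have := Pj k (leqnn k); rewrite divff ?pnatr_eq0// => P m.
apply: le_trans (P m); apply: ler_sum => i _.
by rewrite opn_dil// expr1n mul1r.
Qed.

End APriori.

(** * Sequences tending to zero and Cauchy sequences for a norm *)

Section VanishingSequences.
Context (R : realType).
Implicit Types (u v : nat -> R).

(** One-sided, since it is applied to upper bounds of norms; a limit argument then amounts to
    [vanish_le] followed by [vanish_cst_le]. *)
Definition vanish u := forall e : R, 0 < e -> exists n0, forall n, (n0 <= n)%N -> u n <= e.

Lemma vanishD u v : vanish u -> vanish v -> vanish (fun n => u n + v n).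
Proof.
move=> u0 v0 e e0; have e2 : 0 < e / 2 by rewrite divr_gt0.
have [n1 h1] := u0 _ e2; have [n2 h2] := v0 _ e2.
exists (maxn n1 n2) => n; rewrite geq_max => /andP[/h1 h1n /h2 h2n]; lra.
Qed.

Lemma vanishZ u c : 0 <= c -> vanish u -> vanish (fun n => c * u n).
Proof.
move=> c0 u0 e e0; have c1 : 0 < c + 1 by lra.
have [n1 h1] := u0 _ (divr_gt0 e0 c1).
exists n1 => n /h1 h; apply: le_trans (ler_wpM2l c0 h) _.
by rewrite mulrA ler_pdivrMr// mulrC ler_wpM2l ?(ltW e0)//; lra.
Qed.

Lemma vanish_le u v : (forall n, u n <= v n) -> vanish v -> vanish u.
Proof. by move=> uv v0 e /v0[n0 h]; exists n0 => n /h; apply: le_trans. Qed.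

Lemma incr_ge (k : nat -> nat) : {homo k : i j / (i < j)%N} -> forall n, (n <= k n)%N.
Proof. by move=> kh; elim=> // n IH; apply: leq_ltn_trans IH (kh _ _ (ltnSn n)). Qed.

Lemma vanish_sub u (k : nat -> nat) : {homo k : i j / (i < j)%N} -> vanish u ->
  vanish (fun n => u (k n)).
Proof.
move=> kh u0 e /u0[n0 h]; exists n0 => n nn; apply: h.
by apply: leq_trans nn _; exact: incr_ge.
Qed.

Lemma vanish_cst_le c u : (forall n, c <= u n) -> vanish u -> c <= 0.
Proof.
move=> cu u0; apply/ler_addgt0Pr => e e0; rewrite add0r.
by have [n0 h] := u0 _ e0; apply: le_trans (cu n0) (h _ (leqnn _)).
Qed.

Lemma vanish_invS : vanish (fun n => n.+1%:R^-1).
Proof.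
move=> e e0; exists (Num.truncn e^-1) => n nn.
rewrite -[leRHS]invrK lef_pV2 ?posrE ?invr_gt0// ltW// (lt_le_trans (truncnS_gt _))//.
by rewrite ler_nat.
Qed.

Lemma vanish_dw (beta : R) : 1 < beta -> vanish (dw beta).
Proof.
move=> b1; apply: vanish_le (_ : vanish (fun n => n.+1%:R^-1)); last exact: vanish_invS.
move=> n; rewrite /dw powRN -[n.+1%:R in leRHS]powRr1// lef_pV2 ?posrE ?powR_gt0//.
by rewrite ler_powR// ?ler1n// ltW.
Qed.

Lemma vanish_geometric (q : R) : 0 <= q < 1 -> vanish (fun n => q ^+ n).
Proof.
move=> /andP[q0 q1] e e0.
have := cvg_expr (_ : `|q| < 1); rewrite ger0_norm// => /(_ q1) /cvgrPdist_le /(_ e e0) [n0 _ h].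
exists n0 => n nn; have := h n nn.
by rewrite sub0r normrN ger0_norm ?exprn_ge0.
Qed.

Definition cauchy_for (V : zmodType) (N : V -> R) (u : nat -> V) :=
  forall e : R, 0 < e -> exists n0, forall p q, (n0 <= p)%N -> (n0 <= q)%N -> N (u p - u q) <= e.

Lemma cauchy_sub (V : zmodType) (N : V -> R) (u : nat -> V) (k : nat -> nat) : {homo k : i j / (i < j)%N} ->
  cauchy_for N u -> cauchy_for N (u \o k).
Proof.
move=> kh u0 e /u0[n0 h]; exists n0 => p q np nq /=.
by apply: h; [apply: leq_trans np _ | apply: leq_trans nq _]; exact: incr_ge.
Qed.

Definition rnorm : seminorm R R := Seminorm (@normr0 R R) (@ler_normD R R) (@normrN R R).

Lemma sum_tail u (S : R) : (forall n, 0 <= u n) -> (forall n, \sum_(i < n) u i <= S) ->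
  forall e, 0 < e -> exists m, forall n, (m <= n)%N -> \sum_(m <= i < n) u i <= e.
Proof.
move=> u0 uS e e0.
have nE i : rnorm (u i) = u i by rewrite /seminorm_fun/= ger0_norm.
have [|m hm] := @abssum_tail R R rnorm u e _ e0.
  by exists S => n; rewrite /psum; under eq_bigr do rewrite nE; exact: uS.
by exists m => n mn; have := hm n mn; under eq_bigr do rewrite nE.
Qed.

End VanishingSequences.

Section EvalNearOne.
Context (R : realType) (W : lmodType R[i]) (N : lnorm W).

(** Continuity at 1, uniform in the truncation [n]: the first [m] terms are controlled by
    [|1 - z^i| <= i |1 - z|], the others by summability. *)
Lemma eval_near1 (a : nat -> W) (S : R) : (forall n, \sum_(i < n) N (a i) <= S) ->
  forall e : R, 0 < e -> exists2 d : R, 0 < d & forall z n, normc z <= 1 -> normc (1 - z) <= d ->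
    N (\sum_(i < n) z ^+ i *: a i - \sum_(i < n) a i) <= e.
Proof.
move=> aS e e0.
have zB (z : R[i]) i : normc z <= 1 -> normc (z ^+ i - 1) <= i%:R * normc (1 - z).
  move=> z1; rewrite subrX1 normcM -normc_opp opprB mulrC.
  rewrite ler_wpM2r ?normc_ge0//; apply: le_trans (seminorm_sum (cnorm R) _ _ _) _.
  rewrite -[X in _ <= X%:R]card_ord -sumr_const; apply: ler_sum => j _.
  by rewrite /seminorm_fun/= normcX exprn_ile1// normc_ge0.
have S0 : 0 <= S by apply: le_trans (aS 0%N); rewrite big_ord0.
have [m hm] := @sum_tail R (fun i => N (a i)) S (fun i => seminorm_ge0 N (a i)) aS _
  (divr_gt0 e0 (ltr0Sn _ 3)).
have mS : 0 < m%:R * S + 1 by apply: ltr_wpDl => //; exact: mulr_ge0.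
exists (e / (2 * (m%:R * S + 1))) => [|z n z1 zd]; first by rewrite divr_gt0// mulr_gt0.
rewrite -sumrB; apply: le_trans (seminorm_sum _ _ _ _) _.
pose t (i : nat) := if (m <= i)%N then N (a i) else 0.
apply: le_trans (_ : \sum_(i < n) (m%:R * normc (1 - z) * N (a i) + 2 * t i) <= _).
  apply: ler_sum => i _; rewrite -[X in _ - X]scale1r -scalerBl lnormZ.
  have N0 : 0 <= N (a i) by exact: seminorm_ge0.
  have c0 := normc_ge0 (1 - z).
  rewrite /t; case: leqP => im.
    apply: le_trans (_ : 2 * N (a i) <= _); last by rewrite lerDr; nneg.
    rewrite ler_wpM2r//; apply: le_trans (normcDle _ _) _.
    rewrite normc_opp normc1 normcX -[leRHS]/(1 + 1) lerD2r.
    by rewrite exprn_ile1// normc_ge0.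
  rewrite mulr0 addr0 ler_wpM2r//; apply: le_trans (zB _ _ z1) _.
  by rewrite ler_wpM2r// ler_nat ltnW.
rewrite big_split/= -!mulr_sumr.
have tS : \sum_(i < n) t i <= e / 4.
  have t0 i : 0 <= t i by rewrite /t; case: ifP => // _; exact: seminorm_ge0.
  apply: le_trans (hm _ (leq_maxl m n)).
  apply: le_trans (_ : \sum_(0 <= i < maxn m n) t i <= _).
    rewrite -(big_mkord xpredT t) [leRHS](big_cat_nat (n := n)) ?leq_maxr//= lerDl.
    exact: sumr_ge0.
  rewrite (big_cat_nat (n := m)) ?leq_maxl//= big_nat big1 ?add0r.
    by apply: ler_sum_nat => i /andP[mi _]; rewrite /t mi.
  by move=> i /andP[_ im]; rewrite /t leqNgt im.
have mz : m%:R * normc (1 - z) <= m%:R * (e / (2 * (m%:R * S + 1))) by rewrite ler_wpM2l.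
apply: le_trans (lerD (ler_pM _ _ mz (aS n)) (ler_wpM2l _ tS)) _ => //.
- by rewrite mulr_ge0 ?normc_ge0.
- by apply: sumr_ge0 => i _; exact: seminorm_ge0.
have h : m%:R * (e / (2 * (m%:R * S + 1))) * S <= e / 2.
  have -> : m%:R * (e / (2 * (m%:R * S + 1))) * S = e / 2 * (m%:R * S / (m%:R * S + 1)).
    by field; rewrite gt_eqF.
  rewrite ler_piMr ?divr_ge0 ?(ltW e0)// ler_pdivrMr// mul1r; lra.
lra.
Qed.

End EvalNearOne.

(* Decides the identities of abelian groups by comparing integer coefficients. *)
Inductive zterm := ZVar of nat | ZAdd of zterm & zterm | ZOpp of zterm | ZZero.

Section ZmoduleTactic.
Context (G : zmodType).

Fixpoint zeval (env : seq G) t : G :=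
  match t with
  | ZVar n => nth 0 env n
  | ZAdd a b => zeval env a + zeval env b
  | ZOpp a => - zeval env a
  | ZZero => 0
  end.

Fixpoint zcoef t (i : nat) : int :=
  match t with
  | ZVar n => (n == i)%:Z
  | ZAdd a b => zcoef a i + zcoef b i
  | ZOpp a => - zcoef a i
  | ZZero => 0
  end.

Lemma zevalE env t : zeval env t = \sum_(i < size env) nth 0 env i *~ zcoef t i.
Proof.
elim: t => [n|a IHa b IHb|a IHa|] /=.
- have [nE|En] := ltnP n (size env); last first.
    rewrite nth_default// big1// => i _; rewrite (_ : (n == i) = false) ?mulr0z//.
    by have := ltn_ord i; lia.
  rewrite (bigD1 (Ordinal nE))//= eqxx mulr1z big1 ?addr0// => i iE.
  rewrite (_ : (n == i) = false) ?mulr0z//; apply: contraNF iE => /eqP iE.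
  exact/eqP/val_inj.
- by rewrite IHa IHb -big_split/=; apply: eq_bigr => i _; rewrite mulrzDr.
- by rewrite IHa -sumrN; apply: eq_bigr => i _; rewrite mulrNz.
- by rewrite big1// => i _; rewrite mulr0z.
Qed.

Lemma zeval_eq env t u : all (fun i => zcoef t i == zcoef u i) (iota 0 (size env)) ->
  zeval env t = zeval env u.
Proof.
move=> /allP h; rewrite !zevalE; apply: eq_bigr => i _; congr (_ *~ _).
by apply/eqP/h; rewrite mem_iota add0n ltn_ord.
Qed.

End ZmoduleTactic.

(* Atoms are compared up to conversion, as equal terms may come with different
   canonical instances. *)
Ltac zmod_index x l :=
  match l with
  | cons ?y ?l' =>
    match constr:(tt) with
    | _ => let _ := match constr:(tt) with _ => constr_eq x y end in constr:(0%N)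
    | _ => let _ := match constr:(tt) with _ => unify x y end in constr:(0%N)
    | _ => let n := zmod_index x l' in constr:(S n)
    end
  end.
Ltac zmod_mem x l :=
  match constr:(tt) with
  | _ => let _ := zmod_index x l in constr:(true)
  | _ => constr:(false)
  end.
Ltac zmod_atoms t l :=
  match t with
  | (?a + ?b)%R => let l1 := zmod_atoms a l in zmod_atoms b l1
  | (- ?a)%R => zmod_atoms a l
  | 0%R => l
  | ?x => match zmod_mem x l with true => l | false => constr:(cons x l) end
  end.
Ltac zmod_reify t l :=
  match t with
  | (?a + ?b)%R => let x := zmod_reify a l in let y := zmod_reify b l in constr:(ZAdd x y)
  | (- ?a)%R => let x := zmod_reify a l in constr:(ZOpp x)
  | 0%R => constr:(ZZero)
  | ?x => let n := zmod_index x l in constr:(ZVar n)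
  end.
Ltac zmodule :=
  match goal with |- @eq ?T ?a ?b =>
    let l := zmod_atoms a (@nil T) in
    let l := zmod_atoms b l in
    let ta := zmod_reify a l in
    let tb := zmod_reify b l in
    exact: (@zeval_eq _ l ta tb isT)
  end.

(** * Integration of complex-valued functions *)

Local Notation Re := complex.Re.
Local Notation Im := complex.Im.

Lemma normRe_le (R : realType) (z : R[i]) : `|Re z| <= normc z.
Proof.
by case: z => a b; rewrite /normc /= -sqrtr_sqr ler_sqrt ?addr_ge0 ?sqr_ge0// lerDl sqr_ge0.
Qed.
Lemma normIm_le (R : realType) (z : R[i]) : `|Im z| <= normc z.
Proof.
by case: z => a b; rewrite /normc /= -sqrtr_sqr ler_sqrt ?addr_ge0 ?sqr_ge0// lerDr sqr_ge0.
Qed.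

Section ComplexIntegral.
Context d (E : measurableType d) (R : realType).
Implicit Types (mu : {measure set E -> \bar R}) (D A : set E) (f g psi : E -> R[i]).

Lemma cmeasurableD D f g : cmeasurable D f -> cmeasurable D g ->
  cmeasurable D (fun x => f x + g x).
Proof.
case=> f1 f2 [g1 g2]; split.
  by rewrite (_ : (fun x => _) = (fun x => Re (f x) + Re (g x)));
    [exact: measurable_funD | apply/funext => x; case: (f x); case: (g x)].
by rewrite (_ : (fun x => _) = (fun x => Im (f x) + Im (g x)));
  [exact: measurable_funD | apply/funext => x; case: (f x); case: (g x)].
Qed.

Lemma cmeasurableM D f g : cmeasurable D f -> cmeasurable D g ->
  cmeasurable D (fun x => f x * g x).
Proof.
case=> f1 f2 [g1 g2]; split.
  rewrite (_ : (fun x => _) = (fun x => Re (f x) * Re (g x) - Im (f x) * Im (g x))).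
    by apply: measurable_funB; exact: measurable_funM.
  by apply/funext => x; case: (f x) => a b; case: (g x).
rewrite (_ : (fun x => _) = (fun x => Re (f x) * Im (g x) + Im (f x) * Re (g x))).
  by apply: measurable_funD; exact: measurable_funM.
by apply/funext => x; case: (f x) => a b; case: (g x).
Qed.

Lemma cmeasurable_cst D c : cmeasurable D (fun=> c : R[i]).
Proof. by split; exact: measurable_cst. Qed.

Lemma cmeasurable_indic D A : measurable A -> cmeasurable D (@cindic E R A).
Proof.
move=> mA; split; last exact: measurable_cst.
by apply: (@measurable_funS _ _ _ _ setT) => //; exact: measurable_indic.
Qed.

Lemma cmeasurable_conj D f : cmeasurable D f -> cmeasurable D (fun x => (f x)^*%C).
Proof.
case=> f1 f2; split.
  by rewrite (_ : (fun x => _) = (fun x => Re (f x)))//; apply/funext => x; case: (f x).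
rewrite (_ : (fun x => _) = (fun x => - Im (f x))); first exact: measurable_funN.
by apply/funext => x; case: (f x).
Qed.

Lemma measurable_normc D f : cmeasurable D f -> measurable_fun D (fun x => normc (f x)).
Proof.
case=> f1 f2; rewrite (_ : (fun x => _) = Num.sqrt \o (fun x => Re (f x) ^+ 2 + Im (f x) ^+ 2)).
  apply: measurableT_comp; first exact: continuous_measurable_fun (@sqrt_continuous R).
  by apply: measurable_funD; exact: measurable_funX.
by apply/funext => x; rewrite /=; case: (f x).
Qed.

Lemma L1_Re mu D f : L1 mu D f -> measurable D -> mu.-integrable D (EFin \o (fun x => Re (f x))).
Proof.
move=> [[f1 f2] fi] mD; apply/integrableP; split; first exact/measurable_EFinP.
apply: le_lt_trans fi; apply: ge0_le_integral => //.
- by apply: measurableT_comp => //; exact/measurable_EFinP.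
- by apply/measurable_EFinP; exact: measurable_normc.
- by move=> x _; rewrite lee_fin normRe_le.
Qed.

Lemma L1_Im mu D f : L1 mu D f -> measurable D -> mu.-integrable D (EFin \o (fun x => Im (f x))).
Proof.
move=> [[f1 f2] fi] mD; apply/integrableP; split; first exact/measurable_EFinP.
apply: le_lt_trans fi; apply: ge0_le_integral => //.
- by apply: measurableT_comp => //; exact/measurable_EFinP.
- by apply/measurable_EFinP; exact: measurable_normc.
- by move=> x _; rewrite lee_fin normIm_le.
Qed.

Variables (mu : {measure set E -> \bar R}) (D : set E).
Hypothesis mD : measurable D.
Local Notation L1 := (L1 mu D).
Local Notation cint := (cint mu D).
Local Notation norm1 := (norm1 mu D).

Lemma norm1_ge0 f : (0 <= norm1 f)%E.
Proof. by apply: integral_ge0 => x _; rewrite lee_fin normc_ge0. Qed.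

Lemma measurable_normcE f : cmeasurable D f -> measurable_fun D (EFin \o (fun x => normc (f x))).
Proof. by move=> mf; apply/measurable_EFinP; exact: measurable_normc. Qed.

Lemma norm1_le f g : cmeasurable D f -> cmeasurable D g ->
  (forall x, D x -> normc (f x) <= normc (g x)) -> (norm1 f <= norm1 g)%E.
Proof.
move=> mf mg fg; apply: ge0_le_integral => //; try exact: measurable_normcE.
by move=> x _; rewrite lee_fin normc_ge0.
Qed.

Lemma norm1D f g : cmeasurable D f -> cmeasurable D g ->
  (norm1 (fun x => f x + g x)%R <= norm1 f + norm1 g)%E.
Proof.
move=> mf mg; rewrite -ge0_integralD//; try exact: measurable_normcE;
  try by move=> x _; rewrite lee_fin normc_ge0.
apply: ge0_le_integral => //.
- by move=> x _; rewrite lee_fin normc_ge0.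
- by apply: measurable_normcE; exact: cmeasurableD.
- by apply: emeasurable_funD; exact: measurable_normcE.
- by move=> x _; rewrite -EFinD lee_fin normcDle.
Qed.

Lemma norm1Z c f : cmeasurable D f -> norm1 (fun x => c * f x) = ((normc c)%:E * norm1 f)%E.
Proof.
move=> mf; rewrite -ge0_integralZl_EFin ?normc_ge0//; last 2 first.
- by move=> x _; rewrite lee_fin normc_ge0.
- exact: measurable_normcE.
by apply: eq_integral => x _; rewrite normcM EFinM.
Qed.

Lemma L1D f g : L1 f -> L1 g -> L1 (fun x => f x + g x).
Proof.
move=> [mf fi] [mg gi]; split; first exact: cmeasurableD.
by apply: le_lt_trans (norm1D mf mg) _; exact: lte_add_pinfty.
Qed.

Lemma L1Z c f : L1 f -> L1 (fun x => c * f x).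
Proof.
move=> [mf fi]; split; first by apply: cmeasurableM => //; exact: cmeasurable_cst.
rewrite norm1Z//; have := fi; rewrite -ge0_fin_numE ?norm1_ge0// => /fineK <-.
by rewrite -EFinM ltry.
Qed.

Lemma L1_0 : L1 (fun=> 0).
Proof.
split; first exact: cmeasurable_cst.
by rewrite /Defs.norm1 (eq_integral (cst 0%E)) ?integral0// => x _; rewrite normc0.
Qed.

Lemma eq_L1 f g : (forall x, D x -> f x = g x) -> L1 f -> L1 g.
Proof.
move=> fg [[m1 m2] fi]; split; [split|].
- by apply: eq_measurable_fun m1 => x /[!inE] Dx; rewrite fg.
- by apply: eq_measurable_fun m2 => x /[!inE] Dx; rewrite fg.
- rewrite (_ : norm1 g = norm1 f)//; apply: eq_integral => x /[!inE] Dx.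
  by rewrite fg.
Qed.

Lemma eq_cint f g : (forall x, D x -> f x = g x) -> cint f = cint g.
Proof.
by move=> fg; congr Complex; congr fine; apply: eq_integral => x /[!inE] Dx; rewrite fg.
Qed.

Lemma eq_norm1 f g : (forall x, D x -> f x = g x) -> norm1 f = norm1 g.
Proof. by move=> fg; apply: eq_integral => x /[!inE] Dx; rewrite fg. Qed.

Lemma L1N f : L1 f -> L1 (fun x => - f x).
Proof. by move=> /(L1Z (-1)); apply: eq_L1 => x _; rewrite mulN1r. Qed.

Lemma L1B f g : L1 f -> L1 g -> L1 (fun x => f x - g x).
Proof. by move=> fi /L1N; exact: L1D. Qed.

Lemma L1_sum I (r : seq I) (F : I -> E -> R[i]) : (forall i, L1 (F i)) ->
  L1 (fun x => \sum_(i <- r) F i x).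
Proof.
move=> Fi; elim: r => [|i r IH]; first by under eq_fun do rewrite big_nil; exact: L1_0.
by under eq_fun do rewrite big_cons; exact: L1D.
Qed.

Lemma norm1_fin f : L1 f -> norm1 f \is a fin_num.
Proof. by case=> _ fi; rewrite ge0_fin_numE// norm1_ge0. Qed.

Lemma cintD f g : L1 f -> L1 g -> cint (fun x => f x + g x) = cint f + cint g.
Proof.
move=> fi gi; rewrite /Defs.cint; apply/eqP; rewrite eq_complex /=; apply/andP; split; apply/eqP.
  rewrite -(RintegralD mD (L1_Re fi mD) (L1_Re gi mD)); congr fine.
  by apply: eq_integral => x _; case: (f x); case: (g x).
rewrite -(RintegralD mD (L1_Im fi mD) (L1_Im gi mD)); congr fine.
by apply: eq_integral => x _; case: (f x); case: (g x).
Qed.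

Lemma cintZ c f : L1 f -> cint (fun x => c * f x) = c * cint f.
Proof.
move=> fi; case: c => a b; rewrite /Defs.cint; apply/eqP; rewrite eq_complex /=.
have rZ (s : R) (k : E -> R) : mu.-integrable D (EFin \o k) ->
    mu.-integrable D (EFin \o (fun x => s * k x)).
  by move=> ki; apply: eq_integrable (integrableZl mD s ki).
have [f1 f2] := (L1_Re fi mD, L1_Im fi mD).
apply/andP; split; apply/eqP.
  rewrite -(RintegralZl a mD f1) -(RintegralZl b mD f2) -(RintegralB mD (rZ _ _ f1) (rZ _ _ f2)).
  by congr fine; apply: eq_integral => x _; case: (f x).
rewrite -(RintegralZl a mD f2) -(RintegralZl b mD f1) -(RintegralD mD (rZ _ _ f2) (rZ _ _ f1)).
by congr fine; apply: eq_integral => x _; case: (f x).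
Qed.

Lemma cint0 : cint (fun=> 0) = 0.
Proof. by rewrite -[RHS](mul0r (cint (fun=> 0))) -cintZ ?mul0r//; exact: L1_0. Qed.

Lemma cintN f : L1 f -> cint (fun x => - f x) = - cint f.
Proof. by move=> fi; rewrite -mulN1r -cintZ//; apply: eq_cint => x _; rewrite mulN1r. Qed.

Lemma cintB f g : L1 f -> L1 g -> cint (fun x => f x - g x) = cint f - cint g.
Proof. by move=> fi gi; rewrite cintD ?cintN//; exact: L1N. Qed.

Lemma cint_sum I (r : seq I) (F : I -> E -> R[i]) : (forall i, L1 (F i)) ->
  cint (fun x => \sum_(i <- r) F i x) = \sum_(i <- r) cint (F i).
Proof.
move=> Fi; elim: r => [|i r IH].
  by rewrite big_nil; under eq_fun do rewrite big_nil; exact: cint0.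
by rewrite big_cons -IH -cintD//; [under eq_fun do rewrite big_cons | exact: L1_sum].
Qed.

Lemma normc_cint f : L1 f -> normc (cint f) <= fine (norm1 f).
Proof.
move=> fi; have [->|c0] := eqVneq (cint f) 0; first by rewrite normc0 fine_ge0// norm1_ge0.
(* A rotation that makes the integral real and nonnegative, so that only the real part has to be
   estimated. *)
pose c := (normc (cint f))%:C%C / cint f.
have n0 : normc (cint f) != 0 by apply: contra_neq c0; exact: eq0_normc.
have nc : normc c = 1.
  rewrite /c normcM normc_real ger0_norm ?normc_ge0//.
  by rewrite -[X in _ * X]/(normc ((cint f)^-1)) normcV mulfV.
have : cint (fun x => c * f x) = (normc (cint f))%:C%C by rewrite cintZ// /c divfK.
move=> /(congr1 (@complex.Re R)) /= <-.
rewrite -lee_fin fineK; last exact: (integrable_fin_num mD (L1_Re (L1Z c fi) mD)).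
rewrite fineK ?norm1_fin//; apply: le_integral => //.
- exact: (L1_Re (L1Z c fi) mD).
- case: fi => mf fi; apply/integrableP; split; first exact: measurable_normcE.
  by under eq_integral do rewrite /= ger0_norm ?normc_ge0//.
- move=> x _; rewrite lee_fin; apply: le_trans (ler_norm _) _.
  by apply: le_trans (normRe_le _) _; rewrite normcM nc mul1r.
Qed.

Lemma le_norm1_ae f g : cmeasurable D f -> cmeasurable D g ->
  {ae mu, forall x, D x -> normc (f x) <= normc (g x)} -> (norm1 f <= norm1 g)%E.
Proof.
move=> mf mg fg; apply: ae_ge0_le_integral => //; try exact: measurable_normcE;
  by move=> x _; rewrite lee_fin normc_ge0.
Qed.

Lemma ae_eq_norm1 f g : cmeasurable D f -> cmeasurable D g ->
  {ae mu, forall x, D x -> f x = g x} -> norm1 f = norm1 g.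
Proof.
move=> mf mg fg; apply/eqP; rewrite eq_le; apply/andP; split;
  by apply: le_norm1_ae => //; apply: filterS fg => x + Dx => /(_ Dx) ->.
Qed.

Lemma ae_eq_cint f g : cmeasurable D f -> cmeasurable D g ->
  {ae mu, forall x, D x -> f x = g x} -> cint f = cint g.
Proof.
move=> [f1 f2] [g1 g2] fg; congr Complex; congr fine; apply: ae_eq_integral => //;
  try exact/measurable_EFinP; by apply: filterS fg => x + Dx => /(_ Dx) ->.
Qed.

Lemma norm1_eq0 f : cmeasurable D f -> norm1 f = 0%E <-> {ae mu, forall x, D x -> f x = 0}.
Proof.
move=> mf; have -> : norm1 f = (\int[mu]_(x in D) `|(normc (f x))%:E|)%E.
  by apply: eq_integral => x _; rewrite gee0_abs// lee_fin normc_ge0.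
rewrite (ae_eq_integral_abs mu mD (measurable_normcE mf)).
split; apply: filterS => x + Dx => /(_ Dx); first by move=> [] /(@eq0_normc R).
by move=> /= ->; rewrite normc0.
Qed.

Lemma cint_indic_ae0 f : L1 f ->
  (forall A, measurable A -> cint (fun x => cindic A x * f x) = 0) ->
  {ae mu, forall x, D x -> f x = 0}.
Proof.
move=> fi f0.
have aux (k : E -> R) : mu.-integrable D (EFin \o k) ->
    (forall A, measurable A -> fine (\int[mu]_(x in D) (\1_A x * k x)%:E)%E = 0) ->
    ae_eq mu D (EFin \o k) (cst 0%E).
  move=> ki k0; apply: integral_ae_eq => // A AD mA; rewrite integral0.
  have kA : mu.-integrable D (fun x => (\1_A x * k x)%:E).
    have kA : mu.-integrable D ((EFin \o k) \_ A).
      by apply/integrable_restrict => //; apply: (integrableS mD _ _ ki) => //; exact: measurableI.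
    by apply: eq_integrable kA => // x _; rewrite /patch indicE; case: ifPn => _; rewrite ?mul1r ?mul0r.
  have <- : (\int[mu]_(x in D) (\1_A x * k x)%:E)%E = 0%E.
    by rewrite -[LHS]fineK ?(integrable_fin_num mD kA)// k0.
  have -> : A = D `&` A by rewrite setIidr.
  rewrite integral_mkcondr; apply: eq_integral => x _; rewrite /patch setIidr// indicE.
  by case: ifPn => _; rewrite /= ?mul1r ?mul0r.
have h1 := aux _ (L1_Re fi mD); have h2 := aux _ (L1_Im fi mD).
have {}h1 := h1 _; have {}h2 := h2 _.
suff : forall A, measurable A ->
  fine (\int[mu]_(x in D) (\1_A x * Re (f x))%:E)%E = 0 /\
  fine (\int[mu]_(x in D) (\1_A x * Im (f x))%:E)%E = 0.
  move=> H; apply: filterS2 (h1 (fun A mA => (H A mA).1)) (h2 (fun A mA => (H A mA).2)) => x.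
  move=> /[swap] + + Dx => /(_ Dx) [] + /(_ Dx) []; case: (f x) => a b /= -> ->.
  by [].
move=> A /f0 /eqP; rewrite eq_complex /= => /andP[/eqP A1 /eqP A2]; split.
- by rewrite -[RHS]A1; congr fine; apply: eq_integral => x _; case: (f x) => a b /=; rewrite mul0r subr0.
- by rewrite -[RHS]A2; congr fine; apply: eq_integral => x _; case: (f x) => a b /=; rewrite mul0r addr0.
Qed.

Lemma ae_le_normoo psi : Loo mu D psi ->
  exists2 M : R, 0 <= M & {ae mu, forall x, D x -> normc (psi x) <= M}.
Proof.
move=> [_ pM]; have := ess_sup_ge mu ((fun x => (normc (psi x))%:E) \_ D).
rewrite -/(normoo mu D psi); case: (normoo mu D psi) pM => [M _ H|//|_ H].
  exists `|M| => //; apply: filterS H => x + Dx; rewrite patchE mem_set// lee_fin => /le_trans; apply.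
  exact: ler_norm.
by exists 0 => //; apply: filterS H => x + Dx; rewrite patchE mem_set.
Qed.

Lemma normoo_le psi M : 0 <= M -> {ae mu, forall x, D x -> normc (psi x) <= M} ->
  (normoo mu D psi <= M%:E)%E.
Proof.
move=> M0 H; apply/ess_supP; apply: filterS H => x; rewrite patchE.
by case: ifPn => [|_ _]; rewrite ?inE// => Dx /(_ Dx).
Qed.

Lemma LooP psi M : cmeasurable D psi -> 0 <= M -> {ae mu, forall x, D x -> normc (psi x) <= M} ->
  Loo mu D psi.
Proof. by move=> mp M0 H; split=> //; apply: le_lt_trans (normoo_le M0 H) _; rewrite ltry. Qed.

Lemma norm1_mul_le psi f M : cmeasurable D psi -> L1 f -> 0 <= M ->
  {ae mu, forall x, D x -> normc (psi x) <= M} ->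
  L1 (fun x => psi x * f x) /\ fine (norm1 (fun x => psi x * f x)) <= M * fine (norm1 f).
Proof.
move=> mp fi M0 pM; have mf := fi.1.
have mpf : cmeasurable D (fun x => psi x * f x) by exact: cmeasurableM.
have nM : normc (M%:C%C) = M by rewrite normc_real ger0_norm.
have Mfi : L1 (fun x => M%:C%C * f x) by exact: L1Z.
have le1 : (norm1 (fun x => psi x * f x)%R <= norm1 (fun x => M%:C%C * f x)%R)%E.
  apply: le_norm1_ae => //; first exact: Mfi.1.
  apply: filterS pM => x + Dx => /(_ Dx) h.
  by rewrite !normcM nM ler_wpM2r// normc_ge0.
have L1pf : L1 (fun x => psi x * f x) by split=> //; apply: le_lt_trans le1 Mfi.2.
split=> //; rewrite -lee_fin EFinM !fineK ?norm1_fin//.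
by rewrite -[X in X%:E]nM -norm1Z.
Qed.

Lemma L1_mul psi f : Loo mu D psi -> L1 f -> L1 (fun x => psi x * f x).
Proof.
move=> pL fi; have [M M0 pM] := ae_le_normoo pL.
exact: (norm1_mul_le pL.1 fi M0 pM).1.
Qed.

Lemma Loo_indic A : measurable A -> Loo mu D (@cindic E R A).
Proof.
move=> mA; apply: (@LooP _ 1) => //; first exact: cmeasurable_indic.
apply: nearW => x Dx; rewrite /cindic normc_real indicE.
by case: (x \in A); rewrite ?normr1 ?normr0.
Qed.

Lemma vanish_cvg (u : nat -> \bar R) : u n @[n --> \oo] --> 0%E -> vanish (fun n => fine (u n)).
Proof.
move=> /fine_cvgP[_ /cvgr0Pnorm_le h] e e0.
have [n0 _ hn] := h e e0; exists n0 => n nn; apply: le_trans (ler_norm _) _; exact: (hn n).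
Qed.

End ComplexIntegral.

Lemma cindic_in (E : Type) (R : realType) (A : set E) x : A x -> cindic A x = 1 :> R[i].
Proof. by move=> Ax; rewrite /cindic indicE mem_set. Qed.

Lemma cindic_out (E : Type) (R : realType) (A : set E) x : ~ A x -> cindic A x = 0 :> R[i].
Proof. by move=> Ax; rewrite /cindic indicE memNset. Qed.

(** * First return times *)

Section ReturnTime.
Context (E : Type) (T : E -> E) (A : set E).
Local Notation tau := (return_time T A).

(** The value 0 is excluded because it is the default of [return_time] at points that never
    return. *)
Lemma return_timeP x n : (0 < n)%N ->
  tau x = n <-> A (iter n T x) /\ forall j, (0 < j < n)%N -> ~ A (iter j T x).
Proof.
move=> n0; rewrite /return_time; set S := (X in xget _ X).
have S1 : is_subset1 S.
  move=> i j [i0 Ai hi] [j0 Aj hj]; apply/eqP; rewrite eqn_leq; apply/andP; split.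
    by rewrite leqNgt; apply/negP => ji; by apply: (hi j _ Aj); rewrite j0.
  by rewrite leqNgt; apply/negP => ij; by apply: (hj i _ Ai); rewrite i0.
split=> [xn|[An hn]]; last by apply: xget_subset1.
have : S (xget 0%N S).
  case: (xgetP 0%N S) => // noS.
  by move: xn; rewrite xgetPN// => n00; rewrite -n00 in n0.
by rewrite xn => -[].
Qed.

Lemma return_time_gt0 x : (exists i, (1 <= i)%N /\ A (iter i T x)) -> (0 < tau x)%N.
Proof.
move=> ex; have {}ex : exists i, (0 < i)%N && `[< A (iter i T x) >].
  by case: ex => i [i0 Ai]; exists i; rewrite i0; exact/asboolP.
case: (ex_minnP ex) => n /andP[n0 /asboolP An] hn.
suff -> : tau x = n by [].
apply/return_timeP => //; split=> // j /andP[j0 jn] Aj.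
by have := hn j; rewrite j0 asboolT// leqNgt jn => /(_ isT).
Qed.

Lemma iter_return_time x : (0 < tau x)%N -> A (iter (tau x) T x).
Proof. by move=> t0; have [] := (return_timeP x t0).1 erefl. Qed.

Lemma before_return_time x j : (0 < j < tau x)%N -> ~ A (iter j T x).
Proof.
move=> /[dup] /andP[j0 jt] h; have t0 : (0 < tau x)%N by rewrite (leq_ltn_trans _ jt).
by have [_] := (return_timeP x t0).1 erefl; apply.
Qed.

Lemma return_mapA x : A x -> A (return_map T A x).
Proof.
rewrite /return_map; have [->//|t0 _] := posnP (tau x); exact: iter_return_time.
Qed.

End ReturnTime.

(** * Nonsingular dynamics, the return map and the renewal operators in dual form *)

Section Dynamics.
Context d (E : measurableType d) (R : realType) (nu nuhat : {measure set E -> \bar R}).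
Context (X Xhat : set E) (T : E -> E) (c : R).
Hypotheses (mX : measurable X) (mXh : measurable Xhat) (XhX : Xhat `<=` X).
Hypotheses (c0 : 0 < c)
  (nuE : forall A, measurable A -> A `<=` Xhat -> nu A = (c%:E * nuhat A)%E).
Hypotheses (TX : forall x, X x -> X (T x)) (mT : measurable_fun X T) (nsT : nonsingular nu X T).
Hypothesis returns : {ae nuhat, forall x, Xhat x -> exists i, (1 <= i)%N /\ Xhat (iter i T x)}.
Local Notation tau := (return_time T Xhat).
Local Notation That := (return_map T Xhat).
Implicit Types (f psi phi : E -> R[i]) (A : set E).

Lemma iterX n x : X x -> X (iter n T x).
Proof. by move=> Xx; elim: n => // n; exact: TX. Qed.

Lemma measurable_iter n : measurable_fun X (iter n T).
Proof.
elim: n => [|n IH]; first exact: measurable_id.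
by apply: (measurable_comp mX) mT IH => _ [x Xx <-]; exact: iterX.
Qed.

Lemma measurable_preimage n A : measurable A -> measurable (X `&` iter n T @^-1` A).
Proof. by move=> mA; exact: measurable_iter. Qed.

Lemma nonsingular_iter n A : measurable A -> nu A = 0%E -> nu (X `&` iter n T @^-1` A) = 0%E.
Proof.
elim: n A => [|n IH] A mA A0.
  have mXA : measurable (X `&` A) by exact: measurableI.
  apply/eqP; rewrite -measure_le0 -[leRHS]A0; apply: le_measure; rewrite ?inE//.
have -> : X `&` iter n.+1 T @^-1` A = X `&` iter n T @^-1` (X `&` T @^-1` A).
  by apply/seteqP; split=> x [Xx Ax]; split=> //; [split=> //; exact: iterX | case: Ax].
by apply: IH; [exact: mT | exact: nsT].
Qed.

Lemma Loo_iter n psi : Loo nu X psi -> Loo nu X (fun x => psi (iter n T x)).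
Proof.
move=> pL; have [M M0 [N [mN N0 sN]]] := ae_le_normoo pL.
have img : iter n T @` X `<=` X by move=> _ [x Xx <-]; exact: iterX.
apply: (@LooP _ _ _ nu X _ M) => //.
  case: pL.1 => m1 m2; split.
    exact: (measurable_comp mX img m1 (measurable_iter n)).
  exact: (measurable_comp mX img m2 (measurable_iter n)).
exists (X `&` iter n T @^-1` N); split.
- exact: measurable_preimage.
- exact: nonsingular_iter.
- move=> x /= /not_implyP[Xx h]; split=> //; apply: sN => /= h'; apply: h; apply: h'; exact: iterX.
Qed.

Section Transfer.
Variable P : (E -> R[i]) -> E -> R[i].
Hypothesis tP : transfer_operator nu X T P.

Lemma transfer_iter n phi : L1 nu X phi -> L1 nu X (iter n P phi) /\
  forall psi, Loo nu X psi -> cint nu X (fun x => psi (iter n T x) * phi x) =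
    cint nu X (fun x => psi x * iter n P phi x).
Proof.
move=> phiL; elim: n => [|n [IH1 IH2]]; first by split.
split=> [|psi pL]; first exact: (tP IH1).1.
rewrite -(tP IH1).2// -IH2; last exact: (Loo_iter 1).
by congr cint; apply/funext => x; rewrite iterS.
Qed.

End Transfer.

Lemma measurable_tau_eqS n : measurable [set x | Xhat x /\ tau x = n.+1].
Proof.
have -> : [set x | Xhat x /\ tau x = n.+1] = Xhat `&` ((X `&` iter n.+1 T @^-1` Xhat) `&`
    \bigcap_(j in [set j | 0 < j < n.+1]%N) ~` (X `&` iter j T @^-1` Xhat)).
  apply/seteqP; split=> x.
    move=> [Xx /return_timeP-/(_ isT)[h1 h2]]; split=> //; split; first by split=> //; exact: XhX.
    by move=> j jn [_ hj]; exact: (h2 j).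
  move=> [Xx [[_ h1] h2]]; split=> //; apply/return_timeP => //; split=> // j jn hj.
  by apply: (h2 j jn); split=> //; exact: XhX.
apply: measurableI => //; apply: measurableI; first exact: measurable_preimage.
by apply: bigcap_measurableType => j _; apply: measurableC; exact: measurable_preimage.
Qed.

Lemma measurable_tau (Q : set nat) : measurable [set x | Xhat x /\ Q (tau x)].
Proof.
have m1 n : measurable [set x | Xhat x /\ tau x = n].
  case: n => [|n]; last exact: measurable_tau_eqS.
  have -> : [set x | Xhat x /\ tau x = 0%N] =
      Xhat `\` \bigcup_n [set x | Xhat x /\ tau x = n.+1].
    apply/seteqP; split=> x [Xx t0]; split=> //.
      by move=> [n _ [_]]; rewrite t0.
    by case t: (tau x) => [//|n]; case: t0; exists n.
  by apply: measurableD => //; apply: bigcupT_measurable => n; exact: measurable_tau_eqS.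
have -> : [set x | Xhat x /\ Q (tau x)] = \bigcup_(n in Q) [set x | Xhat x /\ tau x = n].
  apply/seteqP; split=> x; first by move=> [Xx Qx]; exists (tau x).
  by move=> [n Qn [Xx tn]]; split=> //; rewrite tn.
exact: bigcup_measurable.
Qed.

Lemma ae_tau_gt0 : {ae nuhat, forall x, Xhat x -> (0 < tau x)%N}.
Proof. by apply: filterS returns => x h /h; exact: return_time_gt0. Qed.

Lemma ae_nu_nuhat (Q : E -> Prop) :
  {ae nu, forall x, X x -> Q x} -> {ae nuhat, forall x, Xhat x -> Q x}.
Proof.
move=> [N [mN N0 sN]]; exists (N `&` Xhat).
have mNX : measurable (N `&` Xhat) by exact: measurableI.
split=> //.
  have : nu (N `&` Xhat) = 0%E.
    by apply/eqP; rewrite -measure_le0 -[leRHS]N0; apply: le_measure; rewrite ?inE.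
  rewrite nuE// => /eqP; rewrite mule_eq0 => /orP[|/eqP//].
  by rewrite eqe gt_eqF.
move=> x /= /not_implyP[Xx h]; split=> //; apply: sN => /= h'; apply: h; apply: h'; exact: XhX.
Qed.

Lemma ae_nuhat_nu (Q : E -> Prop) :
  {ae nuhat, forall x, Xhat x -> Q x} -> {ae nu, forall x, Xhat x -> Q x}.
Proof.
move=> [N [mN N0 sN]]; exists (N `&` Xhat).
have mNX : measurable (N `&` Xhat) by exact: measurableI.
split=> //.
  rewrite nuE//; have -> : nuhat (N `&` Xhat) = 0%E; last by rewrite mule0.
  by apply/eqP; rewrite -measure_le0 -[leRHS]N0; apply: le_measure; rewrite ?inE.
by move=> x /= /not_implyP[Xx h]; split=> //; apply: sN => /= h'; apply: h; exact: h'.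
Qed.

Lemma Loo_nu_nuhat psi : Loo nu X psi -> Loo nuhat Xhat psi.
Proof.
move=> pL; have [M M0 h] := ae_le_normoo pL.
apply: (@LooP _ _ _ nuhat Xhat _ M) => //; last exact: (ae_nu_nuhat h).
by case: pL.1 => m1 m2; split; [apply: measurable_funS m1 | apply: measurable_funS m2].
Qed.

Lemma cmeasurable_ext f : cmeasurable Xhat f -> cmeasurable X (fun x => cindic Xhat x * f x).
Proof.
move=> [m1 m2]; split.
  apply: (@eq_measurable_fun _ _ _ _ X ((fun x => complex.Re (f x)) \_ Xhat)).
    move=> x _; rewrite /patch /cindic indicE; case: (x \in Xhat); case: (f x) => a b /=;
      by rewrite ?mul1r ?mul0r subr0.
  by apply: (measurable_restrict _ _ _).1 => //; rewrite setIidr.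
apply: (@eq_measurable_fun _ _ _ _ X ((fun x => complex.Im (f x)) \_ Xhat)).
  move=> x _; rewrite /patch /cindic indicE; case: (x \in Xhat); case: (f x) => a b /=;
    by rewrite ?mul1r ?mul0r addr0.
by apply: (measurable_restrict _ _ _).1 => //; rewrite setIidr.
Qed.

Lemma Loo_ext psi : Loo nuhat Xhat psi -> Loo nu X (fun x => cindic Xhat x * psi x).
Proof.
move=> pL; have [M M0 h] := ae_le_normoo pL.
apply: (@LooP _ _ _ nu X _ M) => //; first exact: cmeasurable_ext pL.1.
apply: filterS (ae_nuhat_nu h) => x hx _; rewrite normcM /cindic normc_real indicE.
case: (boolP (x \in Xhat)) => [|_]; last by rewrite normr0 mul0r.
by rewrite inE normr1 mul1r => /hx.
Qed.

Lemma integral_nu_nuhat (u : E -> \bar R) : (forall x, X x -> ~ Xhat x -> u x = 0%E) ->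
  measurable_fun Xhat u -> (forall x, Xhat x -> 0 <= u x)%E ->
  (\int[nu]_(x in X) u x = c%:E * \int[nuhat]_(x in Xhat) u x)%E.
Proof.
move=> u0 mu u1; pose k := NngNum (ltW c0).
have -> : (\int[nu]_(x in X) u x = \int[nu]_(x in Xhat) u x)%E.
  rewrite integral_mkcond [in RHS]integral_mkcond; congr integral; apply/funext => x.
  rewrite /patch; case: (boolP (x \in Xhat)) => [|/negP]; rewrite inE => Xx.
    by rewrite mem_set//; exact: XhX.
  by case: ifPn => //; rewrite inE => /u0 ->.
rewrite (@eq_measure_integral _ _ _ _ (mscale k nuhat) nu); last exact: nuE.
exact: (@ge0_integral_mscale _ _ _ nuhat Xhat mXh k u mu u1).
Qed.

Lemma norm1_nu_nuhat f : (forall x, X x -> ~ Xhat x -> f x = 0) -> cmeasurable Xhat f ->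
  norm1 nu X f = (c%:E * norm1 nuhat Xhat f)%E.
Proof.
move=> f0 mf; apply: integral_nu_nuhat => [x Xx /(f0 x Xx) ->||x _].
- by rewrite normc0.
- exact: measurable_normcE.
- by rewrite lee_fin normc_ge0.
Qed.

Lemma L1_ext f : L1 nuhat Xhat f -> L1 nu X (fun x => cindic Xhat x * f x).
Proof.
move=> fL; have m1 := cmeasurable_ext fL.1; split=> //.
have [h1 h2] : L1 nuhat Xhat (fun x => cindic Xhat x * f x).
  by apply: eq_L1 fL => x Xx; rewrite /cindic indicE mem_set// mul1r.
rewrite norm1_nu_nuhat//; last by move=> x _ Xx; rewrite /cindic indicE memNset// mul0r.
by rewrite -(fineK (norm1_fin (conj h1 h2))) -EFinM ltry.
Qed.

Lemma L1_nu_nuhat f : L1 nu X f -> L1 nuhat Xhat f.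
Proof.
move=> fL; have [m1 m2] := fL.1.
have mf : cmeasurable Xhat f.
  by split; [apply: measurable_funS m1 | apply: measurable_funS m2].
have h : cmeasurable X (fun x => cindic Xhat x * f x) by exact: cmeasurable_ext.
have := norm1_le nu mX h fL.1; have h' : cmeasurable Xhat (fun x => cindic Xhat x * f x).
  by case: h => h1 h2; split; [apply: measurable_funS h1 | apply: measurable_funS h2].
rewrite norm1_nu_nuhat//; last by move=> x _ Xx; rewrite /cindic indicE memNset// mul0r.
have -> : norm1 nuhat Xhat (fun x => cindic Xhat x * f x) = norm1 nuhat Xhat f.
  by apply: eq_norm1 => x Xx; rewrite /cindic indicE mem_set// mul1r.
move=> H; split=> //.
have {H} : (c%:E * norm1 nuhat Xhat f < +oo)%E.
  apply: le_lt_trans (H _) fL.2 => x _; rewrite normcM /cindic normc_real indicE.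
  by case: (x \in Xhat); rewrite ?normr1 ?normr0 ?mul1r ?mul0r// normc_ge0.
rewrite !ltey; apply: contra_neq => ->; exact: gt0_muley.
Qed.

Lemma cint_nu_nuhat f : (forall x, X x -> ~ Xhat x -> f x = 0) -> L1 nuhat Xhat f ->
  cint nu X f = c%:C%C * cint nuhat Xhat f.
Proof.
move=> f0 fL.
have aux (u : E -> R) : (forall x, X x -> ~ Xhat x -> u x = 0) -> nuhat.-integrable Xhat (EFin \o u) ->
    fine (\int[nu]_(x in X) (u x)%:E) = c * fine (\int[nuhat]_(x in Xhat) (u x)%:E).
  move=> u0 ui; have mu := measurable_int _ ui.
  have fp := integrable_pos_fin_num mXh ui; have fn := integrable_neg_fin_num mXh ui.
  have Ep : (\int[nu]_(x in X) (EFin \o u)^\+ x = c%:E * \int[nuhat]_(x in Xhat) (EFin \o u)^\+ x)%E.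
    apply: integral_nu_nuhat => //; last exact: measurable_funepos.
    by move=> x Xx h; rewrite funeposE /= u0// maxxx.
  have En : (\int[nu]_(x in X) (EFin \o u)^\- x = c%:E * \int[nuhat]_(x in Xhat) (EFin \o u)^\- x)%E.
    apply: integral_nu_nuhat => //; last exact: measurable_funeneg.
    by move=> x Xx h; rewrite funenegE /= u0// ?oppe0 ?oppr0 maxxx.
  rewrite integralE [in RHS]integralE [X in fine (X - _)]Ep [X in fine (_ - X)]En.
  by rewrite -(fineK fp) -(fineK fn) -!EFinM -!EFinB /= mulrBr.
rewrite /cint; apply/eqP; rewrite eq_complex /= !mul0r subr0 addr0; apply/andP; split; apply/eqP.
  by apply: aux; [move=> x Xx /(f0 x Xx) -> | exact: L1_Re].
by apply: aux; [move=> x Xx /(f0 x Xx) -> | exact: L1_Im].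
Qed.

Local Notation L1h := (L1 nuhat Xhat).
Local Notation cinth := (cint nuhat Xhat).
Local Notation S_ n := [set x | Xhat x /\ tau x = n].

Lemma cmeasurable_tau (w : nat -> R[i]) : cmeasurable Xhat (fun x => w (tau x)).
Proof.
by split=> _ A mA; [exact: (measurable_tau (fun k => A (complex.Re (w k)))) |
  exact: (measurable_tau (fun k => A (complex.Im (w k))))].
Qed.

Lemma measurable_return_map : measurable_fun Xhat That.
Proof.
move=> _ A mA; have -> : Xhat `&` That @^-1` A = \bigcup_n (S_ n `&` (X `&` iter n T @^-1` A)).
  apply/seteqP; split=> x.
    by move=> [Xx Ax]; exists (tau x) => //; split=> //; split=> //; exact: XhX.
  by move=> [n _ [[Xx tn] [_ Ax]]]; split=> //; rewrite /= /return_map tn.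
apply: bigcupT_measurable => n; apply: measurableI; last exact: measurable_preimage.
exact: (measurable_tau (fun k => k = n)).
Qed.

(** On [tau = n] the return map is [T^n], so the preimage is covered by countably many preimages
    under iterates of [T], each of them null. *)
Lemma nonsingular_return_map A : measurable A -> nuhat A = 0%E ->
  nuhat.-negligible (Xhat `&` That @^-1` A).
Proof.
move=> mA A0; have mAX : measurable (A `&` Xhat) by exact: measurableI.
have nA0 : nu (A `&` Xhat) = 0%E.
  rewrite nuE//; have -> : nuhat (A `&` Xhat) = 0%E; last by rewrite mule0.
  by apply/eqP; rewrite -measure_le0 -[leRHS]A0; apply: le_measure; rewrite ?inE.
suff : nuhat.-negligible (\bigcup_n (Xhat `&` (X `&` iter n T @^-1` (A `&` Xhat)))).
  apply: negligibleS; move=> x [Xx Ax]; exists (tau x) => //; split=> //; split; first exact: XhX.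
  by split=> //; exact: return_mapA.
apply: negligible_bigcup => n.
have m1 : measurable (X `&` iter n T @^-1` (A `&` Xhat)) by exact: measurable_preimage.
have m2 : measurable (Xhat `&` (X `&` iter n T @^-1` (A `&` Xhat))) by exact: measurableI.
apply/negligibleP => //.
have : nu (Xhat `&` (X `&` iter n T @^-1` (A `&` Xhat))) = 0%E.
  apply/eqP; rewrite -measure_le0 -(nonsingular_iter n mAX nA0).
  by apply: le_measure; rewrite ?inE.
rewrite nuE// => /eqP; rewrite mule_eq0 => /orP[|/eqP//].
by rewrite eqe gt_eqF.
Qed.

Lemma ae_return_map (Q : E -> Prop) : {ae nuhat, forall x, Xhat x -> Q x} ->
  {ae nuhat, forall x, Xhat x -> Q (That x)}.
Proof.
move=> [N [mN N0 sN]]; apply: negligibleS (nonsingular_return_map mN N0) => x.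
move=> /= /not_implyP[Xx h]; split=> //; apply: sN => /= h'; apply: h; apply: h'.
exact: return_mapA.
Qed.

Lemma cmeasurable_return_map psi : cmeasurable Xhat psi -> cmeasurable Xhat (fun x => psi (That x)).
Proof.
have img : That @` Xhat `<=` Xhat by move=> _ [x Xx <-]; exact: return_mapA.
case=> m1 m2; split; first exact: (measurable_comp mXh img m1 measurable_return_map).
exact: (measurable_comp mXh img m2 measurable_return_map).
Qed.

Lemma Loo_return_map psi : Loo nuhat Xhat psi -> Loo nuhat Xhat (fun x => psi (That x)).
Proof.
move=> pL; have [M M0 h] := ae_le_normoo pL.
apply: (@LooP _ _ _ nuhat Xhat _ M) => //; first exact: cmeasurable_return_map pL.1.
exact: (ae_return_map h).
Qed.

Lemma sum_tau N x (w : nat -> R[i]) : Xhat x ->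
  \sum_(1 <= k < N) cindic (S_ k) x * w k = if (0 < tau x < N)%N then w (tau x) else 0.
Proof.
move=> Xx; have cE k : cindic (S_ k) x = (k == tau x)%:R :> R[i].
  rewrite /cindic indicE; have [->|/eqP kt] := eqVneq k (tau x); first by rewrite mem_set.
  by rewrite memNset// => -[_ /esym].
case: ifP => [tN|tN].
  rewrite (bigD1_seq (tau x)) ?mem_index_iota ?iota_uniq//= cE eqxx mul1r big1 ?addr0// => k kt.
  by rewrite cE (negbTE kt) mul0r.
rewrite big_nat big1// => k kN; rewrite cE; case: eqP => [kt|_]; last by rewrite mul0r.
by rewrite -kt kN in tN.
Qed.

(** Dominated convergence: [tau] is a natural number at every point, so the sets [n <= tau] decrease
    to the empty set. *)
Lemma norm1_tail f : L1h f ->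
  vanish (fun n => fine (norm1 nuhat Xhat (fun x => cindic [set x | Xhat x /\ (n <= tau x)%N] x * f x))).
Proof.
move=> fL; apply: vanish_cvg; pose S n := [set x | Xhat x /\ (n <= tau x)%N].
have mS n : measurable (S n) by exact: (measurable_tau (fun k => (n <= k)%N)).
have mf n : cmeasurable Xhat (fun x => cindic (S n) x * f x).
  by apply: cmeasurableM; [exact: cmeasurable_indic | exact: fL.1].
have -> : 0%E = (\int[nuhat]_(x in Xhat) (cst 0%E x))%E by rewrite integral0.
apply: (@dominated_cvg _ _ _ nuhat Xhat mXh (fun n x => (normc (cindic (S n) x * f x))%:E) _
  (fun x => (normc (f x))%:E)).
- by move=> n; exact: measurable_normcE.
- move=> x Xx; apply: cvg_near_cst; exists (tau x).+1 => // n /= nt.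
  rewrite /cindic indicE memNset ?mul0r ?normc0// => -[_].
  by rewrite leqNgt nt.
- by [].
- apply/integrableP; split; first exact: (measurable_normcE fL.1).
  by under eq_integral do rewrite gee0_abs ?lee_fin ?normc_ge0//; exact: fL.2.
- move=> n x Xx; rewrite gee0_abs ?lee_fin ?normc_ge0// normcM /cindic normc_real indicE.
  by case: (_ \in _); rewrite ?normr1 ?normr0 ?mul1r ?mul0r// normc_ge0.
Qed.

Section Renewal.
Variable P : (E -> R[i]) -> E -> R[i].
Hypothesis tP : transfer_operator nu X T P.
Local Notation Rn := (renewal T Xhat P).

(** [P^n] is dual to [T^n], which is the return map on [tau = n]. As [P] is known only up to null
    sets, later identities on [R_n] are checked by integration through this formula. *)
Lemma renewal_dual n f : (0 < n)%N -> L1h f -> L1h (Rn n f) /\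
  forall psi, Loo nuhat Xhat psi -> cinth (fun x => psi x * Rn n f x) =
    cinth (fun x => cindic (S_ n) x * (psi (That x) * f x)).
Proof.
move=> n0 fL; have mS : measurable (S_ n) by exact: (measurable_tau (fun k => k = n)).
pose phi y := f y * cindic (S_ n) y.
have phiE x : ~ Xhat x -> phi x = 0.
  by move=> Xx; rewrite /phi /cindic indicE memNset ?mulr0// => -[].
have phiL : L1 nu X phi.
  have : L1h phi.
    have h : L1h (fun x => cindic (S_ n) x * f x) by apply: L1_mul => //; exact: Loo_indic.
    by apply: eq_L1 h => x _; exact: mulrC.
  move=> /L1_ext; apply: eq_L1 => x Xx; rewrite /cindic indicE.
  by case: (boolP (x \in Xhat)) => [|/negP]; rewrite inE ?mul1r// => /phiE ->; rewrite mulr0.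
have [PL dual] := transfer_iter tP n phiL.
have RL : L1h (Rn n f).
  apply: eq_L1 (L1_nu_nuhat PL) => x Xx.
  by rewrite /renewal /cindic [in RHS]indicE mem_set// mul1r.
split=> // psi pL; have p'L := Loo_ext pL.
have cC : c%:C%C != 0 :> R[i].
  by apply/eqP => /(congr1 (@complex.Re R)) /= h; have := c0; rewrite h ltxx.
apply: (mulfI cC).
have L2 := L1_mul mX p'L PL; have L3 := L1_mul mX (Loo_iter n p'L) phiL.
transitivity (cint nu X (fun x => (cindic Xhat x * psi x) * iter n P phi x)).
  rewrite cint_nu_nuhat; [congr (_ * _) | |exact: L1_nu_nuhat].
    apply: eq_cint => x Xx.
    by rewrite /renewal mulrCA /cindic [in RHS]indicE mem_set// mul1r [in LHS]indicE mem_set// mul1r.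
  by move=> x _ Xx; rewrite /cindic indicE memNset// !mul0r.
rewrite -dual// cint_nu_nuhat; [congr (_ * _) | |exact: L1_nu_nuhat].
  apply: eq_cint => x Xx; rewrite /phi.
  have [[_ tx]|xS] := pselect (S_ n x); last by rewrite (cindic_out _ xS) !mulr0 mul0r.
  have TX' : Xhat (iter n T x) by rewrite -tx; apply: iter_return_time; rewrite tx.
  by rewrite !cindic_in// !mul1r mulr1 /return_map tx.
by move=> x _ /phiE ->; rewrite mulr0.
Qed.

(** In dual form: R(z) f is the image of [z^tau f] under the transfer operator of the return map. *)
Lemma renewal_series_dual Rz z f psi : renewal_series Xhat nuhat Rn Rz -> normc z <= 1 ->
  L1h f -> Loo nuhat Xhat psi ->
  cinth (fun x => psi x * Rz z f x) = cinth (fun x => psi (That x) * (z ^+ tau x * f x)).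
Proof.
move=> rs z1 fL pL; have [RzL cv] := rs z f z1 fL.
have {}cv := vanish_cvg cv.
have [M M0 pM] := ae_le_normoo pL.
pose G x := psi (That x) * f x.
have GL : L1h G by exact: (L1_mul mXh (Loo_return_map pL) fL).
have ztau : Loo nuhat Xhat (fun x => z ^+ tau x).
  apply: (@LooP _ _ _ nuhat Xhat _ 1) => //; first exact: (cmeasurable_tau (fun k => z ^+ k)).
  by apply: nearW => x _; rewrite normcX exprn_ile1// normc_ge0.
have zGL : L1h (fun x => z ^+ tau x * G x) by exact: L1_mul.
have -> : cinth (fun x => psi (That x) * (z ^+ tau x * f x)) = cinth (fun x => z ^+ tau x * G x).
  by apply: eq_cint => x _; rewrite mulrCA.
have RnL n : (0 < n)%N -> L1h (Rn n f) by move=> n0; exact: (renewal_dual n0 fL).1.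
pose F N x := \sum_(1 <= n < N) z ^+ n * Rn n f x.
have FL N : L1h (F N).
  have : L1h (fun x => \sum_(1 <= n < N) (fun n x => if n is n'.+1 then z ^+ n * Rn n f x else 0) n x).
    by apply: L1_sum => // -[|n]; [exact: L1_0 | apply: L1Z => //; exact: RnL].
  by apply: eq_L1 => x _; apply: eq_big_nat => -[].
have mSn n : measurable (S_ n) by exact: (measurable_tau (fun k => k = n)).
have FE N : cinth (fun x => psi x * F N x) =
    cinth (fun x => cindic [set x | Xhat x /\ (0 < tau x < N)%N] x * (z ^+ tau x * G x)).
  transitivity (\sum_(1 <= n < N) cinth (fun x => psi x * (if n is n'.+1 then z ^+ n * Rn n f x else 0))).
    rewrite -cint_sum//; last first.
      move=> [|n]; apply: (L1_mul mXh pL); first exact: L1_0.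
      by apply: L1Z => //; exact: RnL.
    apply: eq_cint => x _; rewrite /F mulr_sumr; apply: eq_big_nat => -[]//.
  transitivity (\sum_(1 <= n < N) cinth (fun x => cindic (S_ n) x * (z ^+ n * G x))).
    apply: eq_big_nat => -[//|n] _.
    transitivity (z ^+ n.+1 * cinth (fun x => psi x * Rn n.+1 f x)).
      rewrite -cintZ//; last by apply: (L1_mul mXh pL); exact: RnL.
      by apply: eq_cint => x _; rewrite mulrCA.
    have [_ ->//] := @renewal_dual n.+1 f isT fL.
    rewrite -cintZ//; last by apply: L1_mul => //; exact: Loo_indic.
    by apply: eq_cint => x _; rewrite mulrCA.
  rewrite -cint_sum//; last first.
    by move=> n; apply: L1_mul => //; [exact: Loo_indic | exact: L1Z].
  apply: eq_cint => x Xx; rewrite (sum_tau _ (fun n => z ^+ n * G x))//.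
  rewrite /cindic indicE; case: ifP => h; first by rewrite mem_set// mul1r.
  by rewrite memNset ?mul0r// => -[_]; rewrite h.
apply/eqP; rewrite -subr_eq0; apply/eqP/(@eq0_normc R)/le_anti; rewrite normc_ge0 andbT.
(* The two sides differ by the L1 error of the [N]-th partial sum, weighted by the bound [M] of
   [psi], and by the mass of [G] on [N <= tau]. Both vanish. *)
apply: vanish_cst_le (vanishD (vanishZ M0 cv) (norm1_tail GL)) => N.
have -> : cinth (fun x => psi x * Rz z f x) - cinth (fun x => z ^+ tau x * G x) =
   - (cinth (fun x => psi x * (F N x - Rz z f x))) -
   (cinth (fun x => z ^+ tau x * G x) - cinth (fun x => psi x * F N x)).
  have -> : cinth (fun x => psi x * (F N x - Rz z f x)) =
      cinth (fun x => psi x * F N x) - cinth (fun x => psi x * Rz z f x).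
    rewrite -cintB//; [|exact: L1_mul|exact: L1_mul].
    by apply: eq_cint => x _; rewrite mulrBr.
  by ring.
apply: le_trans (normcDle _ _) _; rewrite !normc_opp; apply: lerD.
  have [h1 h2] := norm1_mul_le mXh pL.1 (L1B mXh (FL N) RzL) M0 pM.
  by apply: le_trans h2; exact: normc_cint.
rewrite FE -cintB//; last by apply: L1_mul => //; apply: Loo_indic => //; exact: (measurable_tau (fun k => 0 < k < N)%N).
have mN := measurable_tau (fun k => N <= k)%N.
have L4 : L1h (fun x => cindic [set x | Xhat x /\ (N <= tau x)%N] x * (z ^+ tau x * G x)).
  by apply: L1_mul => //; exact: Loo_indic.
have L5 : L1h (fun x => cindic [set x | Xhat x /\ (N <= tau x)%N] x * G x).
  by apply: L1_mul => //; exact: Loo_indic.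
apply: le_trans (_ : fine (norm1 nuhat Xhat (fun x => cindic [set x | Xhat x /\ (N <= tau x)%N] x * (z ^+ tau x * G x))) <= _).
  apply: le_trans (_ : normc (cinth (fun x => cindic [set x | Xhat x /\ (N <= tau x)%N] x * (z ^+ tau x * G x))) <= _).
    rewrite le_eqVlt; apply/orP; left; apply/eqP; congr normc; apply: ae_eq_cint => //.
    - apply: (L1B mXh zGL _).1; apply: L1_mul => //; apply: Loo_indic => //.
      exact: (measurable_tau (fun k => 0 < k < N)%N).
    - exact: L4.1.
    (* The sets [0 < tau < N] and [N <= tau] need not cover the points with the default value
       [tau = 0]; these form a null set. *)
    - apply: filterS ae_tau_gt0 => x t0 Xx; have {}t0 := t0 Xx.
      rewrite -[X in X - _]mul1r -mulrBl; congr (_ * _).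
      have [h|h] := leqP N (tau x).
        by rewrite cindic_out ?cindic_in ?subr0// => -[_]; rewrite t0/= ltnNge h.
      rewrite [X in 1 - X]cindic_in; last by split=> //; rewrite t0.
      by rewrite cindic_out ?subrr// => -[_]; rewrite leqNgt h.
  exact: normc_cint.
rewrite -lee_fin !fineK ?norm1_fin//; apply: norm1_le => //; [exact: L4.1 | exact: L5.1 |].
move=> x _; rewrite !normcM; apply: ler_wpM2l; first exact: normc_ge0.
apply: ler_piMl; first by rewrite mulr_ge0 ?normc_ge0.
by rewrite normcX exprn_ile1// normc_ge0.
Qed.

(** Decomposition by the first return time [k]: on [tau = k <= n] the iterate [T^n] is [T^(n - k)]
    after the return map, and on [tau > n > 0] the orbit is outside [Xhat] at time [n], where [g]
    vanishes. *)
Lemma correlation_renewal n f g : L1h f -> Loo nu X g ->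
  (forall x, X x -> ~ Xhat x -> g x = 0) ->
  cinth (fun x => g (iter n T x) * f x) = (if n == 0%N then cinth (fun x => g x * f x) else 0) +
    \sum_(1 <= k < n.+1) cinth (fun x => g (iter (n - k) T x) * Rn k f x).
Proof.
move=> fL gL g0; have [->|n0] := eqVneq n 0%N; first by rewrite big_nil addr0.
have Gn m : Loo nuhat Xhat (fun x => g (iter m T x)).
  by apply: Loo_nu_nuhat; exact: Loo_iter.
have mSn k : measurable (S_ k) by exact: (measurable_tau (fun m => m = k)).
have FL k : L1h (fun x => cindic (S_ k) x * (g (iter n T x) * f x)).
  by apply: L1_mul => //; [exact: Loo_indic | exact: L1_mul].
have -> : \sum_(1 <= k < n.+1) cinth (fun x => g (iter (n - k) T x) * Rn k f x) =
    \sum_(1 <= k < n.+1) cinth (fun x => cindic (S_ k) x * (g (iter n T x) * f x)).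
  apply: eq_big_nat => k /andP[k0 kn]; have [_ ->//] := renewal_dual k0 fL.
  apply: eq_cint => x Xx; rewrite /cindic indicE.
  case: (boolP (x \in S_ k)) => [|_]; last by rewrite !mul0r.
  rewrite inE => -[_ tx]; congr (_ * (g _ * _)).
  by rewrite /return_map tx -iterD subnK.
rewrite -cint_sum// add0r; apply: ae_eq_cint => //.
- by apply: (L1_mul mXh (Gn n) fL).1.
- by apply: (L1_sum mXh _ FL).1.
apply: filterS ae_tau_gt0 => x t0 Xx; have {}t0 := t0 Xx.
rewrite (sum_tau _ (fun=> g (iter n T x) * f x))// t0 ltnS /=; case: ifP => // tn.
rewrite g0 ?mul0r//; first exact/iterX/XhX.
by apply: before_return_time; rewrite lt0n n0 ltnNge tn.
Qed.

End Renewal.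

End Dynamics.

(** * Unimodular eigenfunctions and aperiodicity *)

Lemma normc_eq1_Re (R : realType) (w : R[i]) : normc w <= 1 -> complex.Re w = 1 -> w = 1.
Proof.
case: w => a b /= h a1; subst a; have : 1 + b ^+ 2 <= 1.
  rewrite -[leLHS]sqr_sqrtr ?addr_ge0 ?sqr_ge0//.
  by move: h; rewrite expr1n => h; rewrite exprn_ile1// sqrtr_ge0.
rewrite gerDl => b0; have /eqP : b ^+ 2 = 0 by apply/le_anti; rewrite b0 sqr_ge0.
by rewrite sqrf_eq0 => /eqP ->.
Qed.

Lemma mulr_conj (R : realType) (w : R[i]) : normc w = 1 -> w * (w^*)%C = 1.
Proof.
case: w => a b /= h; apply/eqP; rewrite eq_complex /=; apply/andP; split; apply/eqP; last by ring.
have : Num.sqrt (a ^+ 2 + b ^+ 2) ^+ 2 = 1 by rewrite h expr1n.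
by rewrite sqr_sqrtr ?addr_ge0 ?sqr_ge0// => <-; ring.
Qed.

Lemma normc_conj (R : realType) (w : R[i]) : normc (w^*)%C = normc w.
Proof. by case: w => a b; rewrite /normc /= sqrrN. Qed.

(** Equality case of [Re w <= |w| <= 1] for [w] the conjugate of [a] times [e b]. *)
Lemma unimodular_product (R : realType) (a e b : R[i]) (r : R) : normc a <= 1 ->
  normc e = 1 -> normc b = 1 -> 0 < r ->
  complex.Re ((a^*)%C * (e * (b * r%:C%C))) = r -> a = e * b.
Proof.
move=> a1 e1 b1 r0 ReE; pose w := (a^*)%C * (e * b).
have w1 : w = 1.
  apply: normc_eq1_Re; first by rewrite !normcM e1 b1 !mulr1 normc_conj.
  apply: (mulIf (lt0r_neq0 r0)); rewrite mul1r -[RHS]ReE !mulrA -(mulrA _ e b) -/w.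
  by case: w => p q /=; rewrite mulr0 subr0.
have na : normc a = 1.
  by have := congr1 (@normc R) w1; rewrite !normcM e1 b1 !mulr1 normc_conj normc1.
by have := congr1 (fun y => a * y) w1; rewrite /w mulrA mulr_conj// mul1r mulr1 => ->.
Qed.

Section Eigenfunctions.
Context d (E : measurableType d) (R : realType) (m : {measure set E -> \bar R}) (D : set E).
Context (S : E -> E) (tau : E -> nat).
Hypotheses (mD : measurable D) (SD : forall x, D x -> D (S x)).
Hypothesis mS : forall psi : E -> R[i], cmeasurable D psi -> cmeasurable D (fun x => psi (S x)).
Hypothesis mtau : forall w : nat -> R[i], cmeasurable D (fun x => w (tau x)).
Hypothesis aper : forall (t : R) (F : E -> R[i]), 0 <= t < 2 * pi -> cmeasurable D F ->
  (forall x, D x -> normc (F x) = 1) ->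
  {ae m, forall x, D x -> cis (t * (tau x)%:R) = F x / F (S x)} ->
  t = 0 /\ exists c, {ae m, forall x, D x -> F x = c}.
Variables (z : R[i]) (f : E -> R[i]).
Hypotheses (z1 : normc z = 1) (fL : L1 m D f).
Hypothesis fz : forall psi, Loo m D psi ->
  cint m D (fun x => psi (S x) * (z ^+ tau x * f x)) = cint m D (fun x => psi x * f x).

Let zt x := z ^+ tau x.
Let zt1 x : normc (zt x) = 1. Proof. by rewrite normcX z1 expr1n. Qed.
Let zt0 x : zt x != 0.
Proof. by apply/eqP => h; have := zt1 x; rewrite h normc0 => /esym/eqP; rewrite oner_eq0. Qed.
Let phase x : R[i] := f x * (normc (f x))^-1%:C%C.

Lemma normc_phase x : f x <> 0 -> normc (phase x) = 1.
Proof.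
move=> fx; have n0 : normc (f x) != 0 by apply/eqP => /(@eq0_normc R).
by rewrite normcM normc_real ger0_norm ?invr_ge0 ?normc_ge0// mulfV.
Qed.

Lemma phase_eq0 x : f x = 0 -> phase x = 0.
Proof. by move=> fx; rewrite /phase fx mul0r. Qed.

Lemma phase_normc x : phase x * (normc (f x))%:C%C = f x.
Proof.
have [fx|/eqP fx] := eqVneq (f x) 0; first by rewrite phase_eq0// mul0r.
have n0 : normc (f x) != 0 by apply/eqP => /(@eq0_normc R).
by rewrite /phase -mulrA -rmorphM mulVf// mulr1.
Qed.

Lemma normc_phase_le x : normc (phase x) <= 1.
Proof.
by have [fx|/eqP/normc_phase->//] := eqVneq (f x) 0; rewrite phase_eq0// normc0.
Qed.

Lemma cmeasurable_phase : cmeasurable D phase.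
Proof.
apply: cmeasurableM; first exact: fL.1.
split; last exact: measurable_cst.
apply: (@eq_measurable_fun _ _ _ _ D ((fun r : R => r `^ (-1)) \o (fun x => normc (f x)))).
  by move=> x _ /=; rewrite powR_inv1// normc_ge0.
apply: measurableT_comp; first exact: measurable_powR.
exact: (measurable_normc fL.1).
Qed.

(** Test [fz] with the conjugate phase of [f]. One side is the integral of [|f|], the other the
    integral of a function whose real part is at most [|f|]; equality therefore holds almost
    everywhere and forces the phases. *)
Lemma ae_phase : {ae m, forall x, D x -> phase x <> 0 -> phase (S x) = zt x * phase x}.
Proof.
pose psi x := (phase x)^*%C.
have mpsi : cmeasurable D psi by apply: cmeasurable_conj; exact: cmeasurable_phase.
have pL : Loo m D psi.
  by apply: (@LooP _ _ _ m D _ 1) => //; apply: nearW => x _; rewrite normc_conj normc_phase_le.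
have pSL : Loo m D (fun x => psi (S x)).
  apply: (@LooP _ _ _ m D _ 1) => //; first exact: mS.
  by apply: nearW => x _; rewrite normc_conj normc_phase_le.
have ztL : L1 m D (fun x => zt x * f x).
  apply: (L1_mul mD) fL; apply: (@LooP _ _ _ m D _ 1) => //; first exact: (mtau (fun k => z ^+ k)).
  by apply: nearW => x _; rewrite -/(zt x) zt1.
have pfE x : psi x * f x = (normc (f x))%:C%C.
  have [fx|/eqP fx] := eqVneq (f x) 0; first by rewrite fx mulr0 normc0.
  by rewrite -[f x in LHS]phase_normc mulrA [psi x * _]mulrC mulr_conj ?mul1r// normc_phase.
pose G x := psi x * f x - psi (S x) * (zt x * f x).
have GL : L1 m D G by apply: L1B => //; exact: L1_mul.
have Re_le x : complex.Re (psi (S x) * (zt x * f x)) <= normc (f x).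
  apply: le_trans (ler_norm _) _; apply: le_trans (normRe_le _) _.
  by rewrite !normcM zt1 mul1r ler_piMl ?normc_ge0// normc_conj normc_phase_le.
have ReG x : complex.Re (G x) = normc (f x) - complex.Re (psi (S x) * (zt x * f x)).
  by rewrite /G pfE; case: (psi (S x) * _).
have G0 x : 0 <= complex.Re (G x) by rewrite ReG subr_ge0.
have cG : cint m D G = 0 by rewrite cintB ?fz ?subrr//; exact: L1_mul.
have nG : norm1 m D (fun x => (complex.Re (G x))%:C%C) = 0%E.
  have -> : norm1 m D (fun x => (complex.Re (G x))%:C%C) = (\int[m]_(x in D) (complex.Re (G x))%:E)%E.
    by apply: eq_integral => x _; rewrite normc_real ger0_norm.
  rewrite -[LHS]fineK; first by have := congr1 (@complex.Re R) cG; rewrite /= => ->.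
  exact: (integrable_fin_num mD (L1_Re GL mD)).
have mG : cmeasurable D (fun x => (complex.Re (G x))%:C%C).
  by split; [exact: GL.1.1 | exact: measurable_cst].
have := (norm1_eq0 m mD mG).1 nG; apply: filterS => x + Dx px0 => /(_ Dx).
move=> /(congr1 (@complex.Re R)) /=; rewrite ReG => /eqP; rewrite subr_eq0 => /eqP ReE.
have fx : f x <> 0 by move=> fx; apply: px0; exact: phase_eq0.
have n0 : 0 < normc (f x).
  by rewrite lt_neqAle normc_ge0 andbT eq_sym; apply/eqP => /(@eq0_normc R).
apply: (unimodular_product (normc_phase_le (S x)) (zt1 x) (normc_phase fx) n0).
by rewrite phase_normc -ReE.
Qed.

(** The phase is equivariant only where [f] is nonzero, whereas aperiodicity asks for a unimodular
    function on all of [D]. Stage [k] propagates the phase backwards to the points whose orbit meets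
    the support of [f] within [k] steps. *)
Fixpoint ext_phase k x : R[i] := if k is k'.+1 then
  ext_phase k' x + cindic [set y | D y /\ ext_phase k' y = 0] x * ((zt x)^-1 * ext_phase k' (S x))
  else phase x.
Local Notation Ph := ext_phase.

Lemma ext_phaseS0 k x : D x -> Ph k x = 0 -> Ph k.+1 x = (zt x)^-1 * Ph k (S x).
Proof. by move=> Dx h; rewrite /= cindic_in// h add0r mul1r. Qed.

Lemma ext_phaseS k x : Ph k x <> 0 -> Ph k.+1 x = Ph k x.
Proof. by move=> h; rewrite /= cindic_out ?mul0r ?addr0// => -[]. Qed.

Lemma cmeasurable_zero (F : E -> R[i]) : cmeasurable D F -> measurable [set y | D y /\ F y = 0].
Proof.
move=> mF; have -> : [set y | D y /\ F y = 0] = D `&` (fun y => normc (F y)) @^-1` [set 0].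
  apply/seteqP; split=> y [Dy]; first by move=> h; split=> //=; rewrite h normc0.
  by move=> /(@eq0_normc R).
exact: (measurable_normc mF).
Qed.

Lemma cmeasurable_ext_phase k : cmeasurable D (Ph k).
Proof.
elim: k => [|k IH]; first exact: cmeasurable_phase.
apply: cmeasurableD => //; apply: cmeasurableM.
  by apply: cmeasurable_indic; exact: cmeasurable_zero.
by apply: cmeasurableM; [exact: (mtau (fun k => (z ^+ k)^-1)) | exact: mS].
Qed.

Lemma normc_ext_phase k x : D x -> Ph k x <> 0 -> normc (Ph k x) = 1.
Proof.
elim: k x => [|k IH] x Dx.
  by move=> h; apply: normc_phase => fx; apply: h; exact: phase_eq0.
have [h|/eqP h] := eqVneq (Ph k x) 0; last by rewrite ext_phaseS// => _; exact: IH.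
rewrite ext_phaseS0// normcM normcV zt1 invr1 mul1r => h'.
by apply: IH; [exact: SD | move=> h''; apply: h'; rewrite h'' mulr0].
Qed.

Lemma ext_phase_stable k j x : Ph k x <> 0 -> (k <= j)%N -> Ph j x = Ph k x.
Proof.
move=> h; elim: j => [|j IH]; first by rewrite leqn0 => /eqP ->.
rewrite leq_eqVlt => /predU1P[<-//|/IH hj]; rewrite ext_phaseS//; by rewrite hj.
Qed.

(** The value at which the stages stabilize. Where all of them vanish, the default index 0 gives the
    value 0. *)
Let lim_phase x : R[i] := Ph (xget 0%N [set k | Ph k x <> 0]) x.

Lemma lim_phaseE k x : Ph k x <> 0 -> lim_phase x = Ph k x.
Proof.
move=> h; have h' : Ph (xget 0%N [set k | Ph k x <> 0]) x <> 0 by exact: (@xgetI _ 0%N [set k | Ph k x <> 0] k h).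
rewrite /lim_phase; set j := xget _ _ in h' *.
by rewrite -(ext_phase_stable h (leq_maxl k j)) -(ext_phase_stable h' (leq_maxr k j)).
Qed.

Lemma lim_phase_eq0 x : lim_phase x = 0 -> forall k, Ph k x = 0.
Proof.
move=> h k; have [//|/eqP hk] := eqVneq (Ph k x) 0.
by move: (hk); rewrite -(lim_phaseE hk).
Qed.

Lemma lim_phase_neq0 x : lim_phase x <> 0 -> exists2 k, Ph k x <> 0 & lim_phase x = Ph k x.
Proof. by move=> h; exists (xget 0%N [set k | Ph k x <> 0]). Qed.

Lemma lim_phase_near x : exists k, forall j, (k <= j)%N -> Ph j x = lim_phase x.
Proof.
have [h|/eqP h] := eqVneq (lim_phase x) 0.
  by exists 0%N => j _; rewrite h (lim_phase_eq0 h).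
by have [k hk ->] := lim_phase_neq0 h; exists k => j; exact: ext_phase_stable.
Qed.

Lemma cmeasurable_lim_phase : cmeasurable D lim_phase.
Proof.
split.
  apply: (@measurable_fun_cvg _ _ _ D (fun k x => complex.Re (Ph k x))).
    by move=> k; case: (cmeasurable_ext_phase k).
  move=> x _; apply: cvg_near_cst; have [k hk] := lim_phase_near x.
  by exists k => // j /= kj; rewrite hk.
apply: (@measurable_fun_cvg _ _ _ D (fun k x => complex.Im (Ph k x))).
  by move=> k; case: (cmeasurable_ext_phase k).
move=> x _; apply: cvg_near_cst; have [k hk] := lim_phase_near x.
by exists k => // j /= kj; rewrite hk.
Qed.

Lemma ae_lim_phase : {ae m, forall x, D x -> lim_phase (S x) = zt x * lim_phase x}.
Proof.
apply: filterS ae_phase => x + Dx => /(_ Dx) h0.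
have hk k : Ph k x <> 0 -> Ph k (S x) = zt x * Ph k x.
  elim: k => [//|k IH]; have [h|/eqP h] := eqVneq (Ph k x) 0.
    rewrite ext_phaseS0// => h'; rewrite mulVKf// ext_phaseS// => h''.
    by apply: h'; rewrite h'' mulr0.
  rewrite ext_phaseS// => _; rewrite -IH// ext_phaseS// IH// => /eqP.
  by rewrite mulf_eq0 (negbTE (zt0 x)) => /eqP.
have [h|/eqP/lim_phase_neq0[k h ->]] := eqVneq (lim_phase x) 0; last first.
  rewrite -hk//; apply: lim_phaseE; rewrite hk// => /eqP.
  by rewrite mulf_eq0 (negbTE (zt0 x)) => /eqP.
rewrite h mulr0; have [//|/eqP/lim_phase_neq0[k hS _]] := eqVneq (lim_phase (S x)) 0.
exfalso; have := lim_phase_eq0 h k.+1; rewrite ext_phaseS0 ?(lim_phase_eq0 h)// => /eqP.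
by rewrite mulf_eq0 invr_eq0 (negbTE (zt0 x)) => /eqP.
Qed.

(** The set [Z] where the extended phase vanishes is invariant, hence null or full; full is
    impossible as [f] is not zero. The extended phase then solves the equation of aperiodicity with
    [z = cis t], so [t = 0] and the phase is constant. *)
Theorem unimodular_eigenfunction : ~ {ae m, forall x, D x -> f x = 0} ->
  z = 1 /\ exists c, {ae m, forall x, D x -> f x = c * (normc (f x))%:C%C}.
Proof.
move=> fn0; pose Z := [set x | D x /\ lim_phase x = 0].
have mZ : measurable Z by apply: cmeasurable_zero; exact: cmeasurable_lim_phase.
have mcZ : cmeasurable D (@cindic E R Z) by exact: cmeasurable_indic.
have f0 x : lim_phase x = 0 -> f x = 0.
  by move=> /lim_phase_eq0/(_ 0%N) /= h; rewrite -phase_normc h mul0r.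
have ZS x : D x -> lim_phase (S x) = zt x * lim_phase x -> cindic Z (S x) = cindic Z x :> R[i].
  move=> Dx hx; have [h|/eqP h] := eqVneq (lim_phase x) 0.
    by rewrite !cindic_in//; split=> //; [exact: SD | rewrite hx h mulr0].
  rewrite !cindic_out//; first by move=> [].
  by move=> [_]; rewrite hx => /eqP; rewrite mulf_eq0 (negbTE (zt0 x)) => /eqP.
have aeZ : {ae m, forall x, D x -> lim_phase x <> 0}.
  (* Aperiodicity at [t = 0] is ergodicity, applied here to the invariant function equal to -1 on
     [Z] and 1 elsewhere. *)
  pose F x : R[i] := 1 - 2 * cindic Z x.
  have F0 x : D x -> F x <> 1 -> lim_phase x = 0.
    move=> Dx; have [//|/eqP h] := eqVneq (lim_phase x) 0.
    by rewrite /F cindic_out ?mulr0 ?subr0// => -[].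
  have F1 x : D x -> lim_phase x = 0 -> F x <> 1.
    move=> Dx h; rewrite /F cindic_in// mulr1 => /(congr1 (fun y => 1 - y)).
    by rewrite subrr subKr => /eqP; rewrite pnatr_eq0.
  have Fu x : normc (F x) = 1.
    rewrite /F /cindic indicE; case: (_ \in _); rewrite ?mulr1 ?mulr0 ?subr0 ?normc1//.
    by rewrite -[2]/(1 + 1) opprD addrA subrr add0r normc_opp normc1.
  have Fx0 x : F x != 0.
    by apply/eqP => h; have := Fu x; rewrite h normc0 => /esym/eqP; rewrite oner_eq0.
  have [||||_ [c hc]] := @aper 0 F.
  - by rewrite lexx mulr_gt0// pi_gt0.
  - apply: cmeasurableD; first exact: cmeasurable_cst.
    have := cmeasurableM (cmeasurable_cst D (-2)) mcZ.
    by rewrite (_ : (fun x => -2 * _) = (fun x => - (2 * cindic Z x)))//; apply/funext => x; rewrite mulNr.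
  - by move=> x _.
  - apply: filterS ae_lim_phase => x + Dx => /(_ Dx)/(ZS x Dx) h.
    by rewrite mul0r cis0 /F h -/(F x) mulfV.
  have [c1|/eqP c1] := eqVneq c 1.
    by apply: filterS hc => x + Dx => /(_ Dx) h h0; apply: (F1 x Dx h0); rewrite h.
  exfalso; apply: fn0; apply: filterS hc => x + Dx => /(_ Dx) h; apply/f0/(F0 x Dx).
  by rewrite h.
have [t t01 zt_] := cis_surj z1.
(* The conjugate turns [L (S x) = z^tau L (x)] into the quotient [F / F (S)]; the indicator gives
   modulus one on the null set [Z] as well. *)
pose F x := (lim_phase x + cindic Z x)^*%C.
have FE x : lim_phase x <> 0 -> F x = (lim_phase x)^*%C.
  by move=> h; rewrite /F cindic_out ?addr0// => -[].
have Lu x : D x -> lim_phase x <> 0 -> normc (lim_phase x) = 1.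
  by move=> Dx /lim_phase_neq0[k h ->]; exact: normc_ext_phase.
have [|||t0 [c hc]] := @aper t F t01.
- apply: cmeasurable_conj; apply: cmeasurableD => //; exact: cmeasurable_lim_phase.
- move=> x Dx; rewrite normc_conj; have [h|/eqP h] := eqVneq (lim_phase x) 0.
    by rewrite h cindic_in// add0r normc1.
  by rewrite cindic_out ?addr0; [exact: Lu | move=> []].
- apply: filterS2 ae_lim_phase aeZ => x + + Dx => /(_ Dx) hx /(_ Dx) h.
  have hS : lim_phase (S x) <> 0.
    by rewrite hx => /eqP; rewrite mulf_eq0 (negbTE (zt0 x)) => /eqP.
  have -> : cis (t * (tau x)%:R) = zt x by rewrite /zt zt_ cisX mulrC.
  have FS0 : F (S x) != 0.
    rewrite FE//; apply/eqP => /(congr1 (@normc R)); rewrite normc_conj normc0 Lu//; last exact: SD.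
    by move/eqP; rewrite oner_eq0.
  apply: (mulIf FS0); rewrite divfK// !FE// hx.
  rewrite rmorphM mulrA mulr_conj ?mul1r//.
split; first by rewrite zt_ t0 cis0.
exists (c^*)%C; apply: filterS2 hc aeZ => x + + Dx => /(_ Dx) hc /(_ Dx) h.
have [fx|/eqP fx] := eqVneq (f x) 0; first by rewrite fx normc0 mulr0.
have px : phase x <> 0.
  by move=> h'; apply: fx; rewrite -phase_normc h' mul0r.
rewrite -hc FE// (@lim_phaseE 0%N)//=.
by rewrite conjcK phase_normc.
Qed.

End Eigenfunctions.

Lemma normc_sum (R : realType) I (r : seq I) (P : pred I) (F : I -> R[i]) :
  normc (\sum_(i <- r | P i) F i) <= \sum_(i <- r | P i) normc (F i).
Proof. exact: (seminorm_sum (cnorm R)). Qed.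

Lemma three_quarters (R : realType) : 3 * (1 / 4) = 1 / 4 + 1 / 4 + 1 / 4 :> R.
Proof. lra. Qed.
Lemma three_quarters_lt1 (R : realType) : 3 * (1 / 4) < 1 :> R.
Proof. lra. Qed.

(** * Abstract renewal systems: lower bounds by compactness *)

Section RenewalSystem.
Context (R : realType) (V : lmodType R[i]) (N N1 : lnorm V) (beta : R).
Local Notation A := (bop N).
Local Notation O := (opn N).
Local Notation OM := (@opnM R V N).
Local Notation dw := (dw beta).
Local Notation hw := (hw beta).

(* [rn n] is R_n, [rz z] is R(z), [h] the invariant density, [pi] the integral,
   [s n] the measure of [tau > n] and [tb] the mean return time. *)
Record renewal_system (rn : nat -> A) (rz : R[i] -> A) (h : V) (pi : V -> R[i])
    (s : nat -> R) (tb : R) : Prop := RenewalSystem {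
  rs_definite : forall x, N x = 0 -> x = 0;
  rs_N1 : forall x, N1 x <= N x;
  rs_compact : forall (u : nat -> V) (M : R), (forall n, N (u n) <= M) ->
    exists2 k, {homo k : i j / (i < j)%N} & cauchy_for N1 (u \o k);
  rs_complete : forall u : nat -> V, cauchy_for N u ->
    exists x, vanish (fun n => N (u n - x));
  rs_0 : rn 0%N = 0;
  rs_tail : exists2 C : R, 0 <= C & forall m n, \sum_(m <= i < n) O (rn i) <= C * dw m;
  rs_series : exists2 C : R, 0 <= C & forall n z, normc z <= 1 ->
    O (rz z - fps_eval n (rn : fps A) z) <= C * dw n;
  rs_quasi : exists B D eta : R, [/\ 0 <= B, 0 <= D, 0 <= eta < 1 &
    forall z n x, normc z <= 1 -> (0 < n)%N ->
      N ((rz z ^+ n) x) <= normc z ^+ n * (B * eta ^+ n * N x + D * N1 x)];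
  rs_eigen : forall z x, normc z = 1 -> rz z x = x -> x <> 0 -> z = 1 /\ x = pi x *: h;
  rs_piL : forall c x y, pi (c *: x + y) = c * pi x + pi y;
  rs_pi1 : forall x, normc (pi x) <= N1 x;
  rs_h : rz 1 h = h;
  rs_pih : pi h = 1;
  rs_piR : forall x, pi (rz 1 x) = pi x;
  rs_s : forall n, pi (h - \sum_(i < n.+1) rn i h) = (s n)%:C%C;
  rs_tb : vanish (fun n => `|tb - \sum_(i < n) s i|);
  rs_tb1 : 1 <= tb }.

Variables (rn : nat -> A) (rz : R[i] -> A) (h : V) (pi : V -> R[i]) (s : nat -> R) (tb : R).
Hypothesis beta_gt1 : 1 < beta.
Hypothesis rs : renewal_system rn rz h pi s tb.
Implicit Types (z w : R[i]) (x y : V).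

Let NS x : 0 <= N x := seminorm_ge0 N x.
#[local] Hint Extern 0 (is_true (0 <= normc _)) => exact: normc_ge0 : core.

Lemma piD x y : pi (x + y) = pi x + pi y.
Proof. by rewrite -[x]scale1r (rs_piL rs) scale1r mul1r. Qed.
Lemma pi0 : pi 0 = 0.
Proof. by apply: (@addrI _ (pi 0)); rewrite -piD !addr0. Qed.
Lemma piZ c x : pi (c *: x) = c * pi x.
Proof. by rewrite -[c *: x]addr0 (rs_piL rs) pi0 addr0. Qed.
Lemma piN x : pi (- x) = - pi x.
Proof. by rewrite -scaleN1r piZ mulN1r. Qed.
Lemma piB x y : pi (x - y) = pi x - pi y.
Proof. by rewrite piD piN. Qed.
Lemma pi_sum I (r : seq I) (P : pred I) (F : I -> V) :
  pi (\sum_(i <- r | P i) F i) = \sum_(i <- r | P i) pi (F i).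
Proof. exact: (big_morph _ piD pi0). Qed.
Lemma pi_le x : normc (pi x) <= N x.
Proof. by rewrite (le_trans (rs_pi1 rs x))// (rs_N1 rs). Qed.

Lemma rn_dec : dec beta O (rn : fps A).
Proof.
have [C C0 hC] := rs_tail rs; exists C => // n.
by have := hC n n.+1; rewrite big_nat1.
Qed.

(** The first moment is the sum over [j] of the tails beyond [j], each [O(j^-beta)]. *)
Lemma rn_moment : exists2 L : R, 0 <= L & forall n, \sum_(i < n) i%:R * O (rn i) <= L.
Proof.
have [C C0 hC] := rs_tail rs; exists (C * (1 + (beta - 1)^-1)).
  by rewrite mulr_ge0// addr_ge0// invr_ge0 subr_ge0 ltW.
move=> n; apply: le_trans (_ : \sum_(j < n) C * dw j <= _); last first.
  by rewrite -mulr_sumr ler_wpM2l//; exact: sum_dw.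
apply: le_trans (_ : \sum_(j < n) \sum_(j.+1 <= i < n) O (rn i) <= _); last first.
  apply: ler_sum => j _; apply: le_trans (hC _ _) _; rewrite ler_wpM2l//.
  exact: dw_le.
apply: le_trans (_ : \sum_(j < n) \sum_(i < n | (j < i)%N) O (rn i) <= _); last first.
  apply: ler_sum => j _; rewrite -(big_mkord (fun i => j < i)%N (fun i => O (rn i))).
  rewrite (big_cat_nat (n := j.+1))//= big_nat_cond big_pred0 ?add0r; last by move=> i; lia.
  rewrite [leLHS]big_nat_cond [leRHS]big_nat_cond le_eqVlt; apply/orP; left; apply/eqP.
  by apply: eq_bigl => i; lia.
rewrite (exchange_big_dep xpredT)//=; apply: ler_sum => i _.
by rewrite -(big_ord_widen n (fun=> O (rn i))) ?sumr_const ?card_ord ?mulr_natl// ltnW.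
Qed.

Lemma fps_eval_lip n z w (L : R) : (forall n, \sum_(i < n) i%:R * O (rn i) <= L) ->
  normc z <= 1 -> normc w <= 1 ->
  O (fps_eval n (rn : fps A) z - fps_eval n (rn : fps A) w) <= L * normc (z - w).
Proof.
move=> hL z1 w1; rewrite /fps_eval -sumrB; apply: le_trans (seminorm_sum _ _ _ _) _.
apply: le_trans (_ : \sum_(i < n) (i%:R * O (rn i)) * normc (z - w) <= _).
  apply: ler_sum => i _; rewrite -scalerBl opnZE mulrAC ler_wpM2r ?opn_ge0//.
  rewrite subrXX normcM [leLHS]mulrC; apply: ler_wpM2r => //.
  apply: le_trans (normc_sum _ _ _) _.
  rewrite -[X in _ <= X%:R]card_ord -sumr_const; apply: ler_sum => j _.
  by rewrite normcM !normcX mulr_ile1 ?exprn_ge0 ?exprn_ile1.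
by rewrite -mulr_suml ler_wpM2r.
Qed.

Lemma rz_lip : exists2 L : R, 0 <= L & forall z w, normc z <= 1 -> normc w <= 1 ->
  O (rz z - rz w) <= L * normc (z - w).
Proof.
have [L L0 hL] := rn_moment; have [C C0 hC] := rs_series rs.
exists L => // z w z1 w1; rewrite -subr_le0.
apply: (@vanish_cst_le R _ (fun n => 2 * C * dw n)); last first.
  by apply: vanishZ; [nneg | exact: vanish_dw].
move=> n; rewrite lerBlDr.
have -> : rz z - rz w = (rz z - fps_eval n (rn : fps A) z) - (rz w - fps_eval n (rn : fps A) w) +
    (fps_eval n (rn : fps A) z - fps_eval n (rn : fps A) w).
  zmodule.
apply: le_trans (seminormD _ _ _) _; apply: lerD; last exact: fps_eval_lip.
apply: le_trans (seminormB _ _ _) _.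
by rewrite -mulrA mulr_natl mulr2n; apply: lerD; exact: hC.
Qed.

(** A fixed vector equals all its iterates, and the factor [|z|^n] in [rs_quasi] sends their norm to
    zero. *)
Lemma rz_fixed_disc z x : normc z < 1 -> rz z x = x -> x = 0.
Proof.
move=> z1 zx; apply: (rs_definite rs); apply/le_anti; rewrite NS andbT.
have [B [D [eta [B0 D0 eta1 qc]]]] := rs_quasi rs.
have zn n : (rz z ^+ n) x = x by elim: n => // n IH; rewrite exprSr bopM zx.
have zg : vanish (fun n => normc z ^+ n) by apply: vanish_geometric; rewrite normc_ge0 z1.
apply: (@vanish_cst_le R _ (fun n => (B * N x + D * N1 x) * normc z ^+ n.+1)); last first.
  apply: vanishZ; first by rewrite addr_ge0 ?mulr_ge0 ?seminorm_ge0.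
  apply: vanish_le zg => n; rewrite exprS ler_piMl ?exprn_ge0//; exact: ltW.
move=> n; have := qc z n.+1 x (ltW z1) isT; rewrite zn => /le_trans; apply.
rewrite mulrC ler_wpM2r ?exprn_ge0// lerD2r ler_wpM2r// ler_piMr//.
by case/andP: eta1 => e0 e1; rewrite exprn_ile1// ltW.
Qed.

Lemma rz_fixed z x : normc z <= 1 -> rz z x = x -> x <> 0 -> z = 1 /\ x = pi x *: h.
Proof.
rewrite le_eqVlt => /orP[/eqP z1|z1] zx x0; first exact: (rs_eigen rs).
by case: x0; exact: rz_fixed_disc zx.
Qed.

Lemma N1h_ge1 : 1 <= N1 h.
Proof. by rewrite -(@normc1 R) -(rs_pih rs) (rs_pi1 rs). Qed.

(** The scalars embed in [V] as the line through [h] and are recovered by [pi]; completeness, and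
    compactness in the next lemma, are inherited from [V]. *)
Lemma C_complete (c : nat -> R[i]) : cauchy_for (@normc R) c ->
  exists l, vanish (fun n => normc (c n - l)).
Proof.
move=> cc; have [|v hv] := rs_complete rs (u := fun n => c n *: h).
  move=> e e0; have h1 : 0 < N h + 1 by apply: ltr_wpDl.
  have [n0 hn] := cc _ (divr_gt0 e0 h1); exists n0 => p q np nq.
  rewrite -scalerBl lnormZ; apply: le_trans (ler_wpM2r _ (hn p q np nq)) _ => //.
  by rewrite mulrAC ler_pdivrMr// ler_wpM2l ?(ltW e0)// lerDl.
exists (pi v); apply: vanish_le hv => n.
by have := pi_le (c n *: h - v); rewrite piB piZ (rs_pih rs) mulr1.
Qed.

Lemma C_compact (c : nat -> R[i]) M : (forall n, normc (c n) <= M) ->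
  exists2 k, {homo k : i j / (i < j)%N} & cauchy_for (@normc R) (c \o k).
Proof.
move=> cM; have [n|k kh kc] := rs_compact rs (u := fun n => c n *: h) (M := M * N h).
  by rewrite lnormZ ler_wpM2r.
exists k => // e /kc[n0 hn]; exists n0 => p q np nq; apply: le_trans (hn p q np nq).
by rewrite -scalerBl lnormZ ler_peMr// N1h_ge1.
Qed.

Lemma rz_powB z x n : N ((rz z ^+ n) x - x) <= (\sum_(i < n) O (rz z ^+ i)) * N (rz z x - x).
Proof.
have -> : (rz z ^+ n) x - x = (\sum_(i < n) rz z ^+ i) (rz z x - x).
  elim: n => [|n IH]; first by rewrite big_ord0 bop0 expr0 bop1 subrr.
  rewrite big_ord_recr bopD -IH bop_sub exprSr bopM /=.
  zmodule.
rewrite bop_sumE mulr_suml; apply: le_trans (seminorm_sum _ _ _ _) _.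
by apply: ler_sum => i _; exact: opnP.
Qed.

(* Doeblin-Fortet: an L1-Cauchy sequence of approximate fixed points of an affine
   perturbation of R(z) is Cauchy in the strong norm. *)
Lemma approx_fixed_cauchy z (x u : nat -> V) M : normc z <= 1 -> (forall n, N (x n) <= M) ->
  cauchy_for N1 x -> cauchy_for N u -> (forall n, x n - rz z (x n) = u n) -> cauchy_for N x.
Proof.
move=> z1 xM x1 uc xu e e0.
have [B [D [eta [B0 D0 eta1 qc]]]] := rs_quasi rs.
have M0 : 0 <= M := le_trans (NS _) (xM 0%N).
have e4 : 0 < e / 4 by rewrite divr_gt0.
have [n hn] := vanishZ (mulr_ge0 B0 (mulr_ge0 (ler0n _ 2) M0)) (vanish_geometric eta1) e4.
have {}hn := hn n.+1 (leqnSn n).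
pose S := \sum_(i < n.+1) O (rz z ^+ i).
have S0 : 0 <= S by apply: sumr_ge0 => i _; exact: seminorm_ge0.
have D1 : 0 < D + 1 by apply: ltr_wpDl.
have S1 : 0 < S + 1 by apply: ltr_wpDl.
have [n1 h1] := x1 _ (divr_gt0 e4 D1); have [n2 h2] := uc _ (divr_gt0 e4 S1).
exists (maxn n1 n2) => p q; rewrite !geq_max => /andP[p1 p2] /andP[q1 q2].
set y := x p - x q.
have -> : y = (rz z ^+ n.+1) y - ((rz z ^+ n.+1) y - y) by zmodule.
apply: le_trans (seminormB _ _ _) _.
have yM : N y <= 2 * M by apply: le_trans (seminormB _ _ _) _; have := xM p; have := xM q; lra.
have I1 : N ((rz z ^+ n.+1) y) <= e / 4 + e / 4.
  apply: le_trans (qc z n.+1 y z1 isT) _; apply: le_trans (ler_piMl _ _) _.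
  - by rewrite addr_ge0// mulr_ge0 ?seminorm_ge0// mulr_ge0// exprn_ge0//; case/andP: eta1.
  - by rewrite exprn_ile1.
  apply: lerD.
    apply: le_trans hn; rewrite [leRHS]mulrAC; apply: ler_wpM2l => //.
    by rewrite mulr_ge0// exprn_ge0//; case/andP: eta1.
  apply: le_trans (ler_wpM2l D0 (h1 p q p1 q1)) _.
  by rewrite mulrCA ler_piMr ?(ltW e4)// ler_pdivrMr// mul1r lerDl.
have I2 : N ((rz z ^+ n.+1) y - y) <= e / 4.
  apply: le_trans (rz_powB _ _ _) _.
  have -> : rz z y - y = u q - u p.
    rewrite /y bop_sub -!xu; zmodule.
  rewrite -/S; apply: le_trans (ler_wpM2l S0 (h2 q p q2 p2)) _.
  by rewrite mulrCA ler_piMr ?(ltW e4)// ler_pdivrMr// mul1r lerDl.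
lra.
Qed.

(** Common core of the two lower bounds proved by contradiction. The compact inclusion gives a
    subsequence converging in the weak norm only; [approx_fixed_cauchy] upgrades it to the strong
    norm, in which the limit equation makes sense. *)
Lemma compactness (z_ b_ : nat -> R[i]) (x_ : nat -> V) M : (forall k, normc (z_ k) <= 1) ->
  (forall k, normc (b_ k) <= M) -> (forall k, N (x_ k) <= M) ->
  vanish (fun k => N (x_ k - rz (z_ k) (x_ k) - b_ k *: h)) ->
  exists (k : nat -> nat) z b x, [/\ {homo k : i j / (i < j)%N}, normc z <= 1,
    vanish (fun n => normc (z_ (k n) - z)), vanish (fun n => normc (b_ (k n) - b)) &
    vanish (fun n => N (x_ (k n) - x)) /\ x - rz z x = b *: h].
Proof.
move=> z1 bM xM y0.
have [k1 k1h zc] := C_compact z1.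
have [k2 k2h bc] := C_compact (c := b_ \o k1) (fun n => bM _).
have [k3 k3h xc] := rs_compact rs (u := x_ \o k1 \o k2) (fun n => xM _).
pose k := k1 \o k2 \o k3.
have kh : {homo k : i j / (i < j)%N} by move=> i j ij; apply/k1h/k2h/k3h.
have {}zc : cauchy_for (@normc R) (z_ \o k).
  have := cauchy_sub k3h (cauchy_sub k2h zc); exact.
have {}bc : cauchy_for (@normc R) (b_ \o k) by exact: (cauchy_sub k3h bc).
have [z hz] := C_complete zc; have [b hb] := C_complete bc.
have zle : normc z <= 1.
  rewrite -subr_le0; apply: vanish_cst_le hz => n; rewrite lerBlDr.
  apply: le_trans (seminorm_leD (cnorm R) z (z_ (k n))) _; rewrite addrC.
  by apply: lerD; [rewrite (seminorm_sub (cnorm R)) | exact: z1].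
have [L L0 lip] := rz_lip.
pose u n := x_ (k n) - rz z (x_ (k n)).
have ub : vanish (fun n => N (u n - b *: h)).
  apply: vanish_le (vanishD (vanish_sub kh y0)
    (vanishD (vanishZ (mulr_ge0 L0 (le_trans (NS _) (xM 0%N))) hz) (vanishZ (NS h) hb))) => n.
  set xn := x_ (k n).
  have -> : u n - b *: h = (xn - rz (z_ (k n)) xn - b_ (k n) *: h) +
      ((rz (z_ (k n)) - rz z) xn + (b_ (k n) - b) *: h).
    rewrite /u bopB scalerBl -/xn; zmodule.
  apply: le_trans (seminormD _ _ _) _; rewrite lerD2l.
  apply: le_trans (seminormD _ _ _) _; apply: lerD.
    apply: le_trans (opnP _ _) _; rewrite mulrAC.
    by apply: ler_pM; [exact: opn_ge0 | exact: NS | exact: lip | exact: xM].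
  by rewrite lnormZ mulrC.
have uc : cauchy_for N u.
  move=> e e0; have [n0 hn] := ub _ (divr_gt0 e0 (ltr0Sn _ 1)).
  exists n0 => p q /hn hp /hn hq.
  have -> : u p - u q = (u p - b *: h) - (u q - b *: h) by zmodule.
  by apply: le_trans (seminormB _ _ _) _; lra.
have [x hx] := rs_complete rs (approx_fixed_cauchy zle (fun n => xM (k n)) xc uc (fun n => erefl)).
exists k, z, b, x; split=> //; split=> //.
apply/eqP; rewrite -subr_eq0; apply/eqP/(rs_definite rs)/le_anti; rewrite NS andbT.
apply: vanish_cst_le (vanishD ub (vanishZ (addr_ge0 ler01 (opn_ge0 (rz z))) hx)) => n.
set xn := x_ (k n).
have -> : x - rz z x - b *: h = (u n - b *: h) - ((xn - x) - rz z (xn - x)).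
  rewrite /u -/xn bop_sub; zmodule.
apply: le_trans (seminormB _ _ _) _; rewrite lerD2l.
apply: le_trans (seminormB _ _ _) _; rewrite mulrDl mul1r lerD2l; exact: opnP.
Qed.

Lemma bounded_linear_Pi : bounded_linear N (fun x => pi x *: h).
Proof.
split=> [c x y|]; first by rewrite (rs_piL rs) scalerDl scalerA.
exists (N h) => // x; rewrite lnormZ mulrC ler_wpM2l//; exact: pi_le.
Qed.

Definition Pi : A := mkbop bounded_linear_Pi.
Lemma PiE x : Pi x = pi x *: h. Proof. by []. Qed.

(** The tail [sum_(k > n) R_k], coefficient of [(R(1) - R(z)) / (1 - z)]. *)
Definition Rt : fps A := fun n => rz 1 - \sum_(i < n.+1) rn i.

Lemma Rt_dec : dec beta O Rt.
Proof.
have [C C0 hC] := rs_series rs; exists C => // n.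
have := hC n.+1 1; rewrite normc1 => /(_ (lexx _)).
rewrite /fps_eval; under eq_bigr do rewrite expr1n scale1r.
move=> /le_trans; apply; rewrite ler_wpM2l//; exact: dw_le.
Qed.

Lemma Rt_h n : pi (Rt n h) = (s n)%:C%C.
Proof. by rewrite /Rt bopB (rs_h rs) bop_sumE (rs_s rs). Qed.

Lemma Rt_u : fps_u A * Rt = fpsC (rz 1) - (rn : fps A).
Proof.
apply/funext => -[|n].
  by rewrite fps_uM0 fpsB /Rt big_ord1.
rewrite fps_uMS fpsB /Rt [in LHS]big_ord_recr /fpsC /= sub0r; zmodule.
Qed.

(** Truncating [(1 - z) a(z)] leaves the boundary term [z^(n+1) a_n]. The additive map [f] lets the
    coefficients be a ring seen as a module. *)
Lemma eval_u (B : pzRingType) (W : lmodType R[i]) (f : B -> W)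
    (fB : forall x y : B, f (x - y) = f x - f y) (a : fps B) z n :
  \sum_(i < n.+1) z ^+ i *: f ((fps_u B * a) i) =
  (1 - z) *: (\sum_(i < n.+1) z ^+ i *: f (a i)) + z ^+ n.+1 *: f (a n).
Proof.
elim: n => [|n IH].
  by rewrite !big_ord1 fps_uM0 expr0 scale1r scalerBl scale1r expr1 subrK.
rewrite big_ord_recr/= IH [in RHS]big_ord_recr/= fps_uMS fB scalerBr scalerDr.
rewrite !scalerBl !scale1r scalerA (exprS z n.+1); zmodule.
Qed.

(** At [z = 1] and [x = c h] the value is [c] times the sum of the [s i], hence [c tb]. The
    neighbourhood is uniform in the truncation, by [eval_near1]. *)
Lemma Rt_near_one c (e : R) : 0 < e -> exists2 d : R, 0 < d & exists n0,
  forall z x n, normc z <= 1 -> normc (1 - z) <= d -> N (x - c *: h) <= d -> (n0 <= n)%N ->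
    normc (pi (fps_eval n Rt z x) - c * tb%:C%C) <= e.
Proof.
move=> e0; have [L hL] := dec_abssum beta_gt1 Rt_dec.
have L0 : 0 <= L := le_trans (psum_ge0 _ _ _) (hL 0%N).
have e3 : 0 < e / 3 by rewrite divr_gt0.
have g1 : 0 < L + 1 by apply: ltr_wpDl.
have g2 : 0 < normc c * N h + 1 by apply: ltr_wpDl; rewrite ?mulr_ge0.
have g3 : 0 < normc c + 1 by apply: ltr_wpDl.
have [d1 d10 hd1] := @eval_near1 R _ (Lnorm (@opnZE R V N)) Rt L hL _ (divr_gt0 e3 g2).
have [n0 hn0] := rs_tb rs (divr_gt0 e3 g3).
exists (Num.min d1 (e / 3 / (L + 1))); first by rewrite lt_min d10 divr_gt0.
exists n0 => z x n z1; rewrite !le_min => /andP[zd _] /andP[_ xd] nn.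
set y := x - c *: h in xd.
pose F w : A := fps_eval n Rt w.
have F1 : F 1 = \sum_(i < n) Rt i.
  by rewrite /F /fps_eval; under eq_bigr do rewrite expr1n scale1r.
have -> : pi (F z x) - c * tb%:C%C = pi (F z y) + c * pi ((F z - F 1) h) -
    c * (tb - \sum_(i < n) s i)%:C%C.
  have -> : x = y + c *: h by rewrite /y subrK.
  have -> : (tb - \sum_(i < n) s i)%:C%C = tb%:C%C - pi (F 1 h) :> R[i].
    rewrite rmorphB; congr (_ - _); rewrite F1 bop_sumE pi_sum rmorph_sum.
    by apply: eq_bigr => i _; rewrite Rt_h.
  by rewrite bop_add piD bop_scale piZ bopB piB; ring.
have T1 : normc (pi (F z y)) <= e / 3.
  apply: le_trans (pi_le _) _; apply: le_trans (opnP _ _) _.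
  apply: le_trans (_ : L * (e / 3 / (L + 1)) <= _).
    apply: ler_pM => //; first exact: opn_ge0.
    apply: le_trans (seminorm_sum O _ _ _) _; apply: le_trans (hL n).
    apply: ler_sum => i _; rewrite opnZE ler_piMl ?opn_ge0// normcX.
    exact: exprn_ile1.
  by rewrite mulrCA ler_piMr ?(ltW e3)// ler_pdivrMr// mul1r lerDl.
have T2 : normc (c * pi ((F z - F 1) h)) <= e / 3.
  rewrite normcM; apply: le_trans (ler_wpM2l (normc_ge0 _) (pi_le _)) _.
  apply: le_trans (ler_wpM2l (normc_ge0 _) (opnP _ _)) _.
  have := hd1 z n z1 zd; rewrite -F1 => h1.
  apply: le_trans (ler_wpM2l (normc_ge0 _) (ler_wpM2r (NS h) h1)) _.
  have -> : normc c * (e / 3 / (normc c * N h + 1) * N h) = e / 3 * ((normc c * N h) / (normc c * N h + 1)) by ring.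
  by rewrite ler_piMr ?(ltW e3)// ler_pdivrMr// mul1r lerDl.
have T3 : normc (c * (tb - \sum_(i < n) s i)%:C%C) <= e / 3.
  rewrite normcM normc_real; apply: le_trans (ler_wpM2l (normc_ge0 _) (hn0 n nn)) _.
  by rewrite mulrCA ler_piMr ?(ltW e3)// ler_pdivrMr// mul1r lerDl.
apply: le_trans (seminormB (cnorm R) _ _) _.
apply: le_trans (lerD (seminormD (cnorm R) _ _) (lexx _)) _.
by rewrite /seminorm_fun/=; lra.
Qed.

(** With [Re u >= 0] the terms [u t] and [a] lie in one half plane and cannot cancel. *)
Lemma normc_half_plane (u : R[i]) (t a : R) : 0 <= complex.Re u -> 1 <= t -> 0 <= a ->
  normc u <= normc (u * t%:C%C + a%:C%C) /\ a <= normc (u * t%:C%C + a%:C%C).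
Proof.
case: u => p q p0 t1 a0; have {}p0 : 0 <= p := p0.
have -> : normc (Complex p q) = Num.sqrt (p ^+ 2 + q ^+ 2) by [].
have -> : normc (Complex p q * t%:C%C + a%:C%C) = Num.sqrt ((p * t + a) ^+ 2 + (q * t) ^+ 2).
  by rewrite /normc /=; congr Num.sqrt; ring.
have t0 : 0 <= t by apply: le_trans ler01 t1.
have pt : p <= p * t + a by rewrite -[p in leLHS]mulr1 -[leLHS]addr0 lerD// ler_wpM2l.
have q2 : q ^+ 2 <= (q * t) ^+ 2.
  by rewrite exprMn ler_peMr ?sqr_ge0// expr_ge1.
split.
  rewrite ler_sqrt ?addr_ge0 ?sqr_ge0//; apply: lerD => //.
  by apply: lerXn2r; rewrite ?nnegrE// (le_trans p0).
rewrite -[a in leLHS]ger0_norm// -sqrtr_sqr ler_sqrt ?addr_ge0 ?sqr_ge0//.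
rewrite -[leLHS]addr0; apply: lerD; last exact: sqr_ge0.
by apply: lerXn2r; rewrite ?nnegrE// ?lerDr ?addr_ge0 ?mulr_ge0.
Qed.

Lemma Re_1sub_ge0 z : normc z <= 1 -> 0 <= complex.Re (1 - z).
Proof.
case: z => p q z1; rewrite /= subr_ge0; apply: le_trans (ler_norm _) _.
apply: le_trans z1; rewrite /normc -sqrtr_sqr ler_sqrt ?addr_ge0 ?sqr_ge0//.
by rewrite lerDl sqr_ge0.
Qed.

(* Otherwise, with [a = 1/(k+1)], normalized approximate kernel vectors [x_k] converge to
   some [c h] and [z_k] to 1; applying [pi] gives [(1 - z_k) tb + a] = o(|1 - z_k| + a),
   which contradicts [Re (1 - z_k) >= 0]. *)
Lemma rz_lower_bound : exists a K : R, [/\ 0 < a, 0 <= K &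
  forall z x, normc z <= 1 -> N x <= K * N (x - rz z x + (a%:C%C * pi x) *: h)].
Proof.
apply: contrapT => hno.
(* The bound is denied for [a = 1 / (k + 1)] and [K = (k + 1)^2], so that a normalized vector has a
   residue of at most [a^2], negligible against [a]. *)
have ex (k : nat) : exists zx : R[i] * V, [/\ normc zx.1 <= 1, N zx.2 = 1 &
    N (zx.2 - rz zx.1 zx.2 + ((k.+1%:R^-1)%:C%C * pi zx.2) *: h) <= k.+1%:R^-1 ^+ 2].
  apply: contrapT => hk; apply: hno; exists k.+1%:R^-1, (k.+1%:R ^+ 2).
  split; [by rewrite invr_gt0 | exact: exprn_ge0 |] => z x z1.
  rewrite leNgt; apply/negP => lt; apply: hk.
  have xp : 0 < N x by apply: le_lt_trans lt; rewrite mulr_ge0// exprn_ge0.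
  pose t : R[i] := ((N x)^-1)%:C%C.
  have nt : normc t = (N x)^-1 by rewrite normc_real ger0_norm// invr_ge0.
  exists (z, t *: x); split=> //=; first by rewrite lnormZ nt mulVf// gt_eqF.
  have -> : t *: x - rz z (t *: x) + ((k.+1%:R^-1)%:C%C * pi (t *: x)) *: h =
      t *: (x - rz z x + ((k.+1%:R^-1)%:C%C * pi x) *: h).
    by rewrite bop_scale piZ scalerDr scalerBr scalerA mulrCA.
  rewrite lnormZ nt ler_pdivrMl// exprVn ler_pdivlMr ?exprn_gt0// mulrC; exact: ltW.
have [zx hzx] := choice ex.
pose z_ k := (zx k).1; pose x_ k := (zx k).2; pose a_ k : R := k.+1%:R^-1.
have z1 k : normc (z_ k) <= 1 by case: (hzx k).
have x1 k : N (x_ k) = 1 by case: (hzx k).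
have x1' k : N (x_ k) <= 1 by rewrite x1.
have a0 k : 0 < a_ k by rewrite invr_gt0.
have a1 k : a_ k <= 1 by rewrite invf_le1// ler1n.
pose y_ k := x_ k - rz (z_ k) (x_ k) + ((a_ k)%:C%C * pi (x_ k)) *: h.
have y2 k : N (y_ k) <= a_ k ^+ 2 by case: (hzx k).
have px k : normc (pi (x_ k)) <= 1 by rewrite -(x1 k) pi_le.
pose b_ k := - ((a_ k)%:C%C * pi (x_ k)).
have bk k : normc (b_ k) <= a_ k.
  by rewrite normc_opp normcM normc_real ger0_norm ?ler_piMr// ltW.
have yv : vanish (fun k => N (x_ k - rz (z_ k) (x_ k) - b_ k *: h)).
  apply: (@vanish_le R _ a_ _ (@vanish_invS R)) => k; rewrite /b_ scaleNr opprK.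
  apply: le_trans (y2 k) _; rewrite expr2 ler_piMr//; exact: ltW.
have [k [z [b [x [kh zle zv bv [xv xE]]]]]] :=
  compactness z1 (fun k => le_trans (bk k) (a1 k)) x1' yv.
have av : vanish (a_ \o k) by exact: (vanish_sub kh (@vanish_invS R)).
have b0 : b = 0.
  apply: (@eq0_normc R); apply/le_anti; rewrite normc_ge0 andbT.
  apply: vanish_cst_le (vanishD av bv) => n.
  apply: le_trans (seminorm_leD (cnorm R) b (b_ (k n))) _.
  by apply: lerD; [exact: bk | rewrite (seminorm_sub (cnorm R))].
have zx_ : rz z x = x.
  by apply/esym/eqP; rewrite -subr_eq0 xE b0 scale0r.
have xn0 : x <> 0.
  move=> x0; have : 1 <= 0 :> R.
    by apply: vanish_cst_le xv => n; rewrite x0 subr0 x1.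
  by rewrite ler10.
have [zE xh] := rz_fixed zle zx_ xn0.
set c := pi x in xh.
have c0 : 0 < normc c.
  rewrite lt_neqAle normc_ge0 andbT eq_sym; apply/eqP => /(@eq0_normc R) c0.
  by apply: xn0; rewrite xh c0 scale0r.
pose e := normc c / 4; have e0 : 0 < e by rewrite divr_gt0.
have [d d0 [n0 near]] := Rt_near_one c e0.
have [m1 h1] := zv d d0; have [m2 h2] := xv _ d0; have [m3 h3] := av e e0; have [m4 h4] := xv e e0.
pose n := maxn (maxn m1 m2) (maxn m3 m4).
have {}h1 := h1 n (leq_trans (leq_maxl _ _) (leq_maxl _ _)).
have {}h2 := h2 n (leq_trans (leq_maxr _ _) (leq_maxl _ _)).
have {}h3 := h3 n (leq_trans (leq_maxl _ _) (leq_maxr _ _)).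
have {}h4 := h4 n (leq_trans (leq_maxr _ _) (leq_maxr _ _)).
rewrite /= in h3; move: (hzx (k n)); rewrite -/(z_ (k n)) -/(x_ (k n)) -/(a_ (k n)).
move: h1 h2 h3 h4 (a0 (k n)); set zz := z_ (k n); set xx := x_ (k n); set a := a_ (k n).
move=> h1 h2 h3 h4 a_gt0 [zz1 xx1 hy].
rewrite zE -normc_opp opprB in h1.
rewrite xh in h2; set u := 1 - zz in h1.
have [C1 C10 hC1] := Rt_dec; have [C2 C20 hC2] := rs_series rs.
set y := _ + _ *: h in hy.
(* [pi] annihilates [1 - R(1)]. What it keeps of the residue is [u pi (Rt(z) x) + a pi x] up to
   truncation, close to [u c tb + a c]. *)
have key : normc (u * (c * tb%:C%C) + a%:C%C * c) <= e * (normc u + 2 * a).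
  rewrite -subr_le0; apply: (@vanish_cst_le R _ (fun m => (C1 + C2) * dw m)); last first.
    by apply: vanishZ; [exact: addr_ge0 | exact: vanish_dw].
  move=> m0; rewrite lerBlDr; pose m := maxn m0 n0.
  apply: (@le_trans _ _ ((C1 + C2) * dw m + e * (normc u + 2 * a))); last first.
    by rewrite lerD2r ler_wpM2l ?addr_ge0//; apply: dw_le => //; exact: leq_maxl.
  have FE : rz 1 - fps_eval m.+1 (rn : fps A) zz = u *: fps_eval m.+1 Rt zz + zz ^+ m.+1 *: Rt m.
    rewrite -[RHS](@eval_u A A id)// Rt_u big_ord_recl /= expr0 scale1r.
    rewrite /fps_eval [in LHS]big_ord_recl expr0 scale1r opprD addrA !fpsB -sumrN; congr (_ + _).
    by apply: eq_bigr => i _; rewrite /= fpsB /fpsC sub0r scalerN.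
  have -> : u * (c * tb%:C%C) + a%:C%C * c = pi y - (u * (pi (fps_eval m.+1 Rt zz xx) - c * tb%:C%C)
      + zz ^+ m.+1 * pi (Rt m xx) - pi ((rz zz - fps_eval m.+1 (rn : fps A) zz) xx) + a%:C%C * (pi xx - c)).
    have -> : pi y = pi ((rz 1 - fps_eval m.+1 (rn : fps A) zz) xx) -
        pi ((rz zz - fps_eval m.+1 (rn : fps A) zz) xx) + a%:C%C * pi xx.
      by rewrite /y piD piZ (rs_pih rs) mulr1 !bopB !piB (rs_piR rs); ring.
    have -> : pi ((rz 1 - fps_eval m.+1 (rn : fps A) zz) xx) =
        u * pi (fps_eval m.+1 Rt zz xx) + zz ^+ m.+1 * pi (Rt m xx).
      transitivity (pi (u *: fps_eval m.+1 Rt zz xx + zz ^+ m.+1 *: Rt m xx)); first by rewrite FE.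
      by rewrite piD !piZ.
    ring.
  have Rm : normc (zz ^+ m.+1 * pi (Rt m xx)) <= C1 * dw m.
    rewrite normcM normcX; apply: le_trans (ler_piMl _ _) _ => //; first exact: exprn_ile1.
    apply: le_trans (pi_le _) _; apply: le_trans (opnP _ _) _; rewrite xx1 mulr1; exact: hC1.
  have Sm : normc (pi ((rz zz - fps_eval m.+1 (rn : fps A) zz) xx)) <= C2 * dw m.
    apply: le_trans (pi_le _) _; apply: le_trans (opnP _ _) _; rewrite xx1 mulr1.
    by apply: le_trans (hC2 _ _ zz1) _; rewrite ler_wpM2l//; exact: dw_le.
  have Y : normc (pi y) <= e * a.
    apply: le_trans (pi_le _) _; apply: le_trans hy _.
    by rewrite expr2 ler_wpM2r// ltW.
  have Z : normc (a%:C%C * (pi xx - c)) <= e * a.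
    rewrite normcM normc_real ger0_norm ?(ltW a_gt0)// mulrC ler_wpM2r ?(ltW a_gt0)//.
    by rewrite -piB; apply: le_trans (pi_le _) _.
  have U : normc (u * (pi (fps_eval m.+1 Rt zz xx) - c * tb%:C%C)) <= e * normc u.
    rewrite normcM mulrC ler_wpM2r//; apply: near => //.
    by apply: leq_trans (leq_maxr m0 n0) _.
  apply: le_trans (seminormB (cnorm R) _ _) _.
  apply: le_trans (lerD (lexx _) (seminormD (cnorm R) _ _)) _.
  apply: le_trans (lerD (lexx _) (lerD (seminormB (cnorm R) _ _) (lexx _))) _.
  apply: le_trans (lerD (lexx _) (lerD (lerD (seminormD (cnorm R) _ _) (lexx _)) (lexx _))) _.
  rewrite /seminorm_fun/=; lra.
(* The modulus of [u tb + a] is at least [|u|] and at least [a > 0], hence exceeds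
   [(|u| + 2 a) / 4]. *)
have [|X1 X2] := @normc_half_plane u tb a (Re_1sub_ge0 zz1) (rs_tb1 rs).
  exact: ltW.
have key2 : normc c * normc (u * tb%:C%C + a%:C%C) <= normc c * ((normc u + 2 * a) / 4).
  rewrite -normcM; apply: le_trans (_ : e * (normc u + 2 * a) <= _).
    by apply: le_trans key; rewrite le_eqVlt; apply/orP; left; apply/eqP; congr normc; ring.
  by rewrite /e le_eqVlt; apply/orP; left; apply/eqP; ring.
rewrite ler_pM2l// in key2; lra.
Qed.

Definition sc (g : fps R[i]) : fps A := fun n => g n *: (1 : A).

Lemma scE (g : fps R[i]) (X : fps A) n : (sc g * X) n = \sum_(i < n.+1) g i *: X (n - i)%N.
Proof. by rewrite fpsM; apply: eq_bigr => i _; rewrite /sc bop_scaleAl mul1r. Qed.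

Lemma sc_comm (g : fps R[i]) (X : fps A) : sc g * X = X * sc g.
Proof.
apply/funext => n; rewrite scE fpsM (reindex_inj rev_ord_inj)/=; apply: eq_bigr => i _.
by rewrite subSS subKn -1?ltnS// /sc bop_scaleAr mulr1.
Qed.

Lemma scM (g g' : fps R[i]) : sc (g * g') = sc g * sc g'.
Proof.
apply/funext => n; rewrite scE /sc fpsM scaler_suml; apply: eq_bigr => i _.
by rewrite scalerA.
Qed.

Lemma scD (g g' : fps R[i]) : sc (g + g') = sc g + sc g'.
Proof. by apply/funext => n; rewrite fpsD /sc fpsD scalerDl. Qed.
Lemma scN (g : fps R[i]) : sc (- g) = - sc g.
Proof. by apply/funext => n; rewrite fpsN /sc fpsN scaleNr. Qed.
Lemma sc_u : sc (fps_u R[i]) = fps_u A.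
Proof. by apply/funext => -[|[|n]]; rewrite /sc/= ?scale1r ?scaleN1r ?scale0r. Qed.
Lemma scC c : sc (fpsC c) = fpsC (c *: (1 : A)).
Proof. by apply/funext => -[|n]; rewrite /sc /fpsC//= scale0r. Qed.

Lemma sc_dec (g : fps R[i]) : dec beta (cnorm R) g -> dec beta O (sc g).
Proof.
move=> [C C0 gC]; exists C => // n; rewrite opnZE; apply: le_trans (gC n).
by rewrite ler_piMr//; exact: opn1.
Qed.

(** The only entry of [X] that the rank one projection sees: [P X P] is [chi X] times [P], by
    [PXP]. *)
Definition chi (X : fps A) : fps R[i] := fun n => pi (X n h).

Lemma chiB X Y : chi (X - Y) = chi X - chi Y.
Proof. by apply/funext => n; rewrite fpsB /chi fpsB bopB piB. Qed.
Lemma chi_sc (g : fps R[i]) X : chi (sc g * X) = g * chi X.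
Proof.
apply/funext => n; rewrite fpsM /chi scE bop_sumE pi_sum; apply: eq_bigr => i _.
exact: piZ.
Qed.
Lemma chi_u X : chi (fps_u A * X) = fps_u R[i] * chi X.
Proof. by rewrite -sc_u chi_sc. Qed.

Lemma chi_dec X : dec beta O X -> dec beta (cnorm R) (chi X).
Proof.
move=> [C C0 XC]; exists (C * N h) => [|n]; first exact: mulr_ge0.
apply: le_trans (pi_le _) _; apply: le_trans (opnP _ _) _.
by rewrite [leRHS]mulrAC; apply: ler_wpM2r => //; exact: XC.
Qed.

Local Notation P := (fpsC Pi : fps A).
Notation u := (fps_u A).
Let rf : fps A := rn.

Lemma PiPi : Pi * Pi = Pi.
Proof. by apply: bopP => x; rewrite bopM !PiE piZ (rs_pih rs) mulr1. Qed.
Lemma PP : P * P = P.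
Proof. by rewrite -fpsC_mul PiPi. Qed.
Lemma chi_mulP X : chi (X * P) = chi X.
Proof. by apply/funext => n; rewrite /chi fpsMC bopM PiE (rs_pih rs) scale1r. Qed.
Lemma chi_Pmul X : chi (P * X) = chi X.
Proof. by apply/funext => n; rewrite /chi fpsCM bopM PiE piZ (rs_pih rs) mulr1. Qed.
Lemma chiP : chi P = 1.
Proof.
by apply/funext => -[|n]; rewrite /chi /fpsC /= ?bop0 ?pi0// piZ !(rs_pih rs) mulr1.
Qed.
Lemma PXP X : P * X * P = sc (chi X) * P.
Proof.
apply/funext => n; rewrite fpsMC fpsCM fpsMC; apply: bopP => x.
rewrite !bopM !PiE bop_scale piZ.
by rewrite -[RHS]/(chi X n *: (pi x *: h)) scalerA mulrC.
Qed.
Lemma rz1P : fpsC (rz 1) * P = P.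
Proof.
rewrite -fpsC_mul; congr fpsC; apply: bopP => x.
by rewrite bopM PiE bop_scale (rs_h rs).
Qed.
Lemma Prz1 : P * fpsC (rz 1) = P.
Proof.
rewrite -fpsC_mul; congr fpsC; apply: bopP => x.
by rewrite bopM !PiE (rs_piR rs).
Qed.

Lemma cnorm_real (c : R) : cnorm R c%:C%C = `|c|.
Proof. exact: normc_real. Qed.

(** The tail [sum_(k > n) s k], source of the correction term in the covariance. *)
Definition sigma n : R := tb - \sum_(i < n.+1) s i.

Lemma sigma_bound : exists2 C : R, 0 <= C & forall n, `|sigma n| <= C * n.+1%:R `^ (1 - beta).
Proof.
have [C C0 hC] := chi_dec Rt_dec.
have sC n : `|s n| <= C * dw n by have := hC n; rewrite /chi Rt_h cnorm_real.
exists (C * (beta - 1)^-1) => [|n].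
  by apply: mulr_ge0 => //; rewrite invr_ge0 subr_ge0 ltW.
rewrite -subr_le0; apply: (@vanish_cst_le R _ (fun m => `|tb - \sum_(i < n.+1 + m) s i|)).
  move=> m; rewrite lerBlDr [leRHS]addrC.
  apply: le_trans (_ : _ <= `|tb - \sum_(i < n.+1 + m) s i| + \sum_(n.+1 <= i < n.+1 + m) `|s i|) _.
    apply: le_trans (lerD (lexx _) (ler_norm_sum _ _ _)); apply: le_trans (ler_normD _ _).
    rewrite -!(big_mkord xpredT) (big_cat_nat (leq0n n.+1) (leq_addr m n.+1))/= ?big_mkord.
    by rewrite opprD addrA subrK.
  rewrite [leLHS]addrC lerD2r; apply: le_trans (ler_sum _ (fun i _ => sC i)) _.
  rewrite -mulr_sumr -mulrA; apply: ler_wpM2l => //; rewrite addSn.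
  exact: (sum_dw_tail beta_gt1 (leq_addr m n)).
move=> e /(rs_tb rs)[n0 hn]; exists n0 => m nm; apply: hn.
by apply: leq_trans nm _; exact: leq_addl.
Qed.

(** * Inversion of 1 - R(z) by a rank one perturbation *)

Section Resolvent.
Variables (a K : R).
Hypotheses (a0 : 0 < a) (K0 : 0 <= K).
Hypothesis lb : forall z x, normc z <= 1 -> N x <= K * N (x - rz z x + (a%:C%C * pi x) *: h).

Let aC : fps R[i] := fpsC a%:C%C.
(** At [z = 1] the operator [1 - R(z)] kills [h]. The rank one term restores injectivity there
    without destroying it elsewhere, uniformly on the disc by [lb]. *)
Definition Mf : fps A := 1 - rf + sc aC * P.

Lemma Mf_inverse : exists W : fps A, Mf * W = 1 /\ W * Mf = 1.
Proof.
have a1 : 1 + a%:C%C != 0 :> R[i].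
  rewrite -(rmorph1 (real_complex R)) -rmorphD/=; apply/eqP => /(congr1 (@complex.Re R))/= h0.
  by have := a0; lra.
(* [Pi] being a projection, [1 + a Pi] has the inverse [1 - (a / (1 + a)) Pi]. *)
pose c : R[i] := a%:C%C / (1 + a%:C%C).
have M0 : Mf 0%N = 1 + a%:C%C *: Pi.
  rewrite /Mf fpsD fpsB fps1 /= {1}/rf (rs_0 rs) subr0; congr (_ + _).
  by rewrite scE big_ord1 subnn.
have pert (c1 c2 : R[i]) : c1 + c2 + c1 * c2 = 0 ->
    (1 + c1 *: Pi) * (1 + c2 *: Pi) = 1 :> A.
  move=> c12; rewrite mulrDl mul1r mulrDr mulr1 bop_scaleAl bop_scaleAr PiPi scalerA.
  rewrite -[RHS]addr0 -addrA; congr (_ + _); rewrite -!scalerDl addrA (addrC c2).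
  by rewrite c12 scale0r.
apply: (@fps_inv _ _ (1 + (- c) *: Pi)); rewrite M0; apply: pert; rewrite /c; field.
  exact: a1.
exact: a1.
Qed.

Lemma dec_aC : dec beta (cnorm R) aC.
Proof. exact: decC. Qed.

Lemma rf_dec : dec beta O rf. Proof. exact: rn_dec. Qed.

Lemma Mf_dec : dec beta O Mf.
Proof.
apply: decD; first by apply: decD; [rewrite -fpsC1; exact: decC | apply: decN; exact: rf_dec].
by apply: decM => //; [exact: OM | exact: sc_dec dec_aC | exact: decC].
Qed.

Lemma fps_evalB (X Y : fps A) n z : fps_eval n (X - Y) z = fps_eval n X z - fps_eval n Y z.
Proof. by rewrite /fps_eval -sumrB; apply: eq_bigr => i _; rewrite fpsB scalerBr. Qed.
Lemma fps_evalD (X Y : fps A) n z : fps_eval n (X + Y) z = fps_eval n X z + fps_eval n Y z.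
Proof. by rewrite /fps_eval -big_split; apply: eq_bigr => i _; rewrite fpsD scalerDr. Qed.
Lemma fps_evalC (x : A) n z : fps_eval n.+1 (fpsC x : fps A) z = x.
Proof.
rewrite /fps_eval big_ord_recl expr0 scale1r big1 ?addr0// => i _.
by rewrite /fpsC/= scaler0.
Qed.

Lemma aCP : sc aC * P = fpsC (a%:C%C *: Pi).
Proof. by rewrite /aC scC -fpsC_mul bop_scaleAl mul1r. Qed.

Lemma fps_eval_Mf n z x : fps_eval n.+1 Mf z x = x - fps_eval n.+1 rf z x + (a%:C%C * pi x) *: h.
Proof.
rewrite /Mf fps_evalD fps_evalB aCP fps_evalC -fpsC1 fps_evalC bopD bopB bop1.
by congr (_ + _); rewrite -scalerA.
Qed.

(** [lb] concerns R(z) itself; a partial sum in its place costs [K C dw n], at most 1/2 from some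
    index on, whence the factor 2. *)
Lemma Mf_lower_bound : exists n0, forall n z x, (n0 <= n)%N -> normc z <= 1 ->
  N x <= (2 * K) * N (fps_eval n Mf z x).
Proof.
have [C C0 hC] := rs_series rs.
have v : vanish (fun n => K * C * dw n).
  by apply: vanishZ; [exact: mulr_ge0 | exact: vanish_dw].
have [n0 hn] := v (1 / 2) (divr_gt0 ltr01 (ltr0Sn _ 1)).
exists n0.+1 => -[//|n] z x nn z1; rewrite fps_eval_Mf.
have := lb x z1; set y := x - rz z x + _.
have -> : y = (x - fps_eval n.+1 rf z x + (a%:C%C * pi x) *: h) - (rz z - fps_eval n.+1 rf z) x.
  by rewrite /y bopB; zmodule.
set w := _ + _ *: h; move=> h1.
have h2 : K * N ((rz z - fps_eval n.+1 rf z) x) <= 1 / 2 * N x.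
  apply: le_trans (ler_wpM2l K0 (opnP _ _)) _; rewrite mulrA ler_wpM2r//.
  apply: le_trans (ler_wpM2l K0 (hC n.+1 z z1)) _; rewrite mulrA; apply: hn.
  exact: ltnW.
have := le_trans h1 (ler_wpM2l K0 (seminormB _ _ _)); rewrite mulrDr; lra.
Qed.

Variable W : fps A.
Hypotheses (MW : Mf * W = 1) (WM : W * Mf = 1).

(** [inverse_l1] turns the lower bound and the first moment into summability of [W]; [dec_inverse]
    then transfers the decay rate of [Mf]. *)
Lemma W_dec : dec beta O W.
Proof.
have [n0 lbn] := Mf_lower_bound; have [L L0 hL] := rn_moment.
apply: (dec_inverse beta_gt1 OM MW WM _ Mf_dec).
exists (l1_const (2 * K) L) => m.
apply: (inverse_l1 (mulr_ge0 (ler0n _ 2) K0) L0 MW WM (dec_abssum beta_gt1 Mf_dec) _ lbn).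
move=> n; apply: le_trans (hL n); apply: ler_sum => -[[|i] ip] _; rewrite ?mul0r//=.
rewrite ler_wpM2l// /Mf fpsD fpsB aCP /fpsC/= addr0 fps1/= sub0r seminormN.
exact: lexx.
Qed.

Lemma u_comm (X : fps A) : X * u = u * X. Proof. exact: fps_uC. Qed.

Lemma MP_E : Mf * P = sc aC * P + u * (Rt * P).
Proof.
rewrite mulrA Rt_u /Mf mulrDl mulrBl mul1r -mulrA PP mulrBl rz1P addrC.
by [].
Qed.

Lemma PM_E : P * Mf = sc aC * P + u * (P * Rt).
Proof.
rewrite mulrA -u_comm -mulrA Rt_u /Mf mulrDr mulrBr mulr1 mulrA -sc_comm -mulrA PP.
by rewrite mulrBr Prz1 addrC.
Qed.

(** As R(1) fixes the range of [P], [M P] is [a P] up to a multiple of [1 - z]; multiplying by [W],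
    so is [a W P] with respect to [P]. These relations let the factor [1 - z] be split off the
    denominator. *)
Lemma aWP : sc aC * (W * P) = P - u * (W * Rt * P).
Proof.
have E : W * (Mf * P) = P by rewrite mulrA WM mul1r.
apply/eqP; rewrite eq_sym subr_eq -{1}E MP_E mulrDr; apply/eqP.
by rewrite !mulrA -sc_comm u_comm.
Qed.

Lemma aPW : sc aC * (P * W) = P - u * (P * Rt * W).
Proof.
have E : P * Mf * W = P by rewrite -mulrA MW mulr1.
apply/eqP; rewrite eq_sym subr_eq -{1}E PM_E mulrDl; apply/eqP.
by rewrite -!mulrA.
Qed.

(** By [chiW_E], [(1 - z) kappa = a - a^2 chi W]: up to the factor [a], the denominator
    [1 - a chi W] of the Sherman-Morrison formula for [1 - R = M - a P]. By [kappaE] its value at 1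
    is the sum of [s], that is [tb]. *)
Definition kappa : fps R[i] := aC * chi (Rt * W).
Definition Yf : fps R[i] := chi (Rt * W * Rt).

Lemma kappaE : kappa = chi Rt - fps_u R[i] * Yf.
Proof.
rewrite /kappa -chi_sc -(chi_mulP (sc aC * _)) -!mulrA mulrA (sc_comm aC Rt) -mulrA aWP.
rewrite mulrBr chiB chi_mulP; congr (_ - _).
have -> : Rt * (u * (W * Rt * P)) = u * ((Rt * W * Rt) * P) by rewrite !mulrA u_comm.
by rewrite chi_u chi_mulP.
Qed.

Lemma chiW_E : aC * aC * chi W = aC - fps_u R[i] * kappa.
Proof.
rewrite -mulrA -chi_sc -(chi_Pmul (sc aC * W)) mulrA -sc_comm -mulrA aPW chiB chiP.
rewrite chi_u -mulrA chi_Pmul /kappa mulrBr mulr1; congr (_ - _).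
by rewrite mulrCA.
Qed.

Lemma kappa_dec : dec beta (cnorm R) kappa.
Proof.
apply: decM => //; [exact: cnormM | exact: dec_aC |].
by apply: chi_dec; apply: decM => //; [exact: OM | exact: Rt_dec | exact: W_dec].
Qed.

Lemma Yf_dec : dec beta (cnorm R) Yf.
Proof.
apply: chi_dec; apply: decM => //; [exact: OM | | exact: Rt_dec].
by apply: decM => //; [exact: OM | exact: Rt_dec | exact: W_dec].
Qed.

Let E1 : fps A := sc aC * (W * P).

Lemma MfE1 : Mf * E1 = sc aC * P.
Proof. by rewrite /E1 mulrA -sc_comm -mulrA (mulrA Mf) MW mul1r. Qed.

(** At a zero of [kappa] the vector [E1(z) h], nonzero because [M E1 h = a h], is fixed by R(z).
    This is why [kappa] has no zero on the disc. *)
Lemma resE1 : (1 - rf) * E1 = sc (fps_u R[i] * kappa) * P.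
Proof.
have -> : 1 - rf = Mf - sc aC * P by rewrite /Mf addrK.
have -> : fps_u R[i] * kappa = aC - aC * aC * chi W by rewrite chiW_E opprB addrC subrK.
rewrite mulrBl MfE1 scD mulrDl; congr (_ + _).
rewrite scN mulNr !scM -!mulrA -PXP; congr (- (_ * _)).
by rewrite /E1 !mulrA sc_comm.
Qed.

Lemma kappa_E1 : kappa = chi (Rt * E1).
Proof.
have -> : Rt * E1 = sc aC * ((Rt * W) * P) by rewrite /E1 !mulrA -sc_comm.
by rewrite chi_sc chi_mulP.
Qed.

Lemma E1_dec : dec beta O E1.
Proof.
apply: decM => //; [exact: OM | exact: sc_dec dec_aC |].
by apply: decM => //; [exact: OM | exact: W_dec | exact: decC].
Qed.

Definition corner (X Y : fps A) n : R :=
  \sum_(i < n) \sum_(j < n | (n <= i + j)%N) O (X i) * O (Y j).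

Lemma vanish_corner X Y : dec beta O X -> dec beta O Y -> vanish (corner X Y).
Proof.
by move=> dX dY e e0; apply: sum_corner => //; exact: (dec_abssum beta_gt1).
Qed.

Lemma eval_scP (g : fps R[i]) n z :
  fps_eval n (sc g * P) z h = (\sum_(i < n) z ^+ i * g i) *: h.
Proof.
rewrite /fps_eval bop_sumE scaler_suml; apply: eq_bigr => i _.
rewrite -scalerA fpsMC.
by rewrite -[LHS]/(z ^+ i *: (g i *: (Pi h))) PiE (rs_pih rs) scale1r.
Qed.

Lemma eval_corner X Y n z : normc z <= 1 ->
  N (fps_eval n X z (fps_eval n Y z h) - fps_eval n (X * Y) z h) <= corner X Y n * N h.
Proof.
move=> z1; rewrite -bopM -bopB; apply: le_trans (opnP _ _) _.
by apply: ler_wpM2r => //; exact: fps_evalM.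
Qed.

(** If [kappa] were arbitrarily small, the vectors [E1(z_k) h] would be approximate fixed vectors.
    Their limit is fixed with mean 1, so it is [h] and [z_k] tends to 1; but there
    [kappa = chi (Rt E1)] is close to [tb >= 1]. *)
Lemma kappa_lower_bound : exists (de : R) n0, 0 < de /\
  forall n z, (n0 <= n)%N -> normc z <= 1 -> de <= normc (\sum_(i < n) kappa i * z ^+ i).
Proof.
apply: contrapT => hno.
have ex (k : nat) : exists nz : nat * R[i], [/\ (k <= nz.1)%N, normc nz.2 <= 1 &
    normc (\sum_(i < nz.1.+1) nz.2 ^+ i * kappa i) <= k.+1%:R^-1].
  apply: contrapT => hk; apply: hno; exists k.+1%:R^-1, k.+1; split; first by rewrite invr_gt0.
  move=> [//|n] z nn z1; rewrite leNgt; apply/negP => /ltW lt; apply: hk.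
  by exists (n, z); split=> //=; under eq_bigr do rewrite mulrC.
have [nz hnz] := choice ex.
pose n_ k := (nz k).1; pose z_ k := (nz k).2.
have kn k : (k <= n_ k)%N by case: (hnz k).
have z1 k : normc (z_ k) <= 1 by case: (hnz k).
have vn (v : nat -> R) : vanish v -> vanish (fun k => v (n_ k).+1).
  move=> v0 e /v0[m hm]; exists m => k mk; apply: hm; apply: leq_trans mk _.
  by apply: leq_trans (kn k) _.
pose x_ k := fps_eval (n_ k).+1 E1 (z_ k) h.
have [S hS] := dec_abssum beta_gt1 E1_dec.
have S0 : 0 <= S := le_trans (psum_ge0 _ _ _) (hS 0%N).
have xS k : N (x_ k) <= S * N h.
  apply: le_trans (opnP _ _) _; apply: ler_wpM2r => //.
  apply: le_trans (seminorm_sum O _ _ _) _; apply: le_trans (hS (n_ k).+1).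
  by apply: ler_sum => i _; rewrite opnZE ler_piMl ?opn_ge0// normcX exprn_ile1.
have [C1 C10 hC1] := rs_series rs; have [C2 C20 hC2] := kappa_dec.
have dres : dec beta O (1 - rf).
  by apply: decD; [rewrite -fpsC1; exact: decC | apply: decN; exact: rf_dec].
pose w_ k := x_ k - fps_eval (n_ k).+1 rf (z_ k) (x_ k).
have wv : vanish (fun k => N (w_ k)).
  apply: (@vanish_le R _ (fun k => (corner (1 - rf) E1 (n_ k).+1 +
    (2 * k.+1%:R^-1 + C2 * dw k)) * N h)); last first.
    have := vanishZ (NS h) (vanishD (vn _ (vanish_corner dres E1_dec))
      (vanishD (vanishZ (ler0n R 2) (@vanish_invS R)) (vanishZ C20 (vanish_dw beta_gt1)))).
    by apply: vanish_le => k; rewrite mulrC.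
  move=> k; have := eval_corner (1 - rf) E1 (n_ k).+1 (z1 k).
  rewrite -/(x_ k) fps_evalB -fpsC1 fps_evalC bopB bop1 -/(w_ k) resE1 eval_scP => hc.
  apply: le_trans (seminorm_leD N _ _) _; rewrite addrC mulrDl; apply: lerD; first exact: hc.
  rewrite lnormZ; apply: ler_wpM2r => //.
  rewrite (@eval_u _ R[i]^o id)//; apply: le_trans (normcDle _ _) _; apply: lerD.
    rewrite [normc _]normcM; apply: ler_pM => //; last by case: (hnz k).
    by apply: le_trans (normcDle _ _) _; rewrite normc_opp normc1 -[leRHS]/(1 + 1) lerD2l.
  rewrite [normc _]normcM normcX; apply: le_trans (ler_piMl _ _) _ => //; first exact: exprn_ile1.
  by apply: le_trans (hC2 _) _; rewrite ler_wpM2l//; exact: dw_le.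
have yv : vanish (fun k => N (x_ k - rz (z_ k) (x_ k) - (0 : R[i]) *: h)).
  apply: vanish_le (vanishD wv (vanishZ (mulr_ge0 S0 (NS h)) (vn _ (vanishZ C10 (vanish_dw beta_gt1))))) => k.
  rewrite scale0r subr0.
  have -> : x_ k - rz (z_ k) (x_ k) = w_ k - (rz (z_ k) - fps_eval (n_ k).+1 rf (z_ k)) (x_ k).
    by rewrite /w_ bopB; zmodule.
  apply: le_trans (seminormB _ _ _) _; rewrite lerD2l; apply: le_trans (opnP _ _) _.
  rewrite [leRHS]mulrC; apply: ler_pM => //; [exact: opn_ge0 | exact: hC1].
have z0S (k : nat) : normc (0 : R[i]) <= S * N h by rewrite normc0 mulr_ge0.
have [k [z [b [x [kh zle zv bv [xv xE]]]]]] := @compactness z_ (fun=> 0) x_ (S * N h) z1 z0S xS yv.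
have b0 : b = 0.
  apply: (@eq0_normc R); apply/le_anti; rewrite normc_ge0 andbT.
  by apply: vanish_cst_le bv => n; rewrite sub0r normc_opp.
have Nh1 : 1 <= N h by rewrite (le_trans N1h_ge1)// (rs_N1 rs).
(* [M E1 = a P] applied to [h] pins the mean of [x_k] to 1 in the limit, so that the limit vector is
   nonzero. *)
have pv : vanish (fun k => normc (a%:C%C * (pi (x_ k) - 1))).
  apply: vanish_le (vanishD (vanishZ (NS h) (vn _ (vanish_corner Mf_dec E1_dec))) wv) => j.
  have := eval_corner Mf E1 (n_ j).+1 (z1 j); rewrite -/(x_ j) fps_eval_Mf -/(w_ j) MfE1 eval_scP.
  have -> : \sum_(i < (n_ j).+1) z_ j ^+ i * aC i = a%:C%C.
    by rewrite big_ord_recl expr0 mul1r big1 ?addr0// => i _; rewrite /aC/fpsC/= mulr0.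
  have -> : w_ j + (a%:C%C * pi (x_ j)) *: h - a%:C%C *: h =
      (a%:C%C * (pi (x_ j) - 1)) *: h - (- w_ j).
    by rewrite mulrBr mulr1 scalerBl; zmodule.
  set q := a%:C%C * _ => hc.
  have := seminorm_leD N (q *: h) (- w_ j); rewrite lnormZ seminormN => hq.
  have := normc_ge0 q; have := hc; rewrite mulrC => hc' q0.
  have hqh : normc q <= normc q * N h by rewrite ler_peMr.
  by apply: le_trans hqh _; apply: le_trans hq _; rewrite addrC lerD2r.
have px : pi x = 1.
  apply/eqP; rewrite -subr_eq0; apply/eqP/(@eq0_normc R)/le_anti; rewrite normc_ge0 andbT.
  suff : a * normc (pi x - 1) <= 0 by rewrite pmulr_rle0.
  apply: vanish_cst_le (vanishD (vanish_sub kh pv) (vanishZ (ltW a0) xv)) => j.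
  rewrite normcM normc_real ger0_norm ?(ltW a0)// -mulrDr; apply: ler_wpM2l; first exact: ltW.
  have -> : pi x - 1 = (pi (x_ (k j)) - 1) - pi (x_ (k j) - x) by rewrite piB; ring.
  apply: le_trans (normcDle _ _) _; rewrite normc_opp lerD2l; exact: pi_le.
have zx_ : rz z x = x by apply/esym/eqP; rewrite -subr_eq0 xE b0 scale0r.
have xn0 : x <> 0 by move=> x0; move: px; rewrite x0 pi0 => /esym/eqP; rewrite oner_eq0.
have [zE xh] := rz_fixed zle zx_ xn0.
have e4 : 0 < 1 / 4 :> R by rewrite divr_gt0.
have [d d0 [n0 near]] := Rt_near_one 1 e4.
have cv := vanishZ (NS h) (vn _ (vanish_corner Rt_dec E1_dec)).
have [m1 h1] := zv d d0; have [m2 h2] := xv d d0.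
have [m3 h3] := vanish_sub kh cv e4; have [m4 h4] := vanish_sub kh (@vanish_invS R) e4.
pose j := maxn (maxn m1 m2) (maxn (maxn m3 m4) n0).
have {}h1 := h1 j (leq_trans (leq_maxl _ _) (leq_maxl _ _)).
have {}h2 := h2 j (leq_trans (leq_maxr _ _) (leq_maxl _ _)).
have {}h3 := h3 j (leq_trans (leq_maxl _ _) (leq_trans (leq_maxl _ _) (leq_maxr _ _))).
have {}h4 := h4 j (leq_trans (leq_maxr _ _) (leq_trans (leq_maxl _ _) (leq_maxr _ _))).
have n0j : (n0 <= (n_ (k j)).+1)%N.
  apply: leq_trans (leqW (kn _)); apply: leq_trans (incr_ge kh j).
  exact: leq_trans (leq_maxr _ _) (leq_maxr _ _).
rewrite zE -normc_opp opprB in h1; rewrite xh px in h2.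
have hn := near _ _ _ (z1 (k j)) h1 h2 n0j.
have hc := eval_corner Rt E1 (n_ (k j)).+1 (z1 (k j)).
have hk : normc (\sum_(i < (n_ (k j)).+1) z_ (k j) ^+ i * kappa i) <= (k j).+1%:R^-1.
  by case: (hnz (k j)).
have kE : \sum_(i < (n_ (k j)).+1) z_ (k j) ^+ i * kappa i =
    pi (fps_eval (n_ (k j)).+1 (Rt * E1) (z_ (k j)) h).
  rewrite kappa_E1 /fps_eval bop_sumE pi_sum; apply: eq_bigr => i _.
  by rewrite -piZ.
rewrite kE in hk; rewrite mul1r -/(x_ (k j)) in hn hc.
set p1 := fps_eval _ Rt _ _ in hn hc; set p2 := fps_eval _ (Rt * E1) _ _ in hc hk.
have h5 : normc (pi p1 - pi p2) <= 1 / 4.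
  rewrite -piB; apply: le_trans (pi_le _) _; apply: le_trans hc _; rewrite mulrC; exact: h3.
have : normc tb%:C%C <= 3 * (1 / 4).
  have -> : tb%:C%C = pi p2 + (pi p1 - pi p2) - (pi p1 - tb%:C%C) by ring.
  apply: le_trans (normcDle _ _) _; rewrite normc_opp.
  apply: le_trans (lerD (normcDle _ _) (lexx _)) _.
  rewrite three_quarters.
  by apply: lerD hn; apply: lerD h5; exact: le_trans hk h4.
have tb0 := rs_tb1 rs; rewrite normc_real ger0_norm ?(le_trans ler01)//.
by move=> /(le_trans tb0); rewrite leNgt three_quarters_lt1.
Qed.

Lemma kappa_inverse : exists2 p : fps R[i], kappa * p = 1 & dec beta (cnorm R) p.
Proof.
have [de [n0 [de0 kde]]] := kappa_lower_bound.
have [p kp sp] := scalar_wiener de0 (dec_abssum beta_gt1 kappa_dec) kde.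
exists p => //; apply: (dec_inverse beta_gt1 (@cnormM R) kp _ sp kappa_dec).
by rewrite mulrC.
Qed.

(** [(tb - kappa) / (1 - z)]: its coefficients are the tails of [kappa], small because
    [kappa(1) = tb]. *)
Definition Qf : fps R[i] := fps_int (fpsC tb%:C%C - kappa).

Lemma u_Qf : fps_u R[i] * Qf = fpsC tb%:C%C - kappa.
Proof. exact: fps_intK. Qed.

Lemma QfE n : Qf n = (sigma n)%:C%C + Yf n.
Proof.
rewrite /Qf kappaE opprB addrA addrAC [fps_int _ n]/fps_int.
transitivity (\sum_(i < n.+1) (fpsC tb%:C%C - chi Rt : fps _) i + fps_int (fps_u R[i] * Yf) n).
  by rewrite /fps_int -big_split; apply: eq_bigr => i _; rewrite fpsD.
rewrite fps_uK; congr (_ + _); rewrite /sigma rmorphB rmorph_sum /=.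
transitivity (\sum_(i < n.+1) (fpsC tb%:C%C : fps R[i]) i - \sum_(i < n.+1) (s i)%:C%C).
  by rewrite -sumrB; apply: eq_bigr => i _; rewrite fpsB /chi Rt_h.
by congr (_ - _); rewrite big_ord_recl big1 ?addr0.
Qed.

Lemma Qf_bound : exists2 C : R, 0 <= C & forall n, cnorm R (Qf n) <= C * n.+1%:R `^ (1 - beta).
Proof.
have [C C0 hC] := sigma_bound; have [D D0 hD] := Yf_dec.
exists (C + D) => [|n]; first exact: addr_ge0.
rewrite QfE mulrDl; apply: le_trans (seminormD _ _ _) _; apply: lerD.
  by rewrite cnorm_real.
apply: le_trans (hD n) _; apply: ler_wpM2l => //.
by rewrite /dw; apply: ler_powR; [exact: natS_ge1 | rewrite -[leLHS]add0r lerD2r].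
Qed.

(** From [kappa = tb - (1 - z) Q] one has [p = 1 / tb + (1 - z) Q p / tb]; this is substituted once
    into itself and divided by [1 - z]. The first order term carries [sigma], the second order term
    goes into the error. *)
Lemma int_inverse_kappa (p : fps R[i]) : kappa * p = 1 ->
  fps_int p = fps_int (fpsC (tb^-1)%:C%C) + fpsC (tb^-1 ^+ 2)%:C%C * Qf +
    fpsC (tb^-1 ^+ 2)%:C%C * (fps_u R[i] * (Qf * Qf) * p).
Proof.
move=> kp; set t' : fps R[i] := fpsC (tb^-1)%:C%C.
have -> : fpsC (tb^-1 ^+ 2)%:C%C = t' * t' :> fps R[i].
  by rewrite -fpsC_mul expr2 rmorphM.
have tt : t' * fpsC tb%:C%C = 1 :> fps R[i].
  rewrite -fpsC_mul -rmorphM mulVf ?rmorph1//.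
  by rewrite gt_eqF// (lt_le_trans ltr01)// (rs_tb1 rs).
have E : p = t' + t' * (fps_u R[i] * Qf) * p.
  rewrite u_Qf mulrBr tt mulrBl mul1r -mulrA kp mulr1.
  by rewrite addrC subrK.
apply: fps_u_inj; rewrite fps_intK 2!mulrDr fps_intK {1}E {1}E.
by move: (fps_u R[i]); move: t' {tt E} => t' w; ring.
Qed.

Lemma inverse_kappa_dech (p : fps R[i]) : kappa * p = 1 -> dec beta (cnorm R) p ->
  exists2 C : R, 0 <= C & forall n,
    normc (fps_int p n - (tb^-1 + sigma n / tb ^+ 2)%:C%C) <= C * (dw n * hw n).
Proof.
move=> kp dp.
have dQ : dec beta (cnorm R) (fps_u R[i] * Qf).
  by rewrite u_Qf; apply: decD; [exact: decC | apply: decN; exact: kappa_dec].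
have dQQ := dech_square beta_gt1 (@cnormM R) Qf_bound dQ.
have dQQp := dec_dechM beta_gt1 (@cnormM R) dp dQQ.
have dT := dec_dechM beta_gt1 (@cnormM R) (decC beta_gt1 (cnorm R) (tb^-1 ^+ 2)%:C%C)
  (dechD (dec_dech Yf_dec) dQQp).
case: dT => C C0 hC; exists C => // n; apply: le_trans (hC n).
rewrite int_inverse_kappa// [normc _]/(cnorm R _) le_eqVlt; apply/orP; left; apply/eqP.
congr (cnorm R _); rewrite !fpsD !fpsCM fpsD QfE mulrDr.
have -> : fps_int (fpsC (tb^-1)%:C%C) n = (tb^-1)%:C%C :> R[i].
  by rewrite /fps_int big_ord_recl big1 ?addr0.
have -> : (tb^-1 + sigma n / tb ^+ 2)%:C%C = (tb^-1)%:C%C + (tb^-1 ^+ 2)%:C%C * (sigma n)%:C%C :> R[i].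
  by rewrite -rmorphM -rmorphD exprVn mulrC.
rewrite [p * _]mulrC; move: (_ ^+ 2)%:C%C (_^-1)%:C%C => b c; ring.
Qed.

(** Sherman-Morrison formula for [1 - R = M - a P], the scalar factor [a p / (1 - z)] being [a^2]
    over the denominator, divided by [a]. *)
Lemma resolvent_inverse (p : fps R[i]) : kappa * p = 1 ->
  (1 - rf) * (W + sc (aC * fps_int p) * (E1 * W)) = 1.
Proof.
move=> kp; set g := aC * _.
have -> : W + sc g * (E1 * W) = W + E1 * (sc g * W).
  by rewrite mulrA (sc_comm g E1) -mulrA.
rewrite mulrDr [(1 - rf) * (E1 * _)]mulrA resE1.
have -> : (1 - rf) * W = 1 - sc aC * P * W by rewrite -[X in _ = X - _]MW /Mf [in RHS]mulrDl addrK.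
rewrite -addrA; apply/eqP; rewrite -subr_eq0 addrAC subrr add0r; apply/eqP.
suff -> : sc (fps_u R[i] * kappa) * P * (sc g * W) = sc aC * P * W by rewrite addNr.
have -> : aC = fps_u R[i] * kappa * g.
  transitivity (aC * (kappa * (fps_u R[i] * fps_int p))); first by rewrite fps_intK kp mulr1.
  by rewrite /g; ring.
by rewrite (scM (_ * _) g) -(mulrA _ (sc g) P) (sc_comm g P) !mulrA.
Qed.

Lemma resolvent_dech (p : fps R[i]) : kappa * p = 1 -> dec beta (cnorm R) p ->
  exists2 C : R, 0 <= C & forall n,
    O ((W + sc (aC * fps_int p) * (E1 * W)) n - (tb^-1 + sigma n / tb ^+ 2)%:C%C *: Pi)
      <= C * (dw n * hw n).
Proof.
move=> kp dp; have dcp := sc_dec dp.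
(* As [P P = P], [a^2 W P W] is the product of [P - (1 - z) X] and [P - (1 - z) Y]. After division
   by [1 - z] the pole stays on [P] alone, and all other terms are [dec]. *)
have E : sc (aC * fps_int p) * (E1 * W) = sc (fps_int p) * P -
    sc p * (P * Rt * W + W * Rt * P) + u * (sc p * (W * Rt * P * Rt * W)).
  have -> : sc (aC * fps_int p) * (E1 * W) = sc (fps_int p) * ((sc aC * (W * P)) * (sc aC * (P * W))).
    rewrite mulrC scM -!mulrA; congr (_ * _); rewrite /E1 !mulrA.
    rewrite -(mulrA _ P (sc aC)) -(sc_comm aC P).
    rewrite -!mulrA; congr (_ * _); rewrite !mulrA.
    by rewrite -(sc_comm aC W) -!mulrA (mulrA P P) PP.
  rewrite aWP aPW; set X := W * Rt * P; set Y := P * Rt * W.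
  have XP : X * P = X by rewrite /X -[LHS]mulrA PP.
  have PY : P * Y = Y by rewrite /Y !mulrA PP.
  have gu Z : sc (fps_int p) * (u * Z) = sc p * Z by rewrite mulrA -sc_u -scM mulrC fps_intK.
  have -> : (P - u * X) * (P - u * Y) = P - u * (Y + X) + u * (u * (X * Y)).
    rewrite mulrBl !mulrBr PP (mulrA P u Y) (u_comm P) -(mulrA u P Y) PY -(mulrA u X P) XP.
    rewrite -(mulrA u X) (mulrA X u Y) (u_comm X) -(mulrA u X Y) mulrDr; zmodule.
  rewrite mulrDr mulrBr !gu; congr (_ + _).
  rewrite (mulrA (sc p) u) (u_comm (sc p)) -(mulrA u (sc p)); congr (u * (sc p * _)).
  by rewrite /X /Y -!mulrA (mulrA P P) PP.
have [C1 C10 hC1] : dech beta O (W - sc p * (P * Rt * W + W * Rt * P) +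
    u * (sc p * (W * Rt * P * Rt * W))).
  have dP : dec beta O P by exact: decC.
  have dM (X Y : fps A) : dec beta O X -> dec beta O Y -> dec beta O (X * Y).
    by move=> dX dY; exact: (decM beta_gt1 OM).
  have dW := W_dec; have dR := Rt_dec.
  have dWR := dM _ _ dW dR; have dPR := dM _ _ dP dR.
  apply: dec_dech; apply: decD; first apply: decD => //.
    by apply/decN/dM => //; apply: decD; apply: (dM).
  apply: (dM); last by do !apply: (dM) => //.
  by rewrite -sc_u; apply: sc_dec; apply: (dec_finite beta_gt1 _ (m := 2)) => -[|[]].
have [C2 C20 hC2] := inverse_kappa_dech kp dp.
exists (C1 + C2 * O Pi) => [|n]; first by rewrite addr_ge0 ?mulr_ge0 ?opn_ge0.
set c := (_ + _)%:C%C.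
have -> : (W + sc (aC * fps_int p) * (E1 * W)) n - c *: Pi =
   (W - sc p * (P * Rt * W + W * Rt * P) + u * (sc p * (W * Rt * P * Rt * W))) n +
   (fps_int p n - c) *: Pi.
  rewrite E !fpsD !fpsN fpsMC /sc bop_scaleAl mul1r scalerBl; zmodule.
apply: le_trans (seminormD _ _ _) _; rewrite mulrDl; apply: lerD; first exact: hC1.
by rewrite opnZE mulrAC; apply: ler_wpM2r; [exact: opn_ge0 | exact: hC2].
Qed.

End Resolvent.

Theorem renewal_asymptotics : exists S : fps A, S * (1 - rf) = 1 /\
  exists2 C : R, 0 <= C & forall n,
    O (S n - (tb^-1 + sigma n / tb ^+ 2)%:C%C *: Pi) <= C * (dw n * hw n).
Proof.
have [a [K [a0 K0 lb]]] := rz_lower_bound.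
have [W [MW WM]] := Mf_inverse a0.
have [p kp dp] := kappa_inverse a0 K0 lb MW WM.
have SE := resolvent_inverse MW kp; move: (resolvent_dech K0 lb MW WM kp dp).
set S := W + _ in SE *; exists S; split=> //.
(* [S] is so far a right inverse only; the constant term of [1 - R] being 1, a two-sided formal
   inverse exists and [S] coincides with it. *)
have [||b [rb br]] := @fps_inv A (1 - rf) 1.
  by rewrite mul1r fpsB fps1 /rf (rs_0 rs) subr0.
  by rewrite mulr1 fpsB fps1 /rf (rs_0 rs) subr0.
by rewrite -(fps_inv_uniq br SE).
Qed.

End RenewalSystem.

(* The elements of [B] modulo almost everywhere equality, a class being represented by
   its indefinite integral. *)
Section ClassSpace.
Context d (E : measurableType d) (R : realType) (m : {measure set E -> \bar R}) (D : set E).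
Variable sn : (E -> R[i]) -> \bar R.
Hypotheses (mD : measurable D) (snP : L1_seminorm m D sn).
Local Notation L1 := (L1 m D).
Local Notation cint := (cint m D).
Local Notation inB := (inB m D sn).
Local Notation normB := (normB m D sn).
Implicit Types (f g : E -> R[i]).

(** With the value 0 at nonmeasurable sets, agreement on measurable sets is equality, which makes
    the representative of a class unique. *)
Definition indef f : set E -> R[i]^o :=
  fun A => if `[< measurable A >] then cint (fun x => cindic A x * f x) else 0.

Lemma L1_indic A f : measurable A -> L1 f -> L1 (fun x => cindic A x * f x).
Proof. by move=> mA; apply: L1_mul => //; exact: Loo_indic. Qed.

Lemma indefE A f : measurable A -> indef f A = cint (fun x => cindic A x * f x).
Proof. by move=> mA; rewrite /indef asboolT. Qed.

Lemma indef_linear (c : R[i]) f g : L1 f -> L1 g ->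
  indef (fun x => c * f x + g x) = c *: indef f + indef g.
Proof.
move=> fL gL; apply/funext => A; rewrite /indef.
rewrite -[RHS]/(c * (if `[< measurable A >] then cint (fun x => cindic A x * f x) else 0) +
  (if `[< measurable A >] then cint (fun x => cindic A x * g x) else 0)).
case: ifPn => [/asboolP mA|_]; last by rewrite mulr0 addr0.
have [hf hg] := (L1_indic mA fL, L1_indic mA gL).
rewrite -cintZ// -cintD//; last exact: L1Z.
by apply: eq_cint => x _; ring.
Qed.

Lemma indef_inj f g : L1 f -> L1 g ->
  indef f = indef g <-> {ae m, forall x, D x -> f x = g x}.
Proof.
move=> fL gL; split=> [fg|fg].
  have h : {ae m, forall x, D x -> f x - g x = 0}.
    apply: cint_indic_ae0 => //; first exact: L1B.
    move=> A mA; have -> : cint (fun x => cindic A x * (f x - g x)) = indef f A - indef g A.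
      rewrite !indefE// -cintB//; try exact: L1_indic.
      by apply: eq_cint => x _; rewrite mulrBr.
    by rewrite fg subrr.
  by apply: filterS h => x h Dx; apply/eqP; rewrite -subr_eq0 h.
apply/funext => A; rewrite /indef; case: ifPn => // /asboolP mA.
apply: ae_eq_cint => //; [exact: (L1_indic mA fL).1 | exact: (L1_indic mA gL).1 |].
by apply: filterS fg => x + Dx => /(_ Dx) ->.
Qed.

Lemma inB_L1 f : inB f -> L1 f. Proof. by case. Qed.

Lemma inBZ c f : inB f -> inB (fun x => c * f x).
Proof.
move=> [fL sf]; split; first exact: L1Z.
have [_ h0 -> //_] := snP; have := h0 _ fL; move: sf; case: (sn f) => // r _ _.
by rewrite -EFinM ltry.
Qed.

Lemma inBD f g : inB f -> inB g -> inB (fun x => f x + g x).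
Proof.
move=> [fL sf] [gL sg]; split; first exact: L1D.
have [_ h0 _ h] := snP; apply: le_lt_trans (h _ _ fL gL) _; exact: lte_add_pinfty.
Qed.

Lemma inB0 : inB (fun=> 0).
Proof.
split; first exact: L1_0.
have [_ _ h _] := snP; have := h 0 _ (L1_0 m D); rewrite normc0 mul0e.
by rewrite (_ : (fun x : E => 0 * 0 : R[i]) = fun=> 0) => [->|]; [exact: ltry | apply/funext => x; rewrite mul0r].
Qed.

Lemma inB_ae f g : inB f -> L1 g -> {ae m, forall x, D x -> f x = g x} -> inB g /\ normB f = normB g.
Proof.
move=> [fL sf] gL fg; have [h _ _ _] := snP.
by rewrite /Defs.inB /Defs.normB -(h _ _ fL gL fg) (ae_eq_norm1 mD fL.1 gL.1 fg).
Qed.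

Lemma normB_fin f : inB f -> normB f \is a fin_num.
Proof.
move=> [fL sf]; have [_ h0 _ _] := snP.
by rewrite /Defs.normB fin_numD norm1_fin// andbT ge0_fin_numE// h0.
Qed.

Lemma normBE f : inB f -> normB f = (fine (normB f))%:E.
Proof. by move=> /normB_fin /fineK ->. Qed.

Lemma normB_ge0 f : inB f -> (0 <= normB f)%E.
Proof. by move=> [fL _]; have [_ h0 _ _] := snP; rewrite adde_ge0 ?norm1_ge0// h0. Qed.

(** The two proofs are arguments so that the closure instance, which rests on them, can be attached
    to this predicate. *)
Definition Bpred (_ : measurable D) (_ : L1_seminorm m D sn) : {pred set E -> R[i]^o} :=
  fun v => `[< exists2 f, inB f & v = indef f >].

Lemma Bpred_closed : submod_closed (Bpred mD snP).
Proof.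
split=> [|a u v /asboolP[f fB ->] /asboolP[g gB ->]]; apply/asboolP.
  exists (fun=> 0); first exact: inB0.
  apply/funext => A; rewrite /indef; case: ifP => // _.
  by rewrite -[LHS](cint0 m mD); apply: eq_cint => x _; rewrite mulr0.
exists (fun x => a * f x + g x); first by apply: inBD => //; exact: inBZ.
by rewrite indef_linear//; exact: inB_L1.
Qed.

HB.instance Definition _ := GRing.isSubmodClosed.Build R[i] (set E -> R[i]^o) (Bpred mD snP) Bpred_closed.

Record classB := ClassB { classB_val :> set E -> R[i]^o ; _ : classB_val \in Bpred mD snP }.
HB.instance Definition _ := [isSub of classB for classB_val].
HB.instance Definition _ := [Choice of classB by <:].
HB.instance Definition _ := [SubChoice_isSubLmodule of classB by <:].

Lemma cls_subproof f : inB f -> indef f \in Bpred mD snP.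
Proof. by move=> fB; apply/asboolP; exists f. Qed.

Definition cls f : classB :=
  if pselect (inB f) is left fB then ClassB (cls_subproof fB) else 0.

Lemma clsE f : inB f -> cls f = indef f :> (set E -> R[i]^o).
Proof. by move=> fB; rewrite /cls; case: pselect. Qed.

Lemma classB_rep (v : classB) : exists2 f, inB f & v = cls f.
Proof.
case: v => v vB; have /asboolP[f fB vE] := vB.
by exists f => //; apply/val_inj; rewrite /= clsE.
Qed.

Definition rep (v : classB) : E -> R[i] := s2val (cid2 (classB_rep v)).
Lemma rep_inB v : inB (rep v). Proof. exact: (s2valP (cid2 (classB_rep v))). Qed.
Lemma repK v : cls (rep v) = v. Proof. by rewrite -(s2valP' (cid2 (classB_rep v))). Qed.

Lemma cls_eq f g : inB f -> inB g ->
  cls f = cls g <-> {ae m, forall x, D x -> f x = g x}.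
Proof.
move=> fB gB; rewrite -(indef_inj fB.1 gB.1) -!clsE//; split=> [->//|h].
exact/val_inj.
Qed.

Lemma cls_linear (c : R[i]) f g : inB f -> inB g ->
  cls (fun x => c * f x + g x) = c *: cls f + cls g.
Proof.
move=> fB gB; apply/val_inj; rewrite /= clsE; last by apply: inBD => //; exact: inBZ.
by rewrite indef_linear ?clsE//; exact: inB_L1.
Qed.

Lemma clsZ (c : R[i]) f : inB f -> cls (fun x => c * f x) = c *: cls f.
Proof.
move=> fB; apply/val_inj; rewrite /= !clsE//; last exact: inBZ.
apply/funext => A; rewrite -[RHS]/(c * indef f A) /indef; case: ifPn => [/asboolP mA|_]; last by rewrite mulr0.
by rewrite -cintZ//; [apply: eq_cint => x _; ring | apply: L1_indic => //; exact: inB_L1].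
Qed.

Definition N_fun (v : classB) : R := fine (normB (rep v)).
Definition N1_fun (v : classB) : R := fine (norm1 m D (rep v)).

Lemma rep_cls f : inB f -> {ae m, forall x, D x -> rep (cls f) x = f x}.
Proof. by move=> fB; apply/cls_eq => //; [exact: rep_inB | exact: repK]. Qed.

Lemma N_cls f : inB f -> N_fun (cls f) = fine (normB f).
Proof.
move=> fB; rewrite /N_fun; congr fine.
exact: (inB_ae (rep_inB _) fB.1 (rep_cls fB)).2.
Qed.

Lemma N1_cls f : inB f -> N1_fun (cls f) = fine (norm1 m D f).
Proof.
move=> fB; rewrite /N1_fun; congr fine; apply: ae_eq_norm1 => //.
- exact: (rep_inB _).1.1.
- exact: fB.1.1.
- exact: rep_cls.
Qed.

Lemma clsD f g : inB f -> inB g -> cls (fun x => f x + g x) = cls f + cls g.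
Proof.
move=> fB gB; rewrite -[cls f]scale1r -cls_linear//; congr cls; apply/funext => x.
by rewrite mul1r.
Qed.

Lemma cls0 : cls (fun=> 0) = 0.
Proof.
rewrite -[RHS](scale0r (cls (fun=> 0))) -clsZ; last exact: inB0.
by congr cls; apply/funext => x; rewrite mul0r.
Qed.

Lemma norm_axioms (nf : (E -> R[i]) -> \bar R) (Nf : classB -> R) :
  (forall f, inB f -> nf f \is a fin_num) -> (forall f, inB f -> Nf (cls f) = fine (nf f)) ->
  (forall c f, inB f -> nf (fun x => c * f x) = ((normc c)%:E * nf f)%E) ->
  (forall f g, inB f -> inB g -> (nf (fun x => f x + g x)%R <= nf f + nf g)%E) ->
  [/\ (forall (c : R[i]) v, Nf (c *: v) = normc c * Nf v) &
      forall u v, Nf (u + v) <= Nf u + Nf v].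
Proof.
move=> ffin NE hZ hD; split=> [c v|u v].
  have [f fB ->] := classB_rep v; rewrite -clsZ// !NE ?hZ//; last exact: inBZ.
  by rewrite fineM// ffin.
have [f fB ->] := classB_rep u; have [g gB ->] := classB_rep v.
have fgB := inBD fB gB.
by rewrite -clsD// !NE// -lee_fin EFinD !fineK ?ffin// hD.
Qed.

Lemma norm1_axioms : [/\ (forall (c : R[i]) v, N1_fun (c *: v) = normc c * N1_fun v) &
      forall u v, N1_fun (u + v) <= N1_fun u + N1_fun v].
Proof.
apply: (norm_axioms (nf := norm1 m D)).
- by move=> f fB; exact: norm1_fin fB.1.
- exact: N1_cls.
- by move=> c f fB; exact: norm1Z fB.1.1.
- by move=> f g fB gB; exact: norm1D fB.1.1 gB.1.1.
Qed.

Lemma normB_axioms : [/\ (forall (c : R[i]) v, N_fun (c *: v) = normc c * N_fun v) &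
      forall u v, N_fun (u + v) <= N_fun u + N_fun v].
Proof.
have [_ h0 hZ hD] := snP; apply: (norm_axioms (nf := normB)).
- exact: normB_fin.
- exact: N_cls.
- move=> c f fB; rewrite /Defs.normB hZ ?norm1Z//; [|exact: fB.1.1|exact: fB.1].
  by rewrite (ge0_muleDr _ (h0 _ fB.1) (norm1_ge0 m D f)).
- move=> f g fB gB; rewrite /Defs.normB; apply: le_trans (leeD (hD _ _ fB.1 gB.1) (norm1D m mD fB.1.1 gB.1.1)) _.
  by rewrite addeACA.
Qed.

Lemma seminorm_of (Nf : classB -> R) : (forall (c : R[i]) v, Nf (c *: v) = normc c * Nf v) ->
  (Nf 0 = 0) * (forall v, Nf (- v) = Nf v).
Proof.
move=> h; split=> [|v]; first by rewrite -(scale0r 0) h normc0 mul0r.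
by rewrite -scaleN1r h normc_opp normc1 mul1r.
Qed.

Definition NB : lnorm classB :=
  @Lnorm R classB (Seminorm (seminorm_of normB_axioms.1).1 normB_axioms.2 (seminorm_of normB_axioms.1).2) normB_axioms.1.
Definition NL1 : lnorm classB :=
  @Lnorm R classB (Seminorm (seminorm_of norm1_axioms.1).1 norm1_axioms.2 (seminorm_of norm1_axioms.1).2) norm1_axioms.1.

Lemma NBE f : inB f -> NB (cls f) = fine (normB f).
Proof. exact: N_cls. Qed.
Lemma NL1E f : inB f -> NL1 (cls f) = fine (norm1 m D f).
Proof. exact: N1_cls. Qed.

Lemma clsB f g : inB f -> inB g -> cls (fun x => f x - g x) = cls f - cls g.
Proof.
move=> fB gB; rewrite -scaleN1r -clsZ// -clsD//; last exact: inBZ.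
by congr cls; apply/funext => x; rewrite mulN1r.
Qed.

Lemma inBB f g : inB f -> inB g -> inB (fun x => f x - g x).
Proof.
move=> fB gB; rewrite (_ : (fun x => _) = (fun x => f x + (-1) * g x)).
  by apply: inBD => //; exact: inBZ.
by apply/funext => x; rewrite mulN1r.
Qed.

Lemma NL1_le v : NL1 v <= NB v.
Proof.
have [f fB ->] := classB_rep v; rewrite NBE// NL1E//; apply: fine_le.
- exact: norm1_fin fB.1.
- exact: normB_fin.
- by have [_ h0 _ _] := snP; rewrite /Defs.normB leeDr// h0//; exact: fB.1.
Qed.

Lemma NL1_definite v : NL1 v = 0 -> v = 0.
Proof.
have [f fB ->] := classB_rep v; rewrite NL1E// -cls0 => h.
apply/cls_eq => //; first exact: inB0.
apply/norm1_eq0 => //; first exact: fB.1.1.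
by rewrite -[LHS](fineK (norm1_fin fB.1)) h.
Qed.

(* [K A] is the dual of [Phi] applied to the indicator function of [A]. *)
Lemma operator_of (Phi : (E -> R[i]) -> E -> R[i]) (K : set E -> E -> R[i]) (C : R) : 0 <= C ->
  (forall f, inB f -> inB (Phi f)) -> (forall A, measurable A -> Loo m D (K A)) ->
  (forall f A, inB f -> measurable A ->
    cint (fun x => cindic A x * Phi f x) = cint (fun x => K A x * f x)) ->
  (forall f, inB f -> fine (normB (Phi f)) <= C * fine (normB f)) ->
  exists2 A : bop NB, forall f, inB f -> A (cls f) = cls (Phi f) & opn NB A <= C.
Proof.
move=> C0 PB KL dual PC.
pose k v : E -> R[i] := Phi (rep v).
(* [Phi] is assumed neither linear nor compatible with almost everywhere equality, since transfer
   operators are given only up to null sets; both properties come out of the duality with [K]. *)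
have cong f g : inB f -> inB g -> cls f = cls g -> cls (Phi f) = cls (Phi g).
  move=> fB gB /(cls_eq fB gB) fg; apply/val_inj; rewrite /= !clsE; try exact: PB.
  apply/funext => A; rewrite /indef; case: ifPn => // /asboolP mA; rewrite !dual//.
  apply: ae_eq_cint => //; [exact: (L1_mul mD (KL _ mA) fB.1).1 | exact: (L1_mul mD (KL _ mA) gB.1).1 |].
  by apply: filterS fg => x + Dx => /(_ Dx) ->.
have bl : bounded_linear NB (fun v => cls (Phi (rep v))).
  split=> [c u v|].
    have fB := rep_inB u; have gB := rep_inB v.
    have hB := inBD (inBZ c fB) gB.
    rewrite -cls_linear; [|exact: PB|exact: PB].
    rewrite (cong _ _ (rep_inB _) hB); last by rewrite repK cls_linear// !repK.
    have PfB := PB _ fB; have PgB := PB _ gB; have PhB := PB _ hB.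
    apply/val_inj; rewrite /= !clsE//; last by apply: inBD => //; exact: inBZ.
    rewrite indef_linear; [|exact: (inB_L1 PfB)|exact: (inB_L1 PgB)].
    apply/funext => A; rewrite -[RHS]/(c * indef (Phi (rep u)) A + indef (Phi (rep v)) A).
    rewrite /indef; case: ifPn => [/asboolP mA|_]; last by rewrite mulr0 addr0.
    rewrite !dual//; have [h1 h2] := (L1_mul mD (KL _ mA) fB.1, L1_mul mD (KL _ mA) gB.1).
    rewrite -cintZ// -cintD//; last exact: L1Z.
    by apply: eq_cint => x _; ring.
  exists C => // v; rewrite NBE; last exact/PB/rep_inB.
  by rewrite -[v in NB v]repK NBE; [apply: PC; exact: rep_inB | exact: rep_inB].
exists (mkbop bl) => [f fB|].
  by apply: cong => //; [exact: rep_inB | exact: repK].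
apply: opn_le => // v; rewrite NBE; last exact/PB/rep_inB.
by rewrite -[v in NB v]repK NBE; [apply: PC; exact: rep_inB | exact: rep_inB].
Qed.

End ClassSpace.

Lemma index_shift n0 m : (n0 + 3 < m)%N ->
  exists k, [/\ m = k.+2, (n0 <= k.+1)%N & (k.+2 <= k.*2.+1)%N].
Proof. by move=> h; exists m.-2; split; lia. Qed.

(** * The return operators as a renewal system *)

Section System.
Context d (E : measurableType d) (R : realType) (nu nuhat : {measure set E -> \bar R}).
Context (X Xhat : set E) (T : E -> E) (c : R).
Hypotheses (mX : measurable X) (mXh : measurable Xhat) (XhX : Xhat `<=` X).
Hypotheses (c0 : 0 < c)
  (nuE : forall A, measurable A -> A `<=` Xhat -> nu A = (c%:E * nuhat A)%E).
Hypotheses (TX : forall x, X x -> X (T x)) (mT : measurable_fun X T) (nsT : nonsingular nu X T).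
Hypothesis returns : {ae nuhat, forall x, Xhat x -> exists i, (1 <= i)%N /\ Xhat (iter i T x)}.
Variables (sn : (E -> R[i]) -> \bar R) (P Phat : (E -> R[i]) -> E -> R[i]).
Variables (Rz : R[i] -> (E -> R[i]) -> E -> R[i]) (hhat : E -> R) (beta : R).
Local Notation tau := (return_time T Xhat).
Local Notation That := (return_map T Xhat).
Local Notation Rn := (renewal T Xhat P).
Local Notation inB := (inB nuhat Xhat sn).
Local Notation normB := (normB nuhat Xhat sn).
Local Notation L1h := (L1 nuhat Xhat).
Local Notation cinth := (cint nuhat Xhat).
Local Notation op := (opnormB nuhat Xhat sn).
Local Notation dw := (dw beta).
Local Notation hw := (hw beta).
Local Notation S_ n := [set x | Xhat x /\ tau x = n].
Hypotheses (tP : transfer_operator nu X T P) (tPhat : transfer_operator nuhat Xhat That Phat).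
Hypotheses (sRz : renewal_series Xhat nuhat Rn Rz) (snP : L1_seminorm nuhat Xhat sn).
Hypotheses (complete : B_complete nuhat Xhat sn) (compact : B_compact_in_L1 nuhat Xhat sn).
Hypotheses (qc : quasi_compact Xhat nuhat sn Rz) (aper : aperiodic T Xhat nuhat).
Hypotheses (beta_gt1 : 1 < beta) (tail : return_tail Xhat nuhat sn Rn beta).
Local Notation hC := (fun x => (hhat x)%:C%C).
Hypotheses (hhat0 : forall x, 0 <= hhat x) (hB : inB hC).
Hypothesis hfix : {ae nuhat, forall x, Xhat x -> Phat hC x = hC x}.
Hypothesis hint : (\int[nuhat]_(x in Xhat) (hhat x)%:E)%E = 1%E.

Local Notation V := (classB mXh snP).
Local Notation NBV := (NB mXh snP).
Local Notation NL1V := (NL1 mXh snP).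
Local Notation cl := (cls mXh snP).
Implicit Types (f g psi : E -> R[i]).

Let mS n : measurable (S_ n). Proof. exact: (measurable_tau mX mXh XhX TX mT (fun k => k = n)). Qed.
Let rdual n f : (0 < n)%N -> L1h f -> L1h (Rn n f) /\
  forall psi, Loo nuhat Xhat psi -> cinth (fun x => psi x * Rn n f x) =
    cinth (fun x => cindic (S_ n) x * (psi (That x) * f x)).
Proof. exact: (renewal_dual mX mXh XhX c0 nuE TX mT nsT tP). Qed.
Let zdual z f psi : normc z <= 1 -> L1h f -> Loo nuhat Xhat psi ->
  cinth (fun x => psi x * Rz z f x) = cinth (fun x => psi (That x) * (z ^+ tau x * f x)).
Proof. exact: (renewal_series_dual mX mXh XhX c0 nuE TX mT nsT returns tP sRz). Qed.
Let LoST psi : Loo nuhat Xhat psi -> Loo nuhat Xhat (fun x => psi (That x)).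
Proof. exact: (Loo_return_map mX mXh XhX c0 nuE TX mT nsT). Qed.
Let mtau (w : nat -> R[i]) : cmeasurable Xhat (fun x => w (tau x)).
Proof. exact: (cmeasurable_tau mX mXh XhX TX mT). Qed.

Let LooM psi psi' : Loo nuhat Xhat psi -> Loo nuhat Xhat psi' -> Loo nuhat Xhat (fun x => psi x * psi' x).
Proof.
move=> pL pL'; have [M M0 h] := ae_le_normoo pL; have [M' M'0 h'] := ae_le_normoo pL'.
apply: (@LooP _ _ _ nuhat Xhat _ (M * M')); [exact: cmeasurableM pL.1 pL'.1 | exact: mulr_ge0 |].
apply: filterS2 h h' => x + + Dx => /(_ Dx) h1 /(_ Dx) h2.
by rewrite normcM; apply: ler_pM => //; exact: normc_ge0.
Qed.

Let Loo_pow z : normc z <= 1 -> Loo nuhat Xhat (fun x => z ^+ tau x).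
Proof.
move=> z1; apply: (@LooP _ _ _ nuhat Xhat _ 1) => //; try exact: (mtau (fun k => z ^+ k)).
by apply: nearW => x _; rewrite normcX exprn_ile1// normc_ge0.
Qed.

Lemma opnormB_ge0 n : (0 < n)%N -> (0 <= op (Rn n))%E.
Proof.
move=> n0; apply: le_trans (_ : normB (Rn n (fun=> 0%R)) <= _)%E.
  have RL := (rdual n0 (L1_0 nuhat Xhat)).1.
  by have [_ h0 _ _] := snP; rewrite adde_ge0 ?norm1_ge0// h0.
apply: ereal_sup_ubound; exists (fun=> 0) => //; split; first exact: (inB0 snP).
have := NBE mXh snP (inB0 snP); rewrite cls0 seminorm0 => h.
by rewrite (normBE snP (inB0 snP)) -h lee_fin.
Qed.

Lemma opnormB_fin n : (0 < n)%N -> op (Rn n) \is a fin_num.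
Proof.
move=> n0; rewrite ge0_fin_numE ?opnormB_ge0//; apply: le_lt_trans tail.1.
apply: le_trans (_ : \sum_(1 <= k < n.+1) op (Rn k) <= _)%E; last first.
  by apply: nneseries_lim_ge => k k0 _; exact: opnormB_ge0.
rewrite big_nat_recr//= leeDr//; rewrite big_nat; apply: sume_ge0 => k /andP[k0 _].
exact: opnormB_ge0.
Qed.

Let o n : R := if n is n'.+1 then fine (op (Rn n)) else 0.
Let o0 n : 0 <= o n. Proof. by case: n => // n; rewrite fine_ge0// opnormB_ge0. Qed.
Let oE n : op (Rn n.+1) = (o n.+1)%:E. Proof. by rewrite fineK// opnormB_fin. Qed.

(** The operator norm is a supremum over the unit ball, hence the division by [r]. [R_n] need not be
    homogeneous pointwise; homogeneity almost everywhere follows from [renewal_dual]. *)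
Lemma renewal_scaled n f (r : R) : (0 < n)%N -> inB f -> 0 < r -> (normB f <= r%:E)%E ->
  inB (Rn n f) /\ fine (normB (Rn n f)) <= o n * r.
Proof.
case: n => // n _ fB r0 fr.
have rC : normc r%:C%C = r by rewrite normc_real ger0_norm// ltW.
have rC' : normc r^-1%:C%C = r^-1 by rewrite normc_real ger0_norm// invr_ge0 ltW.
pose f' x := r^-1%:C%C * f x; have f'B : inB f' by exact: (inBZ mXh snP).
have f'1 : (normB f' <= 1)%E.
  have := NBE mXh snP f'B; rewrite (clsZ mXh snP _ fB) lnormZ (NBE mXh snP fB) rC' => h.
  rewrite (normBE snP f'B) -h lee_fin ler_pdivrMl// mulr1 -lee_fin.
  by rewrite -(normBE snP fB).
have hf' : (normB (Rn n.+1 f') <= op (Rn n.+1))%E by apply: ereal_sup_ubound; exists f'.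
have [RL' dual'] := rdual (ltn0Sn n) f'B.1; have [RL dual] := rdual (ltn0Sn n) fB.1.
have R'B : inB (Rn n.+1 f').
  split=> //; apply: le_lt_trans (_ : normB (Rn n.+1 f') < _)%E; first by rewrite leeDl// norm1_ge0.
  by apply: le_lt_trans hf' _; rewrite oE ltry.
pose k x := r%:C%C * Rn n.+1 f' x; have kB : inB k by exact: (inBZ mXh snP).
have kE : {ae nuhat, forall x, Xhat x -> k x = Rn n.+1 f x}.
  apply/(indef_inj mXh kB.1 RL); apply/funext => A; rewrite /indef; case: ifPn => // /asboolP mA.
  have LA := Loo_indic nuhat Xhat mA.
  rewrite dual// /k.
  transitivity (r%:C%C * cinth (fun x => cindic A x * Rn n.+1 f' x)).
    by rewrite -cintZ//; [apply: eq_cint => x _; ring | exact: L1_mul].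
  rewrite dual'// -cintZ//; last by apply: L1_mul => //; [exact: Loo_indic | apply: L1_mul => //; [exact: LoST | exact: f'B.1]].
  apply: eq_cint => x _; rewrite /f' (_ : cindic A (That x) * _ = r^-1%:C%C * (cindic A (That x) * f x)); last by ring.
  rewrite mulrCA [r%:C%C * (r^-1%:C%C * _)]mulrA -rmorphM mulfV ?gt_eqF// rmorph1 mul1r.
  by [].
have [RB RE] := inB_ae mXh snP kB RL kE.
split=> //; rewrite -RE -(NBE mXh snP kB) (clsZ mXh snP _ R'B) lnormZ rC (NBE mXh snP R'B) mulrC.
by apply: ler_wpM2r; [exact: ltW | rewrite -lee_fin -oE fineK// (normB_fin snP)].
Qed.

(** The norm of [f] may vanish, so a slightly larger positive number is used for scaling and then
    lowered to the norm. *)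
Lemma renewal_bounded n f : (0 < n)%N -> inB f ->
  inB (Rn n f) /\ fine (normB (Rn n f)) <= o n * fine (normB f).
Proof.
move=> n0 fB; have b0 : 0 <= fine (normB f) by rewrite fine_ge0// (normB_ge0 snP).
have fr (r : R) : fine (normB f) <= r -> (normB f <= r%:E)%E.
  by rewrite (normBE snP fB) lee_fin.
have [||RB _] := @renewal_scaled n f (fine (normB f) + 1) n0 fB; first by rewrite ltr_wpDl.
  by apply: fr; rewrite lerDl.
split=> //; apply/ler_addgt0Pr => e e0; have o1 : 0 < o n + 1 by rewrite ltr_wpDl.
have [||_] := @renewal_scaled n f (fine (normB f) + e / (o n + 1)) n0 fB.
- by rewrite ltr_wpDl// divr_gt0.
- by apply: fr; rewrite lerDl divr_ge0// ltW.
move=> /le_trans; apply; rewrite mulrDr lerD2l mulrCA ler_piMr ?(ltW e0)//.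
by rewrite ler_pdivrMr// mul1r lerDl.
Qed.

Lemma rn_exists n : exists A : bop NBV,
  (if n is _.+1 then forall f, inB f -> A (cl f) = cl (Rn n f) else A = 0) /\ opn NBV A <= o n.
Proof.
case: n => [|n]; first by exists 0; rewrite seminorm0.
pose K A x : R[i] := cindic (S_ n.+1) x * cindic A (That x).
have [||||A hA oA] := @operator_of _ _ _ _ _ _ mXh snP (Rn n.+1) K (o n.+1) (o0 _).
- by move=> f fB; exact: (renewal_bounded _ fB).1.
- by move=> A mA; apply: LooM; [exact: Loo_indic | exact/LoST/Loo_indic].
- move=> f A fB mA; rewrite (rdual _ fB.1).2//; last exact: Loo_indic.
  by apply: eq_cint => x _; rewrite /K mulrA.
- by move=> f fB; exact: (renewal_bounded _ fB).2.
by exists A.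
Qed.

(** Boundedness of R(z) is quasi-compactness at [n = 1]. Outside the closed disc, where nothing is
    assumed, the operator is set to 0. *)
Lemma rz_exists z : exists A : bop NBV,
  normc z <= 1 -> forall f, inB f -> inB (Rz z f) /\ A (cl f) = cl (Rz z f).
Proof.
have [z1|z1] := leP (normc z) 1; last by exists 0.
have [B [D' [eta [B0 D0 eta1 h]]]] := qc.
have RB f : inB f -> inB (Rz z f) /\ fine (normB (Rz z f)) <= (B * eta + D') * fine (normB f).
  move=> fB; have RL := (sRz z1 fB.1).1; have h1 := h f z 1%N fB z1 isT.
  have n1 : fine (norm1 nuhat Xhat f) <= fine (normB f).
    by have := NL1_le (cl f); rewrite (NL1E mXh snP fB) (NBE mXh snP fB).
  have hn : (normB (Rz z f) <= (normc z * (B * eta * fine (normB f) + D' * fine (norm1 nuhat Xhat f)))%:E)%E.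
    apply: le_trans h1 _; rewrite !expr1 {1}(normBE snP fB) -[X in (_ + D'%:E * X)%E](fineK (norm1_fin fB.1)).
    exact: lexx.
  have {}RB : inB (Rz z f).
    split=> //; apply: le_lt_trans (_ : normB (Rz z f) < _)%E; first by rewrite leeDl// norm1_ge0.
    by apply: le_lt_trans hn _; rewrite ltry.
  split=> //; move: hn; rewrite (normBE snP RB) lee_fin => /le_trans; apply.
  apply: le_trans (ler_piMl _ _) _ => //.
    by rewrite addr_ge0// mulr_ge0 ?fine_ge0 ?norm1_ge0 ?(normB_ge0 snP)// ?mulr_ge0 ?(ltW B0) ?(ltW D0)//; case/andP: eta1 => /ltW.
  by rewrite mulrDl lerD2l ler_wpM2l// ltW.
have C0 : 0 <= B * eta + D'.
  by rewrite addr_ge0 ?(ltW D0)// mulr_ge0 ?(ltW B0)//; case/andP: eta1 => /ltW.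
pose K A x : R[i] := cindic A (That x) * z ^+ tau x.
have [||||A hA oA] := @operator_of _ _ _ _ _ _ mXh snP (Rz z) K (B * eta + D') C0.
- by move=> f fB; exact: (RB _ fB).1.
- by move=> A mA; apply: LooM; [exact/LoST/Loo_indic | exact: Loo_pow].
- move=> f A fB mA; rewrite zdual//; [|exact: fB.1|exact: Loo_indic].
  by apply: eq_cint => x _; rewrite /K mulrA.
- by move=> f fB; exact: (RB _ fB).2.
by exists A => _ f fB; split; [exact: (RB _ fB).1 | exact: hA].
Qed.

Definition rn n : bop NBV := sval (cid (rn_exists n)).
Definition rz z : bop NBV := sval (cid (rz_exists z)).

Lemma rn0 : rn 0%N = 0. Proof. exact: (svalP (cid (rn_exists 0%N))).1. Qed.
Lemma rnE n f : inB f -> rn n.+1 (cl f) = cl (Rn n.+1 f).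
Proof. exact: (svalP (cid (rn_exists n.+1))).1. Qed.
Lemma rn_le n : opn NBV (rn n) <= o n.
Proof. exact: (svalP (cid (rn_exists n))).2. Qed.
Lemma rz_inB z f : normc z <= 1 -> inB f -> inB (Rz z f).
Proof. by move=> z1 fB; have [] := svalP (cid (rz_exists z)) z1 f fB. Qed.
Lemma rzE z f : normc z <= 1 -> inB f -> rz z (cl f) = cl (Rz z f).
Proof. by move=> z1 fB; have [] := svalP (cid (rz_exists z)) z1 f fB. Qed.

Definition mean (v : V) : R[i] := cinth (rep v).

Lemma mean_pair psi f : Loo nuhat Xhat psi -> inB f ->
  cinth (fun x => psi x * rep (cl f) x) = cinth (fun x => psi x * f x).
Proof.
move=> pL fB; apply: ae_eq_cint => //.
- exact: (L1_mul mXh pL (rep_inB _).1).1.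
- exact: (L1_mul mXh pL fB.1).1.
- by apply: filterS (rep_cls mXh snP fB) => x + Dx => /(_ Dx) ->.
Qed.

Lemma mean_cl f : inB f -> mean (cl f) = cinth f.
Proof.
move=> fB; apply: ae_eq_cint => //; [exact: (rep_inB _).1.1 | exact: fB.1.1 |].
exact: rep_cls.
Qed.

Lemma mean_linear (a : R[i]) u v : mean (a *: u + v) = a * mean u + mean v.
Proof.
have [f fB ->] := classB_rep u; have [g gB ->] := classB_rep v.
have fgB := inBD mXh snP (inBZ mXh snP a fB) gB.
rewrite -cls_linear// !mean_cl// -cintZ//; last exact: fB.1.
by rewrite -(cintD mXh (L1Z mXh a fB.1) gB.1).
Qed.

Lemma mean_le v : normc (mean v) <= NL1V v.
Proof.
by have [f fB ->] := classB_rep v; rewrite mean_cl// NL1E//; apply: normc_cint => //; exact: fB.1.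
Qed.

Lemma sum_o_tail : exists2 C : R, 0 <= C & forall m n, \sum_(m <= i < n) o i <= C * dw m.
Proof.
have [tot [K [n0 _ hK]]] := tail.
pose Sg := fine (\sum_(1 <= k <oo) op (Rn k))%E.
have op0 k : (1 <= k)%N -> true -> (0 <= op (Rn k))%E by move=> k1 _; exact: opnormB_ge0.
have SgE : (\sum_(1 <= k <oo) op (Rn k) = Sg%:E)%E.
  by rewrite fineK// ge0_fin_numE//; apply: nneseries_ge0 => k k1 _; exact: op0.
have part m n : (1 <= m)%N -> (\sum_(m <= i < n) o i)%:E = (\sum_(m <= i < n) op (Rn i))%E.
  by move=> m1; rewrite -sumEFin; apply: eq_big_nat => -[|i]; rewrite ?oE// leqn0; case: m m1.
have all0 n : \sum_(0 <= i < n) o i <= Sg.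
  case: n => [|n].
    by rewrite big_nil -lee_fin -SgE; apply: nneseries_ge0 => k k1 _; exact: op0.
  rewrite big_ltn// add0r -lee_fin part// -SgE; exact: nneseries_lim_ge op0.
have Sg0 : 0 <= Sg by apply: le_trans (all0 0%N); rewrite big_nil.
have le_all m n : \sum_(m <= i < n) o i <= Sg.
  have [nm|mn] := leqP n m; first by rewrite big_geq.
  apply: le_trans (all0 n); rewrite (big_cat_nat (leq0n m) (ltnW mn)) /= lerDr.
  by rewrite big_nat; apply: sumr_ge0 => i _; exact: o0.
pose m0 := (n0 + 3)%N; have d0 := dw_gt0 beta m0.
(* The tail hypothesis holds only eventually: up to [m0] the total sum [Sg] is compared with
   [dw m0]. The factor [2^beta] pays for the shift of index between [n^-beta] and [dw]. *)
exists (Sg / dw m0 + `|K| * 2 `^ beta) => [|m n].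
  by rewrite addr_ge0 ?mulr_ge0 ?powR_ge0// ?invr_ge0 ltW.
rewrite mulrDl; have [mm0|m0m] := leqP m m0.
  apply: le_trans (le_all m n) _; rewrite ler_wpDr//.
    by rewrite !mulr_ge0 ?powR_ge0.
  rewrite mulrAC ler_pdivlMr//; apply: ler_wpM2l => //; exact: dw_le.
rewrite ler_wpDl ?mulr_ge0 ?invr_ge0 ?(ltW d0) ?powR_ge0//.
have [k [-> n0k k2]] := index_shift m0m; move: k n0k k2 => {m0m}m n0m m2.
rewrite -lee_fin part//.
apply: le_trans (_ : \sum_(m.+2 <= i <oo) op (Rn i) <= _)%E.
  by apply: nneseries_lim_ge => k mk _; apply: op0 => //; apply: leq_trans mk.
apply: le_trans (hK m.+1 n0m) _.
rewrite lee_fin -mulrA; apply: le_trans (ler_wpM2r (powR_ge0 _ _) (ler_norm K)) _.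
apply: ler_wpM2l => //; apply: powRN_half => //; exact: ltW (lt_trans ltr01 beta_gt1).
Qed.

Lemma sys_tail : exists2 C : R, 0 <= C & forall m n, \sum_(m <= i < n) opn NBV (rn i) <= C * dw m.
Proof.
have [C C0 hC] := sum_o_tail; exists C => // m n; apply: le_trans (hC m n).
by apply: ler_sum => i _; exact: rn_le.
Qed.

Lemma sys_compact (u : nat -> V) (M : R) : (forall n, NBV (u n) <= M) ->
  exists2 k, {homo k : i j / (i < j)%N} & cauchy_for NL1V (u \o k).
Proof.
move=> uM; have [n|k [f [kh fL cv]]] := compact (u := fun n => rep (u n)) (M := M).
  split; first exact: rep_inB.
  by rewrite (normBE snP (rep_inB _)) lee_fin -(NBE mXh snP (rep_inB _)) repK.
exists k => // e e0; have {}cv := vanish_cvg cv.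
have [n0 hn] := cv _ (divr_gt0 e0 (ltr0Sn _ 1)).
exists n0 => p q np nq; rewrite /= -[u (k p)]repK -[u (k q)]repK.
have [B1 B2] := (rep_inB (u (k p)), rep_inB (u (k q))).
rewrite -clsB// NL1E; last exact: (inBB mXh snP).
have [h1 h2] := (hn p np, hn q nq).
have L1p := L1B mXh B1.1 fL; have L1q := L1B mXh B2.1 fL.
have : (norm1 nuhat Xhat (fun x => (rep (u (k p)) x - rep (u (k q)) x)%R) <=
    norm1 nuhat Xhat (fun x => (rep (u (k p)) x - f x)%R) +
    norm1 nuhat Xhat (fun x => (-1 * (rep (u (k q)) x - f x))%R))%E.
  have -> : (fun x => rep (u (k p)) x - rep (u (k q)) x) =
    (fun x => (rep (u (k p)) x - f x) + (-1 * (rep (u (k q)) x - f x))).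
    by apply/funext => x; ring.
  by apply: norm1D => //; [exact: L1p.1 | exact: (L1Z mXh (-1) L1q).1].
rewrite (norm1Z nuhat mXh (-1) L1q.1) normc_opp normc1 mul1e.
rewrite -(fineK (norm1_fin L1p)) -(fineK (norm1_fin L1q)).
rewrite -[X in (X <= _)%E -> _](fineK (norm1_fin (L1B mXh B1.1 B2.1))) lee_fin => /le_trans; apply.
by rewrite [e]splitr; exact: lerD.
Qed.

Lemma sys_complete (u : nat -> V) : cauchy_for NBV u ->
  exists x, vanish (fun n => NBV (u n - x)).
Proof.
move=> uc; have [n|e e0|f fB cv] := complete (u := fun n => rep (u n)); first exact: rep_inB.
  have [n0 hn] := uc e e0; exists n0 => p q np nq; have := hn p q np nq.
  have [B1 B2] := (rep_inB (u p), rep_inB (u q)).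
  rewrite -[u p in X in X -> _]repK -[u q in X in X -> _]repK -clsB// NBE; last exact: (inBB mXh snP).
  by rewrite (normBE snP (inBB mXh snP B1 B2)) lee_fin.
exists (cl f); apply: vanish_le (vanish_cvg cv) => n; rewrite -[u n in X in X <= _]repK.
have B1 := rep_inB (u n).
by rewrite -clsB// NBE//; exact: (inBB mXh snP).
Qed.

Lemma partial_series n z f : inB f -> exists2 g, inB g &
  (forall x, g x = \sum_(1 <= i < n) z ^+ i * Rn i f x) /\
  fps_eval n (rn : fps (bop NBV)) z (cl f) = cl g.
Proof.
move=> fB; elim: n => [|n [g gB [gE IH]]].
  exists (fun=> 0); first exact: inB0; split=> [x|]; first by rewrite big_geq.
  by rewrite /fps_eval big_ord0 bop0 cls0.
case: n => [|n] in g gB gE IH *.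
  exists (fun=> 0); first exact: inB0; split=> [x|]; first by rewrite big_geq.
  by rewrite /fps_eval big_ord_recl big_ord0 rn0 scaler0 addr0 bop0 cls0.
have RB := (renewal_bounded (ltn0Sn n) fB).1.
exists (fun x => z ^+ n.+1 * Rn n.+1 f x + g x); first by apply: inBD => //; exact: inBZ.
split=> [x|]; first by rewrite big_nat_recr//= -gE addrC.
have -> : fps_eval n.+2 (rn : fps (bop NBV)) z = fps_eval n.+1 (rn : fps (bop NBV)) z + z ^+ n.+1 *: rn n.+1.
  by rewrite /fps_eval [LHS]big_ord_recr.
by rewrite bopD addrC cls_linear// -IH -rnE.
Qed.

(** By hypothesis the series converges to R(z) in L1 only. Its partial sums are Cauchy in the strong
    norm, so they converge there by completeness, and the limit is identified in L1. *)
Lemma sys_series : exists2 C : R, 0 <= C & forall n z, normc z <= 1 ->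
    opn NBV (rz z - fps_eval n (rn : fps (bop NBV)) z) <= C * dw n.
Proof.
have [C C0 hC] := sys_tail; exists C => // n z z1.
have d0 k : 0 <= dw k by exact/ltW/dw_gt0.
apply: opn_le => [|v]; first exact: mulr_ge0.
pose p k := fps_eval k (rn : fps (bop NBV)) z v.
have pB k j : (k <= j)%N -> NBV (p j - p k) <= C * dw k * NBV v.
  move=> kj; rewrite /p -bopB; apply: le_trans (opnP _ _) _; apply: ler_wpM2r; first exact: seminorm_ge0.
  have -> : fps_eval j (rn : fps (bop NBV)) z - fps_eval k (rn : fps (bop NBV)) z = \sum_(k <= i < j) z ^+ i *: rn i.
    by rewrite /fps_eval -!(big_mkord xpredT (fun i => z ^+ i *: rn i)) (big_cat_nat (leq0n k) kj) /= addrAC subrr add0r.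
  apply: le_trans (seminorm_sum (opn NBV) _ _ _) _; apply: le_trans (hC k j); apply: ler_sum => i _.
  by apply: le_trans (opnZ _ _) _; rewrite ler_piMl ?opn_ge0// normcX exprn_ile1// normc_ge0.
have Cv : vanish (fun k => C * NBV v * dw k).
  by apply: vanishZ; [rewrite mulr_ge0// seminorm_ge0 | exact: vanish_dw].
have pc : cauchy_for NBV p.
  move=> e e0; have [n0 hn] := Cv e e0; exists n0 => k j ni nj.
  have [ij|/ltnW ij] := leqP k j.
    by rewrite seminorm_sub; apply: le_trans (pB _ _ ij) _; rewrite mulrAC; exact: hn.
  by apply: le_trans (pB _ _ ij) _; rewrite mulrAC; exact: hn.
have [x hx] := sys_complete pc.
have px : vanish (fun k => NL1V (p k - rz z v)).
  have [f fB vE] := classB_rep v; have [_ cv] := sRz z1 fB.1.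
  apply: vanish_le (vanish_cvg cv) => k; have [g gB [gE pE]] := partial_series k z fB.
  rewrite /p vE pE rzE// -clsB//; last exact: rz_inB.
  have gRB := inBB mXh snP gB (rz_inB z1 fB); rewrite NL1E//.
  rewrite le_eqVlt; apply/orP; left; apply/eqP; congr fine; apply: eq_norm1 => y _.
  by rewrite gE.
have xE : x = rz z v.
  apply/eqP; rewrite -subr_eq0; apply/eqP/NL1_definite/le_anti; rewrite seminorm_ge0 andbT.
  apply: vanish_cst_le (vanishD hx px) => k.
  have -> : x - rz z v = (p k - rz z v) - (p k - x) by zmodule.
  apply: le_trans (seminormB _ _ _) _; rewrite addrC; apply: lerD => //; exact: NL1_le.
rewrite bopB -/(p n) -subr_le0; apply: (vanish_cst_le (u := fun k => NBV (p (n + k)%N - x))).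
  move=> k; rewrite lerBlDr -xE.
  have -> : x - p n = (p (n + k)%N - p n) - (p (n + k)%N - x) by zmodule.
  apply: le_trans (seminormB _ _ _) _; rewrite addrC lerD2l; apply: pB; exact: leq_addr.
move=> e /hx[k0 hk]; exists k0 => k kk; apply: hk; apply: leq_trans kk _; exact: leq_addl.
Qed.

Lemma rz_iter z n f : normc z <= 1 -> inB f ->
  inB (iter n (Rz z) f) /\ (rz z ^+ n) (cl f) = cl (iter n (Rz z) f).
Proof.
move=> z1 fB; elim: n => [|n [IH1 IH2]]; first by rewrite expr0 bop1.
by split; [exact: rz_inB | rewrite exprS bopM IH2 rzE].
Qed.

Lemma sys_quasi : exists B D eta : R, [/\ 0 <= B, 0 <= D, 0 <= eta < 1 &
    forall z n x, normc z <= 1 -> (0 < n)%N ->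
      NBV ((rz z ^+ n) x) <= normc z ^+ n * (B * eta ^+ n * NBV x + D * NL1V x)].
Proof.
have [B [D' [eta [B0 D0 /andP[e0 e1] h]]]] := qc.
exists B, D', eta; split; [exact: ltW | exact: ltW | by rewrite (ltW e0) |].
move=> z n v z1 n0; have [f fB ->] := classB_rep v; have [itB ->] := rz_iter n z1 fB.
rewrite !NBE// NL1E// -lee_fin -(normBE snP itB).
apply: le_trans (h f z n fB z1 n0) _; rewrite normcX.
rewrite {1}(normBE snP fB) -[X in (_ + D'%:E * X)%E](fineK (norm1_fin fB.1)).
exact: lexx.
Qed.

Let Loo1 : Loo nuhat Xhat (fun=> 1).
Proof.
apply: (@LooP _ _ _ nuhat Xhat _ 1) => //; try exact: cmeasurable_cst.
by apply: nearW => x _; rewrite normc1.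
Qed.

Lemma rz_fix z f : normc z <= 1 -> inB f -> rz z (cl f) = cl f -> forall psi, Loo nuhat Xhat psi ->
  cinth (fun x => psi (That x) * (z ^+ tau x * f x)) = cinth (fun x => psi x * f x).
Proof.
move=> z1 fB; rewrite rzE// => /(cls_eq mXh snP (rz_inB z1 fB) fB) zf psi pL.
rewrite -zdual//; last exact: fB.1.
apply: ae_eq_cint => //; [exact: (L1_mul mXh pL (rz_inB z1 fB).1).1 | exact: (L1_mul mXh pL fB.1).1 |].
by apply: filterS zf => x + Dx => /(_ Dx) ->.
Qed.

Lemma rz_unimodular z f : normc z = 1 -> inB f -> rz z (cl f) = cl f -> cl f <> 0 ->
  z = 1 /\ exists a, {ae nuhat, forall x, Xhat x -> f x = a * (normc (f x))%:C%C}.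
Proof.
move=> z1 fB zf f0; have zle : normc z <= 1 by rewrite z1.
have mST (psi : E -> R[i]) : cmeasurable Xhat psi -> cmeasurable Xhat (fun x => psi (That x)).
  exact: (cmeasurable_return_map mX mXh XhX TX mT).
have H := @unimodular_eigenfunction _ _ _ nuhat Xhat That tau mXh (@return_mapA _ T Xhat)
  mST mtau aper z f z1 fB.1 (rz_fix zle fB zf).
apply: (H) => h; apply: f0; rewrite -(cls0 mXh snP); apply/cls_eq => //; exact: inB0.
Qed.

Lemma sys_h : rz 1 (cl hC) = cl hC.
Proof.
have z1 : normc (1 : R[i]) <= 1 by rewrite normc1.
rewrite rzE//; have RB := rz_inB z1 hB; apply/cls_eq => //.
apply/(indef_inj mXh RB.1 hB.1); apply/funext => A; rewrite /indef; case: ifPn => // /asboolP mA.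
have LA := Loo_indic nuhat Xhat mA; have [PL dual] := tPhat hB.1.
rewrite zdual//; last exact: hB.1.
transitivity (cinth (fun x => cindic A (That x) * hC x)).
  by apply: eq_cint => x _; rewrite expr1n mul1r.
rewrite dual//; apply: ae_eq_cint => //; [exact: (L1_mul mXh LA PL).1 | exact: (L1_mul mXh LA hB.1).1 |].
by apply: filterS hfix => x + Dx => /(_ Dx) ->.
Qed.

Lemma cint_hC : cinth hC = 1.
Proof.
rewrite /cint /= hint (_ : (\int[nuhat]_(x in Xhat) 0%:E)%E = 0%E)//.
by rewrite integral0.
Qed.

Lemma sys_pih : mean (cl hC) = 1.
Proof. by rewrite mean_cl// cint_hC. Qed.

Lemma sys_piR x : mean (rz 1 x) = mean x.
Proof.
have z1 : normc (1 : R[i]) <= 1 by rewrite normc1.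
have [f fB ->] := classB_rep x; rewrite rzE// !mean_cl//; last exact: rz_inB.
transitivity (cinth (fun x => 1 * Rz 1 f x)); first by apply: eq_cint => y _; rewrite mul1r.
rewrite (zdual z1 fB.1 Loo1); apply: eq_cint => y _; by rewrite expr1n !mul1r.
Qed.

(** The first use of [rz_unimodular] gives [z = 1]. Then [y = f - a hhat] is fixed with mean zero;
    if it were nonzero, the second use would give [y = b |y|] and hence [b] times the integral of
    [|y|] equal to 0, a contradiction. *)
Lemma sys_eigen z x : normc z = 1 -> rz z x = x -> x <> 0 -> z = 1 /\ x = mean x *: cl hC.
Proof.
have [f fB ->] := classB_rep x => z1 zf f0; have [zE _] := rz_unimodular z1 fB zf f0.
split=> //; rewrite zE in zf; set a := mean _.
pose y t := f t + (- a) * hC t; have yB : inB y by apply: inBD => //; exact: inBZ.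
have yE : cl y = cl f - a *: cl hC.
  by rewrite (clsD mXh snP fB (inBZ mXh snP (- a) hB)) (clsZ mXh snP _ hB) scaleNr.
have yfix : rz 1 (cl y) = cl y by rewrite yE bop_sub bop_scale zf sys_h.
apply/eqP; rewrite -subr_eq0 -yE; apply/eqP; apply: contrapT => y0.
have [_ [b hb]] := rz_unimodular (@normc1 R) yB yfix y0.
have nL : L1h (fun t => (normc (y t))%:C%C).
  split; first by split; [exact: (measurable_normc yB.1.1) | exact: measurable_cst].
  have -> : norm1 nuhat Xhat (fun t => (normc (y t))%:C%C) = norm1 nuhat Xhat y.
    by apply: eq_integral => t _; rewrite normc_real ger0_norm ?normc_ge0.
  exact: yB.1.2.
have cy : cinth y = 0.
  by rewrite -(mean_cl yB) yE -scaleNr addrC mean_linear sys_pih mulr1 addNr.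
have cyE : cinth y = b * cinth (fun t => (normc (y t))%:C%C).
  rewrite -cintZ//; apply: ae_eq_cint => //; [exact: yB.1.1 | exact: (L1Z mXh b nL).1].
have n1 : cinth (fun t => (normc (y t))%:C%C) = (fine (norm1 nuhat Xhat y))%:C%C.
  by rewrite /cint /= (_ : (\int[nuhat]_(x in Xhat) 0%:E)%E = 0%E)// integral0.
have : b = 0 \/ cl y = 0.
  move: cyE; rewrite cy n1 => /esym/eqP; rewrite mulf_eq0 => /orP[/eqP|/eqP h]; [by left|right].
  by apply: NL1_definite; rewrite NL1E//; have := congr1 (@complex.Re R) h.
case=> [b0|//]; apply: y0; rewrite -(cls0 mXh snP); apply/cls_eq => //; first exact: inB0.
by apply: filterS hb => t + Dt => /(_ Dt); rewrite b0 mul0r.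
Qed.

Local Notation A_ n := [set x | Xhat x /\ (n < tau x)%N].
Definition tails n : R := complex.Re (cinth (fun x => cindic (A_ n) x * hC x)).

Let mA_ n : measurable (A_ n).
Proof. exact: (measurable_tau mX mXh XhX TX mT (fun k => n < k)%N). Qed.

Lemma tailsE n : cinth (fun x => cindic (A_ n) x * hC x) = (tails n)%:C%C.
Proof.
apply/eqP; rewrite eq_complex /= eqxx /=; apply/eqP.
rewrite (_ : (\int[nuhat]_(x in Xhat) _)%E = 0%E)//.
by rewrite -[RHS](integral0 nuhat Xhat); apply: eq_integral => x _; rewrite mulr0 mul0r addr0.
Qed.

Lemma tails_ge0 n : 0 <= tails n.
Proof.
rewrite /tails /= fine_ge0//; apply: integral_ge0 => x _; rewrite lee_fin mulr0 subr0 indicE.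
by rewrite mulr_ge0.
Qed.

(** [R_i] carries the part of [hhat] on [tau = i] to a function of the same integral, so what is
    left is the part on [tau > n]. *)
Lemma sys_s n : mean (cl hC - \sum_(i < n.+1) rn i (cl hC)) = (tails n)%:C%C.
Proof.
have [g gB [gE]] := partial_series n.+1 1 hB.
have -> : fps_eval n.+1 (rn : fps (bop NBV)) 1 (cl hC) = \sum_(i < n.+1) rn i (cl hC).
  by rewrite /fps_eval bop_sumE; apply: eq_bigr => i _; rewrite expr1n scale1r.
move=> ->; rewrite -clsB// mean_cl; last exact: inBB.
rewrite cintB//; [|exact: hB.1|exact: gB.1].
pose F i x : R[i] := if i is i'.+1 then Rn i'.+1 hC x else 0.
have FL i : L1h (F i) by case: i => [|i]; [exact: L1_0 | exact: (rdual (ltn0Sn i) hB.1).1].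
have SL i : L1h (fun x => cindic (S_ i) x * hC x).
  by apply: L1_mul => //; [exact: Loo_indic | exact: hB.1].
have -> : cinth g = cinth (fun x => \sum_(1 <= i < n.+1) cindic (S_ i) x * hC x).
  transitivity (cinth (fun x => \sum_(1 <= i < n.+1) F i x)).
    apply: eq_cint => x _; rewrite gE; apply: eq_big_nat => -[//|i] _; by rewrite expr1n mul1r.
  rewrite !cint_sum//; apply: eq_big_nat => -[//|i] _.
  transitivity (cinth (fun x => 1 * Rn i.+1 hC x)); first by apply: eq_cint => x _; rewrite mul1r.
  rewrite (rdual (ltn0Sn i) hB.1).2//; by apply: eq_cint => x _; rewrite mul1r.
have sumL := L1_sum mXh (index_iota 1 n.+1) SL.
rewrite -tailsE -(cintB mXh hB.1 sumL); apply: ae_eq_cint => //.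
- exact: (L1B mXh hB.1 sumL).1.
- by apply: (L1_mul mXh _ hB.1).1; exact: Loo_indic.
apply: filterS (ae_tau_gt0 returns) => x t0 Xx; have {}t0 := t0 Xx.
rewrite (sum_tau T n.+1 (fun=> hC x) Xx) t0 ltnS /=.
have [tn|nt] := leqP (tau x) n.
  by rewrite subrr cindic_out ?mul0r// => -[_]; rewrite ltnNge tn.
by rewrite subr0 cindic_in ?mul1r.
Qed.

Lemma tails_le : exists2 C : R, 0 <= C & forall n, tails n <= C * dw n.
Proof.
have [C C0 hC_] := sys_series; exists (C * NBV (cl hC)) => [|n]; first by rewrite mulr_ge0// seminorm_ge0.
have h := hC_ n.+1 1; rewrite normc1 in h; have {}h := h (lexx _).
have E1 : mean ((rz 1 - fps_eval n.+1 (rn : fps (bop NBV)) 1) (cl hC)) = (tails n)%:C%C.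
  rewrite -sys_s bopB sys_h /fps_eval bop_sumE; congr (mean (_ - _)).
  by apply: eq_bigr => i _; rewrite expr1n scale1r.
have := mean_le ((rz 1 - fps_eval n.+1 (rn : fps (bop NBV)) 1) (cl hC)).
rewrite E1 normc_real ger0_norm ?tails_ge0// => /le_trans; apply.
apply: le_trans (NL1_le _) _; apply: le_trans (opnP _ _) _; rewrite mulrAC; apply: ler_wpM2r; first exact: seminorm_ge0.
by apply: le_trans h _; rewrite ler_wpM2l//; apply: dw_le.
Qed.

Definition tbar : R := fine (\sum_(0 <= i <oo) (tails i)%:E)%E.

Lemma tbarE : (\sum_(0 <= i <oo) (tails i)%:E = tbar%:E)%E.
Proof.
have [C C0 h] := tails_le.
have t0 k : (0 <= k)%N -> true -> (0 <= (tails k)%:E)%E by move=> _ _; rewrite lee_fin tails_ge0.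
rewrite fineK// ge0_fin_numE; last by apply: nneseries_ge0 => k k1 _; exact: t0.
apply: (@le_lt_trans _ _ (C * (1 + (beta - 1)^-1))%:E); last exact: ltry.
apply: lime_le; first by apply: is_cvg_nneseries => k k0 _; exact: t0.
apply: nearW => n; rewrite sumEFin lee_fin big_mkord.
apply: le_trans (_ : \sum_(i < n) C * dw i <= _); first by apply: ler_sum => i _; exact: h.
by rewrite -mulr_sumr ler_wpM2l//; exact: sum_dw.
Qed.

Lemma sys_tb : vanish (fun n => `|tbar - \sum_(i < n) tails i|).
Proof.
have t0 k : (0 <= k)%N -> true -> (0 <= (tails k)%:E)%E by move=> _ _; rewrite lee_fin tails_ge0.
have cv : (\sum_(0 <= i < n) (tails i)%:E)%E @[n --> \oo] --> tbar%:E.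
  by rewrite -tbarE; apply: is_cvg_nneseries => k k0 _; exact: t0.
move: cv => /fine_cvgP[_ /cvgrPdist_le h] e e0; have [n0 _ hn] := h e e0.
exists n0 => n nn; have := hn n nn; rewrite /= sumEFin /= big_mkord.
by [].
Qed.

Lemma sys_tb1 : 1 <= tbar.
Proof.
have t0 : tails 0 = 1.
  have : (tails 0)%:C%C = 1 :> R[i]; last by move/(congr1 (@complex.Re R)).
  rewrite -tailsE -cint_hC; apply: ae_eq_cint => //; last first.
  - by apply: filterS (ae_tau_gt0 returns) => x t0 Xx; rewrite cindic_in ?mul1r//; split=> //; exact: t0.
  - exact: hB.1.1.
  - by apply: (L1_mul mXh _ hB.1).1; exact: Loo_indic.
rewrite -lee_fin -tbarE -t0; apply: le_trans (_ : (\sum_(0 <= i < 1) (tails i)%:E <= _)%E).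
  by rewrite big_nat1.
by apply: nneseries_lim_ge => k _ _; rewrite lee_fin tails_ge0.
Qed.

Lemma renewal_system_return : renewal_system NL1V beta rn rz (cl hC) mean tails tbar.
Proof.
split.
- move=> x x0; apply: NL1_definite; apply/le_anti; rewrite seminorm_ge0 andbT -x0; exact: NL1_le.
- exact: NL1_le.
- exact: sys_compact.
- exact: sys_complete.
- exact: rn0.
- exact: sys_tail.
- exact: sys_series.
- exact: sys_quasi.
- exact: sys_eigen.
- exact: mean_linear.
- exact: mean_le.
- exact: sys_h.
- exact: sys_pih.
- exact: sys_piR.
- exact: sys_s.
- exact: sys_tb.
- exact: sys_tb1.
Qed.

Theorem correlation_asymptotics : exists2 C : R, 0 <= C & forall g f n (M : R), Loo nu X g ->
  (forall x, X x -> ~ Xhat x -> g x = 0) -> 0 <= M ->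
  {ae nuhat, forall x, Xhat x -> normc (g x) <= M} -> inB f ->
  normc (cinth (fun x => g (iter n T x) * f x) -
     (tbar^-1 + (tbar - \sum_(i < n.+1) tails i) / tbar ^+ 2)%:C%C *
       (cinth f * cinth (fun x => g x * hC x))) <= C * (dw n * hw n) * M * fine (normB f).
Proof.
have [S [SE [C C0 hS]]] := renewal_asymptotics beta_gt1 renewal_system_return.
exists C => // g f n M gL g0 M0 gM fB.
have gLh : Loo nuhat Xhat g by exact: (Loo_nu_nuhat mX mXh XhX c0 nuE gL).
have gnL k : Loo nuhat Xhat (fun x => g (iter k T x)).
  exact: (Loo_nu_nuhat mX mXh XhX c0 nuE (Loo_iter mX TX mT nsT k gL)).
pose ga (psi : E -> R[i]) (v : V) := cinth (fun x => psi x * rep v x).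
have ga_lin psi a u v : Loo nuhat Xhat psi -> ga psi (a *: u + v) = a * ga psi u + ga psi v.
  move=> pL; have [f1 f1B ->] := classB_rep u; have [f2 f2B ->] := classB_rep v.
  rewrite -cls_linear// /ga !mean_pair//; last by apply: inBD => //; exact: inBZ.
  have [h1 h2] := (L1_mul mXh pL f1B.1, L1_mul mXh pL f2B.1).
  rewrite -(cintZ mXh a h1) -(cintD mXh (L1Z mXh a h1) h2).
  by apply: eq_cint => x _; ring.
have gaD psi u v : Loo nuhat Xhat psi -> ga psi (u + v) = ga psi u + ga psi v.
  by move=> pL; rewrite -[u]scale1r ga_lin// mul1r scale1r.
have ga0 psi : Loo nuhat Xhat psi -> ga psi 0 = 0.
  by move=> pL; apply: (@addrI _ (ga psi 0)); rewrite -gaD// !addr0.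
have gaZ psi a v : Loo nuhat Xhat psi -> ga psi (a *: v) = a * ga psi v.
  by move=> pL; rewrite -[a *: v]addr0 ga_lin// ga0// addr0.
have gaB u v : ga g (u - v) = ga g u - ga g v.
  by rewrite -(scaleN1r v) gaD// gaZ// mulN1r.
have ga_sum (F : nat -> V) k : ga g (\sum_(i < k) F i) = \sum_(i < k) ga g (F i).
  elim: k => [|k IH]; first by rewrite !big_ord0 ga0.
  by rewrite !big_ord_recr /= gaD// IH.
have ga_le v : normc (ga g v) <= M * NL1V v.
  have [h1 h2] := norm1_mul_le mXh gLh.1 (rep_inB v).1 M0 gM.
  apply: le_trans (normc_cint mXh h1) _; apply: le_trans h2 _.
  by rewrite -(NL1E mXh snP (rep_inB v)) repK.
have SR k : S k = (1 : fps (bop NBV)) k + \sum_(i < k.+1) S (k - i)%N * rn i.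
  have : S = 1 + S * (rn : fps (bop NBV)) by rewrite -SE mulrBr mulr1 subrK.
  move=> /(congr1 (fun s => s k)); rewrite fpsD => ->; congr (_ + _).
  rewrite fpsM (reindex_inj rev_ord_inj) /=; apply: eq_bigr => i _.
  by rewrite subSS subKn// -ltnS.
(* Both sides satisfy the same renewal equation: the left one by [correlation_renewal], the right
   one by [S = 1 + S R]. *)
have tS k : forall v, ga (fun x => g (iter k T x)) v = ga g (S k v).
  elim/ltn_ind: k => k IH v; have [f1 f1B ->] := classB_rep v.
  rewrite {1}/ga mean_pair//.
  rewrite (correlation_renewal mX mXh XhX c0 nuE TX mT nsT returns tP k f1B.1 gL g0).
  rewrite SR bopD gaD// bop_sumE (ga_sum (fun i => (S (k - i)%N * rn i) (cl f1))); congr (_ + _).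
    rewrite fps1; case: (k == 0%N); last by rewrite bop0 ga0.
    by rewrite bop1 /ga mean_pair.
  rewrite big_ord_recl rn0 mulr0 bop0 ga0// add0r big_add1 big_mkord; apply: eq_bigr => i _.
  have ki : (k - i.+1 < k)%N by rewrite ltn_subrL /= (leq_ltn_trans _ (ltn_ord i)).
  rewrite bopM -[rn (lift ord0 i)]/(rn i.+1) rnE// -[(k - lift ord0 i)%N]/(k - i.+1)%N -(IH _ ki).
  rewrite /ga mean_pair//; exact: (renewal_bounded (ltn0Sn i) f1B).1.
have -> : cinth (fun x => g (iter n T x) * f x) = ga g (S n (cl f)) by rewrite -tS /ga mean_pair.
set cn := (_ + _)%:C%C.
have -> : cn * (cinth f * cinth (fun x => g x * hC x)) = ga g ((cn *: Pi renewal_system_return) (cl f)).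
  rewrite -[RHS]/(ga g (cn *: (mean (cl f) *: cl hC))) !gaZ// mean_cl//; congr (_ * (_ * _)).
  by rewrite /ga mean_pair.
have -> : ga g (S n (cl f)) - ga g ((cn *: Pi renewal_system_return) (cl f)) =
    ga g ((S n - cn *: Pi renewal_system_return) (cl f)).
  by rewrite bopB gaB.
apply: le_trans (ga_le _) _.
have hn : NBV ((S n - cn *: Pi renewal_system_return) (cl f)) <= C * (dw n * hw n) * NBV (cl f).
  by apply: le_trans (opnP _ _) _; apply: ler_wpM2r; [exact: seminorm_ge0 | exact: hS].
rewrite -(NBE mXh snP fB) -[leRHS]mulrA [leRHS]mulrCA; apply: ler_wpM2l => //.
exact: le_trans (NL1_le _) hn.
Qed.

End System.

(** * Push-forward of weighted measures, integration against set functions *)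

Section Transport.
Local Open Scope ereal_scope.
Import HBNNSimple.
Context d (E : measurableType d) (R : realType) (N : {measure set E -> \bar R}).
Context (D X : set E) (w : E -> R) (S : E -> E).
Hypotheses (mD : measurable D) (mX : measurable X) (w0 : forall x, (0 <= w x)%R) (mw : measurable_fun D w).
Hypotheses (mS : measurable_fun D S) (SX : forall x, D x -> X (S x)).

(** The push-forward under [S] of the measure with density [w] on [D]. *)
Definition transport (A : set E) : \bar R := \int[N]_(x in D) (w x * \1_A (S x))%:E.

Lemma measurable_transport A : measurable A -> measurable_fun D (fun x => (w x * \1_A (S x))%:E).
Proof.
move=> mA; apply/measurable_EFinP; apply: measurable_funM => //.
by apply: measurableT_comp => //; exact: measurable_indic.
Qed.

Let transport0 : transport set0 = 0.
Proof.
rewrite /transport -[RHS](integral0 N D); apply: eq_integral => x _.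
by rewrite indic0 mulr0.
Qed.

Let transport_ge0 A : 0 <= transport A.
Proof. by apply: integral_ge0 => x _; rewrite lee_fin mulr_ge0. Qed.

Let transport_sigma : semi_sigma_additive transport.
Proof.
move=> F mF tF mUF.
have -> : transport (\bigcup_k F k) = \sum_(0 <= k <oo) transport (F k).
  rewrite /transport -integral_nneseries//; last 2 first.
  - by move=> k; exact: measurable_transport.
  - by move=> k x _; rewrite lee_fin mulr_ge0.
  apply: eq_integral => x _.
  have h : (\1_(\bigcup_k F k) (S x))%:E = \sum_(0 <= k <oo) (\1_(F k) (S x))%:E :> \bar R.
    apply/esym/cvg_lim => //.
    exact: (@measure_semi_sigma_additive _ _ _ (dirac (S x) : {measure set E -> \bar R}) F mF tF mUF).
  rewrite EFinM h -nneseriesZl; last by move=> k _; rewrite lee_fin.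
  by apply: eq_eseriesr => k _; rewrite EFinM.
by apply: is_cvg_nneseries => k _ _; exact: transport_ge0.
Qed.

Definition transport_measure : {measure set E -> \bar R} :=
  HB.pack transport (isMeasure.Build d E R transport transport0 transport_ge0 transport_sigma).

Lemma integral_transport (u : E -> \bar R) : measurable_fun X u -> (forall x, X x -> 0 <= u x) ->
  \int[transport_measure]_(x in X) u x = \int[N]_(x in D) ((w x)%:E * u (S x)).
Proof.
move=> mu u0.
have mcomp (k : E -> R) : measurable_fun setT k -> measurable_fun D (fun x => (w x)%:E * (k (S x))%:E).
  move=> mk; apply/measurable_EFinP; apply: measurable_funM => //.
  exact: measurableT_comp.
have simple (h : {nnsfun E >-> R}) : \int[transport_measure]_(x in X) (h x)%:E =
    \int[N]_(x in D) ((w x)%:E * (h (S x))%:E).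
  under eq_integral do rewrite fimfunE -fsumEFin//.
  rewrite ge0_integral_fsum//; last 2 first.
    - by move=> r; exact/measurable_EFinP/measurableT_comp.
    - by move=> n x _; rewrite EFinM nnfun_muleindic_ge0.
  under [RHS]eq_integral.
    move=> x xD; rewrite fimfunE -fsumEFin// ge0_mule_fsumr; last first.
      by move=> r; rewrite EFinM nnfun_muleindic_ge0.
    over.
  rewrite [RHS]ge0_integral_fsum//; last 2 first.
    - by move=> r; apply: (mcomp (fun y => r * \1_(h @^-1` [set r]) y)%R); exact: measurableT_comp.
    - by move=> n x _; apply: mule_ge0; rewrite ?EFinM ?nnfun_muleindic_ge0// lee_fin.
  apply: eq_fsbigr => r _.
  rewrite integralZl_indic_nnsfun// integral_indic//.
  have mr : measurable (h @^-1` [set r]) by [].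
  rewrite -[transport_measure _]/(transport _) /transport.
  have -> : \int[N]_(x in D) (w x * \1_(h @^-1` [set r] `&` X) (S x))%:E =
      \int[N]_(x in D) (w x * \1_(h @^-1` [set r]) (S x))%:E.
    by apply: eq_integral => x /[!inE] Dx; rewrite !indicE in_setI (mem_set (SX Dx)) andbT.
  have [r0|r0] := leP 0%R r.
    rewrite -ge0_integralZl_EFin//; last 2 first.
    - by move=> x _; rewrite lee_fin mulr_ge0.
    - exact: measurable_transport.
    by apply: eq_integral => x _; rewrite -!EFinM mulrCA.
  have -> : h @^-1` [set r] = set0.
    by apply/seteqP; split=> // x /= hx; move: r0; rewrite -hx ltNge fun_ge0.
  have z : \int[N]_(x in D) (w x * \1_(set0 : set E) (S x))%:E = 0 by exact: transport0.
  by rewrite z mule0 -[LHS](integral0 N D); apply: eq_integral => x _; rewrite indic0 mulr0 mule0.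
pose f_ := nnsfun_approx mX mu.
transitivity (limn (fun n => \int[transport_measure]_(x in X) (f_ n x)%:E)).
  rewrite -monotone_convergence//.
  - apply: eq_integral => x /[!inE] xD; apply/esym/cvg_lim => //; exact: cvg_nnsfun_approx.
  - by move=> n; apply: measurableT_comp => //; exact: measurable_funTS.
  - by move=> n x _; rewrite lee_fin.
  - by move=> x _ a b ab; rewrite lee_fin//; exact/lefP/nd_nnsfun_approx.
under eq_fun do rewrite simple.
rewrite -monotone_convergence//=.
- apply: eq_integral => x /[!inE] Dx; apply/cvg_lim => //.
  apply: cvgeZl => //; apply: (cvg_nnsfun_approx mX mu u0); exact: SX.
- by move=> n; apply: mcomp; exact: measurable_funTS.
- by move=> n x _; apply: mule_ge0; rewrite lee_fin.
- by move=> x _ a b ab; apply: lee_wpmul2l; rewrite lee_fin//; exact/lefP/nd_nnsfun_approx.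
Qed.

End Transport.

Section SetFunction.
Local Open Scope ereal_scope.
Context d (E : measurableType d) (R : realType).
Import HBNNSimple.

Let nnint_le (m1 m2 : set E -> \bar R) (D : set E) (f : E -> \bar R) :
  (forall A, measurable A -> m1 A = m2 A) ->
  [set sintegral m1 h | h in [set h : {nnsfun E >-> R} | forall x, (h x)%:E <= f x]] `<=`
  [set sintegral m2 h | h in [set h : {nnsfun E >-> R} | forall x, (h x)%:E <= f x]].
Proof. by move=> m12 _ [h hf <-] /=; exists h => //; apply: eq_fsbigr => r _; rewrite m12. Qed.

(** [density_measure] and [tower_measure] are mere set functions. The integral is built from their
    values on measurable sets, so it can be computed with genuine measures that agree there. *)
Lemma eq_integral_setfun (m1 m2 : set E -> \bar R) (D : set E) (f : E -> \bar R) :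
  (forall A, measurable A -> m1 A = m2 A) -> \int[m1]_(x in D) f x = \int[m2]_(x in D) f x.
Proof.
move=> m12; rewrite /integral; congr (ereal_sup _ - ereal_sup _); rewrite eqEsubset; split;
  apply: nnint_le => // A /m12 //.
Qed.

End SetFunction.

Lemma indic_floor_split (E : Type) (R : realType) (A : set E) (t : E -> nat) i x : A x ->
  \1_[set x | A x /\ (i < t x)%N] x =
  \1_[set x | A x /\ (i.+1 < t x)%N] x + \1_[set x | A x /\ t x = i.+1] x :> R.
Proof.
move=> Ax; rewrite !indicE.
have E1 k : (x \in [set x | A x /\ (k < t x)%N]) = (k < t x)%N.
  by apply/idP/idP => [/[!inE] -[]//|kt]; apply/mem_set.
have -> : (x \in [set x | A x /\ t x = i.+1]) = (t x == i.+1).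
  by apply/idP/eqP => [/[!inE] -[]//|ti]; apply/mem_set.
by rewrite !E1; have [ti|ti|ti] := ltngtP (t x) i.+1; rewrite ?(ltnW ti) ?ti ?ltnSn ?addr0 ?add0r//; rewrite ltnNge -ltnS ti.
Qed.

Lemma nneseries_shift (R : realType) (a : nat -> \bar R) : (forall i, 0 <= a i)%E ->
  (\sum_(0 <= i <oo) a i = a 0%N + \sum_(0 <= i <oo) a i.+1)%E.
Proof.
move=> a0; rewrite (nneseries_split 0 1)// add0n big_nat1; congr (_ + _)%E.
by rewrite -(nneseries_addn 1%N)//; apply: eq_eseriesr => i _; rewrite addn1.
Qed.

(** * The tower measure: invariance and integrals over the base *)

Section Tower.
Context d (E : measurableType d) (R : realType) (nu nuhat : {measure set E -> \bar R}).
Context (X Xhat : set E) (T : E -> E) (c : R).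
Hypotheses (mX : measurable X) (mXh : measurable Xhat) (XhX : Xhat `<=` X).
Hypotheses (c0 : 0 < c)
  (nuE : forall A, measurable A -> A `<=` Xhat -> nu A = (c%:E * nuhat A)%E).
Hypotheses (TX : forall x, X x -> X (T x)) (mT : measurable_fun X T) (nsT : nonsingular nu X T).
Hypothesis returns : {ae nuhat, forall x, Xhat x -> exists i, (1 <= i)%N /\ Xhat (iter i T x)}.
Variables (Phat : (E -> R[i]) -> E -> R[i]) (hhat : E -> R) (tb : R).
Local Notation tau := (return_time T Xhat).
Local Notation That := (return_map T Xhat).
Local Notation hC := (fun x => (hhat x)%:C%C).
Hypothesis tPhat : transfer_operator nuhat Xhat That Phat.
Hypotheses (hhat0 : forall x, 0 <= hhat x) (hL : L1 nuhat Xhat hC).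
Hypothesis hfix : {ae nuhat, forall x, Xhat x -> Phat hC x = hC x}.
Local Notation tails := (tails nuhat Xhat T hhat).
Hypotheses (tb1 : 1 <= tb) (tbE : (\sum_(0 <= i <oo) (tails i)%:E = tb%:E)%E).
Local Notation muhat := (density_measure Xhat nuhat hhat).
Local Notation mu := (tower_measure T Xhat muhat).
Local Notation A_ n := [set x | Xhat x /\ (n < tau x)%N].

Let mh : measurable_fun Xhat hhat. Proof. exact: hL.1.1. Qed.
Let mA_ n : measurable (A_ n).
Proof. exact: (measurable_tau mX mXh XhX TX mT (fun k => n < k)%N). Qed.
Let tb0 : 0 <= tb^-1. Proof. by rewrite invr_ge0 (le_trans ler01). Qed.

Lemma density_measureE B : muhat B = (\int[nuhat]_(x in Xhat) (hhat x * \1_B x)%:E)%E.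
Proof.
rewrite /density_measure setIC integral_mkcondr; apply: eq_integral => x _.
by rewrite /patch indicE; case: ifPn => _; rewrite ?mulr1 ?mulr0.
Qed.

Lemma tails_density n : (tails n)%:E = muhat (A_ n).
Proof.
have h := L1_Re (L1_indic mXh (mA_ n) hL) mXh.
rewrite density_measureE /tails /= fineK; last exact: (integrable_fin_num mXh h).
by apply: eq_integral => x _ /=; rewrite mulr0 subr0 mulrC.
Qed.

(** Layer cake formula: [tau] is the sum over [n] of the indicators of [tau > n]. *)
Lemma mean_return_time : (\int[muhat]_(x in Xhat) (tau x)%:R%:E)%E = tb%:E.
Proof.
pose m2 := transport_measure nuhat (w := hhat) mXh hhat0 mh (@measurable_id _ _ Xhat).
rewrite (@eq_integral_setfun _ _ _ muhat m2); last by move=> A mA; rewrite density_measureE.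
have mtau n : measurable_fun Xhat (fun x => (\1_(A_ n) x)%:E : \bar R).
  by apply/measurable_EFinP; apply: measurable_funTS; exact: measurable_indic.
rewrite -tbE; transitivity (\int[m2]_(x in Xhat) (\sum_(0 <= n <oo) (\1_(A_ n) x)%:E))%E.
  apply: eq_integral => x /[!inE] Xx; rewrite (nneseries_split _ (tau x)); last by move=> k _; rewrite lee_fin.
  rewrite add0n [X in (_ + X)%E]eseries0 ?adde0; last first.
    by move=> k tk _; rewrite indicE memNset// => -[_]; rewrite ltnNge tk.
  rewrite -[LHS]/((tau x)%:R%:E) sumEFin big_nat (eq_bigr (fun=> 1)) -?big_nat.
    by rewrite sumr_const_nat subn0.
  by move=> k /andP[_ kt]; rewrite indicE mem_set.
rewrite integral_nneseries//; apply: eq_eseriesr => n _.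
rewrite integral_indic// tails_density density_measureE -[m2 _]/(transport _ _ _ _ _).
by apply: eq_integral => x /[!inE] Xx; rewrite !indicE in_setI (mem_set Xx) andbT.
Qed.

(** Density on the base of the part of [mu] that [T^i] carries to floor [i] of the tower. *)
Definition floor_weight i x : R := tb^-1 * (\1_(A_ i) x * hhat x).
Lemma floor_weight_ge0 i x : 0 <= floor_weight i x.
Proof. by rewrite !mulr_ge0. Qed.
Lemma measurable_floor_weight i : measurable_fun Xhat (floor_weight i).
Proof.
apply: measurable_funM; first exact: measurable_cst.
by apply: measurable_funM => //; apply: measurable_funTS; exact: measurable_indic.
Qed.
Lemma measurable_iterh i : measurable_fun Xhat (iter i T).
Proof. exact: measurable_funS (measurable_iter mX TX mT i). Qed.

Let floor i := transport_measure nuhat mXh (floor_weight_ge0 i) (measurable_floor_weight i) (measurable_iterh i).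

Lemma tower_measureE A : measurable A -> mu A = mseries floor 0 A.
Proof.
move=> mA; rewrite /tower_measure mean_return_time /= -nneseriesZl; last first.
  by move=> i _; apply: integral_ge0 => x _; rewrite lee_fin.
apply: eq_eseriesr => i _; rewrite density_measureE -[floor i A]/(transport _ _ _ _ _).
rewrite -ge0_integralZl_EFin//; last 2 first.
- by move=> x _; rewrite lee_fin mulr_ge0.
- apply/measurable_EFinP; apply: measurable_funM => //; apply: measurable_funTS.
  have -> : [set x | Xhat x /\ (i < tau x)%N /\ A (iter i T x)] = A_ i `&` (X `&` iter i T @^-1` A).
    apply/seteqP; split=> x /=; first by move=> [Xx [it Ax]]; split=> //; split=> //; exact: XhX.
    by move=> [[Xx it] [_ Ax]].
  apply: measurable_indic; apply: measurableI; first exact: mA_.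
  exact: (measurable_preimage mX TX mT).
apply: eq_integral => x /[!inE] Xx; rewrite -EFinM; congr EFin.
rewrite /floor_weight -!mulrA; congr (_ * _); rewrite mulrCA; congr (_ * _).
rewrite !indicE -natrM mulnb; congr (nat_of_bool _)%:R.
apply/idP/idP => [/[!inE] -[_ [it Ax]]|/andP[/[!inE] -[_ it] Ax]]; last by [].
by apply/andP; split; apply/mem_set.
Qed.

Lemma integral_tower_ge0 (u : E -> \bar R) : measurable_fun X u -> (forall x, X x -> 0 <= u x)%E ->
  (\int[mu]_(x in X) u x =
   \sum_(0 <= i <oo) \int[nuhat]_(x in Xhat) ((floor_weight i x)%:E * u (iter i T x)))%E.
Proof.
move=> mu_ u0; rewrite (@eq_integral_setfun _ _ _ mu (mseries floor 0)); last exact: tower_measureE.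
rewrite ge0_integral_measure_series//; apply: eq_eseriesr => i _.
by apply: integral_transport => // x Xx; apply: iterX => //; exact: XhX.
Qed.

Lemma integral_towerE (u : E -> R) :
  (\int[mu]_(x in X) (u x)%:E = \int[mu]_(x in X) ((EFin \o u)^\+ x) - \int[mu]_(x in X) ((EFin \o u)^\- x))%E.
Proof. by rewrite !(@eq_integral_setfun _ _ _ mu (mseries floor 0)); [exact: integralE|..]; exact: tower_measureE. Qed.

(** On indicators this is [Phat hhat = hhat] read through duality; both sides are integrals against
    push-forwards that agree on measurable sets. *)
Lemma integral_return_map (u : E -> \bar R) : measurable_fun Xhat u -> (forall x, Xhat x -> 0 <= u x)%E ->
  (\int[nuhat]_(x in Xhat) ((hhat x)%:E * u (That x)) = \int[nuhat]_(x in Xhat) ((hhat x)%:E * u x))%E.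
Proof.
move=> mu_ u0; have mTh := measurable_return_map mX mXh XhX TX mT.
rewrite -(integral_transport nuhat mXh mXh hhat0 mh mTh) //; last by move=> x; exact: return_mapA.
rewrite -(integral_transport nuhat mXh mXh hhat0 mh (@measurable_id _ _ Xhat))//.
apply: eq_integral_setfun => A mA; rewrite -[LHS]/(transport _ _ _ _ _) -[RHS]/(transport _ _ _ _ _).
have LA := Loo_indic nuhat Xhat mA; have [PL dual] := tPhat hL.
have LTA : Loo nuhat Xhat (fun x => cindic A (That x)) := Loo_return_map mX mXh XhX c0 nuE TX mT nsT LA.
have E1 : cint nuhat Xhat (fun x => cindic A (That x) * hC x) = cint nuhat Xhat (fun x => cindic A x * hC x).
  rewrite dual//; apply: ae_eq_cint => //; [exact: (L1_mul mXh LA PL).1 | exact: (L1_mul mXh LA hL).1 |].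
  by apply: filterS hfix => x + Dx => /(_ Dx) ->.
have aux (k : E -> E) : L1 nuhat Xhat (fun x => cindic A (k x) * hC x) ->
    (\int[nuhat]_(x in Xhat) (hhat x * \1_A (k x))%:E)%E = (complex.Re (cint nuhat Xhat (fun x => cindic A (k x) * hC x)))%:E.
  move=> kL; rewrite /= fineK; last exact: (integrable_fin_num mXh (L1_Re kL mXh)).
  by apply: eq_integral => x _ /=; rewrite mulr0 subr0 mulrC.
rewrite /transport (aux That) ?E1; last exact: (L1_mul mXh LTA hL).
by rewrite -(aux id)//; exact: (L1_mul mXh LA hL).
Qed.

(** [T] moves floor [i] to floor [i + 1], except on [tau = i + 1], where the orbit comes back to the
    base. The returning parts add up to the integral of [u] after the return map, which is floor 0
    by invariance of the base measure. *)
Lemma integral_tower_shift (u : E -> \bar R) : measurable_fun X u -> (forall x, X x -> 0 <= u x)%E ->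
  (\int[mu]_(x in X) u (T x) = \int[mu]_(x in X) u x)%E.
Proof.
move=> mu_ u0; have img : T @` X `<=` X by move=> _ [x Xx <-]; exact: TX.
have uTm : measurable_fun X (u \o T) := measurable_comp mX img mu_ mT.
rewrite (integral_tower_ge0 (u := u \o T)) ?integral_tower_ge0//; last by move=> x Xx; apply: u0; exact: TX.
have miter k : measurable_fun Xhat (fun x => u (iter k T x)).
  have := measurable_comp (f := u) (g := iter k T) mX _ mu_ (measurable_iterh k); apply.
  by move=> _ [x Xx <-]; apply: iterX => //; exact: XhX.
have ui0 k x : Xhat x -> (0 <= u (iter k T x))%E by move=> Xx; apply: u0; apply: iterX => //; exact: XhX.
pose w' i x : R := tb^-1 * (\1_[set x | Xhat x /\ tau x = i.+1] x * hhat x).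
have mS' i : measurable [set x | Xhat x /\ tau x = i.+1].
  exact: (measurable_tau mX mXh XhX TX mT (fun k => k = i.+1)).
have w'0 i x : 0 <= w' i x by rewrite !mulr_ge0.
have mw' i : measurable_fun Xhat (w' i).
  apply: measurable_funM; first exact: measurable_cst.
  by apply: measurable_funM => //; apply: measurable_funTS; exact: measurable_indic.
have msum (w : E -> R) k : measurable_fun Xhat w -> measurable_fun Xhat (fun x => (w x)%:E * u (iter k T x))%E.
  by move=> mw; apply: emeasurable_funM => //; exact/measurable_EFinP.
have step i : (\int[nuhat]_(x in Xhat) ((floor_weight i x)%:E * (u \o T) (iter i T x)) =
    \int[nuhat]_(x in Xhat) ((floor_weight i.+1 x)%:E * u (iter i.+1 T x)) +
    \int[nuhat]_(x in Xhat) ((w' i x)%:E * u (iter i.+1 T x)))%E.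
  rewrite -ge0_integralD//; last 4 first.
  - by move=> x Xx; rewrite mule_ge0 ?lee_fin ?floor_weight_ge0// ui0.
  - exact/msum/measurable_floor_weight.
  - by move=> x Xx; rewrite mule_ge0 ?lee_fin// ui0.
  - exact: msum.
  apply: eq_integral => x /[!inE] Xx; rewrite -ge0_muleDl ?lee_fin ?floor_weight_ge0//.
  rewrite -EFinD; congr (_%:E * _)%E; rewrite /floor_weight /w' -mulrDr -mulrDl; congr (_ * (_ * _)).
  exact: indic_floor_split.
under eq_eseriesr do rewrite step.
rewrite nneseriesD; last 2 first.
- by move=> i _ _; apply: integral_ge0 => x Xx; rewrite mule_ge0 ?lee_fin ?floor_weight_ge0// ui0.
- by move=> i _ _; apply: integral_ge0 => x Xx; rewrite mule_ge0 ?lee_fin// ui0.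
have a0 i : (0 <= \int[nuhat]_(x in Xhat) ((floor_weight i x)%:E * u (iter i T x)))%E.
  by apply: integral_ge0 => x Xx; rewrite mule_ge0 ?lee_fin ?floor_weight_ge0// ui0.
rewrite [RHS](nneseries_shift a0) addeC; congr (_ + _)%E.
rewrite -integral_nneseries//; last 2 first.
- by move=> i; exact: (msum (w' i) i.+1 (mw' i)).
- by move=> i x Xx; apply: mule_ge0; [rewrite lee_fin | exact: (ui0 i.+1)].
have uXh0 x : Xhat x -> (0 <= u x)%E by move=> Xx; exact: (ui0 0%N).
have muXh : measurable_fun Xhat u by exact: (miter 0%N).
transitivity (\int[nuhat]_(x in Xhat) (tb^-1%:E * ((hhat x)%:E * u (That x))))%E.
  have muT : measurable_fun Xhat (fun x => u (That x)).
    have mTh := measurable_return_map mX mXh XhX TX mT.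
    have := measurable_comp (f := u) (g := That) mXh _ muXh mTh; apply.
    by move=> _ [x Xx <-]; exact: return_mapA.
  have hu0 x : Xhat x -> (0 <= (hhat x)%:E * u (That x))%E.
    by move=> Xx; rewrite mule_ge0 ?lee_fin// uXh0//; exact: return_mapA.
  apply: ge0_ae_eq_integral => //.
  - apply: ge0_emeasurable_sum => [i x Xx _|i _]; last exact: (msum (w' i) i.+1 (mw' i)).
    by apply: mule_ge0; [rewrite lee_fin | exact: (ui0 i.+1)].
  - by apply: emeasurable_funM => //; apply: emeasurable_funM => //; exact/measurable_EFinP.
  - by move=> x Xx; apply: nneseries_ge0 => i _ _; apply: mule_ge0; [rewrite lee_fin | exact: (ui0 i.+1)].
  - by move=> x Xx; apply: mule_ge0; [rewrite lee_fin | exact: hu0].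
  apply: filterS (ae_tau_gt0 returns) => x t0 Xx; have {}t0 := t0 Xx.
  have tE : tau x = (tau x).-1.+1 by rewrite prednK.
  rewrite (@nneseriesD1 R _ (tau x).-1 xpredT)//; last by move=> i _; apply: mule_ge0; [rewrite lee_fin | exact: (ui0 i.+1)].
  rewrite eseries0 ?adde0; last first.
    move=> i _ it; rewrite /w' indicE memNset ?mul0r ?mulr0 ?mul0e// => -[_ ti].
    by move: it; rewrite ti /= eqxx.
  rewrite /w' indicE mem_set// mul1r EFinM -muleA; congr (_ * (_ * u _))%E.
  by rewrite -tE.
have h1 (k : E -> E) : measurable_fun Xhat (fun x => u (k x)) -> (forall x, Xhat x -> Xhat (k x)) ->
    (\int[nuhat]_(x in Xhat) (tb^-1%:E * ((hhat x)%:E * u (k x))) =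
     tb^-1%:E * \int[nuhat]_(x in Xhat) ((hhat x)%:E * u (k x)))%E.
  move=> mk kX; rewrite ge0_integralZl_EFin//.
  - by move=> x Xx; rewrite mule_ge0 ?lee_fin// uXh0//; exact: kX.
  - by apply: emeasurable_funM => //; exact/measurable_EFinP.
rewrite h1; last 2 first.
- have mTh := measurable_return_map mX mXh XhX TX mT.
  have := measurable_comp (f := u) (g := That) mXh _ muXh mTh; apply.
  by move=> _ [x Xx <-]; exact: return_mapA.
- by move=> x; exact: return_mapA.
rewrite integral_return_map// -(h1 id)//; apply: ge0_ae_eq_integral => //.
- by apply: emeasurable_funM => //; apply: emeasurable_funM => //; exact/measurable_EFinP.
- exact/(msum _ 0%N)/measurable_floor_weight.
- by move=> x Xx; rewrite !mule_ge0 ?lee_fin// uXh0.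
- by move=> x Xx; rewrite mule_ge0 ?lee_fin ?floor_weight_ge0// uXh0.
apply: filterS (ae_tau_gt0 returns) => x t0 Xx; have {}t0 := t0 Xx.
by rewrite /floor_weight indicE mem_set// mul1r EFinM muleA.
Qed.

(** Between two visits the orbit is outside [Xhat], so the floors [i > 0] contribute nothing. *)
Lemma integral_tower_support (v : E -> \bar R) : measurable_fun X v -> (forall x, X x -> 0 <= v x)%E ->
  (forall x, X x -> ~ Xhat x -> v x = 0%E) ->
  (\int[mu]_(x in X) v x = \int[nuhat]_(x in Xhat) ((tb^-1 * hhat x)%:E * v x))%E.
Proof.
move=> mv v0 vs; have mvh : measurable_fun Xhat v := measurable_funS mX XhX mv.
rewrite integral_tower_ge0// nneseries_shift; last first.
  move=> i; apply: integral_ge0 => x Xx; apply: mule_ge0; first by rewrite lee_fin floor_weight_ge0.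
  by apply: v0; apply: iterX => //; exact: XhX.
rewrite eseries0 ?adde0; last first.
  move=> i _ _; rewrite -[RHS](integral0 nuhat Xhat); apply: eq_integral => x /[!inE] Xx.
  rewrite /floor_weight indicE; case: (boolP (x \in _)) => [/[!inE] -[_ it]|_]; last by rewrite mul0r mulr0 mul0e.
  rewrite vs ?mule0//; first by apply: iterX => //; exact: XhX.
  exact: before_return_time.
apply: ge0_ae_eq_integral => //.
- by apply: emeasurable_funM => //; apply/measurable_EFinP; exact: measurable_floor_weight.
- by apply: emeasurable_funM => //; apply/measurable_EFinP; apply: measurable_funM => //; exact: measurable_cst.
- by move=> x Xx; apply: mule_ge0; [rewrite lee_fin floor_weight_ge0 | exact/v0/XhX].
- by move=> x Xx; apply: mule_ge0; [rewrite lee_fin mulr_ge0 | exact/v0/XhX].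
apply: filterS (ae_tau_gt0 returns) => x t0 Xx; have {}t0 := t0 Xx.
by rewrite /floor_weight indicE mem_set// mul1r.
Qed.

Lemma integral_tower_support_real (v : E -> R) : measurable_fun X v ->
  (forall x, X x -> ~ Xhat x -> v x = 0) ->
  (\int[mu]_(x in X) (v x)%:E = \int[nuhat]_(x in Xhat) (tb^-1 * (v x * hhat x))%:E)%E.
Proof.
move=> mv vs; have mv' : measurable_fun X (EFin \o v) by exact/measurable_EFinP.
rewrite integral_towerE [RHS]integralE; congr (_ - _)%E.
  rewrite integral_tower_support; first last.
  - by move=> x Xx h; rewrite funeposE /= vs// maxxx.
  - by move=> x _; exact: funepos_ge0.
  - exact: measurable_funepos.
  apply: eq_integral => x _; rewrite !funeposE /= -!EFin_max -EFinM; congr EFin.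
  by rewrite maxr_pMr ?mulr_ge0// mulr0 -mulrA [hhat x * _]mulrC.
rewrite integral_tower_support; first last.
- by move=> x Xx h; rewrite funenegE /= vs// ?oppe0 ?oppr0 maxxx.
- by move=> x _; exact: funeneg_ge0.
- exact: measurable_funeneg.
apply: eq_integral => x _; rewrite !funenegE /= -!EFin_max -EFinM; congr EFin.
by rewrite maxr_pMr ?mulr_ge0// mulr0 mulrN -mulrA [hhat x * _]mulrC.
Qed.

Lemma cint_tower_support (F : E -> R[i]) : cmeasurable X F ->
  (forall x, X x -> ~ Xhat x -> F x = 0) -> L1 nuhat Xhat (fun x => F x * hC x) ->
  cint mu X F = tb^-1%:C%C * cint nuhat Xhat (fun x => F x * hC x).
Proof.
move=> [m1 m2] Fs FL; rewrite -cintZ// /cint.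
rewrite !integral_tower_support_real//; try by move=> x Xx /(Fs x Xx) ->.
by congr Complex; congr fine; apply: eq_integral => x _; case: (F x) => a b /=; congr EFin; ring.
Qed.

Lemma integral_tower_iter (v : E -> \bar R) n : measurable_fun X v -> (forall x, X x -> 0 <= v x)%E ->
  (\int[mu]_(x in X) v (iter n T x) = \int[mu]_(x in X) v x)%E.
Proof.
move=> mv v0; elim: n => // n IH; rewrite -IH.
rewrite -(integral_tower_shift (u := fun x => v (iter n T x))).
- by congr integral; apply/funext => x; rewrite -iterSr.
- have := measurable_comp (f := v) (g := iter n T) mX _ mv (measurable_iter mX TX mT n); apply.
  by move=> _ [x Xx <-]; exact: iterX.
- by move=> x Xx; apply: v0; exact: iterX.
Qed.

Lemma cint_tower_iter (F : E -> R[i]) n : cmeasurable X F ->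
  cint mu X (fun x => F (iter n T x)) = cint mu X F.
Proof.
have aux (v : E -> R) : measurable_fun X v ->
    (\int[mu]_(x in X) (v (iter n T x))%:E = \int[mu]_(x in X) (v x)%:E)%E.
  move=> mv; have mv' : measurable_fun X (EFin \o v) by exact/measurable_EFinP.
  rewrite (integral_towerE (fun x => v (iter n T x))) integral_towerE; congr (_ - _)%E.
    rewrite -(integral_tower_iter n (measurable_funepos mv')); last by move=> x _; exact: funepos_ge0.
    by congr integral; apply/funext => x; rewrite !funeposE.
  rewrite -(integral_tower_iter n (measurable_funeneg mv')); last by move=> x _; exact: funeneg_ge0.
  by congr integral; apply/funext => x; rewrite !funenegE.
by move=> [m1 m2]; rewrite /cint (aux _ m1) (aux _ m2).
Qed.

(** The set [tau > k] lies in the base, where [mu] has density [hhat / tb]; the tail is then [tb]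
    minus a partial sum. *)
Lemma tower_tail n : (\sum_(n.+1 <= k <oo) mu (A_ k) = (tb^-1 * (tb - \sum_(i < n.+1) tails i))%:E)%E.
Proof.
have t0 k : (0 <= (tails k)%:E)%E.
  by rewrite tails_density; apply: integral_ge0 => x _; rewrite lee_fin.
have muA k : mu (A_ k) = (tb^-1 * tails k)%:E.
  have AX : A_ k `<=` X by move=> x [/XhX].
  have -> : mu (A_ k) = (\int[mu]_(x in X) (\1_(A_ k) x)%:E)%E.
    rewrite tower_measureE// (@eq_integral_setfun _ _ _ mu (mseries floor 0)); last exact: tower_measureE.
    by rewrite integral_indic// setIidl.
  rewrite integral_tower_support_real; last 2 first.
  - by apply: measurable_funTS; exact: measurable_indic.
  - by move=> x _ Xx; rewrite indicE memNset// => -[].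
  rewrite EFinM tails_density density_measureE -ge0_integralZl_EFin//.
  - by apply: eq_integral => x _; rewrite -EFinM mulrC [hhat x * _]mulrC mulrC.
  - by move=> x _; rewrite lee_fin mulr_ge0.
  - apply/measurable_EFinP; apply: measurable_funM => //; apply: measurable_funTS; exact: measurable_indic.
under eq_eseriesr do rewrite muA EFinM.
rewrite nneseriesZl; do ?[by move=> *; exact: t0 | exact: tb0].
have := tbE; rewrite (nneseries_split 0 n.+1)// add0n sumEFin big_mkord => h.
rewrite EFinM; congr (_ * _)%E; rewrite EFinB -h addeAC -EFinB subrr add0e.
by [].
Qed.

End Tower.

(** * Comparison of the weights with F_beta *)

Section FbetaBound.
Context (R : realType).

Lemma harmonic_le n : \sum_(i < n.+1) (i.+1%:R : R)^-1 <= 1 + ln n.+1%:R.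
Proof.
elim: n => [|n IH]; first by rewrite big_ord1 invr1 ln1 addr0.
rewrite big_ord_recr /=; apply: le_trans (lerD IH (lexx _)) _; rewrite -addrA lerD2l.
have n0 : 0 < n.+1%:R :> R by []. have m0 : 0 < n.+2%:R :> R by [].
have h : ln (1 + - (n.+2%:R : R)^-1) <= - (n.+2%:R)^-1.
  by apply: le_ln1Dx; rewrite ltrN2 invf_lt1// ltr1n.
have E : 1 + - (n.+2%:R : R)^-1 = n.+1%:R / n.+2%:R.
  have -> : n.+1%:R = n.+2%:R - 1 :> R by apply/eqP; rewrite eq_sym subr_eq natr1.
  by rewrite mulrBl divff ?gt_eqF// mul1r.
by move: h; rewrite E ln_div ?posrE//; move: (ln n.+1%:R) (ln n.+2%:R) (n.+2%:R^-1) => u v w; lra.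
Qed.

Lemma powR_sum_le (a : R) n : 0 < a < 1 ->
  a * (\sum_(i < n) i.+1%:R `^ (a - 1)) <= n%:R `^ a.
Proof.
move=> /andP[a0 a1]; elim: n => [|n IH]; first by rewrite big_ord0 mulr0 powR_ge0.
rewrite big_ord_recr /= mulrDr; apply: le_trans (lerD IH (lexx _)) _.
have m0 : 0 < n.+1%:R :> R by [].
pose t : R := n%:R / n.+1%:R; have t0 : 0 <= t by rewrite divr_ge0.
have q0 : 0 < (1 - a)^-1 by rewrite invr_gt0 subr_gt0.
(* Young's inequality with exponents [1 / a] and [1 / (1 - a)] gives [t^a <= a t + 1 - a], the
   concavity bound that the induction needs at [t = n / (n + 1)]. *)
have := @conjugate_powR R (t `^ a) 1 a^-1 (1 - a)^-1 (powR_ge0 _ _) ler01.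
rewrite !invr_gt0 subr_gt0 !invrK addrC subrK => /(_ a0 a1 erefl).
rewrite mulr1 -powRrM mulfV ?gt_eqF// powRr1// powR1 mul1r => h.
have nE : n%:R `^ a = t `^ a * n.+1%:R `^ a.
  by rewrite -powRM// /t divfK// gt_eqF.
have mE : n.+1%:R `^ (a - 1) = n.+1%:R `^ a * n.+1%:R^-1 :> R.
  have nz : n.+1%:R != 0 :> R by rewrite pnatr_eq0.
  by rewrite powRB ?nz ?implybT// powRr1// ltW.
rewrite nE mE mulrCA [t `^ a * _]mulrC -mulrDr -[leRHS]mulr1; apply: ler_wpM2l; first exact: powR_ge0.
apply: le_trans (lerD h (lexx _)) _; rewrite /t.
have -> : n%:R / n.+1%:R * a + (1 - a) + a / n.+1%:R = 1 - a + a * ((n%:R + 1) / n.+1%:R) :> R by ring.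
by rewrite natr1 divff ?gt_eqF// mulr1 subrK.
Qed.

(** The case [beta = 2], [n = 1] is excluded because [ln 1 = 0] makes the right side vanish. *)
Lemma Fbeta_bound (beta : R) : 1 < beta -> exists2 C : R, 0 <= C &
  forall n, (1 <= n)%N -> (beta = 2 -> (2 <= n)%N) -> dw beta n * hw beta n <= C * Fbeta beta n.
Proof.
move=> b1; have b0 : 0 <= beta := ltW (lt_trans ltr01 b1).
have dn n : (1 <= n)%N -> dw beta n <= n%:R `^ (- beta).
  by move=> n1; apply: powRN_le => //; rewrite ?ltr0n// ler_nat.
have hwE n : hw beta n = \sum_(i < n.+1) dw (beta - 1) i.
  by apply: eq_bigr => i _; rewrite /dw opprB.
have [b2|b2|b2] := ltgtP beta 2.
- pose a := 2 - beta; have a01 : 0 < a < 1 by rewrite /a; apply/andP; split; lra.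
  have a0 : 0 < a by case/andP: a01.
  exists a^-1 => [|n n1 _]; first by rewrite invr_ge0 ltW.
  rewrite /Fbeta ltNge (ltW b2) /= (lt_eqF b2) ler_pdivlMl//.
  have h := powR_sum_le n.+1 a01.
  rewrite mulrCA; apply: le_trans (_ : dw beta n * n.+1%:R `^ a <= _).
    rewrite ler_wpM2l// ?dw_ge0//; apply: le_trans h; rewrite ler_wpM2l ?(ltW a0)//.
    by apply: ler_sum => i _; rewrite /a (_ : 2 - beta - 1 = 1 - beta)//; ring.
  have nz : n.+1%:R != 0 :> R by rewrite pnatr_eq0.
  rewrite /dw -powRD ?nz ?implybT//.
  have -> : - beta + a = - (2 * beta - 2) by rewrite /a; ring.
  by apply: powRN_le; [lra | rewrite ltr0n | rewrite ler_nat].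
- exists (1 + (beta - 1 - 1)^-1) => [|n n1 _]; first by rewrite addr_ge0// invr_ge0; lra.
  rewrite /Fbeta b2 mulrC; apply: ler_pM; [by apply: sumr_ge0 => i _; exact: powR_ge0 | exact: dw_ge0 | | exact: dn].
  by rewrite hwE; apply: sum_dw; lra.
(* For [n >= 2] one has [1 <= ln n / ln 2] and, as [n + 1 <= n^2], [ln (n + 1) <= 2 ln n]. *)
- exists ((ln 2)^-1 + 2) => [|n n1 /(_ b2) n2].
    by rewrite addr_ge0// invr_ge0 ln_ge0// ler1n.
  have l2 : 0 < ln 2 :> R by rewrite ln_gt0// ltr1n.
  rewrite /Fbeta b2 ltxx eqxx mulrA mulrC; apply: ler_pM.
  + by apply: sumr_ge0 => i _; exact: powR_ge0.
  + exact: dw_ge0.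
  + apply: le_trans (_ : 1 + ln n.+1%:R <= _).
      apply: le_trans (harmonic_le n); apply: ler_sum => i _.
      by rewrite (_ : 1 - 2 = - 1 :> R) ?powR_inv1//; lra.
    rewrite mulrDl; apply: lerD.
      by rewrite mulrC ler_pdivlMr// mul1r ler_ln ?posrE ?ltr0n// ler_nat.
    rewrite mulr_natl -lnXn ?ltr0n// ler_ln ?posrE ?exprn_gt0 ?ltr0n//.
    by rewrite -natrX ler_nat; nia.
  + have := dn n n1; rewrite b2 => /le_trans; apply; rewrite powR_invn//.
Qed.

End FbetaBound.

(** Used with [k = 1 / tb] and [s = sigma n]: the product of the means is the leading term of the
    renewal asymptotics, and the sum of the [mu (tau > j)] is its correction term. *)
Lemma cov_decomposition (R : realType) (k s : R) (x a b : R[i]) :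
  k%:C%C * x - k%:C%C * a * (k%:C%C * b) - (k * s)%:C%C * (k%:C%C * a) * (k%:C%C * b) =
  k%:C%C * (x - (k + s * k ^+ 2)%:C%C * (a * b)).
Proof.
case: x a b => x1 x2 [a1 a2] [b1 b2]; apply/eqP; rewrite eq_complex /=.
by apply/andP; split; apply/eqP; ring.
Qed.

Lemma product_bound (R : realType) (k C D N nfh CF F Ca nf nh : R) :
  0 <= k -> 0 <= C -> 0 <= D -> 0 <= N -> 0 <= nfh -> 0 <= F -> 0 <= nf ->
  D <= CF * F -> nfh <= Ca * nf * nh ->
  k * (C * D * N * nfh) <= (k * C * CF * Ca * nh + 1) * F * N * nf.
Proof.
move=> k0 C0 D0 N0 nfh0 F0 nf0 DF nfhE.
apply: (@le_trans _ _ (k * (C * (CF * F) * N * (Ca * nf * nh)))).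
  apply: ler_wpM2l => //; apply: ler_pM => //; first by rewrite !mulr_ge0.
  by rewrite ler_wpM2r// ler_wpM2l.
rewrite -subr_ge0 (_ : _ - _ = F * N * nf); last by ring.
by rewrite !mulr_ge0.
Qed.

Lemma Fbeta_ge0 (R : realType) (beta : R) n : (1 <= n)%N -> 0 <= Fbeta beta n.
Proof.
move=> n1; rewrite /Fbeta; case: ifP => _; first exact: powR_ge0.
case: ifP => _; last exact: powR_ge0.
by rewrite divr_ge0 ?exprn_ge0// ln_ge0// ler1n.
Qed.

(** * From correlations on the base to covariances *)

Section Covariance.
Context d (E : measurableType d) (R : realType) (nu nuhat : {measure set E -> \bar R}).
Context (X Xhat : set E) (T : E -> E) (c : R).
Hypotheses (mX : measurable X) (mXh : measurable Xhat) (XhX : Xhat `<=` X).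
Hypotheses (c0 : 0 < c)
  (nuE : forall A, measurable A -> A `<=` Xhat -> nu A = (c%:E * nuhat A)%E).
Hypotheses (TX : forall x, X x -> X (T x)) (mT : measurable_fun X T) (nsT : nonsingular nu X T).
Hypothesis returns : {ae nuhat, forall x, Xhat x -> exists i, (1 <= i)%N /\ Xhat (iter i T x)}.
Variables (sn : (E -> R[i]) -> \bar R) (P Phat : (E -> R[i]) -> E -> R[i]).
Variables (Rz : R[i] -> (E -> R[i]) -> E -> R[i]) (hhat : E -> R) (beta : R).
Local Notation tau := (return_time T Xhat).
Local Notation That := (return_map T Xhat).
Local Notation Rn := (renewal T Xhat P).
Local Notation inB := (inB nuhat Xhat sn).
Local Notation normB := (normB nuhat Xhat sn).
Local Notation cinth := (cint nuhat Xhat).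
Local Notation mu := (tower_measure T Xhat (density_measure Xhat nuhat hhat)).
Hypotheses (tP : transfer_operator nu X T P) (tPhat : transfer_operator nuhat Xhat That Phat).
Hypotheses (sRz : renewal_series Xhat nuhat Rn Rz) (snP : L1_seminorm nuhat Xhat sn).
Hypotheses (complete : B_complete nuhat Xhat sn) (compact : B_compact_in_L1 nuhat Xhat sn).
Hypothesis algebra : B_algebra nuhat Xhat sn.
Hypotheses (qc : quasi_compact Xhat nuhat sn Rz) (aper : aperiodic T Xhat nuhat).
Hypotheses (beta_gt1 : 1 < beta) (tail : return_tail Xhat nuhat sn Rn beta).
Local Notation hC := (fun x => (hhat x)%:C%C).
Hypotheses (hhat0 : forall x, 0 <= hhat x) (hB : inB hC).
Hypothesis hfix : {ae nuhat, forall x, Xhat x -> Phat hC x = hC x}.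
Hypothesis hint : (\int[nuhat]_(x in Xhat) (hhat x)%:E)%E = 1%E.

(** The essential supremum could be negative only if [Xhat] were a null set, which [hint]
    forbids. *)
Lemma normoo_ge0 g : (0 <= normoo nu X g)%E.
Proof.
rewrite leNgt; apply/negP => neg.
have aeF : {ae nuhat, forall x, Xhat x -> False}.
  apply: (ae_nu_nuhat mXh XhX c0 nuE (Q := fun=> False)).
  apply: filterS (ess_sup_ge nu ((fun x => (normc (g x))%:E) \_ X)) => x h Xx.
  by move: (le_lt_trans h neg); rewrite patchE mem_set// lte_fin ltNge normc_ge0.
have : (\int[nuhat]_(x in Xhat) (hhat x)%:E = \int[nuhat]_(x in Xhat) 0)%E.
  apply: ge0_ae_eq_integral => //;
    do ?[exact: measurable_cst | exact/measurable_EFinP/hB.1.1.1 | by move=> x _; rewrite lee_fin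
        | by apply: filterS aeF => x h /h].
by rewrite hint integral0 => -[] /eqP; rewrite oner_eq0.
Qed.

Theorem covariance_asymptotics : exists2 C : R, 0 < C &
    forall (f g : E -> R[i]) (n : nat),
      inB f -> Loo nu X g ->
      (forall x, ~ Xhat x -> f x = 0) ->
      (forall x, X x -> ~ Xhat x -> g x = 0) ->
      (1 <= n)%N -> (beta = 2 -> (2 <= n)%N) ->
      ((normc (Cov mu X f (fun x => g (iter n T x)) -
         (fine (\sum_(n.+1 <= k <oo)
            mu [set x | Xhat x /\ (k < tau x)%N]))%:C%C *
           cint mu X f * cint mu X g))%:E
       <= C%:E * (Fbeta beta n)%:E * normoo nu X g * normB f)%E.
Proof.
have [C C0 asym] := correlation_asymptotics mX mXh XhX c0 nuE TX mT nsT returns tP tPhat sRz snP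
  complete compact qc aper beta_gt1 tail hhat0 hB hfix hint.
have [Ca hCa] := algebra; have [CF CF0 hF] := Fbeta_bound beta_gt1.
have hL := hB.1; pose tb := tbar nuhat Xhat T hhat.
have tb1 : 1 <= tb by exact: (sys_tb1 mX mXh XhX c0 nuE TX mT nsT returns tP tPhat sRz snP complete qc beta_gt1 tail hhat0 hB hfix hint).
have tbE : (\sum_(0 <= i <oo) (tails nuhat Xhat T hhat i)%:E = tb%:E)%E by exact: (tbarE mX mXh XhX c0 nuE TX mT nsT returns tP tPhat sRz snP complete qc beta_gt1 tail hhat0 hB hfix).
have tb0 : 0 <= tb^-1 by rewrite invr_ge0 (le_trans ler01).
have nB0 f : inB f -> 0 <= fine (normB f) by move=> fB; apply: fine_ge0; first [exact: (normB_ge0 snP fB) | exact: (normB_ge0 snP fB.1) | exact: (normB_ge0 snP f)].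
have nBE f : inB f -> normB f = (fine (normB f))%:E by move=> fB; rewrite fineK// (normB_fin snP fB).
(* The added 1 makes the constant positive. *)
exists (tb^-1 * C * CF * `|Ca| * fine (normB hC) + 1).
  by apply: (lt_le_trans ltr01); rewrite lerDr !mulr_ge0// nB0.
move=> f g n fB gL f0 g0 n1 n2.
(* The renewal asymptotics are applied to [f hhat], which lies in the space, with norm controlled by
   that of [f], by the algebra property. *)
have [fhB fhn] := hCa _ _ fB hB.
have gnL k : Loo nu X (fun x => g (iter k T x)) := Loo_iter mX TX mT nsT k gL.
have gnLh k : Loo nuhat Xhat (fun x => g (iter k T x)) := Loo_nu_nuhat mX mXh XhX c0 nuE (gnL k).
have fm : cmeasurable X f.
  rewrite (_ : f = fun x => cindic Xhat x * f x); first exact: (cmeasurable_ext mX mXh XhX fB.1.1).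
  apply/funext => x; rewrite /cindic indicE; case: (boolP (x \in Xhat)) => [_|]; last first.
    by rewrite notin_setE => /f0 ->; rewrite mulr0.
  by rewrite [X in X * _](_ : _ = 1) ?mul1r.
have L1f := L1_mul mXh (gnLh n) fhB.1.
have E1 : cint mu X (fun x => f x * g (iter n T x)) =
    tb^-1%:C%C * cinth (fun x => g (iter n T x) * (f x * hC x)).
  have sh : (fun x => f x * g (iter n T x) * hC x) = (fun x => g (iter n T x) * (f x * hC x)).
    by apply/funext => x; ring.
  rewrite -sh; apply: (cint_tower_support mX mXh XhX TX mT returns hhat0 hL tb1 tbE).
  - exact: (cmeasurableM fm (gnL n).1).
  - by move=> x _ /f0 ->; rewrite mul0r.
  - by rewrite sh.
have E2 : cint mu X f = tb^-1%:C%C * cinth (fun x => f x * hC x).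
  apply: (cint_tower_support mX mXh XhX TX mT returns hhat0 hL tb1 tbE) => //; [by move=> x _ /f0 | exact: fhB.1].
have E3 : cint mu X g = tb^-1%:C%C * cinth (fun x => g x * hC x).
  apply: (cint_tower_support mX mXh XhX TX mT returns hhat0 hL tb1 tbE) => //; [exact: gL.1 | exact: (L1_mul mXh (gnLh 0%N) hL)].
have E4 : cint mu X (fun x => g (iter n T x)) = cint mu X g.
  exact: (cint_tower_iter mX mXh XhX c0 nuE TX mT nsT returns tPhat hhat0 hL hfix tb1 tbE n gL.1).
have E5 : (\sum_(n.+1 <= k <oo) mu [set x | Xhat x /\ (k < tau x)%N] =
    (tb^-1 * (tb - \sum_(i < n.+1) tails nuhat Xhat T hhat i))%:E)%E.
  exact: (tower_tail mX mXh XhX TX mT returns hhat0 hL tb1 tbE n).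
have no0 := normoo_ge0 g.
have noE : normoo nu X g = (fine (normoo nu X g))%:E by rewrite fineK// ge0_fin_numE// gL.2.
have N0 : 0 <= fine (normoo nu X g) by exact: fine_ge0.
have gM : {ae nuhat, forall x, Xhat x -> normc (g x) <= fine (normoo nu X g)}.
  apply: (ae_nu_nuhat mXh XhX c0 nuE (Q := fun x => normc (g x) <= fine (normoo nu X g))).
  apply: filterS (ess_sup_ge nu ((fun x => (normc (g x))%:E) \_ X)) => x h Xx.
  by rewrite -lee_fin -noE; move: h; rewrite patchE mem_set.
have := asym g _ n _ gL g0 N0 gM fhB.
rewrite /Cov E1 E4 E2 E3 E5 [fine _%:E]/= cov_decomposition -exprVn.
move: (cinth _) (cinth _) (cinth _) => x a b H.
rewrite normcM normc_real ger0_norm// noE (nBE f fB) -!EFinM lee_fin.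
apply: le_trans (ler_wpM2l tb0 H) _; apply: product_bound => //.
- by apply: mulr_ge0; [exact: dw_ge0 | apply: sumr_ge0 => i _; exact: powR_ge0].
- exact: nB0.
- exact: Fbeta_ge0.
- exact: nB0.
- exact: hF.
- rewrite -lee_fin -nBE// !EFinM -(nBE f fB) -(nBE _ hB); apply: le_trans fhn _.
  rewrite (nBE f fB) (nBE _ hB) -!EFinM lee_fin; do 2 (apply: ler_wpM2r; first exact: nB0).
  exact: ler_norm.
Qed.

End Covariance.

(** * Normalized Lebesgue measures on compact sets *)

Lemma lebesgue_compact_lty (R : realType) m (K : set 'rV[R]_m.+1) : compact K ->
  (lebesgue (K : set (rVleb R m)) < +oo)%E.
Proof.
move=> /compact_bounded[M [_ KM]].
have {}KM x : K x -> `|x| <= M + 1 by move=> Kx; apply: (KM (M + 1)) => //; rewrite ltrDl.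
(* Boxes are open on the left, so the lower corner is taken strictly below [- (M + 1)]. *)
pose p : 'rV[R]_m.+1 * 'rV[R]_m.+1 := (const_mx (- (M + 2)), const_mx (M + 1)).
apply: (@le_lt_trans _ _ (box_volume p)); last by rewrite /box_volume ltry.
have z : box_volume ((0, 0) : 'rV[R]_m.+1 * 'rV[R]_m.+1) = 0%E.
  by rewrite /box_volume /= big_ord_recl !mxE subrr max_l// mul0r.
apply: ereal_inf_lbound; exists (fun k => if k == 0%N then p else (0, 0)).
- move=> x Kx; exists 0%N => // i; rewrite /= !mxE.
  have : `|x ord0 i| <= M + 1.
    apply: le_trans (KM x Kx); rewrite -[leRHS]/(mx_norm x) mx_normrE.
    exact: (le_bigmax _ (fun ij => `|x ij.1 ij.2|) (ord0, i)).
  rewrite ler_norml => /andP[h1 ->]; rewrite andbT; apply: lt_le_trans h1.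
  by rewrite ltrN2 ltrD2l ltr1n.
- rewrite (nneseries_split 0 1)//; last by move=> k _; exact: box_volume_ge0.
  rewrite add0n big_nat1 /= eseries0 ?adde0// => -[//|k] _ _ /=; exact: z.
Qed.

Lemma mscale_restr_ratio (R : realType) m (X Xhat : set 'rV[R]_m.+1) (cX : compact X) (cXhat : compact Xhat) :
  Xhat `<=` X -> (0 < lebesgue (Xhat : set (rVleb R m)))%E ->
  let c := fine (lebesgue (Xhat : set (rVleb R m))) / fine (lebesgue (X : set (rVleb R m))) in
  0 < c /\ forall A : set (rVleb R m), measurable A -> A `<=` Xhat ->
    normalized_lebesgue cX A = (c%:E * normalized_lebesgue cXhat A)%E.
Proof.
move=> XhX l0 c.
have lX0 : (0 < lebesgue (X : set (rVleb R m)))%E by apply: lt_le_trans l0 _; exact: lebesgue_outer_le.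
have f1 : 0 < fine (lebesgue (X : set (rVleb R m))) by rewrite fine_gt0// lX0 lebesgue_compact_lty.
have f2 : 0 < fine (lebesgue (Xhat : set (rVleb R m))) by rewrite fine_gt0// l0 lebesgue_compact_lty.
split=> [|A mA AX]; first by rewrite divr_gt0.
rewrite -[LHS]/((fine (lebesgue (X : set (rVleb R m))))^-1%:E * lebesgue (A `&` (X : set (rVleb R m))))%E.
rewrite -[normalized_lebesgue cXhat A]/((fine (lebesgue (Xhat : set (rVleb R m))))^-1%:E * lebesgue (A `&` (Xhat : set (rVleb R m))))%E.
rewrite !setIidl//; last exact: subset_trans XhX.
by rewrite muleA -EFinM /c mulrAC divff ?gt_eqF// mul1r.
Qed.

Theorem theoremA (R : realType) (m : nat)
    (X Xhat : set (rVleb R m))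
    (cX : compact (X : set 'rV[R]_m.+1))
    (cXhat : compact (Xhat : set 'rV[R]_m.+1))
    (T : rVleb R m -> rVleb R m)
    (sn : (rVleb R m -> R[i]) -> \bar R)
    (P Phat : (rVleb R m -> R[i]) -> rVleb R m -> R[i])
    (Rz : R[i] -> (rVleb R m -> R[i]) -> rVleb R m -> R[i])
    (hhat : rVleb R m -> R) (beta : R)
    (nu := normalized_lebesgue cX)
    (nuhat := normalized_lebesgue cXhat)
    (tau := return_time T Xhat)
    (That := return_map T Xhat)
    (Rn := renewal T Xhat P)
    (muhat := density_measure Xhat nuhat hhat)
    (mu := tower_measure T Xhat muhat) :
  Xhat `<=` X ->
  (0 < lebesgue Xhat)%E ->
  (forall x, X x -> X (T x)) ->
  measurable_fun X T ->
  nonsingular nu X T ->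
  {ae nuhat, forall x, Xhat x ->
     exists i, (1 <= i)%N /\ Xhat (iter i T x)} ->
  transfer_operator nu X T P ->
  transfer_operator nuhat Xhat That Phat ->
  renewal_series Xhat nuhat Rn Rz ->
  L1_seminorm nuhat Xhat sn ->
  B_complete nuhat Xhat sn ->
  B_compact_in_L1 nuhat Xhat sn ->
  B_bounded nuhat Xhat sn ->
  B_algebra nuhat Xhat sn ->
  quasi_compact Xhat nuhat sn Rz ->
  aperiodic T Xhat nuhat ->
  1 < beta ->
  return_tail Xhat nuhat sn Rn beta ->
  (forall x, 0 <= hhat x) ->
  inB nuhat Xhat sn (fun x => (hhat x)%:C%C) ->
  {ae nuhat, forall x, Xhat x ->
     Phat (fun y => (hhat y)%:C%C) x = (hhat x)%:C%C} ->
  (\int[nuhat]_(x in Xhat) (hhat x)%:E)%E = 1%E ->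
  exists2 C : R, 0 < C &
    forall (f g : rVleb R m -> R[i]) (n : nat),
      inB nuhat Xhat sn f -> Loo nu X g ->
      (forall x, ~ Xhat x -> f x = 0) ->
      (forall x, X x -> ~ Xhat x -> g x = 0) ->
      (1 <= n)%N -> (beta = 2 -> (2 <= n)%N) ->
      ((normc (Cov mu X f (fun x => g (iter n T x)) -
         (fine (\sum_(n.+1 <= k <oo)
            mu [set x | Xhat x /\ (k < tau x)%N]))%:C%C *
           cint mu X f * cint mu X g))%:E
       <= C%:E * (Fbeta beta n)%:E * normoo nu X g * normB nuhat Xhat sn f)%E.
Proof.
move=> XhX l0 TX mT ns ret tP tPh rs snP complete compact bounded algebra qc aper b1 tail h0 hB hfix hint.
have [c0 nuE] := mscale_restr_ratio cX cXhat XhX l0.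
exact: (covariance_asymptotics (compact_rVleb_measurable cX) (compact_rVleb_measurable cXhat) XhX c0 nuE
  TX mT ns ret tP tPh rs snP complete compact algebra qc aper b1 tail h0 hB hfix hint).
Qed.
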